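(* Let $(M^4,g,f)$ be an orientable $4$-dimensional complete gradient shrinking Ricci soliton. (a) If $(M^4,g,f)$ has $A_2\ge0$ or $C_2\ge0$, then $A\ge0$ or $C\ge0$. (b) If $(M^4,g,f)$ has $A_2>0$ or $C_2>0$, then $A>0$ or $C>0$. Moreover, if $M^4$ is noncompact, then there exists some constant $K>0$ such that the smallest eigenvalue $A_1$ of $A$, or $C_1$ of $C$, satisfies the estimate $$A_1\ge\frac{K}{f},\quad\text{or}\quad C_1\ge\frac{K}{f}.$$
   Context: A gradient shrinking Ricci soliton $(M^4,g,f)$ is a complete Riemannian manifold with a smooth (potential) function $f$ satisfying $Rc+\nabla^2 f=\rho g$ for a constant $\rho>0$. On an oriented Riemannian $4$-manifold, $A=W^++\frac{R}{12}I$ and $C=W^-+\frac{R}{12}I$ are the diagonal blocks of the curvature operator with respect to the splitting $\wedge^2(M)=\wedge^+(M)\oplus\wedge^-(M)$ into self-dual and anti-self-dual $2$-forms, where $W^\pm$ are the self-dual and anti-self-dual Weyl tensors and $R$ is the scalar curvature. Their eigenvalues are denoted $A_1\le A_2\le A_3$ and $C_1\le C_2\le C_3$. Conditions on $A$, $C$ and their eigenvalues are understood to hold at every point of $M^4$; $A\ge0$ (resp. $A>0$) means $A$ is positive semidefinite (resp. positive definite), and likewise for $C$.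
   Formalization: The estimate A₁ ≥ K/f (or C₁ ≥ K/f) is stated for potentials f that are normalized by R+|∇f|²=2ρf or everywhere positive; for an f shifted so that it changes sign, as on S³×ℝ, it fails because K/f is unbounded. *)

(* Defs.v *)
From HB Require Import structures.
From mathcomp Require Import all_boot all_order all_algebra.
From mathcomp Require Import all_classical all_reals all_analysis.
Import Order.TTheory GRing.Theory Num.Theory.
Import numFieldNormedType.Exports.

Set Implicit Arguments.
Unset Strict Implicit.
Unset Printing Implicit Defensive.

Local Open Scope classical_set_scope.
Local Open Scope ring_scope.

Definition partial (R : realType) (k : 'I_4) (u : 'rV[R]_4 -> R) : 'rV[R]_4 -> R :=
  fun x => 'D_(delta_mx 0 k) u x.

(* C^oo on the open set V: every iterated partial derivative exists and is
   continuous at every point of V. *)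
Definition smooth_on (R : realType) (V : set 'rV[R]_4) (u : 'rV[R]_4 -> R) :=
  forall (l : seq 'I_4) (x : 'rV[R]_4), V x ->
    let w := foldr (@partial R) u l in
    {for x, continuous w} /\ (forall k, derivable w x (delta_mx 0 k)).

(* [param i] is the inverse of the chart [coord i]; both are total functions,
   and only their values on [dom i] and on its image are meaningful. *)
Record manifold4 (R : realType) (M : topologicalType) := Manifold4 {
  mfd_hausdorff : hausdorff_space M;
  mfd_second_countable : @second_countable M;
  mfd_connected : connected [set: M];
  chart : Type;
  dom : chart -> set M;
  coord : chart -> M -> 'rV[R]_4;
  param : chart -> 'rV[R]_4 -> M;
  dom_open : forall i, open (dom i);
  dom_cover : forall p, exists i, dom i p;
  codom_open : forall i, open (coord i @` dom i);
  coordK : forall i p, dom i p -> param i (coord i p) = p;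
  coord_continuous : forall i p, dom i p -> {for p, continuous (coord i)};
  param_continuous : forall i x, (coord i @` dom i) x ->
    {for x, continuous (param i)};
  transition_smooth : forall i j (k : 'I_4),
    smooth_on (coord i @` (dom i `&` dom j)) (fun x => coord j (param i x) 0 k)
}.

Section Manifold.
Variables (R : realType) (M : topologicalType) (X : manifold4 R M).

Definition codom (i : chart X) : set 'rV[R]_4 := coord i @` dom i.

(* Entry (a, b) is the derivative along x^a of the b-th coordinate y^b of the
   chart j, where x denotes the coordinates of the chart i. *)
Definition transition_jac (i j : chart X) (p : M) : 'M[R]_4 :=
  \matrix_(a, b) partial a (fun x => coord j (param i x) 0 b) (coord i p).

Definition smooth_fun (f : M -> R) :=
  forall i : chart X, smooth_on (codom i) (f \o param i).

(* An orientation is given by the sign of the coordinate frame of each chart. *)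
Record orientation := Orientation {
  sgn : chart X -> M -> R;
  sgn_unit : forall i p, dom i p -> `|sgn i p| = 1;
  sgn_continuous : forall i p, dom i p -> {for p, continuous (sgn i)};
  sgn_transition : forall i j p, dom i p -> dom j p ->
    sgn i p = Num.sg (\det (transition_jac i j p)) * sgn j p
}.

Record metric := Metric {
  gram : chart X -> 'rV[R]_4 -> 'M[R]_4;
  gram_sym : forall i x, codom i x -> (gram i x)^T = gram i x;
  gram_pos : forall i x (v : 'rV[R]_4), codom i x -> v != 0 ->
    0 < (v *m gram i x *m v^T) 0 0;
  gram_smooth : forall i (a b : 'I_4),
    smooth_on (codom i) (fun x => gram i x a b);
  gram_transition : forall i j p, dom i p -> dom j p ->
    gram i (coord i p) =
    transition_jac i j p *m gram j (coord j p) *m (transition_jac i j p)^T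
}.

Section Curvature.
Variable g : metric.
Implicit Types (i : chart X) (x : 'rV[R]_4) (a b c d k : 'I_4).

Definition cogram i x : 'M[R]_4 := invmx (gram g i x).

(* Gamma^k_{ab} *)
Definition christoffel i k a b x : R :=
  2^-1 * \sum_l cogram i x k l *
    (partial a (fun y => gram g i y b l) x
     + partial b (fun y => gram g i y a l) x
     - partial l (fun y => gram g i y a b) x).

(* R(d_a, d_b) d_c = \sum_k (riemann i k a b c) d_k, where
   R(X, Y) Z = D_X D_Y Z - D_Y D_X Z - D_[X,Y] Z *)
Definition riemann i k a b c x : R :=
  partial a (christoffel i k b c) x - partial b (christoffel i k a c) x
  + \sum_m (christoffel i k a m x * christoffel i m b c x
            - christoffel i k b m x * christoffel i m a c x).

(* R_{abcd} = g(R(d_a, d_b) d_d, d_c), so that R_{abab} > 0 on round spheres. *)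
Definition riemann4 i a b c d x : R :=
  \sum_k gram g i x c k * riemann i k a b d x.

Definition ricci i b c x : R := \sum_a riemann i a a b c x.

Definition scalar_curvature i x : R :=
  \sum_b \sum_c cogram i x b c * ricci i b c x.

Definition hessian (f : M -> R) i a b x : R :=
  partial a (partial b (f \o param i)) x
  - \sum_k christoffel i k a b x * partial k (f \o param i) x.

Definition grad_sqnorm (f : M -> R) i x : R :=
  \sum_a \sum_b
    cogram i x a b * partial a (f \o param i) x * partial b (f \o param i) x.

Definition geodesic (gamma : R -> M) :=
  continuous gamma /\
  forall i t, dom i (gamma t) ->
    let c k : R -> R := fun s => coord i (gamma s) 0 k in
    forall k,
    [/\ \forall s \near t, derivable (c k) s 1,
        derivable (derive1 (c k)) t 1
      & derive1 (derive1 (c k)) t =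
        - \sum_a \sum_b christoffel i k a b (coord i (gamma t))
                        * derive1 (c a) t * derive1 (c b) t].

(* Geodesic completeness: every geodesic is defined on the whole real line. *)
Definition complete_metric :=
  forall i p (v : 'rV[R]_4), dom i p ->
  exists gamma : R -> M, [/\ geodesic gamma, gamma 0 = p
    & forall k, derive1 (fun s => coord i (gamma s) 0 k) 0 = v 0 k].

Definition gradient_shrinking_soliton (f : M -> R) (rho : R) :=
  [/\ complete_metric, smooth_fun f, 0 < rho
    & forall i x, codom i x -> forall a b,
      ricci i a b x + hessian f i a b x = rho * gram g i x a b].

(* R + |grad f|^2 - 2 rho f is constant on a soliton; the usual normalization
   of the potential makes this constant zero. *)
Definition normalized_potential (f : M -> R) (rho : R) :=
  forall i p, dom i p ->
    scalar_curvature i (coord i p) + grad_sqnorm f i (coord i p)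
    = 2 * rho * f p.

(* Bivectors are skew matrices of coordinates: [wedge u v] is u /\ v, and
   2-forms are identified with bivectors through the metric. *)
Definition wedge (u v : 'rV[R]_4) : 'M[R]_4 := u^T *m v - v^T *m u.

(* The factor 1/4 gives (e_i /\ e_j, e_k /\ e_l) |-> R_{ijkl}. *)
Definition curvature_form i x (w z : 'M[R]_4) : R :=
  4^-1 * \sum_a \sum_b \sum_c \sum_d riemann4 i a b c d x * w a b * z c d.

(* With e_0, ..., e_3 the rows of E and s = 1 (resp. s = -1), the bivectors
   (e_0 /\ e_a + s e_b /\ e_c) / sqrt 2, where (a, b, c) runs over the cyclic
   permutations of (1, 2, 3). They form an orthonormal basis of the self-dual
   (resp. anti-self-dual) space when E is an oriented orthonormal frame. *)
Definition half_basis (s : R) (E : 'M[R]_4) (a : 'I_3) : 'M[R]_4 :=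
  let e (n : nat) := row (inord n) E in
  (Num.sqrt 2)^-1 *:
    (wedge (e 0%N) (e a.+1)
     + s *: wedge (e (a.+1 %% 3).+1) (e (a.+2 %% 3).+1)).

Variable o : orientation.

Definition oriented_orthonormal_frame i p (E : 'M[R]_4) :=
  E *m gram g i (coord i p) *m E^T = 1%:M /\ 0 < sgn o i p * \det E.

(* A matrix, at the point p, of the diagonal block of the curvature operator
   on self-dual (s = 1) or anti-self-dual (s = -1) forms. It depends on the
   chart and on the frame only through an orthogonal change of basis, so that
   its eigenvalues and its positivity depend on p only. *)
Definition half_curvature (s : R) (p : M) : 'M[R]_3 :=
  xget 0 [set S | exists i E, [/\ dom i p, oriented_orthonormal_frame i p E
    & S = \matrix_(a, b)
            curvature_form i (coord i p) (half_basis s E a) (half_basis s E b)]].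

Definition curvA (p : M) : 'M[R]_3 := half_curvature 1 p.
Definition curvC (p : M) : 'M[R]_3 := half_curvature (-1) p.

End Curvature.
End Manifold.

(* The k-th smallest eigenvalue (counted from 1, with multiplicity) of a
   symmetric matrix. *)
Definition eigval (R : realType) (n : nat) (k : nat) (S : 'M[R]_n) : R :=
  nth 0 (xget [::] [set s : seq R |
    sorted <=%R s /\ char_poly S = \prod_(a <- s) ('X - a%:P)]) k.-1.

Definition psd (R : realType) (n : nat) (S : 'M[R]_n) :=
  forall u : 'rV[R]_n, 0 <= (u *m S *m u^T) 0 0.

Definition posdef (R : realType) (n : nat) (S : 'M[R]_n) :=
  forall u : 'rV[R]_n, u != 0 -> 0 < (u *m S *m u^T) 0 0.

(* Main.v *)
(** Let [u] be the lowest eigenvalue of [A] (or [C]) and [Delta_f = Delta - <grad f, grad>]. Parallel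
    translation of an eigenframe shows that, in the sense of barriers,
    [Delta_f u <= 2 rho u - 2 u^2 - 4 A_2 A_3]. If [A_2 >= 0] and [u < 0] somewhere, take a maximum of
    [- phi(d)^2 u], with [d] the distance to a fixed point and [phi] a cut-off at distance [r + 1]: the
    second variation of arclength and [Rc + Hess f = rho g] bound [Delta_f d] from above by a constant,
    whatever the curvature, and [r -> oo] gives a contradiction. If [A_2 > 0], then [u] has no zero, since
    a zero would be a minimum. The same second variation, with free end point, shows that [f] is proper. With
    [R + |grad f|^2 = 2 rho f], the function [w = 1/f + 4/f^2] satisfies [Delta_f w > 2 rho w] where
    [f > 8]; at a negative minimum of [u - K w] this contradicts [Delta_f u <= 2 rho u]. *)

From HB Require Import structures.
From mathcomp Require Import all_boot all_order all_algebra.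
From mathcomp Require Import ring lra.
From mathcomp Require Import all_classical all_reals all_analysis.
Require Import Defs.
Import Order.TTheory GRing.Theory Num.Theory.
Import numFieldNormedType.Exports.
Set Implicit Arguments.
Unset Strict Implicit.
Unset Printing Implicit Defensive.
Local Open Scope classical_set_scope.
Local Open Scope ring_scope.

(** Neither the distance nor the lowest eigenvalue is smooth. Every inequality is therefore tested
    along four geodesics that leave the extremal point in orthonormal directions: a parallel frame
    makes the curvature a smooth function on each of them, and the Laplacian is a sum of second
    derivatives at time 0. No cut locus and no normal coordinates enter. The reaction term is -2
    (A^2 + 2 A^#) - 2 B B^T, with A^# the adjugate and B the block of the trace-free Ricci tensor.
    In an eigenframe its first entry leaves -2 A_1^2 - 4 A_2 A_3 and a square of good sign. The term
    -2 A_1^2 makes the cut-off estimate C r^5 independent of A_1, whereas the cut-off function at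
    the centre is -A_1 r^6. On a normalised soliton Delta_f f = 4 rho - 2 rho f. Hence 1/f alone
    falls short of Delta_f w > 2 rho w by 4 rho / f^2; the term 4/f^2 overcompensates, with a net
    gain of 4 rho (f - 8) / f^3 plus gradient terms of good sign. This is the origin of the 8.
    Tensor identities are proved over commutative rings with commuting derivations and reach the
    manifold through evaluation morphisms. *)

Notation cont_at f x := {for x, continuous f} (only parsing).
Tactic Notation "ext_sum" ident(x) := apply: eq_bigr; intros x _.
Tactic Notation "swap_sum" ident(x) := rewrite exchange_big; ext_sum x.

(** * Levi-Civita connections over differential rings *)

Notation I4 := 'I_4.

Section Tensors.
Variable A : comPzRingType.
Implicit Types (M : I4 -> I4 -> A) (T : seq I4 -> A) (s : seq I4).

(* Tensors of any rank are functions of the list of their indices. *)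
Fixpoint act M T s : A := if s is a :: r then \sum_m M a m * T (m :: r) + act M (fun r => T (a :: r)) r else 0.

Lemma act_sum (J : finType) (c : J -> A) M (T : J -> seq I4 -> A) s :
  act M (fun r => \sum_j c j * T j r) s = \sum_j c j * act M (T j) s.
Proof.
elim: s T => [|a s IH] T /=; first by rewrite big1 // => j _; rewrite mulr0.
rewrite (IH (fun j r => T j (a :: r))).
under [RHS]eq_bigr do rewrite mulrDr.
rewrite big_split /=; congr (_ + _).
under eq_bigr do rewrite mulr_sumr.
swap_sum j => /=; rewrite mulr_sumr.
by ext_sum m; rewrite mulrCA.
Qed.

Lemma actD M T T' s : act M (fun r => T r + T' r) s = act M T s + act M T' s.
Proof.
elim: s T T' => [|a s IH] T T' /=; first by rewrite addr0.
rewrite (IH (fun r => T (a :: r)) (fun r => T' (a :: r))).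
under eq_bigr do rewrite mulrDr.
by rewrite big_split /= addrACA.
Qed.

Lemma actZ M c T s : act M (fun r => c * T r) s = c * act M T s.
Proof.
elim: s T => [|a s IH] T /=; first by rewrite mulr0.
rewrite (IH (fun r => T (a :: r))) mulrDr mulr_sumr.
by congr (_ + _); ext_sum m; rewrite mulrCA.
Qed.

Lemma act0 M s : act M (fun _ => 0) s = 0.
Proof.
elim: s => [|a s IH] //=; rewrite IH addr0 big1 // => m _; exact: mulr0.
Qed.

(** Contributions in which the two actions hit different slots cancel; those in the same slot
    compose as matrices. Thus [act] carries matrix commutators to commutators of operators. *)
Lemma act_commutator M M' T s : act M (act M' T) s - act M' (act M T) s =
  act (fun a m => \sum_p (M a p * M' p m - M' a p * M p m)) T s.
Proof.
elim: s T => [|a s IH] T /=; first by rewrite subr0.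
rewrite !actD (act_sum (M' a) M (fun m r => T (m :: r))).
rewrite (act_sum (M a) M' (fun m r => T (m :: r))) -(IH (fun r => T (a :: r))).
have -> : \sum_m (\sum_p (M a p * M' p m - M' a p * M p m)) * T (m :: s) = \sum_m M a m * (\sum_p M' m p * T (p :: s))
  - \sum_m M' a m * (\sum_p M m p * T (p :: s)).
  under eq_bigr do rewrite mulr_suml.
  rewrite exchange_big /= -sumrB; ext_sum m.
  rewrite !mulr_sumr -sumrB; ext_sum p; ring.
have E K K' : \sum_m K a m * (\sum_p K' m p * T (p :: s) + act K' (fun r => T (m :: r)) s) =
   \sum_m K a m * (\sum_p K' m p * T (p :: s)) + \sum_m K a m * act K' (fun r => T (m :: r)) s.
  by rewrite -big_split; ext_sum m; rewrite mulrDr.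
rewrite !E; ring.
Qed.

(* The slot permutations generated by swp and dep commute with act. *)
Definition swp s := if s is a :: b :: r then b :: a :: r else s.
Definition dep (w : seq I4 -> seq I4) s := if s is a :: r then a :: w r else s.
Definition slotwise (w : seq I4 -> seq I4) := forall M T s, act M (fun r => T (w r)) s = act M T (w s).

Lemma slotwise_swp : slotwise swp.
Proof. by move=> M T [|a [|b s]] //=; rewrite addrCA. Qed.

Lemma slotwise_dep w : slotwise w -> slotwise (dep w).
Proof. by move=> h M T [|a s] //=; rewrite (h M (fun r => T (a :: r))). Qed.

Lemma slotwise_comp w w' : slotwise w -> slotwise w' -> slotwise (w \o w').
Proof. by move=> h h' M T s; rewrite -(h M T) -h'. Qed.

End Tensors.

(** An algebraic stand-in for the partial derivatives of smooth functions, so that tensor identities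
    become ring computations. *)
Record derivations (A : comPzRingType) := Derivations { der :> I4 -> A -> A;
  derD : forall k x y, der k (x + y) = der k x + der k y; derM : forall k x y, der k (x * y) = der k x * y + x * der k y;
  derC : forall k l x, der k (der l x) = der l (der k x)
}.

Section Derivations.
Variables (A : comPzRingType) (D : derivations A).

Lemma der0 k : D k 0 = 0.
Proof. by apply: (addrI (D k 0)); rewrite -derD !addr0. Qed.

Lemma derN k x : D k (- x) = - D k x.
Proof. by apply: (addrI (D k x)); rewrite -derD !subrr der0. Qed.

Lemma derB k x y : D k (x - y) = D k x - D k y.
Proof. by rewrite derD derN. Qed.

Lemma der1 k : D k 1 = 0.
Proof.
by apply: (addrI (D k 1)); rewrite addr0 -{3}[1](mulr1 1) derM mul1r mulr1.
Qed.

Lemma der_nat k n : D k n%:R = 0.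
Proof. by elim: n => [|n IH]; rewrite ?der0 // -natr1 derD IH der1 addr0. Qed.

Lemma der_sum (J : Type) (r : seq J) (P : pred J) (F : J -> A) k :
  D k (\sum_(j <- r | P j) F j) = \sum_(j <- r | P j) D k (F j).
Proof. by apply: (big_morph (D k)); [exact: derD | exact: der0]. Qed.

End Derivations.

Section Connection.
Variables (A : comPzRingType) (D : derivations A) (Gam : I4 -> I4 -> I4 -> A).
Implicit Types (T : seq I4 -> A) (s : seq I4).

(** All tensor indices are covariant, and [Gam k a b] is the symbol with upper index [k]. In [nab]
    the derivative index comes first; the value 0 on the empty list is a dummy. *)
Definition cov k T s := D k (T s) - act (fun a m => Gam m k a) T s.
Definition nab T s := if s is k :: r then cov k T r else 0.
Definition riem k a b c := D a (Gam k b c) - D b (Gam k a c) + \sum_m (Gam k a m * Gam m b c - Gam k b m * Gam m a c).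

Lemma covD k T T' s : cov k (fun r => T r + T' r) s = cov k T s + cov k T' s.
Proof. rewrite /cov actD derD; ring. Qed.

Lemma covN k T s : cov k (fun r => - T r) s = - cov k T s.
Proof.
rewrite /cov derN (_ : (fun r => - T r) = (fun r => -1 * T r)).
  rewrite actZ; ring.
by apply/funext => r; rewrite mulN1r.
Qed.

Lemma nabD T T' s : nab (fun r => T r + T' r) s = nab T s + nab T' s.
Proof. by case: s => [|k s] /=; rewrite ?addr0 ?covD. Qed.

Lemma nabN T s : nab (fun r => - T r) s = - nab T s.
Proof. by case: s => [|k s] /=; rewrite ?oppr0 ?covN. Qed.

(** Symmetries of a tensor pass to its covariant derivatives in this way, the derivative index
    staying in front. *)
Lemma nab_slotwise w T : slotwise A w -> nab (T \o w) = nab T \o dep w.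
Proof.
move=> h; apply/funext => -[|k s] //=; rewrite /cov /=; congr (_ - _).
exact: h.
Qed.

Lemma der_act k M T s : D k (act M T s) = act (fun a m => D k (M a m)) T s + act M (fun r => D k (T r)) s.
Proof.
elim: s T => [|a s IH] T /=; first by rewrite der0 addr0.
rewrite derD IH der_sum addrACA -big_split /=; congr (_ + _).
by ext_sum m; rewrite derM.
Qed.

(** The terms quadratic in [Gam] form a commutator of two slot actions; [act_commutator] assembles
    them with the derivatives of [Gam] into the curvature matrix. *)
Lemma cov_commutator k l T s : cov k (cov l T) s - cov l (cov k T) s = - act (fun a m => riem m k l a) T s.
Proof.
rewrite /cov !actD !derB !der_act (derC D l k).
have actN M T' : act M (fun r => - T' r) s = - act M T' s.
  rewrite -mulN1r -actZ; congr (act M _ s); apply/funext => r.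
  by rewrite mulN1r.
rewrite !actN.
have -> : act (fun a m => riem m k l a) T s = act (fun a m => D k (Gam m l a)) T s - act (fun a m => D l (Gam m k a)) T s
  - (act (fun a m => Gam m k a) (act (fun a m => Gam m l a) T) s
    - act (fun a m => Gam m l a) (act (fun a m => Gam m k a) T) s).
  rewrite act_commutator; clear; elim: s T => [|a s IH] T /=.
    by rewrite !subr0.
  rewrite IH opprD !addrA; set X := act _ _ s; set Y := act _ _ s; set Z := act _ _ s.
  rewrite -[LHS]addrA [X in _ = X]addrAC [in RHS]addrAC.
  have -> : \sum_m riem m k l a * T (m :: s) = \sum_m D k (Gam m l a) * T (m :: s) - \sum_m D l (Gam m k a) * T (m :: s)
    - \sum_m (\sum_p (Gam p k a * Gam m l p - Gam p l a * Gam m k p)) * T (m :: s).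
    rewrite -!sumrB; ext_sum m; rewrite -!mulrBl /riem; congr (_ * _).
    rewrite -[in RHS]sumrN; congr (_ + _); ext_sum p; ring.
  ring.
ring.
Qed.

Hypothesis Gam_sym : forall k a b, Gam k a b = Gam k b a.

(** Compared with [cov_commutator], the inner derivative index is now itself a slot; its correction
    is symmetric in [k] and [l] and drops out. *)
Lemma ricci_identity T k l s : nab (nab T) [:: k, l & s] - nab (nab T) [:: l, k & s] = - act (fun a m => riem m k l a) T s.
Proof.
rewrite -cov_commutator /= /cov /=.
rewrite (eq_bigr (fun m => Gam m l k * cov m T s)) => [|m _]; last by rewrite Gam_sym.
ring.
Qed.

Lemma riem_skew k a b c : riem k b a c = - riem k a b c.
Proof.
rewrite /riem opprD -sumrN opprB; congr (_ + _).
by ext_sum m; rewrite opprB.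
Qed.

Lemma riem_bianchi k a b c : riem k a b c + riem k b c a + riem k c a b = 0.
Proof.
rewrite /riem !(Gam_sym k c) !(Gam_sym k b a).
have E (x y z u v w : A) : u + v + w = 0 -> x - y + u + (y - z + v) + (z - x + w) = 0 by move=> <-; ring.
rewrite E // -!big_split /= big1 // => m _.
rewrite !(Gam_sym m c) !(Gam_sym m b a); ring.
Qed.

(** Covariant derivative of the endomorphism part [c], [k] of the curvature; [a] and [b] are mere
    labels here, and their corrections appear in [cov_rm]. *)
Definition dcur e a b c k := D e (riem k a b c) + \sum_m (Gam k e m * riem m a b c - Gam m e c * riem k a b m).

Lemma cov_act_riem e a b T s : cov e (act (fun c k => riem k a b c) T) s - act (fun c k => riem k a b c) (cov e T) s
  = act (dcur e a b) T s.
Proof.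
rewrite /cov actD der_act.
rewrite (_ : (fun r => - act _ T r) = (fun r => -1 * act (fun a m => Gam m e a) T r)); last first.
  by apply/funext => r; rewrite mulN1r.
rewrite actZ.
have -> : act (dcur e a b) T s = act (fun c k => D e (riem k a b c)) T s -
  (act (fun c m => Gam m e c) (act (fun c k => riem k a b c) T) s -
   act (fun c k => riem k a b c) (act (fun c m => Gam m e c) T) s).
  rewrite act_commutator; elim: s T => [|i s IH] T /=; first by rewrite subr0.
  rewrite IH opprD addrACA; congr (_ + _).
  rewrite -sumrB; ext_sum m; rewrite -mulrBl; congr (_ * _).
  rewrite /dcur -sumrN; congr (_ + _); ext_sum p; ring.
ring.
Qed.

(* The Jacobi identity for the commutators of the operators cov e. *)
Lemma dcur_bianchi e a b c k : dcur e a b c k + dcur a b e c k + dcur b e a c k = 0.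
Proof.
(* The indicator of the index [k] reads off one matrix entry from [act]. *)
pose T s : A := (s == [:: k])%:R.
have actT M : act M T [:: c] = M c k.
  rewrite /= addr0 (bigD1 k) //= /T eqxx mulr1 big1 ?addr0 // => m mk.
  by rewrite eqseq_cons andbT (negPf mk) mulr0.
have E a' b' : act (fun c k => riem k a' b' c) T = (fun r => cov b' (cov a' T) r + - cov a' (cov b' T) r).
  by apply/funext => r; rewrite -opprB cov_commutator opprK.
have F a' b' e' : act (fun c k => riem k a' b' c) (cov e' T) [:: c] =
   cov b' (cov a' (cov e' T)) [:: c] - cov a' (cov b' (cov e' T)) [:: c].
  by rewrite -opprB cov_commutator opprK.
have R e' a' b' : dcur e' a' b' c k = cov e' (cov b' (cov a' T)) [:: c] - cov e' (cov a' (cov b' T)) [:: c]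
    - (cov b' (cov a' (cov e' T)) [:: c] - cov a' (cov b' (cov e' T)) [:: c]).
  by rewrite -actT -cov_act_riem F E covD covN.
rewrite !R; ring.
Qed.

End Connection.

(** The element [half] makes it possible to cancel a factor two, on which the pair symmetry of the
    curvature and the uniqueness of the connection rest, although the ring is not a field. *)
Record lc_geometry (A : comPzRingType) := LCGeometry { lcD :> derivations A; lcG : I4 -> I4 -> A; lcH : I4 -> I4 -> A;
  lcGam : I4 -> I4 -> I4 -> A; half : A; halfE : half + half = 1; lcG_sym : forall a b, lcG a b = lcG b a;
  lcGH : forall a b, \sum_c lcG a c * lcH c b = (a == b)%:R; lcGam_sym : forall k a b, lcGam k a b = lcGam k b a;
  lc_compat : forall a b c, lcD a (lcG b c) = \sum_k (lcGam k a b * lcG k c + lcGam k a c * lcG b k)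
}.

Section Geometry.
Variables (A : comPzRingType) (X : lc_geometry A).
Implicit Types (T : seq I4 -> A) (s : seq I4).
Local Notation G := (lcG X).
Local Notation H := (lcH X).
Local Notation Gam := (lcGam X).
Local Notation cov := (cov X Gam).
Local Notation nab := (nab X Gam).
Local Notation riem := (riem X Gam).

Lemma mulr2_inj (x y : A) : x + x = y + y -> x = y.
Proof.
by move=> h; rewrite -(mul1r x) -(mul1r y) -(halfE X) !mulrDl -!mulrDr h.
Qed.

Lemma lcHG a b : \sum_c H a c * G c b = (a == b)%:R.
Proof.
pose MG := \matrix_(i, j) G i j; pose MH := \matrix_(i, j) H i j.
have /mulmx1C/matrixP/(_ a b) : MG *m MH = 1%:M.
  apply/matrixP => i j; rewrite !mxE -(lcGH X); ext_sum k.
  by rewrite !mxE.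
by rewrite !mxE => <-; ext_sum k; rewrite !mxE.
Qed.

Definition met s := if s is [:: a; b] then G a b else 0.

Lemma cov_met k s : cov k met s = 0.
Proof.
case: s => [|a [|b [|c s]]]; rewrite /cov /= ?der0 ?addr0 ?sub0r.
- by rewrite oppr0.
- by rewrite big1 ?oppr0 // => m _; rewrite mulr0.
- by rewrite lc_compat big_split /= subrr.
- by rewrite act0 !big1 ?addr0 ?oppr0 // => m _; rewrite mulr0.
Qed.

(** The upper index is lowered into the third slot. The value 0 on lists of other lengths makes the
    symmetries equalities of functions, which [nab_slotwise] can differentiate. *)
Definition rm s := if s is [:: a; b; c; d] then \sum_k G c k * riem k a b d else 0.

Lemma riemE k a b d : riem k a b d = \sum_c H k c * rm [:: a; b; c; d].
Proof.
rewrite /rm; under eq_bigr do rewrite mulr_sumr.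
rewrite exchange_big /=.
under eq_bigr => j _.
  under eq_bigr do rewrite mulrA.
  rewrite -mulr_suml lcHG; over.
rewrite (bigD1 k) //= eqxx mul1r big1 ?addr0 // => j jk.
by rewrite eq_sym (negPf jk) mul0r.
Qed.

Lemma rm_skew : rm \o swp = (fun s => - rm s).
Proof.
apply/funext => -[|? [|? [|? [|? [|? ?]]]]] //=; rewrite ?oppr0 ?addr0 //; rewrite -sumrN; ext_sum k.
by rewrite riem_skew mulrN.
Qed.

(** The Ricci identity for the metric, whose covariant derivative vanishes. *)
Lemma rm_skew34 : rm \o dep (dep swp) = (fun s => - rm s).
Proof.
apply/funext => -[|a [|b [|c [|d [|? s]]]]] //=; rewrite ?oppr0 //.
apply/eqP; rewrite -addr_eq0; apply/eqP.
have n0 : nab met = (fun _ => 0) by apply/funext => -[|k s] //=; rewrite cov_met.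
have := ricci_identity X (lcGam_sym X) met a b [:: d; c].
rewrite n0 /= /cov !act0 !der0 !subr0 addr0 => /esym/eqP; rewrite oppr_eq0 => /eqP E.
rewrite -[RHS]E addrC; congr (_ + _); ext_sum m; rewrite mulrC // lcG_sym //.
Qed.

Definition cyc := dep swp \o swp.

Lemma slotwise_cyc : slotwise A cyc.
Proof.
by apply: slotwise_comp; [apply: slotwise_dep|]; apply: slotwise_swp.
Qed.

Lemma rm_bianchi s : rm s + rm (cyc s) + rm (cyc (cyc s)) = 0.
Proof.
case: s => [|a [|b [|d [|c [|? s]]]]] //=; rewrite ?addr0 //.
have E x y z w : \sum_k G w k * riem k x y z = - \sum_k G z k * riem k x y w.
  by have /(congr1 (fun f => f [:: x; y; z; w])) /= := rm_skew34.
rewrite E (E b d) (E d a) -!opprD -!big_split big1 ?oppr0 // => k _ /=.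
by rewrite -!mulrDr (riem_bianchi X (lcGam_sym X)) mulr0.
Qed.

(** The octahedron argument: two of the four Bianchi identities minus the other two, after which a
    factor two is cancelled. *)
Lemma rm_pair a b c d : rm [:: a; b; c; d] = rm [:: c; d; a; b].
Proof.
have S x y z w : rm [:: y; x; z; w] = - rm [:: x; y; z; w].
  by have /(congr1 (fun f => f [:: x; y; z; w])) := rm_skew.
have T x y z w : rm [:: x; y; w; z] = - rm [:: x; y; z; w].
  by have /(congr1 (fun f => f [:: x; y; z; w])) := rm_skew34.
have B x y z w : rm [:: x; y; z; w] + rm [:: y; z; x; w] + rm [:: z; x; y; w] = 0 by exact: (rm_bianchi [:: x; y; z; w]).
have h4 := B a b c d; have h3 := B b c d a; have h2 := B c d a b.
have h1 := B d a b c.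
rewrite (S a c b d) in h4; rewrite (T b c a d) (T c d a b) (S b d c a) (T b d a c) in h3.
rewrite (S a d c b) (T a d b c) (T a c b d) in h2; rewrite (S a d b c) (T a b c d) in h1.
apply: mulr2_inj; apply/eqP; rewrite -subr_eq0; apply/eqP.
rewrite (_ : 0 = 0 + 0 - 0 - 0 :> A); last by ring.
rewrite -{1}h4 -{1}h3 -{1}h2 -{1}h1; ring.
Qed.

(** Differentiating the factor [G c k] by [lc_compat] absorbs the correction of the slot [c]; only
    those of [a] and [b] stay visible. *)
Lemma cov_rm e a b c d : cov e rm [:: a; b; c; d] = \sum_k G c k * dcur X Gam e a b d k
  - \sum_m Gam m e a * rm [:: m; b; c; d] - \sum_m Gam m e b * rm [:: a; m; c; d].
Proof.
rewrite /cov /= addr0 der_sum.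
under [X in X - _]eq_bigr do rewrite derM lc_compat.
rewrite big_split /=.
have -> : \sum_k (\sum_p (Gam p e c * G p k + Gam p e k * G c p)) * riem k a b d =
  \sum_m Gam m e c * (\sum_k G m k * riem k a b d) + \sum_k G c k * \sum_m Gam k e m * riem m a b d.
  under eq_bigr do rewrite mulr_suml.
  under [X in _ = X + _]eq_bigr do rewrite mulr_sumr.
  under [X in _ = _ + X]eq_bigr do rewrite mulr_sumr.
  rewrite exchange_big -big_split; ext_sum m => /=.
  rewrite -big_split; ext_sum k => /=; ring.
have -> : \sum_m Gam m e d * (\sum_k G c k * riem k a b m) = \sum_k G c k * \sum_m Gam m e d * riem k a b m.
  under eq_bigr do rewrite mulr_sumr.
  under [RHS]eq_bigr do rewrite mulr_sumr.
  swap_sum k; ext_sum m; ring.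
have -> : \sum_k G c k * dcur X Gam e a b d k = \sum_k G c k * X e (riem k a b d)
  + \sum_k G c k * (\sum_m Gam k e m * riem m a b d) - \sum_k G c k * (\sum_m Gam m e d * riem k a b m).
  rewrite -big_split -sumrB; ext_sum k => /=.
  rewrite /dcur sumrB; ring.
ring.
Qed.

(** [dcur_bianchi] supplies the cyclic sum of the endomorphism parts. The corrections in the first
    two curvature slots cancel in pairs, by the symmetry of [Gam] and the skewness of [rm]. *)
Lemma nab_rm_bianchi s : nab rm s + nab rm (cyc s) + nab rm (cyc (cyc s)) = 0.
Proof.
have C0 k r : (forall x y z w, r <> [:: x; y; z; w]) -> cov k rm r = 0.
  have act_rm M u x y z w t : act M (fun r => rm [:: x, y, z, w, u & r]) t = 0.
    exact: act0.
  case: r => [|x [|y [|z [|w [|u r]]]]] h; rewrite /cov /= ?der0 ?sub0r ?addr0.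
  - by rewrite oppr0.
  - by rewrite big1 ?oppr0 // => m _; rewrite mulr0.
  - by rewrite !big1 ?addr0 ?oppr0 // => m _; rewrite mulr0.
  - by rewrite !big1 ?addr0 ?oppr0 // => m _; rewrite mulr0.
  - by case: (h x y z w).
  - by rewrite act0 !big1 ?addr0 ?oppr0 // => m _; rewrite mulr0.
have C0' k r (n4 : size r != 4%N) : cov k rm r = 0.
  by apply: C0 => x y z w E; rewrite E in n4.
case: s => [|e [|a [|b [|c [|d [|? s]]]]]] /=; try by rewrite ?C0' ?addr0.
rewrite !cov_rm.
have -> : \sum_m Gam m e b * rm [:: a; m; c; d] = - \sum_m Gam m b e * rm [:: m; a; c; d].
  rewrite -sumrN; ext_sum m; rewrite (lcGam_sym X m e b).
  by have /(congr1 (fun f => f [:: m; a; c; d])) /= -> := rm_skew; rewrite mulrN.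
have -> : \sum_m Gam m a e * rm [:: b; m; c; d] = - \sum_m Gam m e a * rm [:: m; b; c; d].
  rewrite -sumrN; ext_sum m; rewrite (lcGam_sym X m e a).
  by have /(congr1 (fun f => f [:: m; b; c; d])) /= -> := rm_skew; rewrite mulrN.
have -> : \sum_m Gam m b a * rm [:: e; m; c; d] = - \sum_m Gam m a b * rm [:: m; e; c; d].
  rewrite -sumrN; ext_sum m; rewrite (lcGam_sym X m b a).
  by have /(congr1 (fun f => f [:: m; e; c; d])) /= -> := rm_skew; rewrite mulrN.
have : \sum_k G c k * dcur X Gam e a b d k + \sum_k G c k * dcur X Gam a b e d k + \sum_k G c k * dcur X Gam b e a d k = 0.
  rewrite -!big_split big1 // => k _ /=.
  by rewrite -!mulrDr dcur_bianchi ?mulr0 //; apply: lcGam_sym.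
move: (\sum_k G c k * dcur X Gam e a b d k) => x.
move: (\sum_k G c k * dcur X Gam a b e d k) => y.
move: (\sum_k G c k * dcur X Gam b e a d k) => z h.
rewrite -[RHS]h; ring.
Qed.

(** Differentiate [G H = 1] and multiply by [H] to solve for the derivative of [H]. *)
Lemma lcH_der e p q : X e (H p q) = - \sum_m (Gam p e m * H m q + Gam q e m * H p m).
Proof.
have hGH a b : \sum_c (X e (G a c) * H c b + G a c * X e (H c b)) = 0.
  rewrite -[RHS](der_nat X e (a == b)) -(lcGH X) der_sum.
  by ext_sum c; rewrite derM.
have : \sum_a H p a * \sum_c (X e (G a c) * H c q + G a c * X e (H c q)) = 0.
  by rewrite big1 // => a _; rewrite hGH mulr0.
under eq_bigr do rewrite big_split mulrDr /=.
rewrite big_split /=.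
have -> : \sum_a H p a * (\sum_c G a c * X e (H c q)) = X e (H p q).
  under eq_bigr do rewrite mulr_sumr; rewrite exchange_big /=.
  under eq_bigr do (under eq_bigr do rewrite mulrA; rewrite -mulr_suml lcHG).
  rewrite (bigD1 p) //= eqxx mul1r big1 ?addr0 // => c cp.
  by rewrite eq_sym (negPf cp) mul0r.
move=> /eqP; rewrite addrC addr_eq0 => /eqP ->; congr (- _).
have E1 : \sum_a H p a * \sum_c X e (G a c) * H c q = \sum_m \sum_a \sum_c H p a * (Gam m e a * G m c * H c q) +
  \sum_m \sum_c \sum_a Gam m e c * H c q * (H p a * G a m).
  rewrite [X in _ = X + _]exchange_big [X in _ = _ + X]exchange_big /=.
  rewrite [X in _ = _ + X](eq_bigr (fun c => \sum_a \sum_m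
     Gam m e c * H c q * (H p a * G a m))) => [|c _]; last by rewrite exchange_big.
  rewrite [X in _ = _ + X]exchange_big -big_split; ext_sum a => /=.
  rewrite mulr_sumr exchange_big -big_split; ext_sum c => /=.
  rewrite lc_compat mulr_suml mulr_sumr -big_split; ext_sum m => /=; ring.
rewrite E1 [RHS]big_split addrC; congr (_ + _).
  swap_sum c => /=.
  under eq_bigr do rewrite -mulr_sumr lcHG.
  rewrite (bigD1 p) //= eqxx mulr1 big1 ?addr0 // => m mp.
  by rewrite eq_sym (negPf mp) mulr0.
swap_sum a => /=.
transitivity (\sum_m H p a * Gam m e a * (\sum_c G m c * H c q)).
  ext_sum m; rewrite mulr_sumr; ext_sum c; ring.
under eq_bigr do rewrite lcGH.
rewrite (bigD1 q) //= eqxx mulr1 big1 ?addr0 1?mulrC // => m mq.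
by rewrite (negPf mq) mulr0.
Qed.

Definition contr T s := \sum_p \sum_q H p q * T [:: p, q & s].

(** Contraction commutes with [cov] because the inverse metric is parallel, which is the content of
    [lcH_der]. *)
Lemma cov_contr e T s : cov e (contr T) s = \sum_p \sum_q H p q * cov e T [:: p, q & s].
Proof.
rewrite /cov /contr.
have -> : act (fun a m => Gam m e a) (fun r => \sum_p \sum_q H p q * T [:: p, q & r]) s =
  \sum_p \sum_q H p q * act (fun a m => Gam m e a) (fun r => T [:: p, q & r]) s.
  transitivity (act (fun a m => Gam m e a) (fun r => \sum_p 1 * \sum_q H p q * T [:: p, q & r]) s).
    by congr (act _ _ s); apply/funext => r; ext_sum p; rewrite mul1r.
  rewrite act_sum; ext_sum p; rewrite mul1r.
  by rewrite (act_sum (H p) _ (fun q r => T [:: p, q & r])).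
have E : \sum_p \sum_q (\sum_m (Gam p e m * H m q + Gam q e m * H p m)) * T [:: p, q & s] =
  \sum_p \sum_q H p q * (\sum_m Gam m e p * T [:: m, q & s] + \sum_m Gam m e q * T [:: p, m & s]).
  transitivity (\sum_p \sum_q (\sum_m Gam p e m * H m q * T [:: p, q & s])
     + \sum_p \sum_q (\sum_m Gam q e m * H p m * T [:: p, q & s])).
    rewrite -big_split; ext_sum p; rewrite -big_split; ext_sum q => /=.
    by rewrite mulr_suml -big_split; ext_sum m; rewrite mulrDl.
  transitivity (\sum_p \sum_q (\sum_m H p q * Gam m e p * T [:: m, q & s])
     + \sum_p \sum_q (\sum_m H p q * Gam m e q * T [:: p, m & s])); last first.
    rewrite -big_split; ext_sum p; rewrite -big_split; ext_sum q => /=.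
    by rewrite mulrDr !mulr_sumr; congr (_ + _); ext_sum m; rewrite mulrA.
  congr (_ + _); last first.
    ext_sum p; swap_sum m.
    by ext_sum q; rewrite (mulrC (H p m)).
  transitivity (\sum_q \sum_p \sum_m Gam p e m * H m q * T [:: p, q & s]).
    exact: exchange_big.
  rewrite [RHS]exchange_big; ext_sum q; rewrite exchange_big.
  ext_sum m; ext_sum p; by rewrite (mulrC (H m q)).
rewrite der_sum; under eq_bigr do rewrite der_sum.
transitivity (\sum_p \sum_q (H p q * (X e (T [:: p, q & s]) - act (fun a m => Gam m e a) (fun r => T [:: p, q & r]) s)) -
  \sum_p \sum_q (\sum_m (Gam p e m * H m q + Gam q e m * H p m)) * T [:: p, q & s]).
  rewrite -!sumrB; ext_sum p; rewrite -!sumrB; ext_sum q.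
  rewrite derM lcH_der; ring.
rewrite E -sumrB; ext_sum p; rewrite -sumrB; ext_sum q => /=.
ring.
Qed.

Definition tens (f : I4 -> A) T s := if s is n :: r then f n * T r else 0.
Definition vect (f : I4 -> A) s := if s is [:: n] then f n else 0.

Lemma cov_tens e f T n s : cov e (tens f T) (n :: s) = cov e (vect f) [:: n] * T s + f n * cov e T s.
Proof.
rewrite /cov /= actZ derM addr0 mulrBl mulrBr mulr_suml.
rewrite (_ : \sum_i Gam i e n * f i * T s = \sum_i Gam i e n * (f i * T s)); first ring.
by ext_sum i; rewrite mulrA.
Qed.

End Geometry.
Arguments rm {A} X s : simpl never.

(** * Curvature identities of gradient solitons *)

Section Soliton.
Variables (A : comPzRingType) (X : lc_geometry A) (f rho : A).
Local Notation G := (lcG X).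
Local Notation H := (lcH X).
Local Notation cov := (cov X (lcGam X)).
Local Notation nab := (nab X (lcGam X)).
Local Notation riem := (riem X (lcGam X)).
Local Notation rm := (rm X).
Local Notation contr := (contr X).

(** [dep swp] puts the contracted pair into slots one and three, which makes the Ricci curvature of
    round spheres positive. *)
Definition rc := contr (rm \o dep swp).
Definition grad := vect (fun a => X a f).

Lemma act_ext M (T T' : seq I4 -> A) n : (forall s, size s = n -> T s = T' s) ->
  forall s, size s = n -> act M T s = act M T' s.
Proof.
elim: n T T' => [|n IH] T T' h [|a s] //= [sn]; congr (_ + _).
  by ext_sum m; rewrite h //= sn.
by apply: IH => // r rn; apply: h; rewrite /= rn.
Qed.

Lemma cov_ext e (T T' : seq I4 -> A) n : (forall s, size s = n -> T s = T' s) ->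
  forall s, size s = n -> cov e T s = cov e T' s.
Proof. by move=> h s sn; rewrite /cov (act_ext _ h) ?h. Qed.

(** The exchange of the two index pairs, written with adjacent swaps so that it is [slotwise]. *)
Definition pair_swap := dep swp \o (dep (dep swp) \o (swp \o dep swp)).

Lemma rm_pair_swap : rm \o pair_swap = rm.
Proof.
apply/funext => -[|a [|b [|c [|d [|? s]]]]] //; exact: rm_pair.
Qed.

Lemma slotwise_pair_swap : slotwise A pair_swap.
Proof.
have s1 := @slotwise_swp A; have s2 := slotwise_dep s1; have s3 := slotwise_dep s2.
by do !apply: slotwise_comp.
Qed.

Lemma nab_rm_skew p a b c d : nab rm [:: p; b; a; c; d] = - nab rm [:: p; a; b; c; d].
Proof.
have := nab_slotwise X (lcGam X) rm (@slotwise_swp A).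
by rewrite rm_skew => /(congr1 (fun g => g [:: p; a; b; c; d])); rewrite nabN.
Qed.

Lemma nab_rm_pair p a b c d : nab rm [:: p; a; b; c; d] = nab rm [:: p; c; d; a; b].
Proof.
have := nab_slotwise X (lcGam X) rm slotwise_pair_swap.
by rewrite rm_pair_swap => /(congr1 (fun g => g [:: p; a; b; c; d])).
Qed.

Lemma nab_rc e a b : nab rc [:: e; a; b] = \sum_p \sum_q H p q * nab rm [:: e; p; a; q; b].
Proof.
rewrite /= /rc cov_contr; ext_sum p; ext_sum q.
have := nab_slotwise X (lcGam X) rm (slotwise_dep (@slotwise_swp A)).
by move=> /(congr1 (fun g => g [:: e; p; q; a; b])) /= ->.
Qed.

Hypothesis rho_const : forall k, X k rho = 0.
Hypothesis soliton : forall a b, rc [:: a; b] + nab grad [:: a; b] = rho * G a b.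

Lemma nab_rc_soliton e a b : nab rc [:: e; a; b] = - nab (nab grad) [:: e; a; b].
Proof.
rewrite /= -covN.
have h : cov e (fun s => rho * met X s) [:: a; b] = 0.
  rewrite /cov actZ derM rho_const mul0r add0r -mulrBr.
  by have := cov_met X e [:: a; b]; rewrite /cov => ->; rewrite mulr0.
apply/eqP; rewrite -subr_eq0 covN opprK -covD -h; apply/eqP.
by apply: (@cov_ext e _ _ 2) => // -[|x [|y [|? s]]] //= _; rewrite -soliton.
Qed.

Lemma contracted_bianchi b c d : contr (nab rm) [:: b; c; d] = nab rc [:: c; d; b] - nab rc [:: d; c; b].
Proof.
  rewrite !nab_rc -sumrB; ext_sum p; rewrite -sumrB; ext_sum q.
  rewrite nab_rm_pair; have := nab_rm_bianchi X [:: p; c; d; q; b].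
  rewrite -[cyc _]/[:: c; d; p; q; b] -[cyc _]/[:: d; p; c; q; b].
  rewrite (nab_rm_skew c p d) -mulrBr => h; congr (_ * _); apply/eqP.
  by rewrite -subr_eq0; apply/eqP; rewrite -[RHS]h; ring.
Qed.

(** On a soliton the derivative of Rc is minus the third derivative of [f]. The difference in the
    contracted Bianchi identity is thus a commutator of derivatives of [f], hence a curvature term:
    div Rm = Rm(grad f). *)
Lemma div_rm b c d : contr (nab rm) [:: b; c; d] = contr (tens (fun a => X a f) rm) [:: b; c; d].
Proof.
rewrite contracted_bianchi !nab_rc_soliton opprK addrC ricci_identity; last exact: lcGam_sym.
rewrite /= addr0 -sumrN; ext_sum m.
rewrite riem_skew mulNr opprK riemE mulr_suml; ext_sum k.
by rewrite -[tens _ _ _]/(X m f * rm [:: k; b; c; d]) (rm_pair X c d k b); ring.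
Qed.

Lemma cov_div_rm e b c d : \sum_p \sum_q H p q * nab (nab rm) [:: e; p; q; b; c; d] =
  \sum_p \sum_q H p q * (nab grad [:: e; p] * rm [:: q; b; c; d] + X p f * nab rm [:: e; q; b; c; d]).
Proof.
rewrite -(cov_contr X e (nab rm) [:: b; c; d]).
rewrite (@cov_ext e _ (contr (tens (fun a => X a f) rm)) 3) //; last first.
  by move=> [|x [|y [|z [|? s]]]] // _; exact: div_rm.
by rewrite cov_contr; ext_sum p; ext_sum q; rewrite cov_tens.
Qed.

Section Normalized.
Variables (K : comPzRingType) (ev : {rmorphism A -> K}).
Hypothesis evH : forall a b, ev (H a b) = (a == b)%:R.

(** [ev] evaluates at a point where the frame is orthonormal, so contractions become plain sums.
    Only the value of the metric is normalised there; its derivatives are arbitrary. *)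
Lemma sum_evH (T : I4 -> I4 -> A) : ev (\sum_p \sum_q H p q * T p q) = \sum_p ev (T p p).
Proof.
rewrite rmorph_sum; ext_sum p; rewrite rmorph_sum (bigD1 p) //=.
rewrite rmorphM evH eqxx mul1r big1 ?addr0 // => q qp.
by rewrite rmorphM evH eq_sym (negPf qp) mul0r.
Qed.

Lemma evG a b : ev (G a b) = (a == b)%:R.
Proof.
rewrite -(rmorph_nat ev) -(lcGH X) rmorph_sum (bigD1 b) //= rmorphM evH eqxx mulr1.
by rewrite big1 ?addr0 // => q qb; rewrite rmorphM evH (negPf qb) mulr0.
Qed.

Lemma ev_riem k a b d : ev (riem k a b d) = ev (rm [:: a; b; k; d]).
Proof.
transitivity (\sum_c ev (H k c) * ev (rm [:: a; b; c; d])).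
  by rewrite riemE rmorph_sum; ext_sum c; rewrite rmorphM.
rewrite (bigD1 k) //= evH eqxx mul1r [X in _ + X]big1 ?addr0 // => q qk.
by rewrite evH eq_sym (negPf qk) mul0r.
Qed.

Local Notation r a b c d := (ev (rm [:: a; b; c; d])).

Lemma ev_hessian a b : ev (nab grad [:: a; b]) = ev rho * (a == b)%:R - \sum_p r p a p b.
Proof.
have /(congr1 ev) := soliton a b; rewrite rmorphD rmorphM evG => <-.
by rewrite sum_evH /= [_ + ev (cov _ _ _)]addrC addrK.
Qed.

(** The drift Laplacian of the curvature is rewritten by the second Bianchi identity, derivatives
    are commuted, and the divergences that appear are known from [div_rm]. The result is [2 rho Rm]
    plus a quadratic expression. *)
Lemma evolution a b c d (Q := fun a b p m => r p a m b * r p m c d + r p a m c * r p b m d + r p a m d * r p b c m) :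
  \sum_p ev (nab (nab rm) [:: p; p; a; b; c; d]) - \sum_m ev (X m f) * ev (nab rm [:: m; a; b; c; d]) =
  ev (rho + rho) * r a b c d + \sum_p \sum_m (Q b a p m - Q a b p m).
Proof.
have skew2 p q x y z w : nab (nab rm) [:: p; q; y; x; z; w] = - nab (nab rm) [:: p; q; x; y; z; w].
  have := nab_slotwise X (lcGam X) (nab rm) (slotwise_dep (@slotwise_swp A)).
  rewrite -(nab_slotwise X (lcGam X) rm (@slotwise_swp A)) rm_skew.
  rewrite (_ : nab (fun s => - rm s) = (fun s => - nab rm s)); last first.
    by apply/funext => s; rewrite nabN.
  by move=> /(congr1 (fun g => g [:: p; q; x; y; z; w])); rewrite nabN => /= ->.
have B2 p x y z : nab (nab rm) [:: p; x; y; z; c; d] + nab (nab rm) [:: p; y; z; x; c; d]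
   + nab (nab rm) [:: p; z; x; y; c; d] = 0.
  have N0 : nab (fun s => nab rm s + nab rm (cyc s) + nab rm (cyc (cyc s))) = fun _ => 0.
    rewrite (_ : (fun s => _) = fun _ => 0); last first.
      by apply/funext => s; rewrite nab_rm_bianchi.
    by apply/funext => -[|k s] //=; rewrite /cov act0 der0 subr0.
  have := congr1 (fun g => g [:: p; x; y; z; c; d]) N0; rewrite !nabD.
  have c1 := nab_slotwise X (lcGam X) (nab rm) (@slotwise_cyc A).
  have c2 := nab_slotwise X (lcGam X) (nab rm \o cyc) (@slotwise_cyc A).
  rewrite -[fun s => nab rm (cyc s)]/(nab rm \o cyc).
  rewrite -[fun s => nab rm (cyc (cyc s))]/(nab rm \o cyc \o cyc).
  by rewrite c2 c1.
(* The commutator yields a Ricci term in the slot [x]; the Hessian of [f] from the divergence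
   carries the opposite one, and only [rho] remains. *)
have comm x y : \sum_p ev (nab (nab rm) [:: p; x; p; y; c; d]) =
   ev rho * r x y c d + \sum_m ev (X m f) * ev (nab rm [:: x; m; y; c; d]) - \sum_p \sum_m Q x y p m.
  have h p : ev (nab (nab rm) [:: p; x; p; y; c; d]) = ev (nab (nab rm) [:: x; p; p; y; c; d])
      - (\sum_m r p x m p * r m y c d + \sum_m Q x y p m).
    have /(congr1 ev) := ricci_identity X (lcGam_sym X) rm p x [:: p; y; c; d].
    rewrite rmorphB rmorphN => h.
    rewrite -[LHS](subrK (ev (nab (nab rm) [:: x; p; p; y; c; d]))) h addrC.
    congr (_ + - _); rewrite /= addr0 !rmorphD !rmorph_sum.
    rewrite /Q 2!big_split /= -!addrA; congr (_ + (_ + (_ + _))); ext_sum m; by rewrite rmorphM ev_riem.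
  under eq_bigr do rewrite h.
  rewrite sumrB big_split opprD addrA; congr (_ - _).
  rewrite -(sum_evH (fun p q => nab (nab rm) [:: x; p; q; y; c; d])) cov_div_rm sum_evH.
  under [X in X - _]eq_bigr do rewrite rmorphD !rmorphM ev_hessian.
  rewrite big_split /= addrAC; congr (_ + _).
  under [X in X - _]eq_bigr do rewrite mulrBl.
  rewrite sumrB (bigD1 x) //= eqxx mulr1 [X in _ + X - _ - _]big1 => [|m mx]; last first.
    by rewrite eq_sym (negPf mx) mulr0 mul0r.
  rewrite addr0 -addrA -[RHS]addr0; congr (_ + _).
  rewrite -opprD -[RHS]oppr0; congr (- _); rewrite [X in _ + X]exchange_big -big_split.
  rewrite big1 // => m _ /=; rewrite mulr_suml -big_split big1 // => p _ /=.
  rewrite /= -mulrDl (_ : rm [:: p; x; m; p] = - rm [:: p; x; p; m]) ?rmorphN ?subrr ?mul0r //.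
  by have /(congr1 (fun g => g [:: p; x; p; m])) /= := rm_skew34 X.
(* The differentiated second Bianchi identity moves one traced index into the curvature slots. *)
have -> : \sum_p ev (nab (nab rm) [:: p; p; a; b; c; d]) = \sum_p ev (nab (nab rm) [:: p; a; p; b; c; d])
  - \sum_p ev (nab (nab rm) [:: p; b; p; a; c; d]).
  rewrite -sumrB; ext_sum p; rewrite -rmorphB; congr (ev _).
  have := B2 p p a b; rewrite (skew2 p a p b) => h.
  by apply/eqP; rewrite -subr_eq0; apply/eqP; rewrite -[RHS]h; ring.
rewrite !comm.
have -> : \sum_m ev (X m f) * ev (nab rm [:: m; a; b; c; d]) = \sum_m ev (X m f) * ev (nab rm [:: a; m; b; c; d]) -
  \sum_m ev (X m f) * ev (nab rm [:: b; m; a; c; d]).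
  rewrite -sumrB; ext_sum m; rewrite -mulrBr -rmorphB; congr (_ * ev _).
  have := nab_rm_bianchi X [:: m; a; b; c; d].
  rewrite -[cyc _]/[:: a; b; m; c; d] -[cyc _]/[:: b; m; a; c; d] (nab_rm_skew a m b).
  by move=> h; apply/eqP; rewrite -subr_eq0; apply/eqP; rewrite -[RHS]h; ring.
have -> : r b a c d = - r a b c d.
  by have /(congr1 (fun g => g [:: a; b; c; d])) /= h := rm_skew X; rewrite -rmorphN -h.
under [X in _ = _ + X]eq_bigr do rewrite sumrB.
rewrite [X in _ = _ + X]sumrB rmorphD; ring.
Qed.

(** [D1] is the contracted identity 2 div Rc = dR, and [D2] is div Rc = Rc(grad f). With the Hessian
    taken from the soliton equation all Ricci terms cancel. *)
Lemma hamilton e : ev (X e (contr rc [::] + contr (tens (fun a => X a f) grad) [::] - (rho + rho) * f)) = 0.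
Proof.
have cov0 T : X e (T [::]) = cov e T [::] by rewrite /cov subr0.
rewrite derB derD !cov0 !cov_contr !rmorphB !rmorphD !sum_evH.
rewrite derM derD rho_const addr0 mul0r add0r rmorphM.
have S4 x y z w : rm [:: x; y; w; z] = - rm [:: x; y; z; w].
  by have /(congr1 (fun g => g [:: x; y; z; w])) := rm_skew34 X.
have S2 x y z w : rm [:: y; x; z; w] = - rm [:: x; y; z; w].
  by have /(congr1 (fun g => g [:: x; y; z; w])) := rm_skew X.
have Rc a b : ev (rc [:: a; b]) = \sum_p r p a p b by rewrite sum_evH.
have nR x a b : ev (nab rc [:: x; a; b]) = \sum_p ev (nab rm [:: x; p; a; p; b]).
  by rewrite nab_rc sum_evH.
have nRsym x a b : ev (nab rc [:: x; a; b]) = ev (nab rc [:: x; b; a]).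
  by rewrite !nR; ext_sum p; rewrite nab_rm_pair.
have D c : \sum_b \sum_p ev (nab rm [:: p; p; b; c; b]) = \sum_p ev (nab rc [:: p; p; c]).
  swap_sum p; rewrite nR; ext_sum b.
  by rewrite nab_rm_skew nab_rm_pair nab_rm_skew opprK nab_rm_pair.
have D1 c : \sum_p ev (nab rc [:: p; p; c]) = \sum_b ev (nab rc [:: c; b; b]) - \sum_p ev (nab rc [:: p; p; c]).
  rewrite -{1}D -sumrB; ext_sum b.
  rewrite -(sum_evH (fun p q => nab rm [:: p; q; b; c; b])).
  rewrite -[\sum_p _]/(contr (nab rm) [:: b; c; b]).
  by rewrite contracted_bianchi rmorphB (nRsym b c b).
have D2 c : \sum_p ev (nab rc [:: p; p; c]) = \sum_m ev (X m f) * ev (rc [:: m; c]).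
  rewrite -D; transitivity (\sum_b \sum_m ev (X m f) * r b m b c).
    ext_sum b; rewrite -(sum_evH (fun p q => nab rm [:: p; q; b; c; b])).
    rewrite -[\sum_p _]/(contr (nab rm) [:: b; c; b]) div_rm sum_evH.
    by ext_sum m; rewrite /= rmorphM S2 S4 opprK.
  by swap_sum m; rewrite Rc mulr_sumr.
have -> : \sum_p ev (cov e rc [:: p; p]) = \sum_p ev (nab rc [:: p; p; e]) + \sum_p ev (nab rc [:: p; p; e]).
  by rewrite {1}D1 subrK.
have -> : \sum_p ev (cov e (tens (fun a => X a f) grad) [:: p; p]) = (\sum_p ev (X p f) * ev (nab grad [:: e; p])) *+ 2.
  rewrite -sumrMnl; ext_sum p; rewrite cov_tens rmorphD !rmorphM mulr2n.
  by rewrite mulrC.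
under [X in _ + X *+ 2 - _]eq_bigr do rewrite ev_hessian mulrBr.
rewrite sumrB D2 [X in _ + (X - _) *+ 2](bigD1 e) //= eqxx mulr1.
rewrite [X in _ + (_ + X - _) *+ 2]big1 => [|m me]; last first.
  by rewrite eq_sym (negPf me) !mulr0.
have -> : \sum_m ev (X m f) * ev (rc [:: m; e]) = \sum_p ev (X p f) * \sum_q r q e q p.
  ext_sum m; rewrite Rc; congr (_ * _); ext_sum p.
  by rewrite rm_pair.
rewrite rmorphD; ring.
Qed.

End Normalized.
End Soliton.

(** * Change of coordinates and of frame *)

Section Transformation.
Variables (A B : comPzRingType) (phi : {rmorphism A -> B}).
Variables (X : lc_geometry A) (Y : lc_geometry B) (J : I4 -> I4 -> B).

(** Components of [T] in the frame [J], the coefficients being carried by [phi] to the ring of the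
    target geometry. Transitions of charts and constant frames are both instances. *)
Fixpoint frm (T : seq I4 -> A) s : B := if s is a :: r then \sum_i J a i * frm (fun r => T (i :: r)) r else phi (T [::]).

Lemma frm_cons T a s : frm T (a :: s) = \sum_i J a i * frm (fun r => T (i :: r)) s.
Proof. by []. Qed.

Lemma frm_sum (c : I4 -> A) (T : I4 -> seq I4 -> A) s : frm (fun r => \sum_i c i * T i r) s = \sum_i phi (c i) * frm (T i) s.
Proof.
elim: s T => [|a s IH] T /=.
  by rewrite rmorph_sum; ext_sum i; rewrite rmorphM.
under eq_bigr do rewrite (IH (fun i r => T i (_ :: r))) mulr_sumr.
swap_sum i => /=; rewrite mulr_sumr.
by ext_sum j; rewrite mulrCA.
Qed.

Lemma frmD T T' s : frm (fun r => T r + T' r) s = frm T s + frm T' s.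
Proof.
elim: s T T' => [|a s IH] T T' /=; first by rewrite rmorphD.
under eq_bigr do rewrite (IH (fun r => T (_ :: r)) (fun r => T' (_ :: r))) mulrDr.
by rewrite big_split.
Qed.

Lemma frmN T s : frm (fun r => - T r) s = - frm T s.
Proof.
elim: s T => [|a s IH] T /=; first by rewrite rmorphN.
by under eq_bigr do rewrite (IH (fun r => T (_ :: r))) mulrN; rewrite sumrN.
Qed.

Hypothesis der_chain : forall a u, Y a (phi u) = \sum_i J a i * phi (X i u).
Hypothesis met_law : forall a b, lcG Y a b = \sum_i \sum_j J a i * J b j * phi (lcG X i j).
Hypothesis J_closed : forall a b k, Y a (J b k) = Y b (J a k).

Let mJ := \matrix_(i, j) J i j.
Let mG := \matrix_(i, j) phi (lcG X i j).
Let mH := \matrix_(i, j) lcH Y i j.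

(** The transformation law of the metric already provides an inverse of [J]. *)
Lemma frame_inverse : mG *m mJ^T *m mH *m mJ = 1%:M.
Proof.
apply: mulmx1C; apply/matrixP => i j; rewrite [RHS]mxE -(lcGH Y) !mulmxA mxE.
ext_sum c; rewrite !mxE; congr (_ * _); rewrite met_law exchange_big.
ext_sum l; rewrite !mxE mulr_suml; ext_sum m; rewrite !mxE.
by rewrite mulrAC.
Qed.

Lemma comet_law i j : \sum_p \sum_q lcH Y p q * (J p i * J q j) = phi (lcH X i j).
Proof.
have E : (\matrix_(i, j) phi (lcH X i j)) *m mG = 1%:M.
  apply/matrixP => k l; rewrite !mxE -(rmorph_nat phi) -(lcHG X) rmorph_sum.
  by ext_sum c; rewrite !mxE rmorphM.
have /matrixP/(_ i j) : mJ^T *m mH *m mJ = \matrix_(i, j) phi (lcH X i j).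
  by rewrite -[RHS]mulmx1 -frame_inverse !mulmxA E mul1mx.
rewrite !mxE => <-; swap_sum q; rewrite !mxE mulr_suml.
by ext_sum p; rewrite !mxE; ring.
Qed.

Lemma frm_swp T s : frm (T \o swp) s = frm T (swp s).
Proof.
case: s => [|a [|b s]] //; rewrite !frm_cons.
under eq_bigr do rewrite frm_cons mulr_sumr.
under [RHS]eq_bigr do rewrite frm_cons mulr_sumr.
swap_sum i; ext_sum j.
by rewrite mulrCA.
Qed.

Lemma frm_dep w T s : (forall T s, frm (T \o w) s = frm T (w s)) -> frm (T \o dep w) s = frm T (dep w s).
Proof.
move=> h; case: s => [|a s] //=; ext_sum i; congr (_ * _).
exact: (h (fun r => T (i :: r))).
Qed.

Lemma contr_frm T s : contr Y (frm T) s = frm (contr X T) s.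
Proof.
have -> : frm (contr X T) s = \sum_i \sum_j phi (lcH X i j) * frm (fun r => T [:: i, j & r]) s.
  transitivity (frm (fun r => \sum_i 1 * \sum_j lcH X i j * T [:: i, j & r]) s).
    by congr (frm _ s); apply/funext => r; ext_sum p; rewrite mul1r.
  rewrite frm_sum; ext_sum i; rewrite rmorph1 mul1r.
  by rewrite (frm_sum (lcH X i) (fun j r => T [:: i, j & r])).
under [RHS]eq_bigr do under eq_bigr do rewrite -comet_law mulr_suml.
under [RHS]eq_bigr do rewrite exchange_big.
swap_sum p.
under [RHS]eq_bigr do under eq_bigr do rewrite mulr_suml.
under [RHS]eq_bigr do rewrite exchange_big /=.
swap_sum q; rewrite frm_cons mulr_sumr.
ext_sum i; rewrite frm_cons !mulr_sumr; ext_sum j; ring.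
Qed.

Let z a b k := Y a (J b k) + \sum_i \sum_j J a i * J b j * phi (lcGam X k i j).

(** The transported connection [z], lowered to [zl], is symmetric and differentiates the metric just
    as the lowered target connection [gl] does. Three cyclic instances force them to agree, as in
    the Koszul formula, and [frame_inverse] undoes the lowering. *)
Lemma lc_unique a b k : z a b k = \sum_c lcGam Y c a b * J c k.
Proof.
have zsym x y t : z x y t = z y x t.
  rewrite /z J_closed exchange_big; congr (_ + _); ext_sum i.
  by ext_sum j; rewrite (lcGam_sym X) (mulrC (J x j)).
pose zl x y w := \sum_t \sum_m z x y t * phi (lcG X t m) * J w m.
pose gl x y w := \sum_d lcGam Y d x y * lcG Y d w.
have hz x y w : Y x (lcG Y y w) = zl x y w + zl x w y.
  have perm4 (F : I4 -> I4 -> I4 -> I4 -> B) : \sum_i \sum_j \sum_l \sum_t F i j l t = \sum_t \sum_j \sum_l \sum_i F i j l t.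
    transitivity (\sum_i \sum_t \sum_j \sum_l F i j l t).
      ext_sum i; rewrite [RHS]exchange_big; ext_sum j.
      exact: exchange_big.
    swap_sum t; rewrite exchange_big.
    by ext_sum j; apply: exchange_big.
  have zlE u v : zl x u v = \sum_t \sum_m Y x (J u t) * phi (lcG X t m) * J v m +
     \sum_j \sum_m \sum_i \sum_t J x i * J u j * phi (lcGam X t i j) * phi (lcG X t m) * J v m.
    rewrite [X in _ = _ + X]perm4 -big_split; ext_sum t; rewrite -big_split.
    ext_sum m; rewrite /= /z 2!mulrDl; congr (_ + _).
    by rewrite !mulr_suml; ext_sum i; rewrite !mulr_suml.
  rewrite met_law der_sum !zlE addrACA [X in _ + X + _]exchange_big.
  rewrite [X in _ + (_ + X)]exchange_big -!big_split; ext_sum i => /=.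
  rewrite der_sum -!big_split; ext_sum j => /=.
  rewrite !derM der_chain mulrDl (lcG_sym X j i); congr (_ + _); first ring.
  rewrite mulr_sumr -big_split; ext_sum l => /=.
  rewrite lc_compat rmorph_sum !mulr_sumr -big_split; ext_sum t => /=.
  rewrite rmorphD !rmorphM (lcG_sym X i t); ring.
have hg x y w : Y x (lcG Y y w) = gl x y w + gl x w y.
  rewrite lc_compat big_split /=; congr (_ + _); ext_sum d.
  by rewrite (lcG_sym Y y).
have E x y w : zl x y w = gl x y w.
  apply: (mulr2_inj Y).
  have := hz x y w; have := hz y w x; have := hz w x y.
  have zls u v t : zl u v t = zl v u t.
    by ext_sum i; ext_sum j; rewrite zsym.
  have gls u v t : gl u v t = gl v u t.
    by ext_sum i; rewrite (lcGam_sym Y).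
  rewrite !hg (zls y x) (zls w y) (zls x w) (gls y x) (gls w y) (gls x w).
  move=> h1 h2 h3; apply/eqP; rewrite -subr_eq0; apply/eqP.
  have : (gl x y w + gl w x y - (zl x y w + zl w x y)) + (gl y w x + gl x y w - (zl y w x + zl x y w))
      - (gl w x y + gl y w x - (zl w x y + zl y w x)) = 0.
    by rewrite h1 h2 h3 !subrr subr0 addr0.
  by move=> /(congr1 (fun u => - u)); rewrite oppr0 => <-; ring.
have inv := frame_inverse.
pose w := \row_t (z a b t - \sum_c lcGam Y c a b * J c t).
have w0 : w *m (mG *m mJ^T) = 0.
  apply/rowP => y; rewrite !mxE.
  have /eqP := E a b y; rewrite -subr_eq0 => /eqP h; rewrite -[RHS]h /zl /gl.
  transitivity (\sum_t \sum_m (z a b t - \sum_c lcGam Y c a b * J c t) * (phi (lcG X t m) * J y m)).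
    by ext_sum t; rewrite !mxE mulr_sumr; ext_sum m; rewrite !mxE.
  have -> : \sum_d lcGam Y d a b * lcG Y d y = \sum_t \sum_m (\sum_c lcGam Y c a b * J c t) * (phi (lcG X t m) * J y m).
    under eq_bigr do rewrite met_law mulr_sumr.
    swap_sum t => /=.
    under eq_bigr do rewrite mulr_sumr.
    swap_sum m => /=; rewrite mulr_suml.
    by ext_sum d; ring.
  rewrite -sumrB; ext_sum t; rewrite -sumrB; ext_sum m; ring.
have : w = 0 by rewrite -[w]mulmx1 -inv !mulmxA -(mulmxA w) w0 !mul0mx.
by move=> /rowP/(_ k); rewrite !mxE => /eqP; rewrite subr_eq0 => /eqP.
Qed.

(** The derivative of [J] and the target Christoffel term combine, by [lc_unique], into the source
    Christoffel term. *)
Lemma cov_frm k T s : cov Y (lcGam Y) k (frm T) s = \sum_i J k i * frm (cov X (lcGam X) i T) s.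
Proof.
elim: s T => [|a s IH] T.
  rewrite /cov /= subr0 der_chain; ext_sum i; by rewrite subr0.
transitivity (\sum_i J a i * cov Y (lcGam Y) k (frm (fun r => T (i :: r))) s +
  \sum_i (Y k (J a i) - \sum_m lcGam Y m k a * J m i) * frm (fun r => T (i :: r)) s).
  rewrite {1}/cov /= der_sum.
  rewrite (act_sum (J a) _ (fun i => frm (fun r => T (i :: r)))).
  under [X in X - _]eq_bigr do rewrite derM.
  rewrite /cov; under [X in _ = X + _]eq_bigr do rewrite mulrBr.
  under [X in _ = _ + X]eq_bigr do rewrite mulrBl mulr_suml.
  rewrite big_split !sumrB /= [X in _ = _ + (_ - X)]exchange_big /=.
  under [X in _ - (X + _)]eq_bigr do rewrite mulr_sumr.
  under [X in _ = _ + (_ - X)]eq_bigr do under eq_bigr do rewrite -mulrA.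
  ring.
under eq_bigr do rewrite IH mulr_sumr.
have -> : \sum_i J k i * frm (cov X (lcGam X) i T) (a :: s) =
  \sum_i \sum_j J k i * (J a j * frm (cov X (lcGam X) i (fun r => T (j :: r))) s)
  - \sum_i \sum_j \sum_m J k i * J a j * phi (lcGam X m i j) * frm (fun r => T (m :: r)) s.
  rewrite -sumrB; ext_sum i; rewrite frm_cons mulr_sumr -sumrB.
  ext_sum j.
  rewrite (_ : (fun r => cov X (lcGam X) i T (j :: r)) = (fun r => cov X (lcGam X) i (fun r => T (j :: r)) r +
       - \sum_m lcGam X m i j * T (m :: r))); last first.
    by apply/funext => r; rewrite /cov /=; ring.
  rewrite frmD frmN (frm_sum (fun m => lcGam X m i j) (fun m r => T (m :: r))).
  rewrite !mulrDr !mulrN !mulr_sumr; congr (_ - _).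
  by ext_sum m; rewrite !mulrA.
congr (_ + _).
  swap_sum i; ext_sum j; ring.
rewrite [X in - X](_ : _ = \sum_m (\sum_i \sum_j J k i * J a j * phi (lcGam X m i j))
   * frm (fun r => T (m :: r)) s); last first.
  under eq_bigr do rewrite exchange_big.
  swap_sum m; rewrite mulr_suml.
  by ext_sum i; rewrite mulr_suml.
rewrite -sumrN; ext_sum m; rewrite -mulNr; congr (_ * _).
by rewrite -lc_unique /z; ring.
Qed.

Lemma nab_frm T : nab Y (lcGam Y) (frm T) = frm (nab X (lcGam X) T).
Proof. by apply/funext => -[|k s] /=; rewrite ?rmorph0 // cov_frm. Qed.

(** The Ricci identity is applied in both geometries to the same coordinate covector, whose frame
    components form the column [m] of [J]. *)
Lemma riem_law k l a m : \sum_p riem Y (lcGam Y) p k l a * J p m =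
  \sum_i J k i * \sum_j J l j * \sum_c J a c * phi (riem X (lcGam X) m i j c).
Proof.
pose T s : A := (s == [:: m])%:R.
have T1 i : T [:: i] = (i == m)%:R by rewrite /T eqseq_cons andbT.
have fT i : frm T [:: i] = J i m.
  rewrite /= (bigD1 m) //= T1 eqxx rmorph1 mulr1 big1 ?addr0 // => j jm.
  by rewrite T1 (negPf jm) rmorph0 mulr0.
have := ricci_identity Y (lcGam_sym Y) (frm T) k l [:: a].
rewrite !nab_frm => /(congr1 -%R); rewrite opprK => E.
have -> : \sum_p riem Y (lcGam Y) p k l a * J p m = act (fun c p => riem Y (lcGam Y) p k l c) (frm T) [:: a].
  by rewrite -[LHS]addr0; under eq_bigr do rewrite -fT.
rewrite -E opprB; set N2 := nab X _ _.
have ricci i j c : phi (N2 [:: j; i; c]) - phi (N2 [:: i; j; c]) = phi (riem X (lcGam X) m i j c).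
  rewrite -rmorphB -opprB (ricci_identity X (lcGam_sym X)) opprK /= addr0; congr (phi _).
  rewrite (bigD1 m) //= T1 eqxx mulr1 big1 ?addr0 // => p pm.
  by rewrite T1 (negPf pm) mulr0.
transitivity (\sum_i \sum_j J k i * J l j * \sum_c J a c * phi (N2 [:: j; i; c]) -
    \sum_i \sum_j J k i * J l j * \sum_c J a c * phi (N2 [:: i; j; c])).
  congr (_ - _).
    rewrite [RHS]exchange_big frm_cons; ext_sum i; rewrite frm_cons mulr_sumr.
    by ext_sum j; rewrite mulrA (mulrC (J l i)).
  rewrite frm_cons; ext_sum i; rewrite frm_cons mulr_sumr.
  by ext_sum j; rewrite mulrA.
rewrite -sumrB; ext_sum i; rewrite -sumrB mulr_sumr; ext_sum j.
rewrite -mulrBr -mulrA; congr (_ * (_ * _)); rewrite -sumrB.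
by ext_sum c; rewrite -mulrBr ricci.
Qed.

Lemma frm_eq0 T n : (forall s, size s = n -> T s = 0) -> forall s, size s = n -> frm T s = 0.
Proof.
elim: n T => [|n IH] T h [|a s] //=; first by rewrite h ?rmorph0.
move=> [sn]; rewrite big1 // => i _; rewrite IH ?mulr0 // => r rn.
by apply: h; rewrite /= rn.
Qed.

Lemma rm_frm : rm Y = frm (rm X).
Proof.
apply/funext => s; have [s4|s4] := eqVneq (size s) 4%N; last first.
  rewrite (@frm_eq0 _ (size s)) //; last first.
    by move=> [|? [|? [|? [|? [|? r]]]]] // rs; rewrite -rs in s4.
  by case: s s4 => [|? [|? [|? [|? [|? r]]]]].
case: s s4 => [|a [|b [|c [|d [|? r]]]]] // _; rewrite {1}/rm.
under eq_bigr do rewrite met_law mulr_suml.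
rewrite exchange_big.
transitivity (\sum_i \sum_j J c i * phi (lcG X i j) * \sum_k riem Y (lcGam Y) k a b d * J k j).
  ext_sum i; under eq_bigr do rewrite mulr_suml.
  swap_sum j => /=; rewrite mulr_sumr.
  by ext_sum k; ring.
have -> : frm (rm X) [:: a; b; c; d] = \sum_x \sum_y \sum_i \sum_w
    J a x * J b y * J c i * J d w * phi (rm X [:: x; y; i; w]).
  rewrite !frm_cons; ext_sum x; rewrite frm_cons mulr_sumr.
  ext_sum y; rewrite frm_cons !mulr_sumr; ext_sum i.
  rewrite frm_cons !mulr_sumr; ext_sum w; rewrite !mulrA //.
rewrite exchange_big.
transitivity (\sum_j \sum_i J c i * phi (lcG X i j) * \sum_x \sum_y \sum_w
    J a x * J b y * J d w * phi (riem X (lcGam X) j x y w)).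
  ext_sum j; ext_sum i; congr (_ * _); rewrite riem_law.
  ext_sum x; rewrite mulr_sumr; ext_sum y; rewrite !mulr_sumr.
  by ext_sum w; rewrite !mulrA.
transitivity (\sum_x \sum_y \sum_i \sum_w \sum_j J a x * J b y * J c i * J d w *
    (phi (lcG X i j) * phi (riem X (lcGam X) j x y w))); last first.
  ext_sum x; ext_sum y; ext_sum i.
  ext_sum w; rewrite /rm rmorph_sum mulr_sumr.
  by ext_sum j; rewrite rmorphM.
transitivity (\sum_j \sum_i \sum_x \sum_y \sum_w J a x * J b y * J c i * J d w *
    (phi (lcG X i j) * phi (riem X (lcGam X) j x y w))).
  ext_sum j; ext_sum i; rewrite mulr_sumr.
  ext_sum x; rewrite mulr_sumr; ext_sum y; rewrite mulr_sumr.
  by ext_sum w; ring.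
rewrite exchange_big /=.
under eq_bigr do rewrite exchange_big /=.
swap_sum x => /=.
under eq_bigr do rewrite exchange_big /=.
swap_sum y => /=; ext_sum i.
by rewrite exchange_big.
Qed.

Lemma rc_frm : rc Y = frm (rc X).
Proof.
apply/funext => s; rewrite -contr_frm /rc rm_frm; congr (contr Y _ s).
by apply/funext => r; rewrite (frm_dep _ _ frm_swp).
Qed.

Lemma scal_frm : contr Y (rc Y) [::] = phi (contr X (rc X) [::]).
Proof. by rewrite rc_frm contr_frm. Qed.

Variable f : A.

Lemma grad_frm : grad Y (phi f) = frm (grad X f).
Proof.
apply/funext => -[|a [|b s]]; [by rewrite /= rmorph0|exact: der_chain|].
rewrite (@frm_eq0 _ (size [:: a, b & s])) //.
by move=> [|? [|? ?]].
Qed.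

Lemma grad2_frm : contr Y (tens (fun a => Y a (phi f)) (grad Y (phi f))) [::] =
  phi (contr X (tens (fun a => X a f) (grad X f)) [::]).
Proof.
rewrite -[RHS]/(frm _ [::]) -contr_frm; ext_sum p; ext_sum q.
congr (_ * _); rewrite grad_frm /= der_chain mulr_suml; ext_sum i.
by rewrite !mulr_sumr; ext_sum j; rewrite rmorphM; ring.
Qed.

End Transformation.

Section ConstantFrame.
Variables (A : comPzRingType) (X : lc_geometry A) (J K : I4 -> I4 -> A).
Hypothesis J_const : forall k a b, X k (J a b) = 0.
Hypothesis JK : forall a b, \sum_c J a c * K c b = (a == b)%:R.
Hypothesis KJ : forall a b, \sum_c K a c * J c b = (a == b)%:R.

Lemma sum_delta (F : I4 -> A) a : \sum_c (c == a)%:R * F c = F a.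
Proof.
rewrite (bigD1 a) //= eqxx mul1r big1 ?addr0 // => c ca.
by rewrite (negPf ca) mul0r.
Qed.

Let D k x := \sum_i J k i * X i x.

Let DD k x y : D k (x + y) = D k x + D k y.
Proof. by rewrite -big_split; ext_sum i; rewrite derD mulrDr. Qed.

Let DM k x y : D k (x * y) = D k x * y + x * D k y.
Proof.
rewrite mulr_suml mulr_sumr -big_split; ext_sum i; rewrite derM /=; ring.
Qed.

Let DC k l x : D k (D l x) = D l (D k x).
Proof.
rewrite /D; under eq_bigr do rewrite der_sum mulr_sumr.
under [RHS]eq_bigr do rewrite der_sum mulr_sumr.
swap_sum i; ext_sum j => /=.
rewrite !derM !J_const (derC X i j); ring.
Qed.

Let G' a b := \sum_i \sum_j J a i * J b j * lcG X i j.
Let H' a b := \sum_i \sum_j K i a * K j b * lcH X i j.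
Let Gam' c a b := \sum_k (\sum_i \sum_j J a i * J b j * lcGam X k i j) * K k c.

Let G'_sym a b : G' a b = G' b a.
Proof.
rewrite /G'; swap_sum i; ext_sum j.
rewrite (lcG_sym X); ring.
Qed.

Let G'H' a b : \sum_c G' a c * H' c b = (a == b)%:R.
Proof.
pose mJ := \matrix_(i, j) J i j; pose mK := \matrix_(i, j) K i j.
pose mG := \matrix_(i, j) lcG X i j; pose mH := \matrix_(i, j) lcH X i j.
have JK1 : mJ *m mK = 1%:M.
  by apply/matrixP => i j; rewrite !mxE -JK; ext_sum c; rewrite !mxE.
have GH1 : mG *m mH = 1%:M.
  by apply/matrixP => i j; rewrite !mxE -(lcGH X); ext_sum c; rewrite !mxE.
have : (mJ *m mG *m mJ^T) *m (mK^T *m mH *m mK) = 1%:M.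
  rewrite !mulmxA -(mulmxA (mJ *m mG)) -trmx_mul (mulmx1C JK1) trmx1 mulmx1.
  by rewrite -(mulmxA mJ) GH1 mulmx1.
move=> /matrixP/(_ a b); rewrite !mxE => <-; ext_sum c; congr (_ * _).
  rewrite /G' exchange_big mxE; ext_sum j; rewrite !mxE mulr_suml.
  by ext_sum i; rewrite !mxE; ring.
rewrite /H' exchange_big mxE; ext_sum j; rewrite !mxE mulr_suml.
by ext_sum i; rewrite !mxE; ring.
Qed.

Let Gam'_sym k a b : Gam' k a b = Gam' k b a.
Proof.
ext_sum i; congr (_ * _); swap_sum j.
by ext_sum l; rewrite (lcGam_sym X); ring.
Qed.

Let compat' a b c : D a (G' b c) = \sum_k (Gam' k a b * G' k c + Gam' k a c * G' b k).
Proof.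
have GamG x y z : \sum_k Gam' k x y * G' k z =
    \sum_i \sum_j \sum_k \sum_l J x i * J y j * J z l * (lcGam X k i j * lcG X k l).
  rewrite /Gam'; under eq_bigr do rewrite mulr_suml; rewrite exchange_big /=.
  transitivity (\sum_k (\sum_i \sum_j J x i * J y j * lcGam X k i j) * \sum_l J z l * lcG X k l).
    ext_sum k; rewrite -[in RHS](sum_delta (fun k => \sum_l J z l * lcG X k l) k).
    rewrite mulr_sumr; under eq_bigr do rewrite -mulrA; rewrite -mulr_sumr.
    rewrite -mulr_sumr; congr (_ * _).
    transitivity (\sum_m \sum_i \sum_j (K k m * J m i) * (J z j * lcG X i j)).
      ext_sum m; rewrite /G' mulr_sumr; ext_sum i.
      by rewrite mulr_sumr; ext_sum j; ring.
    swap_sum i => /=; rewrite exchange_big mulr_sumr /=.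
    by ext_sum j; rewrite -mulr_suml KJ eq_sym.
  under [LHS]eq_bigr do rewrite mulr_suml.
  swap_sum i => /=.
  under [LHS]eq_bigr do rewrite mulr_suml.
  swap_sum j => /=; ext_sum k.
  by rewrite mulr_sumr; ext_sum l; ring.
rewrite big_split /=; under [X in _ = _ + X]eq_bigr do rewrite G'_sym.
rewrite !GamG /D; under eq_bigr => i _.
  rewrite /G' der_sum; under eq_bigr do rewrite der_sum.
  over.
rewrite -big_split; ext_sum i => /=.
rewrite mulr_sumr.
transitivity (\sum_j \sum_l J a i * (J b j * J c l) * \sum_k (lcGam X k i j * lcG X k l + lcGam X k i l * lcG X j k)).
  ext_sum j; rewrite mulr_sumr; ext_sum l.
  rewrite !derM !J_const lc_compat; ring.
have -> : \sum_j \sum_k \sum_l J a i * J c j * J b l * (lcGam X k i j * lcG X k l) =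
  \sum_j \sum_k \sum_l J a i * J c l * J b j * (lcGam X k i l * lcG X k j).
  transitivity (\sum_j \sum_l \sum_k J a i * J c j * J b l * (lcGam X k i j * lcG X k l)).
    by ext_sum j; rewrite exchange_big.
  by swap_sum j; rewrite exchange_big.
rewrite -big_split; ext_sum j => /=.
rewrite [X in _ = X + _]exchange_big [X in _ = _ + X]exchange_big -big_split.
ext_sum l => /=; rewrite mulr_sumr -big_split.
by ext_sum k => /=; rewrite (lcG_sym X j k); ring.
Qed.

(** In effect a linear change of coordinates. It turns the metric into the identity at one point,
    while the frame fields still commute. *)
Definition frame_geometry := @LCGeometry A (Derivations DD DM DC) G' H' Gam' (half X) (halfE X) G'_sym G'H' Gam'_sym compat'.

End ConstantFrame.

Section LeviCivita.
Variables (A : comPzRingType) (D : derivations A) (G H : I4 -> I4 -> A) (h : A).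
Hypothesis hh : h + h = 1.
Hypothesis G_sym : forall a b, G a b = G b a.
Hypothesis GH : forall a b, \sum_c G a c * H c b = (a == b)%:R.

(** The Koszul formula. *)
Let Gam k a b := h * \sum_l H k l * (D a (G b l) + D b (G a l) - D l (G a b)).

Let Gam_sym k a b : Gam k a b = Gam k b a.
Proof.
rewrite /Gam; congr (_ * _); ext_sum l; rewrite (G_sym a b).
by rewrite [D a _ + _]addrC.
Qed.

Let Gam_lower a b c : \sum_k Gam k a b * G k c = h * (D a (G b c) + D b (G a c) - D c (G a b)).
Proof.
rewrite /Gam; under eq_bigr do rewrite -mulrA mulr_suml.
rewrite -mulr_sumr; congr (_ * _); rewrite exchange_big /=.
pose T l := D a (G b l) + D b (G a l) - D l (G a b).
transitivity (\sum_l (l == c)%:R * T l); last by rewrite sum_delta.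
ext_sum l; rewrite eq_sym -GH mulr_suml; ext_sum k.
by rewrite (G_sym c k) /T; ring.
Qed.

Let Gam_compat a b c : D a (G b c) = \sum_k (Gam k a b * G k c + Gam k a c * G b k).
Proof.
rewrite big_split /=; under [X in _ = _ + X]eq_bigr do rewrite G_sym.
rewrite !Gam_lower -mulrDr (G_sym c b).
have E (x y z : A) : x + y - z + (x + z - y) = x + x by ring.
by rewrite E mulrDr -mulrDl hh mul1r.
Qed.

Definition levi_civita := LCGeometry hh G_sym GH Gam_sym Gam_compat.

End LeviCivita.

Section Values.
Variables (A K : comPzRingType) (ev : {rmorphism A -> K}) (X : lc_geometry A) (f : A).
Variables (g h : I4 -> I4 -> K) (gam : I4 -> I4 -> I4 -> K) (df : I4 -> K).
Hypothesis ev_g : forall a b, ev (lcG X a b) = g a b.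
Hypothesis ev_h : forall a b, ev (lcH X a b) = h a b.
Hypothesis ev_gam : forall k a b, ev (lcGam X k a b) = gam k a b.
Hypothesis ev_df : forall k, ev (X k f) = df k.

Lemma riem_value k a b c : ev (riem X (lcGam X) k a b c) = ev (X a (lcGam X k b c)) - ev (X b (lcGam X k a c))
  + \sum_m (gam k a m * gam m b c - gam k b m * gam m a c).
Proof.
rewrite rmorphD rmorphB rmorph_sum; congr (_ + _); ext_sum m.
by rewrite rmorphB !rmorphM !ev_gam.
Qed.

Lemma rm_value a b c d : ev (rm X [:: a; b; c; d]) = \sum_k g c k * ev (riem X (lcGam X) k a b d).
Proof. by rewrite rmorph_sum; ext_sum k; rewrite rmorphM ev_g. Qed.

Lemma rc_value a b : ev (rc X [:: a; b]) = \sum_p ev (riem X (lcGam X) p p a b).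
Proof.
rewrite rmorph_sum; ext_sum p; rewrite rmorph_sum riemE rmorph_sum.
by ext_sum q.
Qed.

Lemma scal_value : ev (contr X (rc X) [::]) = \sum_p \sum_q h p q * ev (rc X [:: p; q]).
Proof.
rewrite rmorph_sum; ext_sum p; rewrite rmorph_sum.
by ext_sum q; rewrite rmorphM ev_h.
Qed.

Lemma hess_value a b : ev (nab X (lcGam X) (grad X f) [:: a; b]) = ev (X a (X b f)) - \sum_k gam k a b * df k.
Proof.
rewrite /= /cov /= addr0 rmorphB rmorph_sum; congr (_ - _); ext_sum k.
by rewrite rmorphM ev_gam ev_df.
Qed.

Lemma grad2_value : ev (contr X (tens (fun a => X a f) (grad X f)) [::]) = \sum_p \sum_q h p q * df p * df q.
Proof.
rewrite rmorph_sum; ext_sum p; rewrite rmorph_sum; ext_sum q.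
by rewrite !rmorphM ev_h !ev_df mulrA.
Qed.

End Values.

Section Contraction.
Variable K : comPzRingType.

(** The multilinear value T(v_1, ..., v_n). *)
Fixpoint con (T : seq I4 -> K) (vs : seq 'rV[K]_4) : K :=
  if vs is v :: r then \sum_i v 0 i * con (fun s => T (i :: s)) r else T [::].

Lemma con_cons T v r : con T (v :: r) = \sum_i v 0 i * con (fun s => T (i :: s)) r.
Proof. by []. Qed.

Lemma eq_con T T' vs : (forall s, size s = size vs -> T s = T' s) -> con T vs = con T' vs.
Proof.
elim: vs T T' => [|v r IH] T T' h /=; first exact: h.
by ext_sum i; congr (_ * _); apply: IH => s sr; apply: h; rewrite /= sr.
Qed.

Lemma ev_frm (A B : comPzRingType) (phi : {rmorphism A -> B}) (ev : {rmorphism B -> K}) (J : I4 -> I4 -> B) T s :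
  ev (frm phi J T s) = con (fun r => ev (phi (T r))) [seq \row_i ev (J a i) | a <- s].
Proof.
elim: s T => [|a s IH] T //; rewrite frm_cons /= rmorph_sum; ext_sum i.
by rewrite rmorphM mxE IH.
Qed.

End Contraction.

(** * The reaction term on self-dual forms *)

Notation o0 := (@Ordinal 4 0 isT).
Notation o1 := (@Ordinal 4 1 isT).
Notation o2 := (@Ordinal 4 2 isT).
Notation o3 := (@Ordinal 4 3 isT).

Section HalfReaction.
Variable K : realFieldType.

Lemma sum4 (V : zmodType) (F : I4 -> V) : \sum_i F i = F o0 + F o1 + F o2 + F o3.
Proof.
rewrite !big_ord_recl big_ord0 addr0 !addrA.
by congr (_ + _ + _ + _); congr F; apply/val_inj.
Qed.

Lemma prod4 (F : I4 -> K) : \prod_i F i = F o0 * F o1 * F o2 * F o3.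
Proof.
rewrite !big_ord_recl big_ord0 mulr1 !mulrA.
by congr (_ * _ * _ * _); congr F; apply/val_inj.
Qed.

Variable r : I4 -> I4 -> I4 -> I4 -> K.
Hypothesis r_skew : forall a b c d, r b a c d = - r a b c d.
Hypothesis r_pair : forall a b c d, r a b c d = r c d a b.
Hypothesis r_bianchi : forall a b c d, r a b c d + r b c a d + r c a b d = 0.

(** [pair1 a], [pair2 a], [pair3 a] are the cyclic permutation of 1, 2, 3 that starts with [a + 1];
    the direction 0 is singled out. *)
Definition pair1 (a : 'I_3) : I4 := inord a.+1.
Definition pair2 (a : 'I_3) : I4 := inord (a.+1 %% 3).+1.
Definition pair3 (a : 'I_3) : I4 := inord (a.+2 %% 3).+1.

(* Pairing of the bivectors (e_0 /\ e_a + s e_b /\ e_c) / sqrt 2 and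
   (e_0 /\ e_a' + t e_b' /\ e_c') / sqrt 2. *)
Definition half_form (s t : K) (a b : 'I_3) : K :=
  2^-1 * (r o0 (pair1 a) o0 (pair1 b) + t * r o0 (pair1 a) (pair2 b) (pair3 b) + s * r (pair2 a) (pair3 a) o0 (pair1 b)
    + s * t * r (pair2 a) (pair3 a) (pair2 b) (pair3 b)).

(** The quadratic part of the right-hand side of [evolution]. *)
Definition reaction a b c d := \sum_p \sum_m ((r p b m a * r p m c d + r p b m c * r p a m d + r p b m d * r p a c m)
   - (r p a m b * r p m c d + r p a m c * r p b m d + r p a m d * r p b c m)).

(* The terms half_form s (- s) come from the trace-free Ricci tensor. *)
Lemma half_reaction (s : K) (S := half_form s s) (B := half_form s (- s)) : s = 1 \/ s = -1 ->
  2^-1 * (reaction o0 o1 o0 o1 + s * reaction o0 o1 o2 o3 + s * reaction o2 o3 o0 o1 + reaction o2 o3 o2 o3) =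
  - 2 * (S 0 0 ^+ 2 + S 0 1 ^+ 2 + S 0 2%:R ^+ 2 + 2 * (S 1 1 * S 2%:R 2%:R - S 1 2%:R ^+ 2))
  - 2 * (B 0 0 ^+ 2 + B 0 1 ^+ 2 + B 0 2%:R ^+ 2).
Proof.
(* Skewness and pair symmetry reduce [r] to 21 entries [Q i j] indexed by the six basic bivectors,
   and the Bianchi identity [bi] removes one of them. What remains is a polynomial identity. *)
pose sg (a b : nat) : K := match a, b with | 0, 1 | 0, 2 | 0, 3 | 1, 2 | 1, 3 | 2, 3 => 1
  | 1, 0 | 2, 0 | 3, 0 | 2, 1 | 3, 1 | 3, 2 => -1 | _, _ => 0 end.
pose idx (a b : nat) : nat := match a, b with | 0, 1 | 1, 0 => 0 | 0, 2 | 2, 0 => 1 | 0, 3 | 3, 0 => 2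
  | 1, 2 | 2, 1 => 3 | 1, 3 | 3, 1 => 4 | _, _ => 5 end.
pose p0 (i : nat) : I4 := match i with 0 | 1 | 2 => o0 | 3 | 4 => o1 | _ => o2 end.
pose p1 (i : nat) : I4 := match i with 0 => o1 | 1 | 3 => o2 | _ => o3 end.
have h1 a b c d : r a b c d = sg a b * r (p0 (idx a b)) (p1 (idx a b)) c d.
  have z12 x : r x x c d = 0 by have := r_skew x x c d; lra.
  have I4P (x : I4) : [\/ x = o0, x = o1, x = o2 | x = o3].
    case: x => -[|[|[|[|//]]]] i; [constructor 1|constructor 2|constructor 3|constructor 4]; exact/val_inj.
  by case: (I4P a) => ->; case: (I4P b) => -> /=; rewrite ?z12 ?mul0r ?mul1r ?mulN1r // r_skew.
pose P (i j : nat) : K := r (p0 i) (p1 i) (p0 j) (p1 j).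
pose Q (i j : nat) : K := if Nat.leb i j then P i j else P j i.
have h2 a b c d : r a b c d = sg a b * (sg c d * Q (idx a b) (idx c d)).
  by rewrite h1 r_pair h1 /Q /P; case: ifP => // _; rewrite r_pair.
have bi : P 2 3 = - P 0 5 + P 1 4.
  have := r_bianchi o0 o1 o2 o3; rewrite (r_pair o1) (r_skew o0 o2) => h.
  by rewrite /P /=; lra.
have e10 : pair1 0 = o1 by apply/val_inj; rewrite /= inordK.
have e11 : pair1 1 = o2 by apply/val_inj; rewrite /= inordK.
have e12 : pair1 2%:R = o3 by apply/val_inj; rewrite /= inordK.
have e20 : pair2 0 = o2 by apply/val_inj; rewrite /= inordK.
have e21 : pair2 1 = o3 by apply/val_inj; rewrite /= inordK.
have e22 : pair2 2%:R = o1 by apply/val_inj; rewrite /= inordK.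
have e30 : pair3 0 = o3 by apply/val_inj; rewrite /= inordK.
have e31 : pair3 1 = o1 by apply/val_inj; rewrite /= inordK.
have e32 : pair3 2%:R = o2 by apply/val_inj; rewrite /= inordK.
rewrite /S /B /half_form !(e10, e11, e12, e20, e21, e22, e30, e31, e32).
rewrite /reaction; have -> : r = fun a b c d => sg a b * (sg c d * Q (idx a b) (idx c d)).
  by do 4!apply/funext => ?; exact: h2.
rewrite !sum4.
rewrite /Q; clearbody P; rewrite /sg /idx /= bi.
by case=> ->; field.
Qed.

End HalfReaction.

(** * Calculus in charts *)

(** Serves continuity as well as the class [smooth_closure], for finite sums and for products. *)
Lemma big_closed (R T : Type) (C : (T -> R) -> Prop) (op : R -> R -> R) (idx : R) (I : Type) (r : seq I)
    (P : pred I) (f : I -> T -> R) :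
  C (fun=> idx) -> (forall u w, C u -> C w -> C (fun x => op (u x) (w x))) -> (forall j, C (f j)) ->
  C (fun x => \big[op/idx]_(j <- r | P j) f j x).
Proof.
move=> h0 hop h; elim: r => [|j r IH].
  by rewrite (_ : (fun x => _) = fun=> idx) //; apply/funext => x; rewrite big_nil.
rewrite (_ : (fun x => _) = if P j then fun x => op (f j x) (\big[op/idx]_(j <- r | P j) f j x)
   else fun x => \big[op/idx]_(j <- r | P j) f j x); first by case: ifP => _ //; exact: hop.
by apply/funext => x; rewrite big_cons; case: ifP.
Qed.

Definition drv (R : realType) (f : R -> R) (t l : R) : Prop := is_derive t 1 f l.

Section RealDerivatives.
Variable R : realType.
Implicit Types (f g : R -> R) (t l : R).

Lemma drvP f t l : drv f t l <-> forall e : R, 0 < e -> exists2 d : R, 0 < d &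
  forall h : R, `|h| < d -> `|f (t + h) - f t - l * h| <= e * `|h|.
Proof.
split=> [[df <-] e e0|H].
  have : (h^-1 *: (f (h *: 1 + t) - f t)) @[h --> 0^'] --> 'D_1 f t by exact: df.
  move=> /cvgrPdist_le/(_ e e0); rewrite near_withinE => /nbhs_norm0P[d /= d0 hd].
  exists d => // h hh; have [->|h0] := eqVneq h 0.
    by rewrite addr0 subrr mulr0 subr0 normr0 mulr0.
  have := hd h hh h0; rewrite -(ler_pM2r (_ : 0 < `|h|)) ?normr_gt0 // -normrM.
  rewrite distrC; congr (`|_| <= _).
  by rewrite mulrBl -mulrAC -[h%:A]/(h * 1) mulVf // mul1r mulr1 (addrC h).
have C : (h^-1 *: (f (h *: 1 + t) - f t)) @[h --> 0^'] --> l.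
  apply/cvgrPdist_le => e e0; have [d d0 hd] := H e e0.
  near=> h; have h0 : h != 0 by near: h; exact: nbhs_dnbhs_neq.
  have hh : `|h| < d by near: h; exact: dnbhs0_lt.
  rewrite -(ler_pM2r (_ : 0 < `|h|)) ?normr_gt0 // -normrM.
  have := hd h hh; rewrite distrC; congr (`|_| <= _).
  by rewrite mulrBl -mulrAC -[h%:A]/(h * 1) mulVf // mul1r mulr1 (addrC h).
by apply: DeriveDef; [apply/cvg_ex; exists l | apply: cvg_lim].
Unshelve. all: by end_near. Qed.

Lemma drv_near f g t l : (\forall s \near t, f s = g s) -> drv f t l -> drv g t l.
Proof. exact: near_eq_is_derive. Qed.

Lemma drv_cont f t l : drv f t l -> cont_at f t.
Proof. by move=> [df _]; apply: differentiable_continuous; apply/derivable1_diffP. Qed.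

Lemma drv_unique f t l l' : drv f t l -> drv f t l' -> l = l'.
Proof. by move=> [_ <-] [_ <-]. Qed.

Lemma drv_val f t l l' : l = l' -> drv f t l -> drv f t l'.
Proof. by move=> ->. Qed.

Lemma drv_cst (c : R) t : drv (fun _ : R => c) t 0.
Proof. exact: is_derive_cst. Qed.

Lemma drv_id t : drv (fun s : R => s) t 1.
Proof. exact: is_derive_id. Qed.

Lemma drvD f g t l m : drv f t l -> drv g t m -> drv (fun s => f s + g s) t (l + m).
Proof. by rewrite /drv => hf hg; apply: is_deriveD. Qed.

Lemma drvN f t l : drv f t l -> drv (fun s => - f s) t (- l).
Proof. by rewrite /drv => hf; apply: is_deriveN. Qed.

Lemma drvB f g t l m : drv f t l -> drv g t m -> drv (fun s => f s - g s) t (l - m).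
Proof. by rewrite /drv => hf hg; apply: is_deriveB. Qed.

Lemma drvM f g t l m : drv f t l -> drv g t m -> drv (fun s => f s * g s) t (l * g t + f t * m).
Proof.
move=> hf hg; apply: (@drv_val _ _ (f t *: m + g t *: l)); last by apply: is_deriveM.
by rewrite addrC -[_ *: l]/(_ * l) (mulrC (g t)).
Qed.

Lemma drvZ (c : R) f t l : drv f t l -> drv (fun s => c * f s) t (c * l).
Proof.
by move=> hf; apply: (drv_val _ (drvM (drv_cst c t) hf)); rewrite mul0r add0r.
Qed.

Lemma drv_sum n (f : 'I_n -> R -> R) t (l : 'I_n -> R) :
  (forall i, drv (f i) t (l i)) -> drv (fun s => \sum_i f i s) t (\sum_i l i).
Proof.
by move=> h; have := is_derive_sum h; rewrite (_ : \sum_i f i = fun s => \sum_i f i s) //;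
  apply/funext => s; rewrite fct_sumE.
Qed.

Lemma drvV f t l : f t != 0 -> drv f t l -> drv (fun s => (f s)^-1) t (- l / f t ^+ 2).
Proof.
move=> f0 hf; apply: (@drv_val _ _ (- (f t) ^- 2 *: l)); last by apply: is_deriveV.
by rewrite -[_ *: l]/(_ * l) mulNr mulrC mulNr.
Qed.

Lemma drv_comp f g t l m : drv f (g t) l -> drv g t m -> drv (fun s => f (g s)) t (l * m).
Proof. by move=> hf hg; apply: is_derive1_comp. Qed.

Lemma drv_affine (a b : R) t : drv (fun s => a + b * s) t b.
Proof.
apply: (drv_val _ (drvD (drv_cst a t) (drvZ b (drv_id t)))); by rewrite add0r mulr1.
Qed.

Lemma quarters_lt (z : R) : z <= z / 4 + z / 4 -> ~ 0 < z.
Proof. by move=> ? ?; lra. Qed.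

Definition btw (a b t : R) := Num.min a b <= t <= Num.max a b.

Lemma btwE (a b t : R) : a <= b -> btw a b t = (a <= t <= b).
Proof. by move=> ab; rewrite /btw min_l // max_r. Qed.

Lemma mvt f (df : R -> R) (a b : R) : (forall t, btw a b t -> drv f t (df t)) ->
  exists2 c, btw a b c & f b - f a = df c * (b - a).
Proof.
have key (a' b' : R) : a' <= b' -> (forall t, a' <= t <= b' -> drv f t (df t)) ->
    exists2 c, a' <= c <= b' & f b' - f a' = df c * (b' - a').
  move=> ab h; have [||c] := @MVT_segment R f df a' b' ab.
  - by move=> x; rewrite in_itv /= => /andP[/ltW ax /ltW xb]; apply: h; rewrite ax.
  - apply: derivable_within_continuous => x; rewrite in_itv /= => xab.
    by case: (h x xab).
  - by rewrite in_itv /= => cab e; exists c.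
rewrite /btw; case: (leP a b) => [ab|/ltW ab] h; first exact: key.
have [c cab e] := key _ _ ab h; exists c => //.
by rewrite -opprB e -mulrN opprB.
Qed.

Lemma mvt_le f (df : R -> R) (a b M : R) : (forall t, btw a b t -> drv f t (df t)) ->
  (forall t, btw a b t -> `|df t| <= M) -> `|f b - f a| <= M * `|b - a|.
Proof.
move=> h hM; have [c cab ->] := mvt h.
by rewrite normrM ler_wpM2r // hM.
Qed.

Lemma mvt_ge0 f (df : R -> R) (a b : R) : a <= b -> (forall t, a <= t <= b -> drv f t (df t)) ->
  (forall t, a <= t <= b -> 0 <= df t) -> f a <= f b.
Proof.
move=> ab h h0; have bt t : btw a b t -> a <= t <= b by rewrite btwE.
have [c cab e] := @mvt f df a b (fun t bt' => h t (bt t bt')).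
by rewrite -subr_ge0 e mulr_ge0 ?subr_ge0 // h0 // bt.
Qed.

End RealDerivatives.

Section RowNorm.
Variables (R : realType) (n : nat).
Implicit Types (x y : 'rV[R]_n) (r : R).

Lemma coord_le_norm x k : `|x 0 k| <= `|x|.
Proof.
by rewrite [leRHS]/Num.Def.normr /= mx_normrE; apply/bigmax_geP; right => /=; exists (0, k).
Qed.

Lemma norm_le_coord x r : 0 <= r -> (forall k, `|x 0 k| <= r) -> `|x| <= r.
Proof.
move=> r0 h; rewrite [leLHS]/Num.Def.normr /= mx_normrE; apply/bigmax_leP; split=> //=.
by move=> [i k] _ /=; rewrite ord1.
Qed.

End RowNorm.

Section Strict.
Variable R : realType.
Implicit Types (x y z : 'rV[R]_4) (u : 'rV[R]_4 -> R) (k : 'I_4).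
Notation e_ k := (delta_mx 0 k : 'rV[R]_4).

Lemma drv_line u x k (s : R) : derivable u (x + s *: e_ k) (e_ k) ->
  drv (fun s => u (x + s *: e_ k)) s (partial k u (x + s *: e_ k)).
Proof.
move=> h.
have E' : (fun h0 : R => h0^-1 *: (((fun s => u (x + s *: e_ k)) \o shift s) (h0 *: (1 : R)) - u (x + s *: e_ k))) =
    (fun h0 : R => h0^-1 *: ((u \o shift (x + s *: e_ k)) (h0 *: e_ k) - u (x + s *: e_ k))).
  apply/funext => h0 /=; congr (_ *: (u _ - u _)).
  by rewrite -[h0%:A]/(h0 * 1) mulr1 scalerDl addrA (addrC x) -addrA.
split; first by rewrite /derivable E'; exact: h.
by rewrite /derive E'.
Qed.

(** Strict differentiability, both points being allowed to move: the increment is telescoped over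
    the four coordinates, with the mean value theorem on each edge. *)
Lemma C1_strict u x : (\forall y \near x, forall k, derivable u y (e_ k)) ->
  (forall k, cont_at (partial k u) x) -> forall e : R, 0 < e ->
  exists2 d : R, 0 < d & forall y z, `|y - x| < d -> `|z - x| < d ->
    `|u y - u z - \sum_k partial k u x * (y - z) 0 k| <= e * `|y - z|.
Proof.
move=> du cu e e0.
have e4 : 0 < e / 4 by rewrite divr_gt0.
have C k : \forall y \near x, `|partial k u x - partial k u y| <= e / 4.
  by have /cvgrPdist_le/(_ _ e4) := cu k.
have N : \forall y \near x, (forall k, derivable u y (e_ k)) /\ forall k, `|partial k u x - partial k u y| <= e / 4.
  near=> y; split; first by near: y.
  by near: y; exact: filter_forall C.
move: N => /nbhs_normP[d /= d0 hd]; exists d => // y z yx zx.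
(* The hybrid point with the first [j] coordinates of [y] and the remaining ones of [z]. *)
pose w j : 'rV[R]_4 := \row_k (if (k < j)%N then y 0 k else z 0 k).
have w0 : w 0%N = z by apply/rowP => k; rewrite mxE.
have w4 : w 4 = y by apply/rowP => k; rewrite mxE ltn_ord.
rewrite -{1}w4 -{1}w0 -(telescope_sumr (fun j => u (w j))) // big_mkord -sumrB.
apply: le_trans (ler_norm_sum _ _ _) _.
have -> : e * `|y - z| = \sum_(k < 4) (e / 4 * `|y - z|).
  by rewrite sumr_const card_ord -mulr_natr; field.
apply: ler_sum => j _; pose q := Num.max `|y - x| `|z - x|.
have qd : q < d by rewrite gt_max yx zx.
have ws t : btw 0 ((y - z) 0 j) t -> `|x - (w j + t *: e_ j)| < d.
  move=> bt; apply: le_lt_trans qd; apply: norm_le_coord; first by rewrite le_max normr_ge0.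
  move=> k; rewrite !mxE eqxx /=.
  have yq : `|y 0 k - x 0 k| <= q.
    by rewrite le_max; apply/orP; left; have := coord_le_norm (y - x) k; rewrite !mxE.
  have zq : `|z 0 k - x 0 k| <= q.
    by rewrite le_max; apply/orP; right; have := coord_le_norm (z - x) k; rewrite !mxE.
  have [E|kj] := eqVneq k j; last first.
    by rewrite mulr0 addr0; case: ifP => _; rewrite distrC.
  rewrite -E ltnn mulr1; move: bt yq zq; rewrite /btw !mxE -E !ler_norml.
  by rewrite /Num.min /Num.max; case: ifP => h; lra.
have wS : w j.+1 = w j + ((y - z) 0 j) *: e_ j.
  apply/rowP => k; rewrite !mxE ltnS leq_eqVlt val_eqE.
  by have [->|kj] := eqVneq k j; rewrite /= ?ltnn ?mulr1 ?mulr0 ?addr0 // addrC subrK.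
have dl t : btw 0 ((y - z) 0 j) t -> drv (fun s => u (w j + s *: e_ j)) t (partial j u (w j + t *: e_ j)).
  by move=> bt; apply: drv_line; have [/(_ j)] := hd _ (ws t bt).
have [c bc E] := mvt dl; rewrite wS.
move: E; rewrite scale0r addr0 subr0 => ->; rewrite -mulrBl normrM ler_pM //.
  by have [_ /(_ j)] := hd _ (ws c bc); rewrite distrC.
exact: coord_le_norm.
Unshelve. all: by end_near. Qed.

Lemma C1_chain u (c : R -> 'rV[R]_4) (t : R) (dc : 'I_4 -> R) : (\forall y \near c t, forall k, derivable u y (e_ k)) ->
  (forall k, cont_at (partial k u) (c t)) -> (forall k, drv (fun s => c s 0 k) t (dc k)) ->
  drv (fun s => u (c s)) t (\sum_k partial k u (c t) * dc k).
Proof.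
move=> du cu hc; apply/drvP => e e0.
pose P := \sum_k `|partial k u (c t)|; pose M := \sum_k `|dc k|.
have P0 : 0 <= P by apply: sumr_ge0.
have M0 : 0 <= M by apply: sumr_ge0.
have e1 : 0 < Num.min 1 (e / (2 * (P + 1))).
  by rewrite lt_min ltr01 /= divr_gt0 // mulr_gt0 // ltr_wpDl.
have e2 : 0 < e / (2 * (M + 1)) by rewrite divr_gt0 // mulr_gt0 // ltr_wpDl.
have [d d0 hd] := C1_strict du cu e2.
have hk k := (drvP (fun s => c s 0 k) t (dc k)).1 (hc k) _ e1.
have N k : \forall h \near (0 : R), `|c (t + h) 0 k - c t 0 k - dc k * h| <= Num.min 1 (e / (2 * (P + 1))) * `|h|.
  by have [dk dk0 hdk] := hk k; apply/nbhs_norm0P; exists dk.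
have /nbhs_norm0P[r /= r0 hr] : \forall h \near (0 : R), forall k,
    `|c (t + h) 0 k - c t 0 k - dc k * h| <= Num.min 1 (e / (2 * (P + 1))) * `|h|.
  exact: filter_forall N.
exists (Num.min r (d / (M + 1))).
  by rewrite lt_min r0 divr_gt0 // ltr_wpDl.
move=> h; rewrite lt_min => /andP[hr' hd'].
have M1 : 0 < M + 1 by rewrite ltr_wpDl.
have P1 : 0 < P + 1 by rewrite ltr_wpDl.
have cd : `|c (t + h) - c t| <= (M + 1) * `|h|.
  apply: norm_le_coord => [|k]; first by rewrite mulr_ge0 // ltW.
  rewrite !mxE -[X in `|X|](subrK (dc k * h)).
  apply: le_trans (ler_normD _ _) _.
  rewrite [leRHS]mulrDl mul1r [leRHS]addrC lerD //.
    by apply: le_trans (hr h hr' k) _; rewrite ler_piMl // ge_min lexx.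
  by rewrite normrM ler_wpM2r // /M (bigD1 k) //= lerDl sumr_ge0.
have cd' : `|c (t + h) - c t| < d.
  by apply: le_lt_trans cd _; rewrite mulrC -ltr_pdivlMr.
have S := hd (c (t + h)) (c t) cd' (_ : `|c t - c t| < d).
rewrite subrr normr0 in S; have {}S := S d0.
have -> : u (c (t + h)) - u (c t) - (\sum_k partial k u (c t) * dc k) * h =
  (u (c (t + h)) - u (c t) - \sum_k partial k u (c t) * (c (t + h) - c t) 0 k) +
  \sum_k partial k u (c t) * (c (t + h) 0 k - c t 0 k - dc k * h).
  have -> : \sum_k partial k u (c t) * (c (t + h) 0 k - c t 0 k - dc k * h) =
     \sum_k partial k u (c t) * (c (t + h) - c t) 0 k - (\sum_k partial k u (c t) * dc k) * h.
    by rewrite mulr_suml -sumrB; ext_sum k; rewrite !mxE; ring.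
  ring.
apply: le_trans (ler_normD _ _) _.
have -> : e * `|h| = e / 2 * `|h| + e / 2 * `|h| by field.
apply: lerD.
  apply: le_trans S _; apply: le_trans (ler_wpM2l (ltW e2) cd) _.
  by rewrite le_eqVlt; apply/orP; left; apply/eqP; field; rewrite gt_eqF.
apply: le_trans (ler_norm_sum _ _ _) _.
apply: (@le_trans _ _ (\sum_k `|partial k u (c t)| * (e / (2 * (P + 1)) * `|h|))).
  apply: ler_sum => k _; rewrite normrM ler_wpM2l //.
  apply: le_trans (hr h hr' k) _; by rewrite ler_wpM2r // ge_min lexx orbT.
rewrite -mulr_suml -/P (_ : e / 2 * `|h| = (P + 1) * (e / (2 * (P + 1)) * `|h|)).
  by rewrite ler_wpM2r ?lerDl // mulr_ge0 // divr_ge0 ?mulr_ge0 // ?ltW.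
by field; rewrite gt_eqF.
Qed.

End Strict.

Section Smooth.
Variable R : realType.
Implicit Types (V : set 'rV[R]_4) (u w : 'rV[R]_4 -> R) (k : 'I_4).
Notation e_ k := (delta_mx 0 k : 'rV[R]_4).

Lemma near_continuous u w (x : 'rV[R]_4) : (\forall y \near x, u y = w y) -> cont_at u x -> cont_at w x.
Proof.
move=> E cu; have Ex : u x = w x by apply: (nbhs_singleton E).
have cu' : u y @[y --> x] --> u x := cu.
rewrite /prop_for /continuous_at -Ex; apply: cvg_trans cu'.
exact: (@near_eq_cvg _ _ (nbhs x)).
Qed.

Lemma partial_near u w k (x : 'rV[R]_4) : (\forall y \near x, u y = w y) -> partial k u x = partial k w x.
Proof. by move=> E; apply: near_eq_derive. Qed.

End Smooth.

Opaque partial.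

Section SmoothOn.
Variable R : realType.
Implicit Types (V : set 'rV[R]_4) (u w : 'rV[R]_4 -> R) (k : 'I_4).
Notation e_ k := (delta_mx 0 k : 'rV[R]_4).

(** Iterated derivatives never leave a class that is stable under partial derivatives, so continuity
    and differentiability of its members suffice. Stability is asked only up to equality on [V]. *)
Lemma smooth_on_ind V (P : ('rV[R]_4 -> R) -> Prop) : open V -> (forall u, P u -> forall x, V x ->
     cont_at u x /\ forall k, derivable u x (e_ k)) ->
  (forall u k, P u -> exists2 w, P w & forall x, V x -> partial k u x = w x) -> forall u, P u -> smooth_on V u.
Proof.
move=> oV hP hd u Pu l x Vx /=.
have near_V w w' y : V y -> (forall z, V z -> w z = w' z) -> \forall z \near y, w z = w' z.
  by move=> Vy E; near=> z; apply: E; near: z; apply: open_nbhs_nbhs.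
have [w Pw E] : exists2 w, P w & forall x, V x -> foldr (@partial R) u l x = w x.
  elim: l => [|k l [w Pw E]] /=; first by exists u.
  have [w' Pw' E'] := hd w k Pw; exists w' => // y Vy; rewrite -E' //.
  exact/partial_near/near_V.
have Es : \forall z \near x, w z = foldr (@partial R) u l z.
  by apply: near_V => // z Vz; rewrite E.
have [cw dw] := hP w Pw x Vx; split=> [|k]; first exact: near_continuous Es cw.
exact: near_eq_derivable Es (dw k).
Unshelve. all: by end_near. Qed.

Lemma smooth_on_partial V u k : smooth_on V u -> smooth_on V (partial k u).
Proof.
move=> h l x Vx; have := h (rcons l k) x Vx.
by rewrite foldr_rcons.
Qed.

Lemma smooth_on_cont V u x : smooth_on V u -> V x -> cont_at u x.
Proof. by move=> h Vx; have [] := h [::] x Vx. Qed.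

Lemma smooth_on_der V u x k : smooth_on V u -> V x -> derivable u x (e_ k).
Proof. by move=> h Vx; have [_] := h [::] x Vx. Qed.

Lemma smooth_on_sub V V' u : V' `<=` V -> smooth_on V u -> smooth_on V' u.
Proof. by move=> VV h l x Vx; apply: h; apply: VV. Qed.

Lemma smooth_on_chain V u (c : R -> 'rV[R]_4) (t : R) (dc : 'I_4 -> R) : open V ->
  smooth_on V u -> V (c t) -> (forall k, drv (fun s => c s 0 k) t (dc k)) ->
  drv (fun s => u (c s)) t (\sum_k partial k u (c t) * dc k).
Proof.
move=> oV su Vc hc; apply: C1_chain => // [|k].
  near=> y; have Vy : V y by near: y; exact: open_nbhs_nbhs.
  by move=> k; apply: smooth_on_der su Vy.
by apply: smooth_on_cont Vc; exact: smooth_on_partial.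
Unshelve. all: by end_near. Qed.

(* The four-point increment of u over a small square, divided by the area,
   approximates both mixed partial derivatives. *)
Lemma partial_square u (x : 'rV[R]_4) a b : (\forall y \near x, derivable u y (e_ a)) ->
  (\forall y \near x, forall k, derivable (partial a u) y (e_ k)) -> (forall k, cont_at (partial k (partial a u)) x) ->
  forall e : R, 0 < e -> exists2 d : R, 0 < d & forall h : R, 0 < h < d ->
  `|u (x + h *: e_ a + h *: e_ b) - u (x + h *: e_ a) - u (x + h *: e_ b) + u x
    - partial b (partial a u) x * h ^+ 2| <= e * h ^+ 2.
Proof.
move=> du dau cau e e0.
have [d1 d10 h1] := C1_strict dau cau e0.
have /nbhs_normP[d2 /= d20 h2] := du.
exists (Num.min d1 d2 / 2) => [|h /andP[h0]]; first by rewrite divr_gt0 // lt_min d10.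
rewrite ltr_pdivlMr // lt_min => /andP[hd1 hd2].
have e1 k : `|e_ k| <= 1.
  apply: norm_le_coord => // j; rewrite mxE eqxx /=.
  by case: eqP => _; rewrite ?normr0 ?normr1.
have near_x (s : R) : 0 <= s <= h -> `|s *: e_ a + h *: e_ b| <= h * 2.
  move=> /andP[s0 sh]; apply: le_trans (ler_normD _ _) _.
  rewrite !normrZ (ger0_norm s0) (ger0_norm (ltW h0)) mulr_natr mulr2n lerD //.
    by rewrite (le_trans _ sh) // ler_piMr.
  by rewrite ler_piMr // ltW.
have near_x' (s : R) : 0 <= s <= h -> `|s *: e_ a| <= h * 2.
  move=> /andP[s0 sh]; rewrite normrZ (ger0_norm s0).
  by apply: (@le_trans _ _ h); [rewrite (le_trans _ sh) // ler_piMr|rewrite ler_peMr ?ltW// ltr1n].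
pose g s := u ((x + h *: e_ b) + s *: e_ a) - u (x + s *: e_ a).
have dg s : btw 0 h s -> drv g s (partial a u ((x + h *: e_ b) + s *: e_ a) - partial a u (x + s *: e_ a)).
  rewrite (btwE _ (ltW h0)) => sh; apply: drvB; apply: drv_line; apply: h2.
    rewrite /ball_ /= -addrA opprD addrA subrr sub0r normrN addrC.
    exact: le_lt_trans (near_x s sh) hd2.
  by rewrite /ball_ /= opprD addrA subrr sub0r normrN (le_lt_trans (near_x' s sh)).
have [c bc E] := mvt dg.
have ch : 0 <= c <= h by rewrite -(btwE _ (ltW h0)).
have -> : u (x + h *: e_ a + h *: e_ b) - u (x + h *: e_ a) - u (x + h *: e_ b) + u x = g h - g 0.
  by rewrite /g scale0r !addr0 (addrAC x); ring.
rewrite E subr0.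
have Hy : `|x + h *: e_ b + c *: e_ a - x| < d1.
  by rewrite addrC !addrA addNr add0r addrC (le_lt_trans (near_x c ch)).
have Hz : `|x + c *: e_ a - x| < d1 by rewrite addrC addKr (le_lt_trans (near_x' c ch)).
have H := h1 _ _ Hy Hz.
have yz : x + h *: e_ b + c *: e_ a - (x + c *: e_ a) = h *: e_ b.
  by apply/rowP => j; rewrite !mxE; ring.
have sb : \sum_k partial k (partial a u) x * (h *: e_ b) 0 k = partial b (partial a u) x * h.
  rewrite (bigD1 b) //= big1 => [|k kb]; last by rewrite !mxE (negPf kb) !mulr0.
  by rewrite !mxE !eqxx /= mulr1 addr0.
rewrite yz sb in H.
rewrite expr2 !mulrA -mulrBl normrM (gtr0_norm h0) ler_pM2r //.
apply: le_trans H _; rewrite normrZ (gtr0_norm h0) ler_wpM2l ?(ltW e0) //.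
by rewrite ler_piMr // ltW.
Qed.

Lemma partialC V u a b (x : 'rV[R]_4) : open V -> smooth_on V u -> V x ->
  partial a (partial b u) x = partial b (partial a u) x.
Proof.
move=> oV su Vx; apply/eqP/contraT; rewrite -subr_eq0 => ne.
(* Both mixed derivatives are within [e] of the same second difference quotient, so their gap would
   be at most half of itself. *)
pose e : R := `|partial a (partial b u) x - partial b (partial a u) x| / 4.
have e0 : 0 < e by rewrite divr_gt0 // normr_gt0.
have nV : \forall y \near x, V y by exact: open_nbhs_nbhs.
have n1 k : \forall y \near x, derivable u y (e_ k) by near=> y; apply: smooth_on_der su _; near: y.
have n2 k : \forall y \near x, forall l, derivable (partial k u) y (e_ l).
  near=> y; have Vy : V y by near: y.
  by move=> l; apply: smooth_on_der (smooth_on_partial k su) Vy.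
have n3 k l := smooth_on_cont (smooth_on_partial l (smooth_on_partial k su)) Vx.
have [d1 d10 h1] := partial_square b (n1 a) (n2 a) (n3 a) e0.
have [d2 d20 h2] := partial_square a (n1 b) (n2 b) (n3 b) e0.
pose h := Num.min d1 d2 / 2.
have h0 : 0 < h by rewrite divr_gt0 // lt_min d10.
have m0 : 0 < Num.min d1 d2 by rewrite lt_min d10.
have hm : h < Num.min d1 d2 by rewrite ltr_pdivrMr // ltr_pMr // ltr1n.
have {}h1 := h1 h; have {}h2 := h2 h; move: h1 h2.
move: hm; rewrite lt_min h0 /= => /andP[-> ->] /(_ isT) h1 /(_ isT) h2.
have hh : 0 < h ^+ 2 by rewrite exprn_gt0.
have : `|partial a (partial b u) x - partial b (partial a u) x| * h ^+ 2 <= (e + e) * h ^+ 2.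
  rewrite -{1}(gtr0_norm hh) -normrM [leRHS]mulrDl.
  rewrite (addrAC x) in h2; apply: le_trans (lerD h1 h2).
  apply: le_trans (ler_normB _ _); rewrite le_eqVlt; apply/orP; left; apply/eqP.
  have E (p q r s A B c : R) : (A - B) * c = p - q - r + s - B * c - (p - r - q + s - A * c).
    by ring.
  by rewrite -E.
rewrite ler_pM2r // /e => /quarters_lt; rewrite normr_gt0 => /(_ ne).
by rewrite ?ltxx.
Unshelve. all: by end_near. Qed.

(* The smallest class containing the smooth functions and closed under the
   operations below; the partial derivatives of its members are members. *)
Inductive smooth_closure V : ('rV[R]_4 -> R) -> Prop :=
| sc_comp V' u (F : 'I_4 -> 'rV[R]_4 -> R) : open V' -> smooth_on V' u ->
    (forall k, smooth_on V (F k)) -> (forall x, V x -> V' (\row_k F k x)) -> smooth_closure V (fun x => u (\row_k F k x))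
| sc_smooth u : smooth_on V u -> smooth_closure V u
| sc_cst (c : R) : smooth_closure V (fun=> c)
| sc_add u w : smooth_closure V u -> smooth_closure V w -> smooth_closure V (fun x => u x + w x)
| sc_mul u w : smooth_closure V u -> smooth_closure V w -> smooth_closure V (fun x => u x * w x)
| sc_inv u : smooth_closure V u -> (forall x, V x -> u x != 0) -> smooth_closure V (fun x => (u x)^-1).

Lemma line_derivable u (x : 'rV[R]_4) k l :
  drv (fun s => u (x + s *: e_ k)) 0 l -> derivable u x (e_ k) /\ partial k u x = l.
Proof.
have E : (fun h0 : R => h0^-1 *: (((fun s : R => u (x + s *: e_ k)) \o shift 0) (h0 *: (1 : R)) - u (x + (0 : R) *: e_ k))) =
    (fun h0 : R => h0^-1 *: ((u \o shift x) (h0 *: e_ k) - u x)).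
  apply/funext => h0 /=; congr (_ *: (u _ - u _)); last by rewrite scale0r addr0.
  by rewrite -[h0%:A]/(h0 * 1) mulr1 addr0 addrC.
by move=> [d v]; split; [move: d; rewrite /derivable E | rewrite -v /derive E].
Qed.

Lemma derivable_line u (x : 'rV[R]_4) k : derivable u x (e_ k) -> drv (fun s => u (x + s *: e_ k)) 0 (partial k u x).
Proof.
by move=> d; have := @drv_line _ u x k 0; rewrite scale0r addr0; apply.
Qed.

Lemma row_continuous (T : topologicalType) (F : 'I_4 -> T -> R) (x : T) : (forall k, cont_at (F k) x) ->
  cont_at (fun y => \row_k F k y : 'rV[R]_4) x.
Proof.
move=> h; apply/cvgrPdist_le => e e0.
have H k : \forall y \near x, `|F k x - F k y| <= e.
  by have /cvgrPdist_le := h k; apply.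
have H' : \forall y \near x, forall k, `|F k x - F k y| <= e by exact: filter_forall H.
apply: (@filterS _ (nbhs x) _ _ _ _ H') => y Hy.
by apply: norm_le_coord => [|k]; [exact: ltW|rewrite !mxE; exact: Hy].
Qed.

Lemma sc_regular V u (x : 'rV[R]_4) : open V -> smooth_closure V u -> V x -> cont_at u x /\ forall k, derivable u x (e_ k).
Proof.
move=> oV su.
elim: su x => {u} [V' u F oV' su sF FV|u su|c|u w _ IHu _ IHw|u w _ IHu _ IHw|u _ IHu nu] x Vx.
- have cF : cont_at (fun x => \row_k F k x : 'rV[R]_4) x.
    by apply: row_continuous => k; apply: smooth_on_cont (sF k) Vx.
  split=> [|k]; first by apply: continuous_comp => //; apply: smooth_on_cont su (FV x Vx).
  have D : drv (fun s => (fun y => u (\row_j F j y)) (x + s *: e_ k)) 0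
      (\sum_m partial m u (\row_j F j x) * partial k (F m) x).
    have := @smooth_on_chain V' u (fun s => \row_j F j (x + s *: e_ k)) 0
      (fun m => partial k (F m) x) oV' su; rewrite scale0r addr0; apply; first exact: FV.
    move=> m; under eq_fun do rewrite mxE.
    by apply: derivable_line; apply: smooth_on_der (sF m) Vx.
  by have [] := @line_derivable (fun y => u (\row_j F j y)) x k _ D.
- by split=> [|k]; [apply: smooth_on_cont su Vx|apply: smooth_on_der su Vx].
- by split=> [|k]; [exact: cst_continuous|exact: derivable_cst].
- have [cu du] := IHu x Vx; have [cw dw] := IHw x Vx.
  by split=> [|k]; [apply: continuousD|apply: derivableD].
- have [cu du] := IHu x Vx; have [cw dw] := IHw x Vx.
  by split=> [|k]; [apply: continuousM|apply: derivableM].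
- have [cu du] := IHu x Vx.
  by split=> [|k]; [apply: continuousV => //; apply: nu|apply: derivableV => //; apply: nu].
Qed.

Lemma partial_comp V' u (F : 'I_4 -> 'rV[R]_4 -> R) (x : 'rV[R]_4) k : open V' -> smooth_on V' u -> V' (\row_j F j x) ->
  (forall m, derivable (F m) x (e_ k)) -> partial k (fun y => u (\row_j F j y)) x =
  \sum_m partial m u (\row_j F j x) * partial k (F m) x.
Proof.
move=> oV' su Vx dF; suff D : drv (fun s => (fun y => u (\row_j F j y)) (x + s *: e_ k)) 0
    (\sum_m partial m u (\row_j F j x) * partial k (F m) x).
  by have [] := @line_derivable (fun y => u (\row_j F j y)) x k _ D.
have := @smooth_on_chain V' u (fun s => \row_j F j (x + s *: e_ k)) 0
  (fun m => partial k (F m) x) oV' su; rewrite scale0r addr0; apply => // m.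
by under eq_fun do rewrite mxE; apply: derivable_line.
Qed.

(** The chain, product and quotient rules exhibit each partial derivative as a member of the class,
    so [smooth_on_ind] applies. *)
Lemma smooth_closureP V u : open V -> smooth_closure V u -> smooth_on V u.
Proof.
move=> oV; apply: (smooth_on_ind oV) => {u} [u su x Vx|u k]; first exact: sc_regular oV su Vx.
have dl w x : smooth_closure V w -> V x -> drv (fun s => w (x + s *: e_ k)) 0 (partial k w x).
  by move=> sw Vx; apply: derivable_line; have [_] := sc_regular oV sw Vx.
elim=> {u} [V' u F oV' su sF FV|u su|c|u w su [u' su' Eu] sw [w' sw' Ew]|
  u w su [u' su' Eu] sw [w' sw' Ew]|u su [u' su' Eu] nu].
- exists (fun x => \sum_m partial m u (\row_j F j x) * partial k (F m) x).
    apply: (big_closed _ _ (sc_cst V 0) (@sc_add V)) => m; apply: sc_mul.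
      exact: (sc_comp oV' (smooth_on_partial m su) sF FV).
    by apply: sc_smooth; apply: smooth_on_partial.
  move=> x Vx; apply: (@partial_comp V') => //; first exact: FV.
  by move=> m; apply: smooth_on_der (sF m) Vx.
- by exists (partial k u) => //; apply: sc_smooth; apply: smooth_on_partial.
- exists (fun=> 0); first exact: sc_cst.
  move=> x Vx; by have [] := @line_derivable (fun=> c) x k 0 (drv_cst c 0).
- exists (fun x => u' x + w' x); first exact: sc_add.
  move=> x Vx; rewrite -Eu // -Ew //; apply: (fun l D => proj2 (@line_derivable (fun y => u y + w y) x k l D)).
  by apply: drvD; apply: dl.
- exists (fun x => u' x * w x + u x * w' x); first by apply: sc_add; apply: sc_mul.
  move=> x Vx; rewrite -Eu // -Ew //; apply: (fun l D => proj2 (@line_derivable (fun y => u y * w y) x k l D)).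
  by have := drvM (dl u x su Vx) (dl w x sw Vx); rewrite scale0r addr0.
- exists (fun x => (-1) * u' x * ((u x)^-1 * (u x)^-1)).
    do !apply: sc_mul => //; [exact: sc_cst|exact: sc_inv|exact: sc_inv].
  move=> x Vx; rewrite -Eu //; apply: (fun l D => proj2 (@line_derivable (fun y => (u y)^-1) x k l D)).
  have := drvV _ (dl u x su Vx); rewrite scale0r addr0 => /(_ (nu x Vx)).
  by apply: drv_val; rewrite mulN1r -invfM -expr2.
Qed.

End SmoothOn.

(** * The ring of smooth functions on an open set *)

Record opens (R : realType) := Opens { oset :> 'rV[R]_4 -> Prop; opensP : open (oset : set 'rV[R]_4)
}.

Section SmoothRing.
Variables (R : realType) (V : opens R).
Let oV : open (V : set _) := @opensP R V.
Implicit Types (u w : 'rV[R]_4 -> R) (x : 'rV[R]_4).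

(* Smooth functions on V, represented by their extension by zero. *)
Record sring := SRing { sfun :> 'rV[R]_4 -> R; sfun_prop : `[< smooth_on V sfun /\ forall x, ~ V x -> sfun x = 0 >]
}.
Notation S := sring.

(** Extension by zero turns equality on [V] into equality of elements, which the ring axioms
    require. *)
Lemma sring_inj (f g : S) : (forall x, V x -> f x = g x) -> f = g.
Proof.
case: f g => f hf [g hg] /= E.
have fg : f = g.
  apply/funext => x; have [/E//|nV] := pselect (V x).
  by have /asboolP[_ ->//] := hf; have /asboolP[_ ->//] := hg.
by subst g; congr SRing; exact: bool_irrelevance.
Qed.

Lemma smooth_on_eq u w : (forall x, V x -> u x = w x) -> smooth_on V u -> smooth_on V w.
Proof.
move=> E su; apply: (smooth_on_ind (P := fun v => exists2 v', smooth_on V v' &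
  forall x, V x -> v' x = v x)); [exact: oV| | |by exists u].
  move=> v [v' sv' Ev] x Vx.
  have Es : \forall z \near x, v' z = v z.
    by near=> z; apply: Ev; near: z; apply: open_nbhs_nbhs.
  split=> [|k]; first by apply: near_continuous Es _; apply: smooth_on_cont sv' Vx.
  by apply: near_eq_derivable Es _; apply: smooth_on_der sv' Vx.
move=> v k [v' sv' Ev]; exists (partial k v') => [|x Vx].
  by exists (partial k v'); [exact: smooth_on_partial|move=> ? _; reflexivity].
apply: partial_near; near=> z; apply/esym/Ev; near: z; exact: open_nbhs_nbhs.
Unshelve. all: by end_near. Qed.

Definition mksf u (su : smooth_on V u) : S.
Proof.
exists (fun x => if `[< V x >] then u x else 0); apply/asboolP; split.
  by apply: smooth_on_eq su => x /asboolP ->.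
by move=> x nV; case: asboolP.
Defined.

Lemma mksfE u (su : smooth_on V u) x : V x -> mksf su x = u x.
Proof. by move=> Vx /=; case: asboolP. Qed.

Opaque mksf.

Lemma sfun_smooth (f : S) : smooth_on V f.
Proof. by case: f => f /= /asboolP[]. Qed.

Lemma sfun_off (f : S) x : ~ V x -> f x = 0.
Proof. by case: f => f /= /asboolP[_]; apply. Qed.

HB.instance Definition _ := gen_eqMixin S.
HB.instance Definition _ := gen_choiceMixin S.

Let sm f := @smooth_closureP _ V f oV.

Definition scst (c : R) : S := mksf (sm (@sc_cst _ V c)).
Definition sadd (f g : S) : S := mksf (sm (sc_add (sc_smooth (sfun_smooth f)) (sc_smooth (sfun_smooth g)))).
Definition smul (f g : S) : S := mksf (sm (sc_mul (sc_smooth (sfun_smooth f)) (sc_smooth (sfun_smooth g)))).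
Definition sopp (f : S) : S := smul (scst (-1)) f.

Lemma saddE f g x : V x -> sadd f g x = f x + g x. Proof. exact: mksfE. Qed.
Lemma smulE f g x : V x -> smul f g x = f x * g x. Proof. exact: mksfE. Qed.
Lemma scstE c x : V x -> scst c x = c. Proof. exact: mksfE. Qed.
Lemma soppE f x : V x -> sopp f x = - f x.
Proof. by move=> Vx; rewrite smulE // scstE // mulN1r. Qed.

Let E := (saddE, smulE, soppE, scstE).

Lemma saddA : associative sadd.
Proof. by move=> f g h; apply: sring_inj => x Vx; rewrite !E // addrA. Qed.
Lemma saddC : commutative sadd.
Proof. by move=> f g; apply: sring_inj => x Vx; rewrite !E // addrC. Qed.
Lemma sadd0 : left_id (scst 0) sadd.
Proof. by move=> f; apply: sring_inj => x Vx; rewrite !E // add0r. Qed.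
Lemma saddN : left_inverse (scst 0) sopp sadd.
Proof. by move=> f; apply: sring_inj => x Vx; rewrite !E // addNr. Qed.

HB.instance Definition _ := GRing.isZmodule.Build S saddA saddC sadd0 saddN.

Lemma smulA : associative smul.
Proof. by move=> f g h; apply: sring_inj => x Vx; rewrite !E // mulrA. Qed.
Lemma smulC : commutative smul.
Proof. by move=> f g; apply: sring_inj => x Vx; rewrite !E // mulrC. Qed.
Lemma smul1 : left_id (scst 1) smul.
Proof. by move=> f; apply: sring_inj => x Vx; rewrite !E // mul1r. Qed.
Lemma smulD : left_distributive smul sadd.
Proof. by move=> f g h; apply: sring_inj => x Vx; rewrite !E // mulrDl. Qed.

HB.instance Definition _ := GRing.Zmodule_isComPzRing.Build S smulA smulC smul1 smulD.

Section Evaluation.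
Variables (x : 'rV[R]_4) (Vx : V x).

(** The proof that [x] lies in [V] is an argument on which the morphism instances depend: outside
    [V] evaluation would send 1 to 0. *)
Definition ev_ of V x := fun f : S => f x.
Local Notation ev := (ev_ Vx).

Lemma ev_zmod : zmod_morphism ev.
Proof. by move=> f g; rewrite /ev_ [(f - g) x]saddE // soppE. Qed.

Lemma ev_monoid : monoid_morphism ev.
Proof. by split=> [|f g]; rewrite /ev_ ?[(1 : S) x]scstE // [(f * g) x]smulE. Qed.

HB.instance Definition _ := GRing.isZmodMorphism.Build S R ev ev_zmod.
HB.instance Definition _ := GRing.isMonoidMorphism.Build S R ev ev_monoid.

End Evaluation.

Definition sder (k : I4) (f : S) : S := mksf (smooth_on_partial k (sfun_smooth f)).

Lemma sderE k f x : V x -> sder k f x = partial k f x. Proof. exact: mksfE. Qed.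

Lemma sder_dl k (f : S) (x : 'rV[R]_4) : V x -> drv (fun s => f (x + s *: delta_mx 0 k)) 0 (partial k f x).
Proof. by move=> Vx; apply: derivable_line; apply: smooth_on_der (sfun_smooth f) Vx. Qed.

Lemma partial_mksf k u (su : smooth_on V u) x : V x -> partial k (mksf su) x = partial k u x.
Proof.
move=> Vx; apply: partial_near; near=> z; apply: mksfE; near: z; exact: open_nbhs_nbhs.
Unshelve. all: by end_near. Qed.

Lemma partial_sder k l f x : V x -> partial k (sder l f) x = partial k (partial l f) x.
Proof. exact: partial_mksf. Qed.

Lemma sder_add k f g : sder k (f + g) = sder k f + sder k g.
Proof.
apply: sring_inj => x Vx; rewrite [RHS]saddE // !sderE // partial_mksf //.
apply: (fun l D => proj2 (@line_derivable _ (fun y => f y + g y) x k l D)).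
by apply: drvD; apply: sder_dl.
Qed.

Lemma sder_mul k f g : sder k (f * g) = sder k f * g + f * sder k g.
Proof.
apply: sring_inj => x Vx; rewrite [RHS]saddE // ![(_ * _ : S) x]smulE // !sderE // partial_mksf //.
apply: (fun l D => proj2 (@line_derivable _ (fun y => f y * g y) x k l D)).
by have := drvM (sder_dl k f Vx) (sder_dl k g Vx); rewrite scale0r addr0.
Qed.

Opaque sder.

Lemma sder_comm k l f : sder k (sder l f) = sder l (sder k f).
Proof.
apply: sring_inj => x Vx; apply: (etrans (sderE k _ Vx)); apply: (etrans _ (esym (sderE l _ Vx))).
apply: (etrans (partial_sder k l f Vx)).
apply: (etrans _ (esym (partial_sder l k f Vx))).
exact: partialC oV (sfun_smooth f) Vx.
Qed.

Definition sderivations := Derivations sder_add sder_mul sder_comm.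

Lemma sder_cst k c : sder k (scst c) = 0.
Proof.
apply: sring_inj => x Vx; apply: (etrans (sderE k _ Vx)); apply: (etrans (partial_mksf k _ Vx)).
rewrite [RHS]scstE //; by have [] := @line_derivable _ (fun=> c) x k 0 (drv_cst c 0).
Qed.

Lemma sum_ev x (Vx : V x) (I : finType) (F : I -> S) : (\sum_j F j : S) x = \sum_j F j x.
Proof. exact: (rmorph_sum (ev_ Vx)). Qed.

Lemma mul_ev x (Vx : V x) (u w : S) : (u * w : S) x = u x * w x.
Proof. exact: smulE. Qed.

Lemma add_ev x (Vx : V x) (u w : S) : (u + w : S) x = u x + w x.
Proof. exact: saddE. Qed.

Lemma opp_ev x (Vx : V x) (u : S) : (- u : S) x = - u x.
Proof. exact: soppE. Qed.

Lemma nat_ev x (Vx : V x) n : (n%:R : S) x = n%:R.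
Proof. exact: (rmorph_nat (ev_ Vx)). Qed.

Lemma one_ev x (Vx : V x) : (1 : S) x = 1.
Proof. exact: scstE. Qed.

End SmoothRing.

Opaque sadd smul sopp scst mksf sder.

(** * The curvature of a chart inside its function ring *)

Section ChartGeometry.
Variables (R : realType) (M : topologicalType) (X : manifold4 R M) (g : metric X).
Variable i : chart X.
Implicit Types (x : 'rV[R]_4) (a b c d k l : I4).

Variables (V : opens R) (VV : forall x, V x -> codom i x).
Notation S := (sring V).

Lemma sc_det n (A : 'rV[R]_4 -> 'M[R]_n) : (forall (a b : 'I_n), smooth_closure V (fun x => A x a b)) ->
  smooth_closure V (fun x => \det (A x)).
Proof.
move=> h; apply: (big_closed _ _ (@sc_cst R V 0) (@sc_add R V)) => s; apply: sc_mul; first exact: sc_cst.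
by apply: (big_closed _ _ (@sc_cst R V 1) (@sc_mul R V)) => j; apply: h.
Qed.

Lemma gram_det x : codom i x -> \det (gram g i x) != 0.
Proof.
move=> Vx; apply/negP => /det0P[v v0 vG].
by have := gram_pos g Vx v0; rewrite vG mul0mx mxE ltxx.
Qed.

Lemma gram_unit x : codom i x -> gram g i x \in unitmx.
Proof. by move=> Vx; rewrite unitmxE unitfE gram_det. Qed.

Let oV : open (V : set _) := @opensP R V.

(** Cramer's rule: [smooth_closure] handles determinants and scalar inverses. *)
Lemma cogram_smooth a b : smooth_on V (fun x => cogram g i x a b).
Proof.
have sG c d : smooth_closure V (fun x => gram g i x c d).
  by apply: sc_smooth; apply: smooth_on_sub VV _; exact: gram_smooth.
apply: (@smooth_on_eq _ V (fun x => (\det (gram g i x))^-1 * ((-1) ^+ (b + a) * \det (row' b (col' a (gram g i x)))))).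
  by move=> x Vx; rewrite /cogram /invmx (gram_unit (VV Vx)) !mxE.
apply: (smooth_closureP oV); apply: sc_mul.
  by apply: sc_inv; [exact: sc_det | move=> x /VV; exact: gram_det].
apply: sc_mul; first exact: sc_cst.
apply: sc_det => c d; rewrite (_ : (fun x => _) = fun x => gram g i x (lift b c) (lift a d)) //.
by apply/funext => x; rewrite !mxE.
Qed.

Definition cG a b : S := @mksf _ V _ (smooth_on_sub VV (@gram_smooth _ _ _ g i a b)).
Definition cH a b : S := @mksf _ V _ (cogram_smooth a b).
Definition cD := @sderivations R V.
Lemma cG_ev x a b : V x -> cG a b x = gram g i x a b. Proof. exact: mksfE. Qed.
Lemma cH_ev x a b : V x -> cH a b x = cogram g i x a b. Proof. exact: mksfE. Qed.

Lemma cG_sym a b : cG a b = cG b a.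
Proof.
apply: sring_inj => x Vx; apply: (etrans (cG_ev a b Vx)); apply: (etrans _ (esym (cG_ev b a Vx))).
by rewrite -{1}(gram_sym g (VV Vx)) mxE.
Qed.

Lemma cGH a b : \sum_c cG a c * cH c b = (a == b)%:R.
Proof.
apply: sring_inj => x Vx; rewrite (sum_ev Vx) (nat_ev Vx).
have := mulmxV (gram_unit (VV Vx)) => /matrixP/(_ a b); rewrite !mxE => <-.
by ext_sum c; rewrite (mul_ev Vx) (cG_ev _ _ Vx) (cH_ev _ _ Vx).
Qed.

Lemma half_cst : scst V 2^-1 + scst V 2^-1 = 1.
Proof.
apply: sring_inj => x Vx; rewrite (add_ev Vx) !(scstE _ Vx).
by field.
Qed.

(** Built over an arbitrary open part [V] of the chart image, so that it also exists on the overlap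
    of two charts. *)
Definition cgeo := levi_civita cD half_cst cG_sym cGH.
Definition cGam := lcGam cgeo.

Lemma cGam_ev x k a b : V x -> cGam k a b x = christoffel g i k a b x.
Proof.
move=> Vx; apply: (etrans (mul_ev Vx _ _)); rewrite (scstE _ Vx) (sum_ev Vx); congr (_ * _).
ext_sum l; apply: (etrans (mul_ev Vx _ _)); congr (_ * _); first exact: cH_ev.
apply: (etrans (add_ev Vx _ _)); congr (_ + _); last first.
  apply: (etrans (opp_ev Vx _)); congr (- _); apply: (etrans (sderE _ _ Vx)).
  exact: partial_mksf.
apply: (etrans (add_ev Vx _ _)); congr (_ + _); apply: (etrans (sderE _ _ Vx)); exact: partial_mksf.
Qed.

Lemma christoffel_smooth k a b : smooth_on V (christoffel g i k a b).
Proof.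
apply: (@smooth_on_eq _ V (cGam k a b)) (sfun_smooth _) => x Vx; exact: cGam_ev.
Qed.

Lemma partial_ev_near (u : S) (w : 'rV[R]_4 -> R) k x : (forall y, V y -> u y = w y) -> V x -> cD k u x = partial k w x.
Proof.
move=> E Vx; apply: (etrans (sderE _ _ Vx)); apply: partial_near.
near=> y; apply: E; near: y; exact: open_nbhs_nbhs.
Unshelve. all: by end_near. Qed.

Definition criem k a b c : S := riem cgeo (lcGam cgeo) k a b c.
Definition crm := rm cgeo.

Section Point.
Variables (x : 'rV[R]_4) (Vx : V x).
Let ev : {rmorphism S -> R} := ev_ Vx.

Lemma criem_ev k a b c : criem k a b c x = riemann g i k a b c x.
Proof.
apply: (etrans (riem_value (ev := ev) (X := cgeo) (gam := fun k a b => christoffel g i k a b x)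
  (fun k a b => cGam_ev k a b Vx) k a b c)).
by congr (_ - _ + _); apply: partial_ev_near Vx => y Vy; exact: cGam_ev.
Qed.

Lemma crm_ev a b c d : crm [:: a; b; c; d] x = riemann4 g i a b c d x.
Proof.
apply: (etrans (rm_value (ev := ev) (X := cgeo) (g := fun a b => gram g i x a b) (fun a b => cG_ev a b Vx) a b c d)).
by ext_sum k; congr (_ * _); exact: criem_ev.
Qed.

Lemma crc_ev a b : rc cgeo [:: a; b] x = ricci g i a b x.
Proof.
apply: (etrans (rc_value ev cgeo a b)); ext_sum p; exact: criem_ev.
Qed.

Lemma scal_ev : contr cgeo (rc cgeo) [::] x = scalar_curvature g i x.
Proof.
apply: (etrans (scal_value (ev := ev) (X := cgeo) (h := fun a b => cogram g i x a b) (fun a b => cH_ev a b Vx))).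
by ext_sum p; ext_sum q; congr (_ * _); exact: crc_ev.
Qed.

End Point.

Section Potential.
Variables (f : M -> R) (rho : R) (sf : smooth_fun X f).

Definition cf : S := @mksf _ V _ (smooth_on_sub VV (@sf i)).

Lemma cf_ev x : V x -> cf x = f (param i x).
Proof. exact: mksfE. Qed.

Lemma dcf_ev k x : V x -> cD k cf x = partial k (f \o param i) x.
Proof. by move=> Vx; apply: partial_ev_near => // y Vy; exact: cf_ev. Qed.

Section AtPoint.
Variables (x : 'rV[R]_4) (Vx : V x).
Let ev : {rmorphism S -> R} := ev_ Vx.

Lemma chess_ev a b : nab cgeo (lcGam cgeo) (grad cgeo cf) [:: a; b] x = hessian g f i a b x.
Proof.
apply: (etrans (hess_value (ev := ev) (X := cgeo) (f := cf) (gam := fun k a b => christoffel g i k a b x)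
  (df := fun k => partial k (f \o param i) x) (fun k a b => cGam_ev k a b Vx) (fun k => dcf_ev k Vx) a b)).
by congr (_ - _); apply: partial_ev_near Vx => y Vy; exact: dcf_ev.
Qed.

Lemma cgrad2_ev : contr cgeo (tens (fun a => cgeo a cf) (grad cgeo cf)) [::] x = grad_sqnorm g f i x.
Proof.
exact: (grad2_value (ev := ev) (X := cgeo) (f := cf)
  (h := fun a b => cogram g i x a b) (df := fun k => partial k (f \o param i) x)
  (fun a b => cH_ev a b Vx) (fun k => dcf_ev k Vx)).
Qed.

End AtPoint.

Hypothesis soliton : forall x, codom i x -> forall a b, ricci g i a b x + hessian g f i a b x = rho * gram g i x a b.

Lemma csoliton a b : rc cgeo [:: a; b] + nab cgeo (lcGam cgeo) (grad cgeo cf) [:: a; b] = scst V rho * lcG cgeo a b.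
Proof.
apply: sring_inj => x Vx; apply: (etrans (add_ev Vx _ _)).
apply: (etrans _ (esym (mul_ev Vx _ _))); rewrite (scstE _ Vx).
apply: (etrans _ (congr1 _ (esym (cG_ev a b Vx)))); rewrite -(soliton (VV Vx)).
by congr (_ + _); [exact: crc_ev|exact: chess_ev].
Qed.

End Potential.
End ChartGeometry.

(** * Change of charts *)

Section Overlap.
Variables (R : realType) (M : topologicalType) (X : manifold4 R M) (g : metric X).
Variables (i j : chart X).
Implicit Types (x : 'rV[R]_4) (a b c d k l : I4).

Definition overlap : set 'rV[R]_4 := coord i @` (dom i `&` dom j).

Lemma overlap_codom x : overlap x -> codom i x.
Proof. by move=> [p [pi _] <-]; exists p. Qed.

Lemma overlap_open : open overlap.
Proof.
have -> : overlap = codom i `&` (param i @^-1` dom j).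
  apply/seteqP; split=> [x [p [pi pj] <-]|x [[p pi <-]] /=].
    by split; [exists p|rewrite /= coordK].
  by rewrite coordK // => pj; exists p.
rewrite openE => x [Vx /= Dx].
have h := open_nbhs_nbhs (conj (@dom_open R M X j) Dx).
have h' : \forall y \near x, dom j (param i y) := @param_continuous R M X i x Vx _ h.
apply: (filterI _ h'); apply: open_nbhs_nbhs; split => //; exact: codom_open.
Qed.

Let W : opens R := Opens overlap_open.
Let V : opens R := Opens (@codom_open R M X j).

(** The transition map as a row of scalar functions, the form in which [sc_comp] composes. *)
Definition tau x : 'rV[R]_4 := \row_k coord j (param i x) 0 k.

Lemma tauE x : tau x = coord j (param i x).
Proof. by apply/rowP => k; rewrite mxE. Qed.

Lemma tau_codom x : W x -> V (tau x).
Proof. by move=> [p [pi pj] <-]; rewrite tauE coordK //; exists p. Qed.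

Lemma pull_smooth (u : sring V) : smooth_on W (fun x => u (tau x)).
Proof.
apply: smooth_closureP (@opensP R W) _; apply: (@sc_comp _ W V); [exact: opensP|exact: sfun_smooth| |].
  move=> k; exact: transition_smooth.
exact: tau_codom.
Qed.

Definition pull (u : sring V) : sring W := mksf (pull_smooth u).

Lemma pull_ev x (u : sring V) : W x -> pull u x = u (tau x).
Proof. exact: mksfE. Qed.

Lemma pull_zmod : zmod_morphism pull.
Proof.
move=> u w; apply: sring_inj => x Wx; have Vx := tau_codom Wx.
apply: (etrans (pull_ev _ Wx)); apply: (etrans (add_ev Vx _ _)).
apply: (etrans _ (esym (add_ev Wx _ _))); congr (_ + _); first by rewrite pull_ev.
apply: (etrans (opp_ev Vx _)); apply: (etrans _ (esym (opp_ev Wx _))).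
by rewrite pull_ev.
Qed.

Lemma pull_monoid : monoid_morphism pull.
Proof.
split=> [|u w]; apply: sring_inj => x Wx; have Vx := tau_codom Wx; apply: (etrans (pull_ev _ Wx)).
  by apply: (etrans (one_ev Vx)); rewrite (one_ev Wx).
apply: (etrans (mul_ev Vx _ _)); apply: (etrans _ (esym (mul_ev Wx _ _))).
by congr (_ * _); rewrite pull_ev.
Qed.

HB.instance Definition _ := GRing.isZmodMorphism.Build (sring V) (sring W) pull pull_zmod.
HB.instance Definition _ := GRing.isMonoidMorphism.Build (sring V) (sring W) pull pull_monoid.

Let GX := cgeo g (i := j) (V := V) (fun x Vx => Vx).
Let GY := cgeo g (i := i) (V := W) overlap_codom.

Lemma jac_smooth a b : smooth_on W (partial a (fun x => coord j (param i x) 0 b)).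
Proof. by apply: smooth_on_partial; exact: transition_smooth. Qed.

Definition jac a b : sring W := mksf (jac_smooth a b).

Lemma jac_ev x a b : W x -> jac a b x = transition_jac i j (param i x) a b.
Proof.
move=> Wx; apply: (etrans (mksfE _ Wx)); rewrite mxE.
by case: Wx => p [pi _] <-; rewrite coordK.
Qed.

Lemma pull_chain a u : GY a (pull u) = \sum_l jac a l * pull (GX l u).
Proof.
apply: sring_inj => x Wx; have Vx := tau_codom Wx; rewrite (sum_ev Wx).
apply: (etrans (sderE _ _ Wx)); apply: (etrans (partial_mksf _ _ Wx)).
apply: (etrans (@partial_comp _ V u (fun k x => coord j (param i x) 0 k) x a (@opensP R V) (sfun_smooth u) Vx _)).
  by move=> m; apply: (@smooth_on_der _ W); [exact: transition_smooth|exact: Wx].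
ext_sum m; apply: (etrans _ (esym (mul_ev Wx _ _))).
rewrite mulrC (mksfE _ Wx) (pull_ev _ Wx); congr (_ * _); symmetry; exact: sderE.
Qed.

Lemma pull_metric a b : lcG GY a b = \sum_k \sum_l jac a k * jac b l * pull (lcG GX k l).
Proof.
apply: sring_inj => x Wx; have Vx := tau_codom Wx;
apply: (etrans (mksfE _ Wx)).
have E : (\sum_k \sum_l jac a k * jac b l * pull (lcG GX k l) : sring W) x =
    \sum_k \sum_l jac a k x * jac b l x * gram g j (tau x) k l.
  apply: (etrans (sum_ev Wx _)); ext_sum k; rewrite (sum_ev Wx); ext_sum l.
  apply: (etrans (mul_ev Wx _ _)); congr (_ * _); first exact: mul_ev.
  by rewrite (pull_ev _ Wx); exact: mksfE.
apply: (etrans _ (esym E)).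
have [p [pi pj] px] := Wx; rewrite tauE -px coordK // (gram_transition g pi pj).
rewrite px mxE; swap_sum l; rewrite !mxE mulr_suml.
ext_sum k; rewrite !(jac_ev _ _ Wx) -px coordK // [transition_jac i j p b l]mxE; ring.
Qed.

(** Mixed second derivatives of the transition functions commute. *)
Lemma jac_closed a b k : GY a (jac b k) = GY b (jac a k).
Proof.
apply: sring_inj => x Wx; apply: (etrans (sderE _ _ Wx)).
apply: (etrans _ (esym (sderE _ _ Wx))); apply: (etrans (partial_mksf _ _ Wx)).
apply: (etrans _ (esym (partial_mksf _ _ Wx))).
apply: (@partialC _ W) => //; first exact: opensP.
exact: transition_smooth.
Qed.

Variables (p : M) (pi : dom i p) (pj : dom j p).
Let x := coord i p.
Let Wx : W x. Proof. by exists p. Qed.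
Let tx : tau x = coord j p. Proof. by rewrite tauE coordK. Qed.
Let Vx : V (coord j p). Proof. by exists p. Qed.

Definition riemT (h : chart X) (y : 'rV[R]_4) (s : seq I4) : R := if s is [:: a; b; c; d] then riemann4 g h a b c d y else 0.

Lemma crmT_ev (h : chart X) (U : opens R) (UU : forall x, U x -> codom h x) y s : U y ->
  (crm g UU s : sring U) y = riemT h y s.
Proof.
move=> Uy; case: s => [|a [|b [|c [|d [|? s]]]]]; try exact: (nat_ev Uy 0).
exact: crm_ev.
Qed.

Lemma riemann4_transition s : riemT i x s = con (riemT j (coord j p)) [seq row a (transition_jac i j p) | a <- s].
Proof.
have := congr1 (fun T => (T s : sring W) x) (rm_frm pull_chain pull_metric jac_closed).
move=> E; apply: (etrans (esym (crmT_ev (h := i) (U := W) overlap_codom s Wx))).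
apply: (etrans E); apply: (etrans (ev_frm pull (ev_ Wx) jac (rm GX) s)).
have -> : [seq \row_k ev_ Wx (jac a k) | a <- s] = [seq row a (transition_jac i j p) | a <- s].
  apply: eq_map => a; apply/rowP => k; rewrite !mxE.
  by apply: (etrans (jac_ev _ _ Wx)); rewrite coordK // mxE.
apply: eq_con => r _; apply: (etrans (pull_ev _ Wx)); rewrite tx.
exact: (crmT_ev (h := j) (U := V) (fun x Vx => Vx) r Vx).
Qed.

Lemma scalar_curvature_transition : scalar_curvature g i x = scalar_curvature g j (coord j p).
Proof.
have := congr1 (fun u => (u : sring W) x) (scal_frm pull_chain pull_metric jac_closed).
move=> E; apply: (etrans (esym (scal_ev g (i := i) (V := W) overlap_codom Wx))).
apply: (etrans E); apply: (etrans (pull_ev _ Wx)); rewrite tx.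
exact: (scal_ev g (i := j) (V := V) (fun x Vx => Vx) Vx).
Qed.

Lemma grad_sqnorm_transition f : smooth_fun X f -> grad_sqnorm g f i x = grad_sqnorm g f j (coord j p).
Proof.
move=> sf; pose fi := cf (i := i) (V := W) overlap_codom sf.
pose fj := cf (i := j) (V := V) (fun x Vx => Vx) sf.
have fE : pull fj = fi.
  apply: sring_inj => y Wy; apply: (etrans (pull_ev _ Wy)).
  apply: (etrans (cf_ev _ _ (tau_codom Wy))); apply: (etrans _ (esym (cf_ev _ _ Wy))).
  by have [q [qi qj] <-] := Wy; rewrite tauE /= !coordK.
have := congr1 (fun u => (u : sring W) x) (grad2_frm pull_chain pull_metric fj).
move=> E.
apply: (etrans (esym (cgrad2_ev g (i := i) (V := W) overlap_codom sf Wx))).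
rewrite -/fi -fE; apply: (etrans E); apply: (etrans (pull_ev _ Wx)); rewrite tx.
exact: (cgrad2_ev g (i := j) (V := V) (fun x Vx => Vx) sf Vx).
Qed.

End Overlap.

(** * The evolution equation in an orthonormal frame *)

Section FrameEvolution.
Variables (A K : comPzRingType) (X : lc_geometry A) (J L : I4 -> I4 -> A) (f rho : A).
Hypothesis J_const : forall k a b, X k (J a b) = 0.
Hypothesis JL : forall a b, \sum_c J a c * L c b = (a == b)%:R.
Hypothesis LJ : forall a b, \sum_c L a c * J c b = (a == b)%:R.
Hypothesis rho_const : forall k, X k rho = 0.
Hypothesis soliton : forall a b, rc X [:: a; b] + nab X (lcGam X) (grad X f) [:: a; b] = rho * lcG X a b.

Let Y := frame_geometry J_const JL LJ.
Let id' : {rmorphism A -> A} := idfun.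

Let Y_chain a u : Y a (id' u) = \sum_i J a i * id' (X i u). Proof. by []. Qed.
Let Y_met a b : lcG Y a b = \sum_i \sum_j J a i * J b j * id' (lcG X i j). Proof. by []. Qed.
Let Y_closed a b k : Y a (J b k) = Y b (J a k).
Proof. by rewrite /= !big1 // => i _; rewrite J_const mulr0. Qed.

Let Y_soliton a b : rc Y [:: a; b] + nab Y (lcGam Y) (grad Y f) [:: a; b] = rho * lcG Y a b.
Proof.
rewrite (rc_frm Y_chain Y_met Y_closed) (grad_frm Y_chain).
rewrite (nab_frm Y_chain Y_met Y_closed) -frmD.
rewrite [lcG Y a b]/= mulr_sumr; ext_sum i; rewrite /= !mulr_sumr.
ext_sum j; have /= -> := soliton i j; ring.
Qed.

Variable ev : {rmorphism A -> K}.
Hypothesis evH : forall a b, ev (\sum_i \sum_j L i a * L j b * lcH X i j) = (a == b)%:R.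
Let e a := \row_i ev (J a i).
Let val T := con (fun r => ev (T r)).

Let ev_val T s : ev (frm id' J T s) = val T [seq e a | a <- s].
Proof. exact: ev_frm. Qed.

Let r a b c d := val (rm X) [:: e a; e b; e c; e d].

Let rE a b c d : ev (rm Y [:: a; b; c; d]) = r a b c d.
Proof. by rewrite (rm_frm Y_chain Y_met Y_closed) ev_val. Qed.

Lemma frame_skew a b c d : r b a c d = - r a b c d.
Proof.
rewrite -!rE -rmorphN; congr (ev _).
by have /(congr1 (fun g => g [:: a; b; c; d])) := rm_skew Y.
Qed.

Lemma frame_pair a b c d : r a b c d = r c d a b.
Proof. by rewrite -!rE rm_pair. Qed.

Lemma frame_bianchi a b c d : r a b c d + r b c a d + r c a b d = 0.
Proof. by rewrite -!rE -!rmorphD (rm_bianchi Y [:: a; b; c; d]) rmorph0. Qed.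

(** [evolution] for the constant frame [J], read back as values of the original tensors on frame
    vectors; this is the form that can be used along geodesics. *)
Lemma frame_evolution a b c d (Q := fun a b p m => r p a m b * r p m c d + r p a m c * r p b m d + r p a m d * r p b c m) :
  \sum_p val (nab X (lcGam X) (nab X (lcGam X) (rm X))) [:: e p; e p; e a; e b; e c; e d]
  - \sum_m (\sum_k e m 0 k * ev (X k f)) * val (nab X (lcGam X) (rm X)) [:: e m; e a; e b; e c; e d] =
  ev (rho + rho) * r a b c d + \sum_p \sum_m (Q b a p m - Q a b p m).
Proof.
have rho' k : Y k rho = 0 by rewrite /= big1 // => i _; rewrite rho_const mulr0.
have := evolution rho' Y_soliton evH a b c d.
rewrite (rm_frm Y_chain Y_met Y_closed) !(nab_frm Y_chain Y_met Y_closed).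
under eq_bigr do rewrite ev_val; under [X in _ - X]eq_bigr do rewrite ev_val.
rewrite -(rm_frm Y_chain Y_met Y_closed) rE => E.
apply: (etrans _ (etrans E _)).
  congr (_ - _); ext_sum m; congr (_ * _); rewrite /= rmorph_sum.
  by ext_sum k; rewrite rmorphM mxE.
congr (_ + _); ext_sum p; ext_sum m.
by rewrite /Q !rE.
Qed.

Lemma frame_hamilton k : ev (X k (contr X (rc X) [::]
  + contr X (tens (fun a => X a f) (grad X f)) [::] - (rho + rho) * f)) = 0.
Proof.
have rho' k' : Y k' rho = 0 by rewrite /= big1 // => i _; rewrite rho_const mulr0.
set u := (_ - _).
have Yu m : \sum_i ev (J m i) * ev (X i u) = 0.
  have := hamilton rho' Y_soliton evH m.
  rewrite (scal_frm Y_chain Y_met Y_closed) (grad2_frm Y_chain Y_met) => E.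
  apply: (etrans _ E); rewrite /= rmorph_sum; ext_sum i.
  by rewrite rmorphM.
transitivity (\sum_m ev (L k m) * \sum_i ev (J m i) * ev (X i u)); last first.
  by rewrite big1 // => m _; rewrite Yu mulr0.
under eq_bigr do rewrite mulr_sumr; rewrite exchange_big /=.
transitivity (\sum_i ev (k == i)%:R * ev (X i u)).
  rewrite (bigD1 k) //= eqxx rmorph1 mul1r big1 ?addr0 // => i ik.
  by rewrite eq_sym (negPf ik) rmorph0 mul0r.
ext_sum i; rewrite -LJ rmorph_sum mulr_suml; ext_sum m.
by rewrite rmorphM mulrA.
Qed.

End FrameEvolution.

Lemma rc_contraction (A K : comPzRingType) (X : lc_geometry A) (ev : {rmorphism A -> K}) a b :
  ev (rc X [:: a; b]) = \sum_p \sum_q ev (lcH X p q) * ev (rm X [:: p; a; q; b]).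
Proof.
rewrite rmorph_sum; ext_sum p; rewrite rmorph_sum; ext_sum q.
by rewrite rmorphM.
Qed.

Section Multilinear.
Variable K : comPzRingType.
Implicit Types (T : seq I4 -> K) (r : seq 'rV[K]_4) (u v : 'rV[K]_4).

(** A trace sees the frame only through [E^T E], which is the inverse metric for every orthonormal
    frame. Different orthonormal frames therefore give the same trace. *)
Lemma con_trace n (E : 'M[K]_(n, 4)) T r : \sum_p con T (row p E :: row p E :: r) =
  \sum_i \sum_j (E^T *m E) i j * con (fun s => T (i :: j :: s)) r.
Proof.
under eq_bigr => p _ do (rewrite con_cons; under eq_bigr do rewrite con_cons mulr_sumr).
swap_sum i => /=; swap_sum j => /=.
by rewrite mxE mulr_suml; ext_sum p; rewrite !mxE mulrA.
Qed.

Lemma con_sum (I : finType) (c : I -> K) (T : I -> seq I4 -> K) r :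
  con (fun s => \sum_j c j * T j s) r = \sum_j c j * con (T j) r.
Proof.
elim: r T => [|v r IH] T //=; under eq_bigr do rewrite (IH (fun j s => T j (_ :: s))) mulr_sumr.
swap_sum j => /=; rewrite mulr_sumr.
by ext_sum i; rewrite mulrCA.
Qed.

Lemma conD T T' r : con (fun s => T s + T' s) r = con T r + con T' r.
Proof.
elim: r T T' => [|v r IH] T T' //=.
under eq_bigr do rewrite (IH (fun s => T (_ :: s)) (fun s => T' (_ :: s))) mulrDr.
by rewrite big_split.
Qed.

Lemma conZ (c : K) T r : con (fun s => c * T s) r = c * con T r.
Proof.
elim: r T => [|v r IH] T //=; under eq_bigr do rewrite (IH (fun s => T (_ :: s))) mulrCA.
by rewrite mulr_sumr.
Qed.

Lemma con2 T u v : con T [:: u; v] = \sum_i \sum_j u 0 i * v 0 j * T [:: i; j].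
Proof.
rewrite /=; ext_sum i; rewrite mulr_sumr.
by ext_sum j; rewrite mulrA.
Qed.

Lemma con_swap23 T u v w z : con T [:: u; v; w; z] =
  con (fun s => if s is [:: a; b; c; d] then T [:: a; c; b; d] else 0) [:: u; w; v; z].
Proof.
rewrite /=; ext_sum k; congr (_ * _).
under eq_bigr do rewrite mulr_sumr.
swap_sum l => /=; rewrite mulr_sumr.
by ext_sum m; rewrite mulrCA.
Qed.

End Multilinear.

Section OrthonormalFrames.
Variable R : realType.
Implicit Types (G E : 'M[R]_4).

Lemma frame_cogram G E : E *m G *m E^T = 1%:M -> E^T *m E = invmx G.
Proof.
move=> h; have h1 : G *m (E^T *m E) = 1%:M.
  by rewrite mulmxA; apply: mulmx1C; rewrite mulmxA.
have uG : G \in unitmx by have [] := mulmx1_unit h1.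
by rewrite -[LHS](mulKmx uG) h1 mulmx1.
Qed.

Lemma frame_exists G : G^T = G -> (forall v : 'rV[R]_4, v != 0 -> 0 < (v *m G *m v^T) 0 0) -> exists E, E *m G *m E^T = 1%:M.
Proof.
move=> sG pG; pose b (u v : 'rV[R]_4) := (u *m G *m v^T) 0 0.
have bC u v : b u v = b v u.
  have E : (u *m G *m v^T)^T = v *m G *m u^T by rewrite !trmx_mul trmxK sG mulmxA.
  by rewrite /b -E [RHS]mxE.
have step (n : nat) : (n <= 4)%N -> exists e : nat -> 'rV[R]_4,
    forall i j, (i < n)%N -> (j < n)%N -> b (e i) (e j) = (i == j)%:R.
  elim: n => [|n IH] n4; first by exists (fun=> 0).
  have [e he] := IH (ltnW n4).
  (* Gram-Schmidt without projections: orthogonality to the [n < 4] vectors found so far is a linear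
     system with a nonzero solution. *)
  pose B : 'M[R]_(4, n) := \matrix_(k < 4, j < n) (G *m (e j)^T) k 0.
  have : kermx B != 0.
    rewrite -mxrank_eq0 mxrank_ker subn_eq0 -ltnNge.
    by apply: leq_ltn_trans (rank_leq_col _) n4.
  move=> /rowV0Pn[v /sub_kermxP vB v0].
  have bv j : (j < n)%N -> b v (e j) = 0.
    move=> jn; have /rowP/(_ (Ordinal jn)) := vB; rewrite !mxE => E.
    rewrite /b -mulmxA mxE; apply: (etrans _ E).
    by ext_sum k; rewrite [X in _ = _ * X]mxE.
  have p0 := pG v v0; pose c := (Num.sqrt (b v v))^-1.
  have cc : c * c * b v v = 1.
    by rewrite -expr2 exprVn sqr_sqrtr ?ltW // mulVf // gt_eqF.
  have bZ u w : b (c *: u) w = c * b u w by rewrite /b -!scalemxAl mxE.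
  exists (fun j => if j == n then c *: v else e j) => i j.
  rewrite !ltnS => hi hj; case: (eqVneq i n) => [ei|ni]; case: (eqVneq j n) => [ej|nj].
  - by rewrite ei ej bZ bC bZ mulrA cc eqxx.
  - by rewrite ei bZ bv ?mulr0 1?eq_sym ?(negPf nj) // ltn_neqAle nj.
  - by rewrite ej bC bZ bv ?mulr0 ?(negPf ni) // ltn_neqAle ni.
  by apply: he; rewrite ltn_neqAle ?ni ?nj.
have [e he] := step 4 (leqnn _).
exists (\matrix_(a, k) e a 0 k); apply/matrixP => i j; rewrite !mxE.
rewrite -[(i == j)]/(nat_of_ord i == j) -he // /b mxE; ext_sum k.
by rewrite !mxE; congr (_ * _); ext_sum l; rewrite !mxE.
Qed.

End OrthonormalFrames.

Section Point.
Variables (R : realType) (M : topologicalType) (X : manifold4 R M) (g : metric X).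
Variables (i : chart X) (x : 'rV[R]_4) (Vx : codom i x).
Implicit Types (E : 'M[R]_4) (a b c d k l : I4).

Let V : opens R := Opens (@codom_open R M X i).
Notation S := (sring V).
Let C : lc_geometry S := cgeo g (i := i) (V := V) (fun x Vx => Vx).

Definition chart_opens : opens R := V.
Definition curvature_tensor : seq I4 -> S := rm C.
Definition chart_nab (T : seq I4 -> S) := nab C (lcGam C) T.
Definition tval (T : seq I4 -> S) (y : 'rV[R]_4) vs := con (fun s => T s y) vs.

Lemma curvature_tval vs : tval curvature_tensor x vs = con (riemT g i x) vs.
Proof. by apply: eq_con => s _; exact: crmT_ev. Qed.

Section Frame.
Variable E : 'M[R]_4.
Hypothesis on : E *m gram g i x *m E^T = 1%:M.
Let J a b := scst V (E a b).
Let L a b := scst V (invmx E a b).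

Let uE : E \in unitmx.
Proof.
by have := on; rewrite -mulmxA => /mulmx1_unit[].
Qed.

Let J_const k a b : C k (J a b) = 0. Proof. exact: sder_cst. Qed.

Let prod_cst (P Q : 'M[R]_4) a b : P *m Q = 1%:M -> \sum_c scst V (P a c) * scst V (Q c b) = (a == b)%:R.
Proof.
move=> /matrixP/(_ a b); rewrite !mxE => h; apply: sring_inj => y Vy.
apply: (etrans (sum_ev Vy _)); apply: (etrans _ (esym (nat_ev Vy _))).
rewrite -h; ext_sum c; apply: (etrans (mul_ev Vy _ _)).
by congr (_ * _); exact: scstE.
Qed.

Let JL a b : \sum_c J a c * L c b = (a == b)%:R.
Proof. exact: prod_cst (mulmxV uE). Qed.
Let LJ a b : \sum_c L a c * J c b = (a == b)%:R.
Proof. exact: prod_cst (mulVmx uE). Qed.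

Let ev : {rmorphism S -> R} := @ev_ R V x Vx.

Let evH a b : ev (\sum_k \sum_l L k a * L l b * lcH C k l) = (a == b)%:R.
Proof.
have : (invmx E)^T *m invmx (gram g i x) *m invmx E = 1%:M.
  by rewrite -(frame_cogram on) mulmxA -trmx_mul mulmxV // tr_scalar_mx mul1mx mulmxV.
move=> /matrixP/(_ a b); rewrite !mxE => <-; rewrite rmorph_sum /=.
under [RHS]eq_bigr => l _ do rewrite mxE mulr_suml; rewrite exchange_big /=.
ext_sum k; rewrite rmorph_sum; ext_sum l.
apply: (etrans (rmorphM ev _ _)); rewrite [(invmx E)^T a k]mxE mulrAC; congr (_ * _).
  by apply: (etrans (rmorphM ev _ _)); congr (_ * _); exact: scstE.
exact: (cH_ev g (V := V) (fun x Vx => Vx) k l Vx).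
Qed.

Let rowE a : \row_k ev (J a k) = row a E.
Proof. by apply/rowP => k; rewrite !mxE; exact: scstE. Qed.

Let r a b c d := con (riemT g i x) [:: row a E; row b E; row c E; row d E].

Let rE a b c d : con (fun s => ev (rm C s))
  [:: \row_k ev (J a k); \row_k ev (J b k); \row_k ev (J c k); \row_k ev (J d k)] = r a b c d.
Proof. by rewrite !rowE /r -curvature_tval. Qed.

Lemma curvature_skew a b c d : r b a c d = - r a b c d.
Proof. by rewrite -!rE; exact: (frame_skew J_const JL LJ ev). Qed.

Lemma curvature_pair a b c d : r a b c d = r c d a b.
Proof. by rewrite -!rE; exact: (frame_pair J_const JL LJ ev). Qed.

Lemma curvature_bianchi a b c d : r a b c d + r b c a d + r c a b d = 0.
Proof. by rewrite -!rE; exact: (frame_bianchi J_const JL LJ ev). Qed.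

Section Soliton.
Variables (f : M -> R) (rho : R) (sf : smooth_fun X f).
Hypothesis soliton : forall x, codom i x -> forall a b, ricci g i a b x + hessian g f i a b x = rho * gram g i x a b.

Let rho_const k : C k (scst V rho) = 0. Proof. exact: sder_cst. Qed.
Let sol := @csoliton R M X g i V (fun x Vx => Vx) f rho sf soliton.

(** Components refer to [E] and traces to [E2], because the eigenframe and the directions of the
    test geodesics are unrelated. *)
Lemma curvature_evolution (E2 : 'M[R]_4) a b c d : E2 *m gram g i x *m E2^T = 1%:M ->
  \sum_p tval (chart_nab (chart_nab curvature_tensor)) x [:: row p E2; row p E2; row a E; row b E; row c E; row d E]
  - \sum_m (\sum_k E2 m k * partial k (f \o param i) x) *
     tval (chart_nab curvature_tensor) x [:: row m E2; row a E; row b E; row c E; row d E] =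
  2 * rho * r a b c d + reaction r a b c d.
Proof.
move=> on2; have := frame_evolution J_const JL LJ rho_const sol evH a b c d.
have rho2 : ev (scst V rho + scst V rho) = 2 * rho.
  by apply: (etrans (rmorphD ev _ _)); rewrite mulr_natl; congr (_ + _); exact: scstE.
rewrite rho2 !rE => h; apply: (etrans _ (etrans h _)); last first.
  congr (_ + _); ext_sum p; ext_sum m.
  by rewrite !rE.
have sw (T : seq I4 -> R) vs : \sum_p con T (row p E2 :: row p E2 :: vs) = \sum_p con T (row p E :: row p E :: vs).
  by rewrite !con_trace (frame_cogram on) (frame_cogram on2).
congr (_ - _).
  by apply: (etrans (sw _ _)); ext_sum p; rewrite !rowE.
pose df k := partial k (f \o param i) x.
have sw2 (E0 : 'M[R]_4) (T : seq I4 -> R) vs : \sum_m (\sum_k E0 m k * df k) * con T (row m E0 :: vs) =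
    \sum_m con (fun s => if s is k :: s then df k * T s else 0) (row m E0 :: row m E0 :: vs).
  ext_sum m; rewrite mulr_suml [RHS]con_cons; ext_sum k.
  by rewrite mxE conZ mulrA.
apply: (etrans (sw2 E2 _ _)); apply: (etrans (sw _ _)); rewrite -sw2.
ext_sum m; rewrite !rowE; congr (_ * _).
ext_sum k; rewrite [row m E 0 k]mxE; congr (_ * _).
by apply: esym; exact: dcf_ev.
Qed.

Lemma hamilton_identity k : partial k (fun y => scalar_curvature g i y + grad_sqnorm g f i y
    - 2 * rho * f (param i y)) x = 0.
Proof.
have := frame_hamilton J_const JL LJ rho_const sol evH k.
set u := (X in C k X) => h; apply: (etrans (esym _) h).
apply: (partial_ev_near (V := V)) => [y Vy|]; last exact: Vx.
apply: (etrans (add_ev Vy _ _)); congr (_ + _).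
  apply: (etrans (add_ev Vy _ _)); congr (_ + _).
    exact: (scal_ev g (i := i) (V := V) (fun x Vx => Vx) Vy).
  exact: (cgrad2_ev g (i := i) (V := V) (fun x Vx => Vx) sf Vy).
apply: (etrans (opp_ev Vy _)); congr (- _); apply: (etrans (mul_ev Vy _ _)).
congr (_ * _); last exact: cf_ev.
by apply: (etrans (add_ev Vy _ _)); rewrite mulr_natl; congr (_ + _); exact: scstE.
Qed.

End Soliton.
End Frame.

Lemma ricci_trace E (v : 'rV[R]_4) (f : M -> R) (rho : R) (sf : smooth_fun X f) : E *m gram g i x *m E^T = 1%:M ->
  (forall a b, ricci g i a b x + hessian g f i a b x = rho * gram g i x a b) ->
  \sum_p con (riemT g i x) [:: row p E; v; row p E; v] = rho * (v *m gram g i x *m v^T) 0 0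
  - \sum_a \sum_b v 0 a * v 0 b * hessian g f i a b x.
Proof.
move=> on sol.
have rcE a b : ricci g i a b x = \sum_p \sum_q cogram g i x p q * riemT g i x [:: p; a; q; b].
  apply: (etrans (esym (crc_ev g (V := V) (fun x Vx => Vx) Vx a b))).
  apply: (etrans (rc_contraction C (@ev_ R V x Vx) a b)).
  ext_sum p; ext_sum q; congr (_ * _); first exact: cH_ev.
  exact: (crmT_ev g (h := i) (U := V) (fun x Vx => Vx) [:: p; a; q; b] Vx).
transitivity (\sum_a \sum_b v 0 a * v 0 b * ricci g i a b x).
  under eq_bigr do rewrite con_swap23.
  rewrite con_trace (frame_cogram on).
  under eq_bigr do under eq_bigr do rewrite con2 mulr_sumr.
  under eq_bigr do (under eq_bigr do (under eq_bigr do rewrite mulr_sumr)).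
  under eq_bigr do rewrite exchange_big.
  swap_sum a => /=.
  under eq_bigr do rewrite exchange_big.
  swap_sum b => /=; rewrite rcE mulr_sumr.
  ext_sum p; rewrite mulr_sumr; ext_sum q.
  by rewrite mulrCA.
rewrite mxE mulr_sumr.
transitivity (\sum_a \sum_b (rho * (v 0 a * gram g i x a b * v 0 b) - v 0 a * v 0 b * hessian g f i a b x)).
  ext_sum a; ext_sum b.
  have := sol a b; move=> /(congr1 (fun z => v 0 a * v 0 b * z)); lra.
under eq_bigr do rewrite sumrB; rewrite sumrB; congr (_ - _).
swap_sum b; rewrite mxE mulr_suml mulr_sumr.
by ext_sum a; rewrite !mxE.
Qed.

End Point.

(** * Geodesics and distance *)

Section LineInduction.
Variable R : realType.

(** Induction along an interval: the supremum of the good times is reached and, unless it is [b],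
    passed. For this the step has to lead from a time before [t] to a time after it. *)
Lemma line_ind (Q : R -> Prop) (a b : R) : a <= b -> Q a ->
  (forall t, a <= t <= b -> exists2 e : R, 0 < e & forall t1 t2, a <= t1 -> t1 <= t -> t <= t2 ->
    t2 <= b -> `|t1 - t| < e -> `|t2 - t| < e -> Q t1 -> Q t2) -> Q b.
Proof.
move=> ab Qa step; pose S := [set t : R | a <= t <= b /\ Q t].
have Sa : S a by split=> //; rewrite lexx ab.
have Sb : ubound S b by move=> t [/andP[]].
have hS : has_sup S by split; [exists a|exists b].
pose s := sup S.
have sb : s <= b by apply: ge_sup => //; exists a.
have as_ : a <= s by apply: ub_le_sup => //; exists b.
have [e e0 he] := step s (introT andP (conj as_ sb)).
have [t1 [t1ab Qt1] t1s] := sup_adherent e0 hS; have /andP[at1 t1b] := t1ab.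
have t1s' : t1 <= s by apply: ub_le_sup; [exists b|].
pose t2 := Num.min b (s + e / 2).
have t2b : t2 <= b by rewrite ge_min lexx.
have st2 : s <= t2 by rewrite le_min sb lerDl divr_ge0 // ltW.
have Qt2 : Q t2.
  apply: (he t1) => //.
    by rewrite ler0_norm ?subr_le0 // opprB ltrBlDl -ltrBlDr.
  rewrite ger0_norm ?subr_ge0 // ltrBlDl (le_lt_trans (y := s + e / 2)) ?ge_min ?lexx ?orbT //.
  by rewrite ltrD2l ltr_pdivrMr // ltr_pMr // ltr1n.
have t2s : t2 <= s.
  by apply: ub_le_sup; [exists b|split=> //; rewrite t2b andbT (le_trans as_)].
move: t2s; rewrite ge_min => /orP[bs|]; last first.
  by rewrite gerDl => h; move: e0; rewrite ltNge; case/negP; lra.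
suff -> : b = t2 by [].
by apply/eqP; rewrite eq_le t2b andbT (le_trans bs).
Qed.

Lemma antiderivative (h : R -> R) (a b : R) : continuous h -> exists H : R -> R, forall t, a < t < b -> drv H t (h t).
Proof.
move=> ch; pose H x := (\int[lebesgue_measure]_(t in [set` `[a, x]]) (h t))%R.
exists H => t /andP[a_t tb].
have ih : lebesgue_measure.-integrable `[a, b] (EFin \o h).
  apply: continuous_compact_integrable; first exact: segment_compact.
  exact: continuous_subspaceT.
have [dH H'] := continuous_FTC1_closed tb ih a_t (ch t).
by rewrite -H' derive1E; apply: DeriveDef; [exact: dH|].
Qed.

Lemma near0P (P : R -> Prop) (t : R) : (\forall s \near t, P s) <-> exists2 d : R, 0 < d & forall s, `|s - t| < d -> P s.
Proof.
split=> [/nbhs_ballP[d d0 h]|[d d0 h]].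
  by exists d => // s sd; apply: h; rewrite /ball /= distrC.
by apply/nbhs_ballP; exists d => // s; rewrite /ball /= distrC; exact: h.
Qed.

Lemma compact_max (T : topologicalType) (K : set T) (u : T -> R) : compact K -> K !=set0 ->
  (forall x, K x -> cont_at u x) -> exists2 x, K x & forall y, K y -> u y <= u x.
Proof.
move=> cK K0 cu.
have [|x xK h] := compact_EVT_max K0 cK (f := u).
  by apply: continuous_in_subspaceT => x; rewrite inE; exact: cu.
exists x => [|y Ky]; first by rewrite inE in xK.
by apply: h; rewrite inE.
Qed.

Lemma compact_min (T : topologicalType) (K : set T) (u : T -> R) : compact K -> K !=set0 ->
  (forall x, K x -> cont_at u x) -> exists2 x, K x & forall y, K y -> u x <= u y.
Proof.
move=> cK K0 cu; have [|x Kx h] := @compact_max T K (fun x => - u x) cK K0.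
  by move=> x Kx; apply: cvgN; exact: cu.
by exists x => // y /h; rewrite lerN2.
Qed.

End LineInduction.

Section Vectors.
Variable R : realType.
Implicit Types (x y u v : 'rV[R]_4) (t : R).

Definition vdrv (c : R -> 'rV[R]_4) t v := forall k, drv (fun s => c s 0 k) t (v 0 k).

Lemma vdrvD c d t u v : vdrv c t u -> vdrv d t v -> vdrv (fun s => c s + d s) t (u + v).
Proof.
move=> hc hd k; rewrite mxE (_ : (fun s => _) = fun s => c s 0 k + d s 0 k).
  exact: drvD.
by apply/funext => s; rewrite mxE.
Qed.

Lemma vdrvZ (p : R -> R) c t l v : drv p t l -> vdrv c t v -> vdrv (fun s => p s *: c s) t (l *: c t + p t *: v).
Proof.
move=> hp hc k; rewrite !mxE (_ : (fun s => _) = fun s => p s * c s 0 k).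
  exact: drvM.
by apply/funext => s; rewrite mxE.
Qed.

Lemma vdrvZl (a : R) c t v : vdrv c t v -> vdrv (fun s => a *: c s) t (a *: v).
Proof. by move=> /(vdrvZ (drv_cst a t)); rewrite scale0r add0r. Qed.

Lemma vdrvN c t v : vdrv c t v -> vdrv (fun s => - c s) t (- v).
Proof.
move=> /(vdrvZl (-1)); rewrite scaleN1r (_ : (fun s => -1 *: c s) = fun s => - c s) //.
by apply/funext => s; rewrite scaleN1r.
Qed.

Lemma vdrvB c d t u v : vdrv c t u -> vdrv d t v -> vdrv (fun s => c s - d s) t (u - v).
Proof. by move=> hc hd; apply: vdrvD => //; exact: vdrvN. Qed.

Lemma vdrv_cst v t : vdrv (fun=> v) t 0.
Proof. by move=> k; rewrite mxE; exact: drv_cst. Qed.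

Lemma vdrv_line x v t : vdrv (fun s => x + s *: v) t v.
Proof.
have := vdrvD (vdrv_cst x t) (vdrvZ (drv_id t) (vdrv_cst v t)).
by rewrite add0r scale1r scaler0 addr0.
Qed.

Lemma vdrv_near c d t v : (\forall s \near t, c s = d s) -> vdrv c t v -> vdrv d t v.
Proof. by move=> h hc k; apply: drv_near (hc k); apply: filterS h => s ->. Qed.

Lemma vdrvP c t v (e : R) : vdrv c t v -> 0 < e -> exists2 d : R, 0 < d &
  forall h : R, `|h| < d -> `|c (t + h) - c t - h *: v| <= e * `|h|.
Proof.
move=> hc e0; have /boolp.choice[dk hdk] k : exists d : R, 0 < d /\ forall h : R, `|h| < d ->
    `|c (t + h) 0 k - c t 0 k - v 0 k * h| <= e * `|h|.
  by have [d d0 hd] := (drvP _ _ _).1 (hc k) _ e0; exists d.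
exists (\big[Num.min/1]_k dk k); first by apply/bigmin_gtP; split=> // k _; case: (hdk k).
move=> h hh; apply: norm_le_coord => [|k]; first by rewrite mulr_ge0 // ltW.
rewrite !mxE [h * _]mulrC; apply: (hdk k).2.
by apply: lt_le_trans hh _; exact: bigmin_le_cond.
Qed.

Lemma vdrv_comp c (p : R -> R) t l v : vdrv c (p t) v -> drv p t l -> vdrv (fun s => c (p s)) t (l *: v).
Proof. by move=> hc hp k; rewrite mxE mulrC; exact: (drv_comp (hc k) hp). Qed.

Lemma near_continuousM (T U : topologicalType) (f h : U -> T) (p : U) :
  (\forall s \near p, f s = h s) -> cont_at f p -> cont_at h p.
Proof.
move=> E cf A; rewrite /= -(nbhs_singleton E) => /cf; rewrite /nbhs /= => nA.
by apply: filterS2 E nA => s /= <-.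
Qed.

Lemma continuous_sum (T : topologicalType) n (f : 'I_n -> T -> R) (p : T) :
  (forall k, cont_at (f k) p) -> cont_at (fun s : T => \sum_k f k s) p.
Proof.
have c0 : cont_at (fun=> 0 : R) p by exact: cvg_cst.
move=> h; by apply: (big_closed (C := fun a : T -> R => cont_at a p) _ _ c0) => // a b; exact: cvgD.
Qed.

Lemma continuous_mul (T : topologicalType) (f h : T -> R) (p : T) :
  cont_at f p -> cont_at h p -> cont_at (fun s => f s * h s) p.
Proof. by move=> cf ch; apply: cvgM. Qed.

Lemma continuous_coord (T : topologicalType) (c : T -> 'rV[R]_4) (p : T) k : cont_at c p -> cont_at (fun s => c s 0 k) p.
Proof.
move=> cc; apply/cvgrPdist_lt => e e0; have /cvgrPdist_lt/(_ _ e0) := cc.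
apply: filterS => s; apply: le_lt_trans.
by have := coord_le_norm (c p - c s) k; rewrite !mxE.
Qed.

Lemma sevenths_lt (a b e n : R) : 0 < e -> a < e / 7 -> b < e / 7 -> n <= 3 * (a + b) -> n < e.
Proof. by move=> e0 ha hb hn; lra. Qed.

Lemma continuous_dist (T : topologicalType) (c : T -> 'rV[R]_4) (p : T) :
  (forall e : R, 0 < e -> \forall s \near p, `|c p - c s| < e) -> cont_at c p.
Proof. by move=> h; apply/cvgrPdist_lt. Qed.

Lemma continuous_normB (T : topologicalType) (c : T -> 'rV[R]_4) (a : 'rV[R]_4) (p : T) :
  cont_at c p -> cont_at (fun s => `|c s - a|) p.
Proof.
move=> cc; apply/cvgrPdist_lt => e e0; have /cvgrPdist_lt/(_ _ e0) := cc.
apply: filterS => s; apply: le_lt_trans; apply: le_trans (ler_dist_dist _ _) _.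
by rewrite opprB addrA subrK.
Qed.

Lemma vcontinuous (T : topologicalType) (c : T -> 'rV[R]_4) (p : T) :
  (forall k, cont_at (fun s => c s 0 k) p) -> cont_at c p.
Proof.
move=> h; have := @row_continuous R T (fun k s => c s 0 k) p h.
by rewrite (_ : (fun y : T => \row_k c y 0 k) = c) //; apply/funext => s; apply/rowP => k; rewrite mxE.
Qed.

Lemma vdrv_cont c t v : vdrv c t v -> cont_at c t.
Proof. by move=> h; apply: vcontinuous => k; exact: drv_cont (h k). Qed.

Lemma vmvt_le c (dc : R -> 'rV[R]_4) (a b N : R) : 0 <= N ->
  (forall t, btw a b t -> vdrv c t (dc t)) -> (forall t, btw a b t -> `|dc t| <= N) -> `|c b - c a| <= N * `|b - a|.
Proof.
move=> N0 h hN; apply: norm_le_coord => [|k]; first by rewrite mulr_ge0.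
rewrite !mxE; apply: (@mvt_le R (fun s => c s 0 k) (fun t => dc t 0 k)) => t ht.
  exact: h.
by apply: le_trans (coord_le_norm _ _) (hN t ht).
Qed.

(** The bound on the speed may vary with time; lengths of paths are compared with coordinate
    distances in this way. *)
Lemma vmvt_mono c (H : R -> R) (a b : R) : a <= b ->
  (forall t, a <= t <= b -> exists h v, [/\ drv H t h, vdrv c t v & `|v| <= h]) -> `|c b - c a| <= H b - H a.
Proof.
move=> ab hp; have /boolp.choice[w hw] t : exists w : R * 'rV[R]_4, a <= t <= b ->
    [/\ drv H t w.1, vdrv c t w.2 & `|w.2| <= w.1].
  case: (boolP (a <= t <= b)) => [/hp[h [v hv]]|_]; last by exists (0, 0).
  by exists (h, v).
have key k (s : R) : `|s| = 1 -> s * (c b 0 k - c a 0 k) <= H b - H a.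
  move=> s1; have := @mvt_ge0 R (fun t => H t - s * c t 0 k) (fun t => (w t).1 - s * (w t).2 0 k) a b ab.
  have P t : a <= t <= b -> 0 <= (w t).1 - s * (w t).2 0 k.
    move=> /hw[_ _ hn]; rewrite subr_ge0; apply: le_trans hn.
    apply: le_trans (ler_norm _) _; rewrite normrM s1 mul1r; exact: coord_le_norm.
  have D t : a <= t <= b -> drv (fun t => H t - s * c t 0 k) t ((w t).1 - s * (w t).2 0 k).
    by move=> /hw[h1 h2 _]; apply: drvB => //; exact: drvZ.
  by move=> /(_ D P); lra.
have H0 : 0 <= H b - H a by have := key 0 1 (normr1 _); have := key 0 (-1) (normrN1 _); lra.
apply: norm_le_coord => // k; rewrite !mxE ler_norml.
have := key k 1 (normr1 _); have := key k (-1) (normrN1 _) => h1 h2; apply/andP; split; lra.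
Qed.

Definition cball x (r : R) : set 'rV[R]_4 := [set y | `|y - x| <= r].

Lemma cball_compact x r : compact (cball x r).
Proof.
apply: bounded_closed_compact.
  exists (`|x| + `|r|); split => // e he y xy; apply: (le_trans _ (ltW he)).
  rewrite -[y](subrK x) addrC (le_trans (ler_normD _ _)) // lerD2l.
  exact: le_trans xy (ler_norm _).
rewrite (_ : cball x r = closed_ball_ Num.norm x r); first exact: closed_closed_ball_.
by apply/seteqP; split=> y; rewrite /cball /closed_ball_ /= distrC.
Qed.

Lemma cball_center x r : 0 <= r -> cball x r x.
Proof. by move=> r0; rewrite /cball /= subrr normr0. Qed.

Lemma cball_convex x r y z (s : R) : cball x r y -> cball x r z -> 0 <= s <= 1 -> cball x r (y + s *: (z - y)).
Proof.
move=> hy hz /andP[s0 s1]; rewrite /cball /=.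
have -> : y + s *: (z - y) - x = (1 - s) *: (y - x) + s *: (z - x).
  by apply/rowP => k; rewrite !mxE; ring.
apply: le_trans (ler_normD _ _) _; rewrite !normrZ !ger0_norm ?subr_ge0 //.
apply: (@le_trans _ _ ((1 - s) * r + s * r)); last by rewrite -mulrDl subrK mul1r.
by apply: lerD; apply: ler_wpM2l; rewrite ?subr_ge0.
Qed.

Lemma open_cball (V : set 'rV[R]_4) x : open V -> V x -> exists2 r : R, 0 < r & cball x r `<=` V.
Proof.
move=> oV Vx; have /nbhs_ballP[e e0 h] := open_nbhs_nbhs (conj oV Vx).
exists (e / 2); first exact: divr_gt0.
move=> y hy; apply: h; rewrite -ball_normE /= distrC; apply: le_lt_trans hy _.
by rewrite ltr_pdivrMr // ltr_pMr // ltr1n.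
Qed.

Section OnBall.
Variables (V : set 'rV[R]_4) (x : 'rV[R]_4) (r : R).
Hypotheses (oV : open V) (r0 : 0 <= r) (BV : cball x r `<=` V).

Lemma ball_bounded (w : 'rV[R]_4 -> R) : smooth_on V w -> exists2 K : R, 0 < K & forall y, cball x r y -> `|w y| <= K.
Proof.
move=> sw; have [|y _ h] := compact_max (@cball_compact x r) (ex_intro _ x (cball_center x r0)) (u := fun y => `|w y|).
  move=> y /BV Vy; apply: (@continuous_comp _ _ _ w (fun z : R => `|z|)).
    exact: smooth_on_cont sw Vy.
  exact: norm_continuous.
by exists (`|w y| + 1) => [|z /h zy]; rewrite ?ltr_wpDl // (le_trans zy) // lerDl.
Qed.

Lemma line_chain (w : 'rV[R]_4 -> R) y z (s : R) : smooth_on V w -> cball x r y -> cball x r z ->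
  0 <= s <= 1 -> drv (fun s => w (y + s *: (z - y))) s (\sum_k partial k w (y + s *: (z - y)) * (z - y) 0 k).
Proof.
move=> sw hy hz hs; apply: (smooth_on_chain oV sw).
  by apply: BV; exact: cball_convex.
exact: vdrv_line.
Qed.

Lemma ball_lipschitz (w : 'rV[R]_4 -> R) : smooth_on V w ->
  exists2 K : R, 0 < K & forall y z, cball x r y -> cball x r z -> `|w z - w y| <= K * `|z - y|.
Proof.
move=> sw.
have /boolp.choice[K hK] k : exists K : R, 0 < K /\ forall y, cball x r y -> `|partial k w y| <= K.
  by have [K K0 h] := ball_bounded (@smooth_on_partial _ _ _ k sw); exists K.
exists (\sum_k K k).
  rewrite big_ord_recl ltr_wpDr ?(hK _).1 // sumr_ge0 // => k _; exact: ltW (hK _).1.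
move=> y z hy hz; have := @mvt_le R (fun s => w (y + s *: (z - y)))
  (fun s => \sum_k partial k w (y + s *: (z - y)) * (z - y) 0 k) 0 1 (\sum_k K k * `|z - y|).
rewrite scale1r scale0r addr0 subr0 normr1 mulr1 [y + _]addrC subrK mulr_suml; apply.
  by move=> t; rewrite btwE // => ht; exact: line_chain.
move=> t; rewrite btwE // => ht; apply: le_trans (ler_norm_sum _ _ _) _.
apply: ler_sum => k _; rewrite normrM ler_pM // ?coord_le_norm //.
by apply: (hK k).2; exact: cball_convex.
Qed.

End OnBall.
End Vectors.

Lemma compat_value (A K : comPzRingType) (ev : {rmorphism A -> K}) (X : lc_geometry A)
    (g : I4 -> I4 -> K) (gam : I4 -> I4 -> I4 -> K) :
  (forall a b, ev (lcG X a b) = g a b) -> (forall k a b, ev (lcGam X k a b) = gam k a b) ->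
  forall a b c, ev (X a (lcG X b c)) = \sum_k (gam k a b * g k c + gam k a c * g b k).
Proof.
move=> eg egam a b c; rewrite lc_compat rmorph_sum; ext_sum k.
by rewrite rmorphD !rmorphM !eg !egam.
Qed.

Section ChartVectors.
Variables (R : realType) (M : topologicalType) (X : manifold4 R M) (g : metric X).
Variable i : chart X.
Implicit Types (x y z u v w : 'rV[R]_4) (t : R).
Notation V := (codom i).

Definition ip x u v : R := \sum_a \sum_b u 0 a * v 0 b * gram g i x a b.
Definition gam x u v : 'rV[R]_4 := \row_k \sum_a \sum_b u 0 a * v 0 b * christoffel g i k a b x.
Definition dgam x w u v : 'rV[R]_4 :=
  \row_k \sum_a \sum_b u 0 a * v 0 b * \sum_m partial m (christoffel g i k a b) x * w 0 m.

Lemma ipE x u v : ip x u v = (u *m gram g i x *m v^T) 0 0.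
Proof.
rewrite mxE /ip; swap_sum b; rewrite !mxE mulr_suml.
by ext_sum a; rewrite mulrAC.
Qed.

Lemma ipC x u v : V x -> ip x u v = ip x v u.
Proof.
move=> Vx; rewrite /ip; swap_sum a; ext_sum b.
by rewrite -{1}(gram_sym g Vx) mxE [u 0 b * _]mulrC.
Qed.

Lemma ipDl x u v w : ip x (u + v) w = ip x u w + ip x v w.
Proof. by rewrite !ipE mulmxDl mulmxDl mxE. Qed.
Lemma ipZl x a u w : ip x (a *: u) w = a * ip x u w.
Proof. by rewrite !ipE -!scalemxAl mxE. Qed.
Lemma ipDr x u v w : ip x w (u + v) = ip x w u + ip x w v.
Proof. by rewrite !ipE linearD mulmxDr mxE. Qed.
Lemma ipZr x a u w : ip x w (a *: u) = a * ip x w u.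
Proof. by rewrite !ipE linearZ -scalemxAr mxE. Qed.
Lemma ipNl x u w : ip x (- u) w = - ip x u w.
Proof. by rewrite -scaleN1r ipZl mulN1r. Qed.
Lemma ipNr x u w : ip x w (- u) = - ip x w u.
Proof. by rewrite -scaleN1r ipZr mulN1r. Qed.
Lemma ip0 x u : ip x 0 u = 0.
Proof. by rewrite -(scale0r u) ipZl mul0r. Qed.
Lemma ip0r x u : ip x u 0 = 0.
Proof. by rewrite -(scale0r u) ipZr mul0r. Qed.
Definition ipl := (ipDl, ipZl, ipNl, ipDr, ipZr, ipNr).

Lemma ip_gt0 x v : V x -> v != 0 -> 0 < ip x v v.
Proof. by rewrite ipE; exact: gram_pos. Qed.

Lemma ip_ge0 x v : V x -> 0 <= ip x v v.
Proof. by move=> Vx; have [->|/(ip_gt0 Vx)/ltW //] := eqVneq v 0; rewrite ip0. Qed.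

Lemma gamDl x u v w : gam x (u + v) w = gam x u w + gam x v w.
Proof.
apply/rowP => k; rewrite !mxE -big_split; ext_sum a; rewrite -big_split.
by ext_sum b; rewrite !mxE !mulrDl.
Qed.
Lemma gamZl x a u w : gam x (a *: u) w = a *: gam x u w.
Proof.
apply/rowP => k; rewrite !mxE mulr_sumr; ext_sum c; rewrite mulr_sumr.
by ext_sum b; rewrite !mxE !mulrA.
Qed.
Lemma gamDr x u v w : gam x w (u + v) = gam x w u + gam x w v.
Proof.
apply/rowP => k; rewrite !mxE -big_split; ext_sum a; rewrite -big_split.
by ext_sum b; rewrite !mxE mulrDr mulrDl.
Qed.
Lemma gamZr x a u w : gam x w (a *: u) = a *: gam x w u.
Proof.
apply/rowP => k; rewrite !mxE mulr_sumr; ext_sum c; rewrite mulr_sumr.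
by ext_sum b; rewrite !mxE !mulrA [_ * a]mulrC.
Qed.
Lemma gamNl x u w : gam x (- u) w = - gam x u w.
Proof. by rewrite -scaleN1r gamZl scaleN1r. Qed.
Lemma gamNr x u w : gam x w (- u) = - gam x w u.
Proof. by rewrite -scaleN1r gamZr scaleN1r. Qed.
Definition gaml := (gamDl, gamZl, gamNl, gamDr, gamZr, gamNr).

Let W : opens R := Opens (@codom_open R M X i).
Let C : lc_geometry (sring W) := cgeo g (i := i) (V := W) (fun x Vx => Vx).

Lemma christoffel_sym x k a b : V x -> christoffel g i k a b x = christoffel g i k b a x.
Proof.
move=> Vx; have E c d := cGam_ev g (V := W) (fun x Vx => Vx) k c d Vx.
apply: (etrans (esym (E a b))); apply: (etrans _ (E b a)).
exact: (congr1 (fun s => sfun s x) (lcGam_sym C k a b)).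
Qed.

Lemma gamC x u v : V x -> gam x u v = gam x v u.
Proof.
move=> Vx; apply/rowP => k; rewrite !mxE; swap_sum a.
by ext_sum b; rewrite [u 0 b * _]mulrC christoffel_sym.
Qed.

Lemma christoffel_smooth_chart k a b : smooth_on V (christoffel g i k a b).
Proof. exact: (@christoffel_smooth R M X g i W (fun x Vx => Vx)). Qed.

Lemma metric_compat x a b c : V x -> partial a (fun y => gram g i y b c) x =
  \sum_k (christoffel g i k a b x * gram g i x k c + christoffel g i k a c x * gram g i x b k).
Proof.
move=> Vx; have GE a' b' := cG_ev g (V := W) (fun x Vx => Vx) a' b' Vx.
have ME c' d' e' := cGam_ev g (V := W) (fun x Vx => Vx) c' d' e' Vx.
apply: (etrans _ (compat_value (ev := @ev_ R W x Vx) (X := C) GE ME a b c)).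
symmetry; apply: (partial_ev_near (V := W)) => [y Vy|]; last exact: Vx.
exact: (cG_ev g (V := W) (fun x Vx => Vx) b c Vy).
Qed.

(** The product rule for the metric along a curve with velocity [u]: the vector [v + gam u d] is the
    covariant derivative of [d]. *)
Lemma ip_along c d e t u v w : V (c t) -> vdrv c t u -> vdrv d t v -> vdrv e t w -> drv (fun s => ip (c s) (d s) (e s)) t
    (ip (c t) (v + gam (c t) u (d t)) (e t) + ip (c t) (d t) (w + gam (c t) u (e t))).
Proof.
move=> Vc hc hd he; apply: (drv_val _ (drv_sum (fun a => drv_sum (fun b => drvM (drvM (hd a) (he b))
  (smooth_on_chain (@codom_open R M X i) (@gram_smooth _ _ _ g i a b) Vc hc))))).
set x := c t; set p := d t; set q := e t.
rewrite !ipl [ip x v q + _]addrC addrACA [ip x v q + _]addrC addrC.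
transitivity (\sum_a \sum_b (v 0 a * q 0 b + p 0 a * w 0 b) * gram g i x a b + (ip x (gam x u p) q + ip x p (gam x u q))).
  have -> : \sum_a \sum_b ((v 0 a * q 0 b + p 0 a * w 0 b) * gram g i x a b +
      p 0 a * q 0 b * \sum_k partial k (fun y => gram g i y a b) x * u 0 k) =
    \sum_a \sum_b (v 0 a * q 0 b + p 0 a * w 0 b) * gram g i x a b +
    \sum_a \sum_b p 0 a * q 0 b * \sum_k partial k (fun y => gram g i y a b) x * u 0 k.
    by rewrite -big_split; ext_sum a; rewrite -big_split.
  congr (_ + _).
  transitivity (\sum_a \sum_b \sum_m \sum_k (p 0 a * q 0 b * u 0 k *
      (christoffel g i m k a x * gram g i x m b) + p 0 a * q 0 b * u 0 k * (christoffel g i m k b x * gram g i x a m))).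
    ext_sum a; ext_sum b; rewrite exchange_big mulr_sumr.
    ext_sum k; rewrite metric_compat //= mulr_suml mulr_sumr.
    by ext_sum m; ring.
  rewrite /ip; under eq_bigr do (under eq_bigr do (under eq_bigr do rewrite big_split;
    rewrite big_split); rewrite big_split); rewrite big_split /=; congr (_ + _).
    rewrite exchange_big [RHS]exchange_big /=; ext_sum b.
    swap_sum m => /=; rewrite mxE mulrAC mulr_suml mulr_suml.
    swap_sum k => /=; rewrite !mulr_suml.
    by ext_sum a; ring.
  ext_sum a; swap_sum m => /=.
  rewrite mxE mulrAC mulr_sumr; swap_sum k => /=.
  by rewrite mulr_sumr; ext_sum b; ring.
have -> : \sum_a \sum_b (v 0 a * q 0 b + p 0 a * w 0 b) * gram g i x a b = ip x v q + ip x p w.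
  rewrite /ip -big_split; ext_sum a.
  by rewrite -big_split; ext_sum b => /=; ring.
ring.
Qed.

Lemma gam_along c d e t u v w : V (c t) -> vdrv c t u -> vdrv d t v -> vdrv e t w -> vdrv (fun s => gam (c s) (d s) (e s)) t
    (dgam (c t) u (d t) (e t) + gam (c t) v (e t) + gam (c t) (d t) w).
Proof.
move=> Vc hc hd he k; rewrite (_ : (fun s => _) = fun s => \sum_a \sum_b
    d s 0 a * e s 0 b * christoffel g i k a b (c s)); last by apply/funext => s; rewrite mxE.
apply: (drv_val _ (drv_sum (fun a => drv_sum (fun b => drvM (drvM (hd a) (he b))
  (smooth_on_chain (@codom_open R M X i) (@christoffel_smooth_chart k a b) Vc hc))))).
rewrite !mxE -!big_split; ext_sum a; rewrite -!big_split.
by ext_sum b => /=; ring.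
Qed.

(** The coordinate formula for R(u, v) z, paired with [w]. *)
Lemma curvature_vector x u v w z : con (riemT g i x) [:: u; v; w; z] =
  ip x w (dgam x u v z - dgam x v u z + (gam x u (gam x v z) - gam x v (gam x u z))).
Proof.
pose Q k a b d := riemann g i k a b d x.
transitivity (\sum_c \sum_k w 0 c * gram g i x c k * \sum_a \sum_b \sum_d u 0 a * v 0 b * z 0 d * Q k a b d).
  transitivity (\sum_a \sum_b \sum_c \sum_d \sum_k w 0 c * gram g i x c k * (u 0 a * v 0 b * z 0 d * Q k a b d)).
    rewrite /=; ext_sum a; rewrite mulr_sumr; ext_sum b.
    rewrite !mulr_sumr; ext_sum c; rewrite !mulr_sumr; ext_sum d.
    by rewrite /riemann4 !mulr_sumr; ext_sum k; rewrite /Q; ring.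
  under eq_bigr do rewrite exchange_big; swap_sum c => /=.
  under eq_bigr do under eq_bigr do rewrite exchange_big.
  under eq_bigr do rewrite exchange_big; swap_sum k => /=.
  by rewrite mulr_sumr; ext_sum a; rewrite mulr_sumr; ext_sum b; rewrite mulr_sumr.
rewrite /ip; ext_sum c; ext_sum k; rewrite mulrAC; congr (_ * _).
congr (_ * _); rewrite !mxE.
have G2 (p q : 'rV[R]_4) : \sum_a \sum_b p 0 a * (gam x q z) 0 b * christoffel g i k a b x =
   \sum_a \sum_b \sum_d p 0 a * q 0 b * z 0 d * \sum_m christoffel g i k a m x * christoffel g i m b d x.
  ext_sum a.
  transitivity (\sum_m \sum_b \sum_d p 0 a * q 0 b * z 0 d * (christoffel g i k a m x * christoffel g i m b d x)).
    ext_sum m; rewrite mxE mulrAC mulr_sumr; ext_sum b.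
    by rewrite mulr_sumr; ext_sum d; ring.
  swap_sum b => /=; swap_sum d => /=.
  by rewrite mulr_sumr.
have DG (p q : 'rV[R]_4) : \sum_a \sum_b q 0 a * z 0 b * (\sum_m partial m (christoffel g i k a b) x * p 0 m) =
   \sum_a \sum_b \sum_d p 0 a * q 0 b * z 0 d * partial a (christoffel g i k b d) x.
  transitivity (\sum_b \sum_d \sum_a p 0 a * q 0 b * z 0 d * partial a (christoffel g i k b d) x).
    ext_sum b; ext_sum d; rewrite mulr_sumr.
    by ext_sum a; ring.
  by rewrite [RHS]exchange_big; ext_sum b; exact: exchange_big.
have sw (F : I4 -> I4 -> I4 -> R) : \sum_a \sum_b \sum_d v 0 a * u 0 b * z 0 d * F a b d =
   \sum_a \sum_b \sum_d u 0 a * v 0 b * z 0 d * F b a d.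
  swap_sum a; ext_sum b; ext_sum d.
  ring.
rewrite !G2 !DG !(sw _) -!sumrB -big_split; ext_sum a.
rewrite -!sumrB -big_split; ext_sum b; rewrite -!sumrB -big_split.
by ext_sum d; rewrite /Q /riemann sumrB mulrDr !mulrBr.
Qed.

Lemma cauchy_schwarz x u v : V x -> ip x u v ^+ 2 <= ip x u u * ip x v v.
Proof.
move=> Vx; have [->|v0] := eqVneq v 0.
  by rewrite ip0 ipC // ip0 expr0n mulr0.
have p0 := ip_gt0 Vx v0.
have := ip_ge0 (ip x v v *: u - ip x u v *: v) Vx.
rewrite !ipl (ipC v u) //.
have -> : ip x v v * (ip x v v * ip x u u - ip x u v * ip x u v) - ip x u v * (ip x v v * ip x u v - ip x u v * ip x v v) =
   ip x v v * (ip x u u * ip x v v - ip x u v ^+ 2) by ring.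
by rewrite pmulr_rge0 // subr_ge0.
Qed.

Lemma cauchy_sqrt x u v : V x -> ip x u v <= Num.sqrt (ip x u u) * Num.sqrt (ip x v v).
Proof.
move=> Vx; rewrite -sqrtrM ?ip_ge0 //; apply: le_trans (ler_norm _) _.
by rewrite -sqrtr_sqr ler_wsqrtr // cauchy_schwarz.
Qed.

(** On a compact coordinate ball one constant [K] compares the metric with the sup norm and controls
    [gam] and its variation. The local estimates that follow are explicit in [r] and [K]. *)
Record good_ball x0 (r K : R) : Prop := GoodBall { gb_r : 0 < r; gb_K : 1 <= K; gb_codom : forall y, cball x0 r y -> V y;
  gb_low : forall y v, cball x0 r y -> `|v| ^+ 2 <= K * ip y v v;
  gb_up : forall y u v, cball x0 r y -> `|ip y u v| <= K * (`|u| * `|v|);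
  gb_gam : forall y u v, cball x0 r y -> `|gam y u v| <= K * (`|u| * `|v|);
  gb_ip_lip : forall y z u v, cball x0 r y -> cball x0 r z -> `|ip z u v - ip y u v| <= K * `|z - y| * (`|u| * `|v|);
  gb_gam_lip : forall y z u v, cball x0 r y -> cball x0 r z -> `|gam z u v - gam y u v| <= K * `|z - y| * (`|u| * `|v|)
}.

Let sum16 u v (F : I4 -> I4 -> R) (B : R) : (forall a b, `|F a b| <= B) ->
  `|\sum_a \sum_b u 0 a * v 0 b * F a b| <= 16 * B * (`|u| * `|v|).
Proof.
move=> hF; have B0 : 0 <= B by apply: le_trans (hF ord0 ord0).
apply: le_trans (ler_norm_sum _ _ _) _.
apply: (@le_trans _ _ (\sum_(a < 4) 4 * B * (`|u| * `|v|))); last first.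
  by rewrite sumr_const card_ord -mulr_natl; lra.
apply: ler_sum => a _; apply: le_trans (ler_norm_sum _ _ _) _.
apply: (@le_trans _ _ (\sum_(b < 4) B * (`|u| * `|v|))); last first.
  by rewrite sumr_const card_ord -mulr_natl; lra.
apply: ler_sum => b _; rewrite normrM mulrC ler_pM // normrM ler_pM // coord_le_norm //.
Qed.

Let finbound (I : finType) (P : I -> R -> Prop) :
  (forall j, exists2 K : R, 0 < K & P j K) -> (forall j K K', K <= K' -> P j K -> P j K') ->
  exists2 K : R, 0 < K & forall j, P j K.
Proof.
move=> /(_ _)/cid2-/all_sig2[K K0 hK] mono.
exists (1 + \sum_j K j) => [|j].
  by rewrite ltr_wpDr // sumr_ge0 // => j _; exact: ltW (K0 j).
apply: mono (hK j); rewrite (bigD1 j) //= addrCA lerDl addr_ge0 // sumr_ge0 // => l _.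
exact: ltW (K0 l).
Qed.

Lemma good_ball_exists x0 : V x0 -> exists r K, good_ball x0 r K.
Proof.
move=> Vx0; have [r r0 rV] := open_cball (@codom_open R M X i) Vx0.
have oV := @codom_open R M X i.
have sH a b : smooth_on V (fun y => cogram g i y a b).
  exact: (@cogram_smooth R M X g i W (fun x Vx => Vx) a b).
have Vmono (P Q : R) K K' : 0 <= P -> K <= K' -> Q <= K * P -> Q <= K' * P.
  by move=> P0 KK; move=> /le_trans; apply; rewrite ler_wpM2r.
have [K1 K10 h1] := finbound (fun ab : I4 * I4 => ball_bounded (ltW r0) rV (@gram_smooth _ _ _ g i ab.1 ab.2))
   (fun _ K K' KK h y hy => le_trans (h y hy) KK).
have [K2 K20 h2] := finbound (fun ab : I4 * I4 => ball_bounded (ltW r0) rV (sH ab.1 ab.2))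
   (fun _ K K' KK h y hy => le_trans (h y hy) KK).
have [K3 K30 h3] := finbound (fun ab : I4 * I4 * I4 => ball_bounded (ltW r0) rV
   (@christoffel_smooth_chart ab.1.1 ab.1.2 ab.2)) (fun _ K K' KK h y hy => le_trans (h y hy) KK).
have [K4 K40 h4] := finbound (fun ab : I4 * I4 => ball_lipschitz oV (ltW r0) rV (@gram_smooth _ _ _ g i ab.1 ab.2))
   (fun _ K K' KK h y z hy hz => Vmono _ _ _ _ (normr_ge0 _) KK (h y z hy hz)).
have [K5 K50 h5] := finbound (fun ab : I4 * I4 * I4 => ball_lipschitz oV (ltW r0) rV
   (@christoffel_smooth_chart ab.1.1 ab.1.2 ab.2))
   (fun _ K K' KK h y z hy hz => Vmono _ _ _ _ (normr_ge0 _) KK (h y z hy hz)).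
pose K := 1 + 16 * (K1 + K2 + K3 + K4 + K5).
have K_ : [/\ 1 <= K, 16 * K1 <= K, K2 <= K & [/\ 16 * K3 <= K, 16 * K4 <= K & 16 * K5 <= K]].
  by rewrite /K; split; [| | |split]; lra.
have [KK1 KK2 KK3 [KK4 KK5 KK6]] := K_.
exists r, K; split => //.
- move=> y v hy; have Vy := rV _ hy; have p0 := ip_ge0 v Vy.
  have co k : v 0 k ^+ 2 <= K * ip y v v.
    (* The gradient of the coordinate [k]: pairing a vector with it reads off that coordinate, so
       Cauchy-Schwarz bounds it. *)
    pose w := row k (cogram g i y).
    have wv u : ip y u w = u 0 k.
      have sH' : (cogram g i y)^T = cogram g i y by rewrite /cogram trmx_inv gram_sym.
      by rewrite ipE /w tr_row sH' colE mulmxA -[u *m _ *m _]mulmxA mulmxV ?gram_unit // mulmx1 -colE mxE.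
    have := cauchy_schwarz v w Vy; rewrite !wv mulrC => /le_trans; apply.
    apply: ler_wpM2r => //; rewrite mxE; apply: le_trans KK3.
    exact: le_trans (ler_norm _) (h2 (k, k) y hy).
  have : `|v| <= Num.sqrt (K * ip y v v).
    apply: norm_le_coord; first exact: sqrtr_ge0.
    by move=> k; rewrite -sqrtr_sqr ler_wsqrtr.
  rewrite -(ler_pXn2r (n := 2)) ?nnegrE ?sqrtr_ge0 // sqr_sqrtr //.
  by rewrite mulr_ge0 // (le_trans _ KK1).
- move=> y u v hy; apply: (Vmono _ _ _ _ _ KK2); first by rewrite mulr_ge0.
  by apply: sum16 => a b; exact: (h1 (a, b)).
- move=> y u v hy; have p0 : 0 <= `|u| * `|v| by rewrite mulr_ge0.
  apply: norm_le_coord => [|k]; first by rewrite mulr_ge0 // (le_trans _ KK1).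
  rewrite mxE; apply: (Vmono _ _ _ _ p0 KK4).
  by apply: sum16 => a b; exact: (h3 (k, a, b)).
- move=> y z u v hy hz; have -> : ip z u v - ip y u v = \sum_a \sum_b u 0 a * v 0 b * (gram g i z a b - gram g i y a b).
    rewrite /ip -sumrB; ext_sum a; rewrite -sumrB; ext_sum b.
    by rewrite mulrBr.
  have p0 : 0 <= `|z - y| * (`|u| * `|v|) by rewrite !mulr_ge0.
  rewrite -mulrA; apply: (Vmono _ _ _ _ p0 KK5).
  rewrite (_ : 16 * K4 * _ = 16 * (K4 * `|z - y|) * (`|u| * `|v|)); last by ring.
  by apply: sum16 => a b; exact: (h4 (a, b)).
- move=> y z u v hy hz; have p0 : 0 <= `|z - y| * (`|u| * `|v|) by rewrite !mulr_ge0.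
  rewrite -mulrA; apply: norm_le_coord => [|k]; first by rewrite mulr_ge0 // (le_trans _ KK1).
  have -> : (gam z u v - gam y u v) 0 k = \sum_a \sum_b u 0 a * v 0 b * (christoffel g i k a b z - christoffel g i k a b y).
    rewrite !mxE -sumrB; ext_sum a; rewrite -sumrB; ext_sum b.
    by rewrite mulrBr.
  apply: (Vmono _ _ _ _ p0 KK6).
  rewrite (_ : 16 * K5 * _ = 16 * (K5 * `|z - y|) * (`|u| * `|v|)); last by ring.
  by apply: sum16 => a b; exact: (h5 (k, a, b)).
Qed.

End ChartVectors.

(** * Paths, lengths and the Riemannian distance *)

Section Distance.
Variables (R : realType) (M : topologicalType) (X : manifold4 R M) (g : metric X).
Implicit Types (i j : chart X) (p q : M) (c : R -> M) (H : R -> R) (u v x y : 'rV[R]_4).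
Notation nrm i x v := (Num.sqrt (ip g i x v v)).

Lemma codom_coord i p : dom i p -> codom i (coord i p).
Proof. by move=> di; exists p. Qed.

Lemma ip_transition i j p u v : dom i p -> dom j p -> ip g i (coord i p) u v =
  ip g j (coord j p) (u *m transition_jac i j p) (v *m transition_jac i j p).
Proof. by move=> pi pj; rewrite !ipE (gram_transition g pi pj) trmx_mul !mulmxA. Qed.

Lemma vdrv_transition i j c t v : dom i (c t) -> dom j (c t) -> cont_at c t -> vdrv (fun s => coord i (c s)) t v ->
  vdrv (fun s => coord j (c s)) t (v *m transition_jac i j (c t)).
Proof.
move=> ci cj cc hv.
have Wc : overlap i j (coord i (c t)) by exists (c t).
have near_i : \forall s \near t, dom i (c s).
  exact: (cc _ (open_nbhs_nbhs (conj (@dom_open R M X i) ci))).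
apply: (vdrv_near (c := fun s => \row_k coord j (param i (coord i (c s))) 0 k)) => [|k].
  by apply: filterS near_i => s si; apply/rowP => k; rewrite mxE coordK.
have := smooth_on_chain (@overlap_open R M X i j) (@transition_smooth R M X i j k) Wc hv.
rewrite (_ : (fun s => (\row_k0 _) 0 k) = fun s => coord j (param i (coord i (c s))) 0 k).
  by apply: drv_val; rewrite mxE; ext_sum l; rewrite mxE mulrC.
by apply/funext => s; rewrite mxE.
Qed.

Lemma neighbor_ball i p (r : R) : dom i p -> 0 < r ->
  exists2 U : set M, open U /\ U p & forall q, U q -> dom i q /\ cball (coord i p) r (coord i q).
Proof.
move=> di r0.
have : \forall q \near p, dom i q /\ cball (coord i p) r (coord i q).
  apply: filterI; first exact: open_nbhs_nbhs (conj (@dom_open R M X i) di).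
  have /cvgrPdist_lt/(_ r r0) := @coord_continuous R M X i p di.
  by apply: filterS => q; rewrite /cball /= distrC => /ltW.
by move=> h; exists (interior [set q | dom i q /\ cball (coord i p) r (coord i q)]);
  [split=> //; exact: open_interior|move=> q /interior_subset].
Qed.

Definition speed_le c t (h : R) := forall i, dom i (c t) ->
  exists2 v, vdrv (fun s => coord i (c s)) t v & nrm i (coord i (c t)) v <= h.

Lemma speed_chart i c t v h : dom i (c t) -> cont_at c t ->
  vdrv (fun s => coord i (c s)) t v -> nrm i (coord i (c t)) v <= h -> speed_le c t h.
Proof.
move=> ci cc hv vh j cj; exists (v *m transition_jac i j (c t)); first exact: vdrv_transition.
by rewrite -ip_transition.
Qed.

(** The function [H] has a derivative that dominates the speed, and its increment serves as length;
    no integral of the speed is formed. *)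
Definition path a b c H := a <= b /\ forall t, a <= t <= b -> cont_at c t /\ exists2 h, drv H t h & speed_le c t h.

(** Finite concatenations admit corners, as required by the triangle inequality and by shortcuts. *)
Inductive chain : M -> M -> R -> Prop :=
| chain_nil p : chain p p 0
| chain_cons a b c H q L : path a b c H -> chain (c b) q L -> chain (c a) q (H b - H a + L).

Lemma speed_ge0 c t h : speed_le c t h -> 0 <= h.
Proof.
by have [i ci] := dom_cover X (c t) => /(_ i ci)[v _]; apply: le_trans; exact: sqrtr_ge0.
Qed.

Lemma path_sub a b c H a' b' : path a b c H -> a <= a' -> a' <= b' -> b' <= b -> path a' b' c H.
Proof.
move=> [ab h] aa ab' bb; split=> // t /andP[t1 t2]; apply: h.
by rewrite (le_trans aa) // (le_trans t2).
Qed.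

Lemma path_mono a b c H : path a b c H -> H a <= H b.
Proof.
move=> [ab hp]; have /boolp.choice[dH hH] t : exists l, a <= t <= b -> drv H t l /\ 0 <= l.
  case: (boolP (a <= t <= b)) => [/hp[_ [h dh sp]]|_]; last by exists 0.
  by exists h => _; split=> //; exact: speed_ge0 sp.
by apply: (mvt_ge0 ab (df := dH)) => t /hH[].
Qed.

Lemma chain_ge0 p q L : chain p q L -> 0 <= L.
Proof. by elim=> [//|a b c H q' L' /path_mono h _ L0]; rewrite addr_ge0 // subr_ge0. Qed.

Lemma chain_trans p q r L L' : chain p q L -> chain q r L' -> chain p r (L + L').
Proof.
elim=> [p'|a b c H q' l hp _ IH] h; first by rewrite add0r.
by rewrite -addrA; apply: chain_cons hp (IH h).
Qed.

Lemma path_chain a b c H : path a b c H -> chain (c a) (c b) (H b - H a).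
Proof. by move=> h; rewrite -[_ - _]addr0; exact: chain_cons h (chain_nil _). Qed.

Lemma path_rev a b c H : path a b c H -> path (- b) (- a) (c \o -%R) (fun t => - H (- t)).
Proof.
move=> [ab hp]; split=> [|t /andP[t1 t2]]; first by rewrite lerN2.
have [|cc [h dh sp]] := hp (- t); first by rewrite lerNr t2 lerNl.
have dN : drv (fun s : R => - s) t (-1) := drvN (drv_id t).
split; first by apply: (@continuous_comp _ _ _ (fun s : R => - s) c) => //; exact: opp_continuous.
exists h; first by apply: (drv_val _ (drvN (drv_comp dh dN))); rewrite mulrN1 opprK.
move=> i /= ci; have [v hv vh] := sp i ci; exists (- v).
  by have := vdrv_comp hv dN; rewrite scaleN1r.
by rewrite ipNl ipNr opprK.
Qed.

Lemma chain_sym p q L : chain p q L -> chain q p L.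
Proof.
elim=> [p'|a b c H q' l hp _ IH]; first exact: chain_nil.
rewrite addrC; apply: chain_trans IH _; have := path_chain (path_rev hp).
by rewrite /= !opprK addrC.
Qed.

Section Ball.
Variables (i : chart X) (x0 : 'rV[R]_4) (r K : R).
Hypothesis gb : good_ball g i x0 r K.
Let r0 : 0 < r := gb_r gb.
Let K1 : 1 <= K := gb_K gb.
Let K0 : 0 < K := lt_le_trans ltr01 K1.

Lemma paramK y : cball x0 r y -> dom i (param i y) /\ coord i (param i y) = y.
Proof. by move=> /(gb_codom gb)[p pi <-]; rewrite coordK. Qed.

Lemma param_ball_cont y : cball x0 r y -> cont_at (param i) y.
Proof. by move=> /(gb_codom gb); exact: param_continuous. Qed.

Lemma param_ball_compact : compact (param i @` cball x0 r).
Proof.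
apply: continuous_compact; last exact: cball_compact.
by apply: continuous_in_subspaceT => y; rewrite inE; exact: param_ball_cont.
Qed.

Lemma norm_le_speed y v (h : R) : cball x0 r y -> nrm i y v <= h -> `|v| <= K * h.
Proof.
move=> hy vh; have p0 := ip_ge0 g v (gb_codom gb hy).
have h0 : 0 <= h by apply: le_trans (sqrtr_ge0 _) vh.
rewrite -(ler_pXn2r (n := 2)) ?nnegrE ?mulr_ge0 ?(ltW K0) //.
apply: le_trans (gb_low gb v hy) _; rewrite exprMn; apply: ler_pM => //; first exact: ltW.
  by rewrite expr2 ler_pMl.
by rewrite -[leLHS]sqr_sqrtr // lerXn2r ?nnegrE ?sqrtr_ge0.
Qed.

Lemma speed_le_norm y v : cball x0 r y -> nrm i y v <= K * `|v|.
Proof.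
move=> hy; have p0 := ip_ge0 g v (gb_codom gb hy).
rewrite -[leRHS]ger0_norm ?mulr_ge0 ?(ltW K0) // -sqrtr_sqr ler_wsqrtr //.
apply: le_trans (ler_norm _) (le_trans (gb_up gb v v hy) _).
by rewrite exprMn -expr2 ler_wpM2r ?exprn_ge0 // expr2 ler_pMl.
Qed.

Lemma segment_path y z (h : R) : cball x0 r y -> cball x0 r z ->
  (forall s, 0 <= s <= 1 -> nrm i (y + s *: (z - y)) (z - y) <= h) -> chain (param i y) (param i z) h.
Proof.
move=> hy hz hh; pose c s := param i (y + s *: (z - y)).
have pc : path 0 1 c (fun s => h * s).
  split=> // s s01; have hs := cball_convex hy hz s01; have [di cK] := paramK hs.
  have cc : cont_at c s.
    apply: (@continuous_comp R 'rV[R]_4 M (fun s => y + s *: (z - y)) (param i) s).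
      exact: vdrv_cont (vdrv_line y (z - y) s).
    exact: param_ball_cont.
  split=> //; exists h; first by have := drv_affine 0 h s; apply: drv_near; near=> w; rewrite add0r.
  apply: (speed_chart (i := i) (v := z - y)) => //; last by rewrite cK hh.
  apply: vdrv_near (vdrv_line y (z - y) s).
  have oV := open_nbhs_nbhs (conj (@codom_open R M X i) (gb_codom gb hs)).
  have nV : \forall w \near s, codom i (y + w *: (z - y)) := vdrv_cont (vdrv_line y (z - y) s) oV.
  by apply: filterS nV => w [p pi pw]; rewrite /c -pw coordK.
have := path_chain pc; rewrite /c scale0r addr0 scale1r addrC subrK.
by rewrite mulr1 mulr0 subr0.
Unshelve. all: by end_near. Qed.

Lemma segment_chain y z : cball x0 r y -> cball x0 r z -> chain (param i y) (param i z) (K * `|z - y|).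
Proof.
move=> hy hz; apply: segment_path => // s s01.
by apply: speed_le_norm; exact: cball_convex.
Qed.

(** Leaving the ball costs length. It must also be excluded that the path escapes from the chart
    while its coordinates stay bounded: the image of the compact ball is closed, because [M] is
    Hausdorff. *)
Lemma path_in_ball a b c H : path a b c H -> dom i (c a) -> `|coord i (c a) - x0| + K * (H b - H a) < r ->
  dom i (c b) /\ `|coord i (c b) - coord i (c a)| <= K * (H b - H a).
Proof.
set r' := _ + _ => hp da lt_r; have [ab hpt] := hp.
pose Q t := dom i (c t) /\ `|coord i (c t) - coord i (c a)| <= K * (H t - H a).
have mono t t' : a <= t -> t <= t' -> t' <= b -> H t <= H t'.
  by move=> h1 h2 h3; exact: path_mono (path_sub hp h1 h2 h3).
pose C := param i @` cball x0 r'.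
have sub : cball x0 r' `<=` cball x0 r by move=> y /= h; exact: le_trans h (ltW lt_r).
have clC : closed C.
  apply: compact_closed; first exact: mfd_hausdorff X.
  apply: continuous_compact; last exact: cball_compact.
  by apply: continuous_in_subspaceT => y; rewrite inE => /sub; exact: param_ball_cont.
have QC t : a <= t -> t <= b -> Q t -> C (c t).
  move=> h1 h2 [dt Qt]; exists (coord i (c t)); last by rewrite coordK.
  rewrite /cball /=; apply: le_trans (ler_distD (coord i (c a)) _ _) _.
  rewrite addrC /r' lerD2l (le_trans Qt) //.
  by rewrite ler_wpM2l ?(ltW K0) // lerD2r mono.
suff : Q b by [].
apply: (line_ind (a := a)) => //; first by split=> //; rewrite !subrr normr0 mulr0.
move=> t tab; have [cct _] := hpt t tab.
have [[y hy ety]|Ct] := pselect (C (c t)); last first.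
  have /near0P[e e0 he] : \forall s \near t, (~` C) (c s).
    by apply: (cct); apply: open_nbhs_nbhs; split=> //; exact: closed_openC.
  exists e => // t1 t2 h1 h2 h3 h4 t1e _ Q1; exfalso; apply: (he t1 t1e).
  by apply: QC => //; rewrite (le_trans h2) // (le_trans h3).
have [dy cy] := paramK (sub _ hy).
have /near0P[e e0 he] : \forall s \near t, dom i (c s) /\ cball x0 r (coord i (c s)).
  have n1 : \forall s \near t, dom i (c s).
    by apply: (cct); apply: open_nbhs_nbhs; split; [exact: dom_open|rewrite -ety].
  have ccoord : cont_at (fun s => coord i (c s)) t.
    apply: (@continuous_comp _ _ _ c (coord i)) => //.
    by apply: coord_continuous; rewrite -ety.
  have n2 : \forall s \near t, cball x0 r (coord i (c s)).
    have rr : 0 < r - r' by rewrite subr_gt0.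
    have /cvgrPdist_lt/(_ _ rr) := ccoord.
    apply: filterS => s hs; rewrite /cball /=; apply: le_trans (ler_distD (coord i (c t)) _ _) _.
    rewrite -[leRHS](subrK r') lerD //; first by rewrite distrC ltW.
    by rewrite -ety cy.
  by apply: filterS2 n1 n2.
exists e => // t1 t2 h1 t1t tt2 h3 t1e t2e [d1 Q1]; have h2 := le_trans t1t tt2.
have near_s s : t1 <= s <= t2 -> dom i (c s) /\ cball x0 r (coord i (c s)).
  move=> /andP[s1 s2]; apply: he; rewrite ltr_norml.
  move: t1e t2e; rewrite !ltr_norml => /andP[? ?] /andP[? ?]; apply/andP; split; lra.
have [d2 _] := near_s t2 (introT andP (conj h2 (lexx t2))).
split=> //; apply: le_trans (ler_distD (coord i (c t1)) _ _) _. rewrite (_ : H t2 - H a = H t2 - H t1 + (H t1 - H a)); last ring.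
rewrite mulrDr lerD //; have := @vmvt_mono R (fun s => coord i (c s)) (fun s => K * H s) t1 t2 h2.
rewrite mulrBr; apply => s hs; have [ds bs] := near_s s hs.
have [|_ [h dh sp]] := hpt s; first by case/andP: hs => ? ?; rewrite (le_trans h1) // (le_trans _ h3).
have [v hv vh] := sp i ds; exists (K * h), v; split=> //; first exact: drvZ.
exact: norm_le_speed vh.
Qed.

Lemma chain_in_ball p q L : chain p q L -> dom i p -> `|coord i p - x0| + K * L < r ->
  dom i q /\ `|coord i q - coord i p| <= K * L.
Proof.
elim=> {p q L} [p|a b c H q L hp hL IH] dp lt_r; first by rewrite subrr normr0 mulr0.
have HH := path_mono hp; have L0 := chain_ge0 hL.
have [db hb] : dom i (c b) /\ `|coord i (c b) - coord i (c a)| <= K * (H b - H a).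
  apply: path_in_ball => //; apply: le_lt_trans lt_r; rewrite lerD2l.
  by rewrite ler_wpM2l ?(ltW K0) // lerDl.
have [|dq hq] := IH db.
  apply: le_lt_trans lt_r; rewrite mulrDr addrA lerD2r.
  apply: le_trans (ler_distD (coord i (c a)) _ _) _; rewrite addrC.
  by apply: lerD.
split=> //; rewrite mulrDr; apply: le_trans (ler_distD (coord i (c b)) _ _) _.
by rewrite addrC lerD.
Qed.

End Ball.

(** The set of points that can be reached from [p] is open and closed. *)
Lemma chain_exists p q : exists L, chain p q L.
Proof.
pose S := [set q | exists L, chain p q L].
suff ST : S = [set: M] by have : S q by rewrite ST.
have loc z : exists2 U : set M, open U /\ U z & forall y : M, U y -> exists L, chain z y L.
  have [i di] := dom_cover X z.
  have [r [K gb]] := good_ball_exists g (codom_coord di).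
  have [|U oU zU] := @neighbor_ball i z r di; first exact: gb_r gb.
  exists U => // y /zU[dy hy]; exists (K * `|coord i y - coord i z|).
  have := segment_chain gb (cball_center _ (ltW (gb_r gb))) hy.
  by rewrite !coordK.
apply: (mfd_connected X); first by exists p; exists 0; exact: chain_nil.
- exists S; last by rewrite setTI.
  rewrite openE => z [L hL]; have [U [oU Uz] hU] := loc z.
  apply: filterS (open_nbhs_nbhs (conj oU Uz)) => y /hU[L' hL'].
  by exists (L + L'); exact: chain_trans hL hL'.
exists S; last by rewrite setTI.
rewrite -[S]setCK; apply: open_closedC; rewrite openE => z Sz; have [U [oU Uz] hU] := loc z.
apply: filterS (open_nbhs_nbhs (conj oU Uz)) => y /hU[L' hL'] [L hL].
by apply: Sz; exists (L + L'); exact: chain_trans hL (chain_sym hL').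
Qed.

Definition dist p q : R := inf [set L | chain p q L].

Let has_dist p q : has_inf [set L | chain p q L].
Proof.
split; first by have [L hL] := chain_exists p q; exists L.
by exists 0 => L; exact: chain_ge0.
Qed.

Lemma dist_le p q L : chain p q L -> dist p q <= L.
Proof. by move=> h; apply: ge_inf => //; exact: (has_dist p q).2. Qed.

Lemma dist_ge p q (e : R) : (forall L, chain p q L -> e <= L) -> e <= dist p q.
Proof. by move=> h; apply: lb_le_inf => //; exact: (has_dist p q).1. Qed.

Lemma dist_adherent p q (e : R) : 0 < e -> exists2 L, chain p q L & L < dist p q + e.
Proof. by move=> e0; have [L hL lt_L] := inf_adherent e0 (has_dist p q); exists L. Qed.

Lemma dist_ge0 p q : 0 <= dist p q.
Proof. by apply: dist_ge => L; exact: chain_ge0. Qed.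

Lemma dist_refl p : dist p p = 0.
Proof. by apply/eqP; rewrite eq_le dist_ge0 dist_le //; exact: chain_nil. Qed.

Lemma distC p q : dist p q = dist q p.
Proof. by rewrite /dist; congr inf; apply/seteqP; split=> L; exact: chain_sym. Qed.

Lemma dist_triangle p q r : dist p r <= dist p q + dist q r.
Proof.
apply/ler_addgt0Pr => e e0; have e2 : 0 < e / 2 by rewrite divr_gt0.
have [L hL lL] := dist_adherent p q e2; have [L' hL' lL'] := dist_adherent q r e2.
have := dist_le (chain_trans hL hL'); lra.
Qed.

Lemma dist_path a b c H : path a b c H -> dist (c a) (c b) <= H b - H a.
Proof. by move=> /path_chain/dist_le. Qed.

Section LocalDistance.
Variables (i : chart X) (x0 : 'rV[R]_4) (r K : R).
Hypothesis gb : good_ball g i x0 r K.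

Lemma dist_local y z : cball x0 r y -> cball x0 r z -> dist (param i y) (param i z) <= K * `|z - y|.
Proof. by move=> hy hz; apply: dist_le; exact: (segment_chain gb). Qed.

(** Nearly minimal chains stay in the ball by [chain_in_ball]; their excess length then tends to
    0. *)
Lemma dist_in_ball p q : dom i p -> `|coord i p - x0| + K * dist p q < r ->
  dom i q /\ `|coord i q - coord i p| <= K * dist p q.
Proof.
move=> dp; rewrite -ltrBrDl => lt_r.
have K0 : 0 < K := lt_le_trans ltr01 (gb_K gb).
pose e0 := (r - `|coord i p - x0| - K * dist p q) / K.
have e00 : 0 < e0 by rewrite divr_gt0 // subr_gt0.
have main e : 0 < e -> e <= e0 -> dom i q /\ `|coord i q - coord i p| <= K * dist p q + K * e.
  move=> e1 ee; have [L hL lL] := dist_adherent p q e1.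
  have KL : K * L < K * dist p q + K * e by rewrite -mulrDr ltr_pM2l.
  have Ke : K * e <= r - `|coord i p - x0| - K * dist p q.
    by have := ee; rewrite /e0 ler_pdivlMr // mulrC.
  have [|dq hq] := chain_in_ball gb hL dp; first lra.
  by split=> //; apply: le_trans hq (ltW KL).
have [dq _] := main e0 e00 (lexx _); split=> //.
apply/ler_addgt0Pr => e e1.
have [|//|_ h] := main (Num.min e0 (e / K)); rewrite ?lt_min ?e00 ?divr_gt0 ?ge_min ?lexx //.
apply: (le_trans h); rewrite lerD2l mulrC -ler_pdivlMr //.
by rewrite ge_min lexx orbT.
Qed.

End LocalDistance.

Lemma dist_continuous p q : cont_at (dist p) q.
Proof.
have [i di] := dom_cover X q.
have [r [K gb]] := good_ball_exists g (codom_coord di).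
have K0 : 0 < K := lt_le_trans ltr01 (gb_K gb).
apply/cvgrPdist_le => e e0.
have [|U [oU Uq] hU] := @neighbor_ball i q (Num.min r (e / K)) di.
  by rewrite lt_min (gb_r gb) divr_gt0.
apply: filterS (open_nbhs_nbhs (conj oU Uq)) => y /hU[dy hy].
have hr : cball (coord i q) r (coord i y) by apply: le_trans hy _; rewrite ge_min lexx.
have qy : dist q y <= e.
  rewrite -(coordK di) -(coordK dy); apply: le_trans (dist_local gb _ hr) _.
    by apply: cball_center; exact: ltW (gb_r gb).
  rewrite mulrC -ler_pdivlMr //; apply: le_trans hy _.
  by rewrite ge_min lexx orbT.
rewrite ler_norml; have := dist_triangle p q y; have := dist_triangle p y q.
rewrite (distC y q) => h1 h2; apply/andP; split; lra.
Qed.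

End Distance.

(** * Geodesics and their dependence on the initial data *)

Section Geodesics.
Variables (R : realType) (M : topologicalType) (X : manifold4 R M) (g : metric X).
Implicit Types (i j : chart X) (p q z : M) (c : R -> M) (u v w x y : 'rV[R]_4).
Notation nrm i x v := (Num.sqrt (ip g i x v v)).
Notation gm := (gam g).

Definition vel i c t : 'rV[R]_4 := \row_k derive1 (fun s => coord i (c s) 0 k) t.

Lemma vel_unique i c t v : vdrv (fun s => coord i (c s)) t v -> vel i c t = v.
Proof. by move=> h; apply/rowP => k; rewrite mxE derive1E; case: (h k). Qed.

Lemma geodesic_chart c i t : geodesic g c -> dom i (c t) -> vdrv (fun s => coord i (c s)) t (vel i c t) /\
  vdrv (vel i c) t (- gm i (coord i (c t)) (vel i c t) (vel i c t)).
Proof.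
move=> [_ geo] ci; have h k := geo i t ci k; split=> k; have [h1 h2 h3] := h k; rewrite !mxE.
  by rewrite derive1E; apply: DeriveDef; [exact: nbhs_singleton h1|by []].
rewrite (_ : (fun s => vel i c s 0 k) = derive1 (fun s => coord i (c s) 0 k)); last first.
  by apply/funext => s; rewrite mxE.
apply: DeriveDef; first exact: h2.
rewrite -derive1E h3; congr (- _).
by ext_sum a; ext_sum b; rewrite !mxE [RHS]mulrC mulrA.
Qed.

Lemma vel_transition c i j t : geodesic g c -> dom i (c t) -> dom j (c t) ->
  vel j c t = vel i c t *m transition_jac i j (c t).
Proof.
move=> geo ci cj; apply: vel_unique; apply: vdrv_transition => //.
  by case: geo => cc _; exact: cc.
by case: (geodesic_chart geo ci).
Qed.

Lemma dom_near c i t : cont_at c t -> dom i (c t) -> \forall s \near t, dom i (c s).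
Proof. by move=> cc ci; apply: (cc); apply: open_nbhs_nbhs; split=> //; exact: dom_open. Qed.

(** The squared speed is constant inside a chart and does not depend on the chart; line induction
    links the charts met between [s] and [t]. *)
Lemma geodesic_speed c i j s t : geodesic g c -> dom i (c s) -> dom j (c t) ->
  ip g i (coord i (c s)) (vel i c s) (vel i c s) = ip g j (coord j (c t)) (vel j c t) (vel j c t).
Proof.
move=> geo.
wlog st : i j s t / s <= t => [h ci cj|ci cj].
  by have [st|/ltW ts] := leP s t; [exact: h|rewrite -(h j i t s)].
pose Q t' := forall k, dom k (c t') -> ip g k (coord k (c t')) (vel k c t') (vel k c t') =
   ip g i (coord i (c s)) (vel i c s) (vel i c s).
have change k l t' : dom k (c t') -> dom l (c t') ->
    ip g k (coord k (c t')) (vel k c t') (vel k c t') = ip g l (coord l (c t')) (vel l c t') (vel l c t').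
  by move=> dk dl; rewrite (vel_transition geo dk dl) (ip_transition g _ _ dk dl).
symmetry; suff : Q t by apply.
apply: (line_ind st) => [k dk|t' _]; first exact: change.
have [k dk] := dom_cover X (c t'); have [cc _] := geo.
have /near0P[e e0 he] := dom_near (cc t') dk.
exists e => // t1 t2 _ h1 h2 _ t1e t2e Q1 l dl.
have dk2 := he t2 t2e; have dk1 := he t1 t1e.
rewrite (change l k) // -(Q1 k dk1).
pose E t := ip g k (coord k (c t)) (vel k c t) (vel k c t).
have D t0 : btw t1 t2 t0 -> drv E t0 0.
  rewrite btwE; last exact: le_trans h2.
  move=> /andP[a1 a2].
  have d0 : dom k (c t0).
    apply: he; move: t1e t2e; rewrite !ltr_norml => /andP[? ?] /andP[? ?]; apply/andP; split; lra.
  have [h3 h4] := geodesic_chart geo d0.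
  have := ip_along g (codom_coord d0) h3 h4 h4.
  by apply: drv_val; rewrite addNr ip0 ip0r addr0.
by have [t0 _] := mvt D; rewrite mul0r => /subr0_eq.
Qed.

(** Measured at time 0 in an arbitrarily chosen chart; [gspeedE] shows that neither choice
    matters. *)
Definition gspeed c := let i := sval (cid (dom_cover X (c 0))) in nrm i (coord i (c 0)) (vel i c 0).

Lemma gspeedE c i t : geodesic g c -> dom i (c t) -> nrm i (coord i (c t)) (vel i c t) = gspeed c.
Proof.
move=> geo ci; rewrite /gspeed; case: cid => j dj /=; congr Num.sqrt; exact: geodesic_speed.
Qed.

Lemma geodesic_path c a b : geodesic g c -> a <= b -> path g a b c (fun t => gspeed c * t).
Proof.
move=> geo ab; split=> // t _; split; first by case: geo => cc _; exact: cc.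
exists (gspeed c).
  by apply: (drv_val _ (drvZ (gspeed c) (drv_id t))); rewrite mulr1.
move=> i ci; exists (vel i c t); first by case: (geodesic_chart geo ci).
by rewrite (gspeedE geo ci).
Qed.

Lemma gspeed_ge0 c : 0 <= gspeed c.
Proof. exact: sqrtr_ge0. Qed.

Lemma geodesic_dist c a b : geodesic g c -> a <= b -> dist g (c a) (c b) <= gspeed c * (b - a).
Proof. by move=> geo ab; rewrite mulrBr; exact: dist_path (geodesic_path geo ab). Qed.

Lemma geodesic_in_ball c a b i x0 r K : good_ball g i x0 r K -> geodesic g c -> a <= b ->
  dom i (c a) -> `|coord i (c a) - x0| + K * (gspeed c * (b - a)) < r ->
  forall t, a <= t <= b -> [/\ dom i (c t), cball x0 r (coord i (c t)) & `|vel i c t| <= K * gspeed c].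
Proof.
move=> gb geo ab da lt_r t /andP[at_ tb]; have K1 := gb_K gb.
have KL : K * (gspeed c * (t - a)) <= K * (gspeed c * (b - a)).
  by rewrite ler_wpM2l ?(le_trans ler01) // ler_wpM2l ?gspeed_ge0 // lerD2r.
have [|dt] := path_in_ball gb (geodesic_path geo at_) da.
  by rewrite /= -mulrBr; apply: le_lt_trans lt_r; rewrite lerD2l.
rewrite /= -mulrBr => ht.
have bt : cball x0 r (coord i (c t)).
  apply: le_trans (ler_distD (coord i (c a)) _ _) _; rewrite addrC.
  by apply: le_trans (ltW lt_r); rewrite lerD2l (le_trans ht).
by split=> //; apply: (norm_le_speed gb bt); rewrite gspeedE.
Qed.

(** A Gronwall estimate on a short interval: the maximum of the first derivative is at most its
    initial value plus a fraction of itself and of the initial displacement. *)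
Lemma growth (d d1 d2 : R -> 'rV[R]_4) (a b C : R) : a <= b -> b <= a + 1 -> 0 <= C -> C * (b - a) <= 4^-1 ->
  (forall t, a <= t <= b -> [/\ vdrv d t (d1 t), vdrv d1 t (d2 t) & `|d2 t| <= C * (`|d t| + `|d1 t|)]) ->
  forall t, a <= t <= b -> `|d1 t| <= 2 * (`|d a| + `|d1 a|) /\ `|d t| <= 3 * (`|d a| + `|d1 a|).
Proof.
move=> ab ba C0 Cab h.
have [||m m_ab hm] := @compact_max R R `[a, b]%classic (fun t => `|d1 t|) (@segment_compact _ a b).
- by exists a; rewrite /= in_itv /= lexx ab.
- move=> t /=; rewrite in_itv /= => /h[_ h1 _].
  apply: (@continuous_comp R 'rV[R]_4 R d1 (fun v => `|v|) t); first exact: vdrv_cont h1.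
  exact: norm_continuous.
rewrite /= in_itv /= in m_ab; have /andP[am mb] := m_ab; set N := `|d1 m|.
have N0 : 0 <= N by exact: normr_ge0.
have hN t : a <= t <= b -> `|d1 t| <= N by move=> ht; apply: hm; rewrite /= in_itv.
have hd t : a <= t <= b -> `|d t| <= `|d a| + N.
  move=> /andP[at_ tb]; have sub s : btw a t s -> a <= s <= b.
    by rewrite btwE // => /andP[-> /le_trans]; apply.
  have := vmvt_le N0 (fun s hs => let: And3 k _ _ := h s (sub s hs) in k) (fun s hs => hN s (sub s hs)).
  rewrite (ger0_norm (x := t - a)) ?subr_ge0 // => hdt.
  have -> : d t = d a + (d t - d a) by rewrite addrC subrK.
  apply: le_trans (ler_normD _ _) _; rewrite lerD2l (le_trans hdt) // ler_piMr //; lra.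
have hNN : N <= `|d1 a| + C * (`|d a| + N + N) * (m - a).
  have sub s : btw a m s -> a <= s <= b by rewrite btwE // => /andP[-> /le_trans]; apply.
  have B0 : 0 <= C * (`|d a| + N + N) by rewrite mulr_ge0 // !addr_ge0.
  have := @vmvt_le R d1 d2 a m _ B0 (fun s hs => let: And3 _ k _ := h s (sub s hs) in k).
  have hb s : btw a m s -> `|d2 s| <= C * (`|d a| + N + N).
    move=> hs; have [_ _ k] := h s (sub s hs); apply: (le_trans k).
    by rewrite ler_wpM2l // lerD ?hd ?hN ?sub.
  move=> /(_ hb); rewrite (ger0_norm (x := m - a)) ?subr_ge0 // => hm1.
  apply: (@le_trans _ _ `|d1 a + (d1 m - d1 a)|); first by rewrite addrC subrK.
  by apply: le_trans (ler_normD _ _) _; rewrite lerD2l.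
have Cm : C * (m - a) <= 4^-1 by apply: le_trans Cab; rewrite ler_wpM2l // lerD2r.
have Cm' : C * (`|d a| + N + N) * (m - a) <= 4^-1 * (`|d a| + N + N).
  by rewrite mulrAC ler_wpM2r // !addr_ge0.
have a0 : 0 <= `|d a| by []. have b0 : 0 <= `|d1 a| by [].
have N2 : N <= 2 * (`|d a| + `|d1 a|) by lra.
move=> t ht; split; first exact: le_trans (hN t ht) N2.
apply: (le_trans (hd t ht)); lra.
Qed.

Section Comparison.
Variables (i : chart X) (x0 : 'rV[R]_4) (r K B : R).
Hypotheses (gb : good_ball g i x0 r K) (B0 : 0 <= B).

Lemma gam_diff x y u v : cball x0 r x -> cball x0 r y -> `|u| <= B -> `|v| <= B ->
  `|gm i x u u - gm i y v v| <= K * B * (B + 2) * (`|x - y| + `|u - v|).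
Proof.
move=> hx hy hu hv; have K0 : 0 <= K by apply: le_trans ler01 (gb_K gb).
have -> : gm i x u u - gm i y v v = (gm i x u u - gm i y u u) + (gm i y (u - v) u + gm i y v (u - v)).
  by rewrite !gaml; apply/rowP => k; rewrite !mxE; ring.
apply: le_trans (ler_normD _ _) _.
have h1 := gb_gam_lip gb u u hy hx.
have h2 := gb_gam gb (u - v) u hy; have h3 := gb_gam gb v (u - v) hy.
have h4 := ler_normD (gm i y (u - v) u) (gm i y v (u - v)).
set D := `|x - y| in h1 *; set N := `|u - v| in h2 h3 *.
have D0 : 0 <= D := normr_ge0 _. have N0 : 0 <= N := normr_ge0 _.
have u0 : 0 <= `|u| by []. have v0 : 0 <= `|v| by [].
have e1 : K * D * (`|u| * `|u|) <= K * D * (B * B).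
  by rewrite ler_wpM2l ?mulr_ge0 // ler_pM.
have e2 : K * (N * `|u|) <= K * (N * B) by rewrite ler_wpM2l // ler_wpM2l.
have e3 : K * (`|v| * N) <= K * (B * N) by rewrite ler_wpM2l // ler_wpM2r.
have e4 : 0 <= K * B * D by rewrite !mulr_ge0.
have e5 : 0 <= K * B * B * N by rewrite !mulr_ge0.
lra.
Qed.

Lemma geodesic_comparison c1 c2 a b : geodesic g c1 -> geodesic g c2 -> a <= b -> b <= a + 1 ->
  K * B * (B + 2) * (b - a) <= 4^-1 ->
  (forall t, a <= t <= b -> [/\ dom i (c1 t), cball x0 r (coord i (c1 t)) & `|vel i c1 t| <= B]) ->
  (forall t, a <= t <= b -> [/\ dom i (c2 t), cball x0 r (coord i (c2 t)) & `|vel i c2 t| <= B]) ->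
  let N := `|coord i (c1 a) - coord i (c2 a)| + `|vel i c1 a - vel i c2 a| in
  forall t, a <= t <= b -> `|vel i c1 t - vel i c2 t| <= 2 * N /\ `|coord i (c1 t) - coord i (c2 t)| <= 3 * N.
Proof.
move=> g1 g2 ab ba Cab h1 h2 N.
have C0 : 0 <= K * B * (B + 2) by rewrite !mulr_ge0 ?addr_ge0 // (le_trans ler01 (gb_K gb)).
apply: (@growth (fun t => coord i (c1 t) - coord i (c2 t)) (fun t => vel i c1 t - vel i c2 t)
  (fun t => - gm i (coord i (c1 t)) (vel i c1 t) (vel i c1 t)
    - - gm i (coord i (c2 t)) (vel i c2 t) (vel i c2 t)) a b _ ab ba C0 Cab) => t ht.
have [d1 b1 v1] := h1 t ht; have [d2 b2 v2] := h2 t ht.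
have [e1 f1] := geodesic_chart g1 d1; have [e2 f2] := geodesic_chart g2 d2.
split; [exact: vdrvB|exact: vdrvB|].
by rewrite opprK addrC distrC; exact: gam_diff.
Qed.

End Comparison.

Section Families.
Variables (F : 'rV[R]_4 -> R -> M) (v0 : 'rV[R]_4).
Hypothesis geoF : forall v, geodesic g (F v).

Definition continuous_state t := cont_at (fun v => F v t) v0 /\
  forall i, dom i (F v0 t) -> cont_at (fun v => vel i (F v) t) v0.

(** Continuity in one chart is enough, since velocities transform by the Jacobian, which is
    continuous. *)
Lemma continuous_state_chart i t : dom i (F v0 t) -> cont_at (fun v => F v t) v0 ->
  cont_at (fun v => vel i (F v) t) v0 -> continuous_state t.
Proof.
move=> di cF cv; split; first exact: cF.
move=> j dj.
have nij : \forall v \near v0, dom i (F v t) /\ dom j (F v t).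
  by apply: filterI; apply: (cF); apply: open_nbhs_nbhs; split; [exact: dom_open|exact: di| exact: dom_open|exact: dj].
apply: (@near_continuousM 'rV[R]_4 'rV[R]_4 (fun v => vel i (F v) t *m transition_jac i j (F v t))).
  by apply: filterS nij => v [a b]; rewrite (vel_transition (geoF v) a b).
apply: vcontinuous => k.
rewrite (_ : (fun v => _) = fun v => \sum_l vel i (F v) t 0 l * partial l
   (fun x => coord j (param i x) 0 k) (coord i (F v t))); last first.
  by apply/funext => v; rewrite mxE; ext_sum l; rewrite [transition_jac _ _ _ _ _]mxE.
apply: continuous_sum => l; apply: continuous_mul; first exact: continuous_coord.
apply: (@continuous_comp _ _ _ (fun v => coord i (F v t))).
  apply: (@continuous_comp _ _ _ (fun v => F v t) (coord i)) => //.
  exact: Defs.coord_continuous.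
apply: (@smooth_on_cont _ (overlap i j)); last by exists (F v0 t).
by apply: smooth_on_partial; exact: transition_smooth.
Qed.

(** Within a good ball [geodesic_comparison] is a Lipschitz bound in the initial state, and line
    induction passes from ball to ball. Nearby geodesics have bounded speed, so they remain in the
    ball for a common time. *)
Lemma continuous_state_propagation (T : R) : 0 <= T -> continuous_state 0 -> continuous_state T.
Proof.
move=> T0 h0.
have [L L0 hL] : exists2 L : R, 0 < L & \forall v \near v0, gspeed (F v) <= L.
  have [i di] := dom_cover X (F v0 0); have [cF /(_ i di) cv] := h0.
  have [r [K gb]] := good_ball_exists g (codom_coord di).
  have K0 : 0 < K := lt_le_trans ltr01 (gb_K gb).
  have [U [oU Uz] hU] := neighbor_ball di (gb_r gb).
  exists (K * (`|vel i (F v0) 0| + 1)); first by rewrite mulr_gt0 // ltr_wpDl.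
  have n1 : \forall v \near v0, U (F v 0) by apply: (cF); exact: open_nbhs_nbhs.
  have /cvgrPdist_lt/(_ _ ltr01) n2 := cv.
  apply: filterS2 n1 n2 => v /hU[dv bv] hv; rewrite -(gspeedE (geoF v) dv).
  apply: le_trans (speed_le_norm gb _ bv) _; rewrite ler_wpM2l ?(ltW K0) //.
  rewrite -[vel i (F v) 0](subrK (vel i (F v0) 0)) addrC (le_trans (ler_normD _ _)) // lerD2l.
  by rewrite distrC ltW.
apply: (line_ind T0 h0) => t _.
have [i di] := dom_cover X (F v0 t); have [cc _] := geoF v0.
have [r [K gb]] := good_ball_exists g (codom_coord di).
have r0 := gb_r gb; have K0 : 0 < K := lt_le_trans ltr01 (gb_K gb).
pose B := K * L; have B0 : 0 < B by rewrite mulr_gt0.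
pose C := K * B * (B + 2); have C0 : 0 < C by rewrite !mulr_gt0 // addr_gt0.
have [U [oU Ut] hU] : exists2 U : set M, open U /\ U (F v0 t) &
    forall q, U q -> dom i q /\ cball (coord i (F v0 t)) (r / 3) (coord i q).
  by apply: neighbor_ball => //; rewrite divr_gt0.
have /near0P[e1 e10 he1] : \forall s \near t, U (F v0 s) by apply: (cc); exact: open_nbhs_nbhs.
(* [r / (6 * B)] keeps all the curves in the ball, and [(8 * C)^-1] makes the interval short enough
   for [growth]. *)
pose e := Num.min (Num.min e1 4^-1) (Num.min (r / (6 * B)) ((8 * C)^-1)).
have e0 : 0 < e.
  have h1 : 0 < r / (6 * B) by rewrite divr_gt0 // mulr_gt0.
  have h2 : 0 < (8 * C)^-1 by rewrite invr_gt0 mulr_gt0.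
  by rewrite /e !lt_min e10 h1 h2 !andbT invr_gt0 ltr0n.
exists e => // t1 t2 _ t1t tt2 _ t1e t2e [c1 v1].
have t12 := le_trans t1t tt2.
have [w1 w2 w3 w4] : [/\ e <= e1, e <= 4^-1, e <= r / (6 * B) & e <= (8 * C)^-1].
  by rewrite /e; split; rewrite !ge_min lexx ?orbT.
have t21 : t2 - t1 <= 2 * e by move: t1e t2e; rewrite !ltr_norml => /andP[? ?] /andP[? ?]; lra.
have U1 : U (F v0 t1) by apply: he1; apply: lt_le_trans t1e _.
have nU : \forall v \near v0, U (F v t1) by apply: (c1); exact: open_nbhs_nbhs.
have e6 : K * (L * (2 * e)) <= r / 3.
  by move: w3; rewrite ler_pdivlMr ?mulr_gt0 // /B; lra.
have e8 : C * (2 * e) <= 4^-1.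
  by move: w4; rewrite -[(8 * C)^-1]mul1r ler_pdivlMr ?mulr_gt0 //; lra.
have stay v : U (F v t1) -> gspeed (F v) <= L -> forall s, t1 <= s <= t2 ->
    [/\ dom i (F v s), cball (coord i (F v0 t)) r (coord i (F v s)) & `|vel i (F v) s| <= B].
  move=> /hU[dv bv] sv s hs.
  have [|dd bb vv] := geodesic_in_ball gb (geoF v) t12 dv _ hs.
    have h2 : K * (gspeed (F v) * (t2 - t1)) <= K * (L * (2 * e)).
      rewrite ler_wpM2l ?(ltW K0) // ler_pM ?gspeed_ge0 ?subr_ge0 //.
    rewrite /cball /= in bv; lra.
  by split=> //; apply: (le_trans vv); rewrite ler_wpM2l // ltW.
have [U0 L0'] := (U1, nbhs_singleton hL).
have main v : U (F v t1) -> gspeed (F v) <= L ->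
   `|vel i (F v0) t2 - vel i (F v) t2| <= 2 * (`|coord i (F v0 t1) - coord i (F v t1)| +
      `|vel i (F v0) t1 - vel i (F v) t1|) /\
   `|coord i (F v0 t2) - coord i (F v t2)| <= 3 * (`|coord i (F v0 t1) - coord i (F v t1)| +
      `|vel i (F v0) t1 - vel i (F v) t1|).
  move=> hv sv; apply: (geodesic_comparison gb (ltW B0) (geoF v0) (geoF v) t12) => //.
  - by lra.
  - by apply: le_trans e8; rewrite ler_wpM2l // ltW.
  - exact: stay.
  - exact: stay.
  - by rewrite t12 lexx.
have [d1 _] := hU _ U1.
have cN : \forall v \near v0, U (F v t1) /\ gspeed (F v) <= L by apply: filterI.
have cc1 : cont_at (fun v => coord i (F v t1)) v0.
  apply: (@continuous_comp _ _ _ (fun v => F v t1) (coord i)) => //.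
  exact: Defs.coord_continuous.
have small (e' : R) : 0 < e' -> \forall v \near v0, `|vel i (F v0) t2 - vel i (F v) t2| < e' /\
    `|coord i (F v0 t2) - coord i (F v t2)| < e'.
  move=> e'0; have e6' : 0 < e' / 7 by rewrite divr_gt0.
  have /cvgrPdist_lt/(_ _ e6') n1 := cc1; have /cvgrPdist_lt/(_ _ e6') n2 := v1 i d1.
  apply: filterS (filterI cN (filterI n1 n2)) => v [[hv sv] [a1 a2]].
  have [b1 b2] := main v hv sv; split; last exact: sevenths_lt e'0 a1 a2 b2.
  by apply: sevenths_lt e'0 a1 a2 (le_trans b1 _); rewrite ler_wpM2r ?addr_ge0 // ler_nat.
have st0 := stay v0 U1 L0'; have [d2 _ _] := st0 t2 (introT andP (conj t12 (lexx t2))).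
apply: (continuous_state_chart d2); last first.
  by apply: continuous_dist => e' /small; apply: filterS => v [].
have ccoord : cont_at (fun v => coord i (F v t2)) v0.
  by apply: continuous_dist => e' /small; apply: filterS => v [].
apply: (@near_continuousM M 'rV[R]_4 (fun v => param i (coord i (F v t2)))).
  apply: filterS cN => v [hv sv]; apply: coordK.
  by have [] := stay v hv sv t2 (introT andP (conj t12 (lexx t2))).
apply: (@continuous_comp _ _ _ (fun v => coord i (F v t2)) (param i)) => //.
by apply: param_continuous; exists (F v0 t2).
Qed.

End Families.

(** Uniqueness out of continuous dependence: the family equal to [c1] at the parameter 0 and to [c2]
    elsewhere has a continuous initial state, hence is continuous at 0, and [M] is Hausdorff. *)
Lemma geodesic_unique c1 c2 i t : geodesic g c1 -> geodesic g c2 -> 0 <= t -> c1 0 = c2 0 ->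
  dom i (c1 0) -> vel i c1 0 = vel i c2 0 -> c1 t = c2 t.
Proof.
move=> g1 g2 t0 c0 di v0; pose F (v : 'rV[R]_4) := if v == 0 then c1 else c2.
have geoF v : geodesic g (F v) by rewrite /F; case: ifP.
have [] := @continuous_state_propagation F 0 geoF t t0.
  apply: (continuous_state_chart geoF (i := i)); first by rewrite /F eqxx.
    rewrite (_ : (fun v => F v 0) = fun=> c1 0); first exact: cst_continuous.
    by apply/funext => v; rewrite /F; case: ifP.
  rewrite (_ : (fun v => vel i (F v) 0) = fun=> vel i c1 0); first exact: cst_continuous.
  by apply/funext => v; rewrite /F; case: ifP.
move=> cF _; apply: (mfd_hausdorff X) => A B nA nB.
have F0 : F 0 t = c1 t by rewrite /F eqxx.
have nA' : nbhs (F 0 t) A by rewrite F0.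
have /near0P[d d0 hd] : \forall s \near (0 : R), A (F (s *: const_mx 1) t).
  have cs : cont_at (fun s : R => s *: (const_mx 1 : 'rV[R]_4)) (0 : R).
    by have := vdrv_cont (vdrv_line 0 (const_mx 1 : 'rV[R]_4) 0);
      rewrite (_ : (fun s => 0 + _) = fun s : R => s *: (const_mx 1 : 'rV[R]_4)) //; apply/funext => s; rewrite add0r.
  have : cont_at (fun s : R => F (s *: const_mx 1) t) (0 : R).
    by apply: (@continuous_comp R 'rV[R]_4 M _ (fun v => F v t)) => //; rewrite scale0r.
  by apply; rewrite scale0r.
exists (c2 t); split; last exact: nbhs_singleton nB.
have := hd (d / 2); rewrite subr0 ger0_norm ?divr_ge0 ?(ltW d0) // ltr_pdivrMr // ltr_pMr // ltr1n.
rewrite /F scaler_eq0 mulf_eq0 gt_eqF //= invr_eq0 pnatr_eq0 /=.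
have -> : (const_mx 1 == 0 :> 'rV[R]_4) = false.
  by apply/negbTE/eqP => /rowP/(_ 0)/eqP; rewrite !mxE oner_eq0.
by apply.
Qed.

End Geodesics.

(** * The exponential map *)

Section ExponentialMap.
Variables (R : realType) (M : topologicalType) (X : manifold4 R M) (g : metric X).
Hypothesis cpl : complete_metric g.
Implicit Types (i j : chart X) (p q z : M) (c : R -> M) (u v w x y : 'rV[R]_4).
Notation nrm i x v := (Num.sqrt (ip g i x v v)).
Notation gm := (gam g).

Definition geo_from i p v : R -> M := xget (fun=> p) [set c | [/\ geodesic g c, c 0 = p & vel i c 0 = v]].

Lemma geo_fromP i p v : dom i p -> [/\ geodesic g (geo_from i p v), geo_from i p v 0 = p & vel i (geo_from i p v) 0 = v].
Proof.
move=> di; have [c [gc c0 cv]] := cpl v di.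
have hc : [set c | [/\ geodesic g c, c 0 = p & vel i c 0 = v]] c.
  by split=> //; apply/rowP => k; rewrite mxE cv.
by have := xgetPex (fun=> p) (ex_intro _ c hc).
Qed.

Lemma gspeed_from i p v : dom i p -> gspeed g (geo_from i p v) = nrm i (coord i p) v.
Proof.
move=> di; have [gc c0 cv] := geo_fromP v di.
by rewrite -(gspeedE gc (i := i) (t := 0)) ?c0 // cv.
Qed.

Lemma geo_from_continuous i p v t : dom i p -> 0 <= t -> cont_at (fun v => geo_from i p v t) v.
Proof.
move=> di t0; have gg v' : geodesic g (geo_from i p v') by have [] := geo_fromP v' di.
apply: (proj1 (continuous_state_propagation (v0 := v) gg t0 _)).
have z0 v' : geo_from i p v' 0 = p by have [] := geo_fromP v' di.
apply: (continuous_state_chart gg (i := i)); first by rewrite z0.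
  rewrite (_ : (fun v' => geo_from i p v' 0) = fun=> p); first exact: cst_continuous.
  by apply/funext => v'; rewrite z0.
rewrite (_ : (fun v' => vel i (geo_from i p v') 0) = id); first exact: cvg_id.
by apply/funext => v'; have [] := geo_fromP v' di.
Qed.

Lemma nrm_triangle i x u v : codom i x -> nrm i x (u + v) <= nrm i x u + nrm i x v.
Proof.
move=> Vx; rewrite -(ler_pXn2r (n := 2)) ?nnegrE ?addr_ge0 ?sqrtr_ge0 // sqrrD.
rewrite !sqr_sqrtr ?ip_ge0 //; have := cauchy_sqrt g u v Vx.
by rewrite !ipl (ipC g v u) //; lra.
Qed.

Lemma nrmZ i x (a : R) v : nrm i x (a *: v) = `|a| * nrm i x v.
Proof. by rewrite ipZl ipZr mulrA -expr2 sqrtrM ?sqr_ge0 // sqrtr_sqr. Qed.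

(** Expansion of the metric in the base point with a quadratic remainder; by compatibility the
    linear term is expressed through [gam]. *)
Lemma ip_taylor i x0 r K (y z v : 'rV[R]_4) : good_ball g i x0 r K -> cball x0 r y -> cball x0 r z ->
  `|ip g i z v v - ip g i y v v - 2 * ip g i y v (gm i y (z - y) v)| <= 4 * K ^+ 2 * `|z - y| ^+ 2 * `|v| ^+ 2.
Proof.
move=> gb hy hz; pose w := z - y; have K0 : 0 <= K by apply: le_trans ler01 (gb_K gb).
pose f s := ip g i (y + s *: w) v v.
have D s : btw 0 1 s -> drv f s (2 * ip g i (y + s *: w) v (gm i (y + s *: w) w v)).
  rewrite btwE // => hs; have hb := cball_convex hy hz hs; have Vb := gb_codom gb hb.
  have := ip_along g (c := fun s => y + s *: w) (t := s) Vb (vdrv_line y w s) (vdrv_cst v s) (vdrv_cst v s).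
  by apply: drv_val; rewrite add0r (ipC g (gm _ _ _ _)) //; ring.
have [s hs] := mvt D; rewrite btwE // in hs; have hb := cball_convex hy hz hs.
rewrite /f scale1r scale0r addr0 subr0 mulr1 [y + w]addrC subrK => ->.
rewrite -mulrBr normrM ger0_norm //; set x := y + s *: w.
have -> : ip g i x v (gm i x w v) - ip g i y v (gm i y w v) =
  (ip g i x v (gm i x w v) - ip g i y v (gm i x w v)) + ip g i y v (gm i x w v - gm i y w v).
  by rewrite ipDr ipNr addrA subrK.
have xy : `|x - y| <= `|w|.
  rewrite /x addrAC subrr add0r normrZ ler_piMl //; case/andP: hs => s0 s1; by rewrite ger0_norm.
have h1 := gb_ip_lip gb v (gm i x w v) hy hb; have h2 := gb_gam gb w v hb.
have h3 := gb_up gb v (gm i x w v - gm i y w v) hy; have h4 := gb_gam_lip gb w v hy hb.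
have n0 : 0 <= `|w| * `|v| by rewrite mulr_ge0.
have e1 : K * `|x - y| * (`|v| * `|gm i x w v|) <= K * `|w| * (`|v| * (K * (`|w| * `|v|))).
  by rewrite ler_pM ?mulr_ge0 // ler_wpM2l.
have e2 : K * (`|v| * `|gm i x w v - gm i y w v|) <= K * (`|v| * (K * `|w| * (`|w| * `|v|))).
  by rewrite !ler_wpM2l // (le_trans h4) // ler_wpM2r // ler_wpM2l.
rewrite -/w; apply: (@le_trans _ _ (2 * (2 * K ^+ 2 * `|w| ^+ 2 * `|v| ^+ 2))); last lra.
rewrite ler_wpM2l // (le_trans (ler_normD _ _)) //; lra.
Qed.

Section LocalExp.
Variables (i : chart X) (z : M) (r K e : R).
Let x0 := coord i z.
Hypotheses (di : dom i z) (gb : good_ball g i x0 r K) (e0 : 0 < e).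
Hypotheses (e_r : K * (K * e) < r) (e_K : 48 * K ^+ 3 * e <= 1).
Let K1 : 1 <= K := gb_K gb.
Let K0 : 0 < K := lt_le_trans ltr01 K1.
Let r0 : 0 < r := gb_r gb.
Let B := K * (K * e).
Let G u := geo_from i z u.
Let B0 : 0 <= B. Proof. by rewrite !mulr_ge0 // ltW. Qed.

Let KB : K * B <= 48^-1.
Proof. by rewrite /B; have := e_K; rewrite !exprS expr0; lra. Qed.

Let B1 : B <= 48^-1.
Proof. by apply: le_trans KB; rewrite ler_peMl. Qed.

(** The constant 48 in [e_K] is chosen for this bound, which leaves room both for [growth] and for
    the factor 1/2 of [lexp_diff]. *)
Let CB : K * B * (B + 2) <= 16^-1.
Proof.
apply: (@le_trans _ _ (48^-1 * 3)); last lra.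
by rewrite ler_pM ?mulr_ge0 ?addr_ge0 // ?ltW //; have := B1; lra.
Qed.

Lemma exp_stay u t : `|u| <= e -> 0 <= t <= 1 -> [/\ dom i (G u t), cball x0 r (coord i (G u t)) & `|vel i (G u) t| <= B].
Proof.
move=> ue t01; have [gu u0 uv] := geo_fromP u di.
have sp : gspeed g (G u) <= K * e.
  rewrite gspeed_from //; apply: le_trans (speed_le_norm gb u (cball_center _ (ltW r0))) _.
  by rewrite ler_wpM2l // ltW.
have [||a b c] := geodesic_in_ball gb gu ler01 _ _ t01.
- by rewrite u0.
- rewrite u0 subrr normr0 add0r subr0 mulr1; apply: le_lt_trans e_r.
  by rewrite ler_wpM2l // ltW.
by split=> //; apply: (le_trans c); rewrite ler_wpM2l // ltW.
Qed.

Lemma exp_compare u w t : `|u| <= e -> `|w| <= e -> 0 <= t <= 1 -> `|vel i (G u) t - vel i (G w) t| <= 2 * `|u - w| /\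
  `|coord i (G u t) - coord i (G w t)| <= 3 * `|u - w|.
Proof.
move=> ue we t01; have [gu u0 uv] := geo_fromP u di; have [gw w0 wv] := geo_fromP w di.
have := geodesic_comparison gb B0 gu gw ler01 (ltac:(by rewrite add0r)) _
  (fun t h => exp_stay ue h) (fun t h => exp_stay we h) t01.
rewrite u0 w0 uv wv subrr normr0 add0r; apply.
by rewrite subr0 mulr1 (le_trans CB) // lef_pV2 ?posrE // ler_nat.
Qed.

Definition lexp u := coord i (G u 1).

(** In the chart the exponential map is the identity up to a constant and a map with Lipschitz
    constant 1/2. Indeed the accelerations of two geodesics from [z] differ little, as both have
    coordinate speed at most [B]. *)
Lemma lexp_diff u w : `|u| <= e -> `|w| <= e -> `|lexp u - lexp w - (u - w)| <= 2^-1 * `|u - w|.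
Proof.
move=> ue we; have [gu u0 uv] := geo_fromP u di; have [gw w0 wv] := geo_fromP w di.
set N := `|u - w|; have N0 : 0 <= N := normr_ge0 _.
pose acc (c : R -> M) t := - gm i (coord i (c t)) (vel i c t) (vel i c t).
have A t : 0 <= t <= 1 -> `|acc (G u) t - acc (G w) t| <= 2^-1 * N.
  move=> t01; have [d1 b1 v1] := exp_stay ue t01; have [d2 b2 v2] := exp_stay we t01.
  have [h1 h2] := exp_compare ue we t01; rewrite /acc opprK addrC distrC.
  apply: le_trans (gam_diff gb B0 b1 b2 v1 v2) _.
  apply: (@le_trans _ _ (16^-1 * (5 * N))); last lra.
  apply: ler_pM; [by rewrite !mulr_ge0 ?addr_ge0 // ltW|exact: addr_ge0|exact: CB|].
  by rewrite -/N in h1 h2; lra.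
have D1 t : 0 <= t <= 1 -> `|vel i (G u) t - vel i (G w) t - (u - w)| <= 2^-1 * N.
  move=> /andP[t0 t1]; have sub s : btw 0 t s -> 0 <= s <= 1.
    by rewrite btwE // => /andP[-> /le_trans]; apply.
  have := @vmvt_le R (fun t => vel i (G u) t - vel i (G w) t) (fun t => acc (G u) t - acc (G w) t)
    0 t (2^-1 * N); rewrite uv wv subr0 (ger0_norm t0) => h.
  apply: le_trans (h _ _ _) _; first by rewrite mulr_ge0.
  - move=> s /sub hs; have [d1 _ _] := exp_stay ue hs; have [d2 _ _] := exp_stay we hs.
    by apply: vdrvB; [case: (geodesic_chart gu d1)|case: (geodesic_chart gw d2)].
  - by move=> s /sub; exact: A.
  by rewrite ler_piMr // mulr_ge0.
have := @vmvt_le R (fun t => coord i (G u t) - coord i (G w t) - t *: (u - w))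
  (fun t => vel i (G u) t - vel i (G w) t - (u - w)) 0 1 (2^-1 * N).
rewrite /G u0 w0 subrr scale0r subr0 subr0 scale1r subr0 normr1 mulr1; apply.
- by rewrite mulr_ge0.
- move=> s; rewrite btwE // => hs; have [d1 _ _] := exp_stay ue hs; have [d2 _ _] := exp_stay we hs.
  apply: vdrvB.
    by apply: vdrvB; [case: (geodesic_chart gu d1)|case: (geodesic_chart gw d2)].
  by have := vdrvZ (drv_id s) (vdrv_cst (u - w) s); rewrite scale1r scaler0 addr0.
by move=> s; rewrite btwE //; exact: D1.
Qed.

Lemma lexp_inj u w : `|u| <= e -> `|w| <= e -> `|u - w| <= 2 * `|lexp u - lexp w|.
Proof.
move=> ue we; have := lexp_diff ue we; have := ler_distD (lexp u - lexp w) (u - w) 0.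
rewrite subr0 [`|u - w - _|]distrC subr0; lra.
Qed.

Lemma lexp0 : lexp 0 = x0.
Proof.
have [g0 z0 v0] := geo_fromP 0 di; have e0' : `|0 : 'rV[R]_4| <= e by rewrite normr0 ltW.
have := geodesic_dist g0 ler01; rewrite gspeed_from // ip0 sqrtr0 mul0r z0 => d0.
have {}d0 : dist g z (G 0 1) = 0 by apply/eqP; rewrite eq_le d0 dist_ge0.
have [|_] := dist_in_ball gb di (q := G 0 1).
  by rewrite d0 subrr normr0 mulr0 addr0.
by rewrite d0 mulr0 normr_le0 subr_eq0 => /eqP.
Qed.

(** At a minimiser of the distance from [lexp u] to [y], the correction [f u] stays in the ball and
    at least halves that distance, which is therefore 0. Compactness replaces an iteration. *)
Lemma lexp_surj y : `|y - x0| <= e / 2 -> exists2 u, `|u| <= e & lexp u = y.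
Proof.
move=> ye; pose U : set 'rV[R]_4 := cball 0 e; pose f u := u - lexp u + y.
have Ue u : U u -> `|u| <= e by rewrite /U /cball /= subr0.
have e0' : `|0 : 'rV[R]_4| <= e by rewrite normr0 ltW.
have fU : set_fun U U f.
  move=> u /Ue ue; rewrite /U /cball /= subr0 /f.
  have -> : u - lexp u + y = (y - x0) - (lexp u - lexp 0 - (u - 0)).
    by rewrite lexp0; apply/rowP => k; rewrite !mxE; ring.
  apply: le_trans (ler_normB _ _) _; have := lexp_diff ue e0'; rewrite subr0.
  by move: ye ue; lra.
have [|||u /Ue ue um] := @compact_min R _ U (fun u => `|lexp u - y|).
- exact: cball_compact.
- by exists 0; apply: cball_center; exact: ltW.
- move=> u /Ue ue; have [d1 _ _] := exp_stay ue (introT andP (conj ler01 (lexx 1))).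
  have cl : cont_at lexp u.
    apply: (@continuous_comp _ _ _ (fun u => G u 1) (coord i)).
      exact: geo_from_continuous.
    exact: Defs.coord_continuous.
  exact: continuous_normB.
exists u => //; have Uf := fU u (_ : U u); have {}Uf : U (f u).
  by apply: Uf; rewrite /U /cball /= subr0.
have := um _ Uf; have := lexp_diff (Ue _ Uf) ue.
have -> : lexp (f u) - lexp u - (f u - u) = lexp (f u) - y.
  by rewrite /f; apply/rowP => k; rewrite !mxE; ring.
have -> : f u - u = - (lexp u - y) by rewrite /f; apply/rowP => k; rewrite !mxE; ring.
rewrite normrN => h1 h2; apply/eqP; rewrite -subr_eq0 -normr_le0.
by have := le_trans h2 h1; have := normr_ge0 (lexp u - y); lra.
Qed.

(** Energies of two geodesics issuing from [z]. They are constant in time, so they can be compared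
    at any moment: their difference is [2 h'] up to a quadratic error, and the mean value theorem
    for [h] leaves the boundary term at time 1. *)
Lemma first_variation u1 u2 : `|u1| <= e -> `|u2| <= e -> ip g i x0 u2 u2 <= ip g i x0 u1 u1 +
    2 * ip g i (lexp u1) (vel i (G u1) 1) (lexp u2 - lexp u1) + 208 * K ^+ 2 * `|lexp u2 - lexp u1| ^+ 2.
Proof.
move=> u1e u2e; have [g1 z1 v1] := geo_fromP u1 di; have [g2 z2 v2] := geo_fromP u2 di.
set N := `|u2 - u1|; have N0 : 0 <= N := normr_ge0 _.
have NL : N ^+ 2 <= 4 * `|lexp u2 - lexp u1| ^+ 2.
  have := lexp_inj u2e u1e; rewrite -/N => NL.
  have -> : 4 = 2 ^+ 2 :> R by rewrite expr2; lra.
  by rewrite -exprMn lerXn2r ?nnegrE ?mulr_ge0.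
pose c1 t := coord i (G u1 t); pose c2 t := coord i (G u2 t).
pose p1 := vel i (G u1); pose p2 := vel i (G u2).
pose w t := c2 t - c1 t; pose w' t := p2 t - p1 t.
pose h t := ip g i (c1 t) (p1 t) (w t).
pose h' t := ip g i (c1 t) (p1 t) (w' t + gm i (c1 t) (p1 t) (w t)).
set E := ip g i x0 u2 u2 - ip g i x0 u1 u1.
have Dh t : 0 <= t <= 1 -> drv h t (h' t).
  move=> t01; have [d1 b1 _] := exp_stay u1e t01; have [d2 b2 _] := exp_stay u2e t01.
  have [a1 a1'] := geodesic_chart g1 d1; have [a2 a2'] := geodesic_chart g2 d2.
  have := ip_along g (gb_codom gb b1) a1 a1' (vdrvB a2 a1).
  by apply: drv_val; rewrite addNr ip0 add0r.
(* The sum 52 = 36 + 6 + 6 + 4 collects the bounds [k1] to [k4]; [NL] contributes the factor 4 that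
   leads to 208. *)
have Eh t : 0 <= t <= 1 -> `|E - 2 * h' t| <= 52 * K ^+ 2 * N ^+ 2.
  move=> t01; have [d1 b1 s1] := exp_stay u1e t01; have [d2 b2 s2] := exp_stay u2e t01.
  have [hw' hw] := exp_compare u2e u1e t01.
  have -> : E = ip g i (c2 t) (p2 t) (p2 t) - ip g i (c1 t) (p1 t) (p1 t).
    have d10 : dom i (G u1 0) by rewrite /G z1.
    have d20 : dom i (G u2 0) by rewrite /G z2.
    rewrite /c1 /c2 /p1 /p2 (geodesic_speed g2 d2 d20) (geodesic_speed g1 d1 d10).
    by rewrite /G z1 z2 v1 v2.
  have Vb1 := gb_codom gb b1.
  have -> : ip g i (c2 t) (p2 t) (p2 t) - ip g i (c1 t) (p1 t) (p1 t) - 2 * h' t =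
    (ip g i (c2 t) (p1 t) (p1 t) - ip g i (c1 t) (p1 t) (p1 t) - 2 * ip g i (c1 t) (p1 t) (gm i (c1 t) (w t) (p1 t))) +
    ((ip g i (c2 t) (p1 t) (w' t) - ip g i (c1 t) (p1 t) (w' t)) +
     (ip g i (c2 t) (w' t) (p2 t) - ip g i (c1 t) (w' t) (p2 t))) + ip g i (c1 t) (w' t) (w' t).
    rewrite /h' (gamC g (w t)) // /w' !ipl (ipC g (p2 t) (p1 t) (x := c1 t)) //.
    by move: (ip g i (c2 t)) (ip g i (c1 t)) => a b; ring.
  have t1 := ip_taylor (p1 t) gb b1 b2.
  have t2 := gb_ip_lip gb (p1 t) (w' t) b1 b2; have t3 := gb_ip_lip gb (w' t) (p2 t) b1 b2.
  have t4 := gb_up gb (w' t) (w' t) b1.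
  rewrite -/(c1 t) -/(c2 t) -/(w t) in t1 t2 t3 t4 hw; rewrite -/(p1 t) -/(p2 t) -/(w' t) in hw' s1 s2.
  have q1 : `|p1 t| <= 1 by apply: le_trans (le_trans s1 B1) _; rewrite invf_le1 // ler1n.
  have q2 : `|p2 t| <= 1 by apply: le_trans (le_trans s2 B1) _; rewrite invf_le1 // ler1n.
  have k1 : 4 * K ^+ 2 * `|w t| ^+ 2 * `|p1 t| ^+ 2 <= 4 * K ^+ 2 * (3 * N) ^+ 2 * 1.
    have K20 : 0 <= 4 * K ^+ 2 by rewrite mulr_ge0 // exprn_ge0 // ltW.
    apply: ler_pM; [by rewrite mulr_ge0 ?exprn_ge0|exact: exprn_ge0| |exact: exprn_ile1].
    by apply: ler_wpM2l => //; rewrite lerXn2r ?nnegrE ?mulr_ge0.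
  have kw : `|w t| * `|w' t| <= 3 * N * (2 * N) by rewrite ler_pM.
  have K2 : K <= K ^+ 2 by rewrite expr2 ler_peMl // ltW.
  have K20 : 0 <= K ^+ 2 by rewrite exprn_ge0 // ltW.
  have k2 : K * `|w t| * (`|p1 t| * `|w' t|) <= K ^+ 2 * (3 * N * (2 * N)).
    have -> : K * `|w t| * (`|p1 t| * `|w' t|) = K * (`|w t| * `|w' t|) * `|p1 t| by ring.
    rewrite -[leRHS]mulr1 ler_pM ?mulr_ge0 // ?(ltW K0) //.
    by rewrite ler_pM ?mulr_ge0 // ltW.
  have k3 : K * `|w t| * (`|w' t| * `|p2 t|) <= K ^+ 2 * (3 * N * (2 * N)).
    have -> : K * `|w t| * (`|w' t| * `|p2 t|) = K * (`|w t| * `|w' t|) * `|p2 t| by ring.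
    rewrite -[leRHS]mulr1 ler_pM ?mulr_ge0 // ?(ltW K0) //.
    by rewrite ler_pM ?mulr_ge0 // ltW.
  have k4 : K * (`|w' t| * `|w' t|) <= K ^+ 2 * (2 * N * (2 * N)).
    by rewrite ler_pM ?mulr_ge0 ?ler_pM // ltW.
  apply: le_trans (ler_normD _ _) _; apply: le_trans (lerD (ler_normD _ _) (lexx _)) _.
  apply: le_trans (lerD (lerD (lexx _) (ler_normD _ _)) (lexx _)) _.
  have -> : 52 * K ^+ 2 * N ^+ 2 = 4 * K ^+ 2 * (3 * N) ^+ 2 * 1 + (K ^+ 2 * (3 * N * (2 * N)) +
    K ^+ 2 * (3 * N * (2 * N))) + K ^+ 2 * (2 * N * (2 * N)) by ring.
  apply: lerD; last exact: le_trans t4 k4.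
  by apply: lerD; [exact: le_trans t1 k1|apply: lerD; [exact: le_trans t2 k2|exact: le_trans t3 k3]].
have [t] := mvt (fun t (ht : btw 0 1 t) => Dh t (etrans (esym (btwE t ler01)) ht)).
rewrite btwE // subr0 mulr1 => t01 ht; have := Eh t t01; rewrite -ht.
have -> : h 0 = 0 by rewrite /h /w /c1 /c2 /G z1 z2 subrr ip0r.
have -> : h 1 = ip g i (lexp u1) (vel i (G u1) 1) (lexp u2 - lexp u1) by [].
rewrite subr0 => /ler_normlW; rewrite /E => hE.
have k5 : 52 * K ^+ 2 * N ^+ 2 <= 52 * K ^+ 2 * (4 * `|lexp u2 - lexp u1| ^+ 2).
  by rewrite ler_wpM2l // mulr_ge0 // exprn_ge0 // ltW.
lra.
Qed.

End LocalExp.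
End ExponentialMap.

Section DiniBound.
Variable R : realType.

(** A mean value inequality that asks only for upper bounds on increments, because the radial length
    is not known to be differentiable. *)
Lemma dini_bound (P H : R -> R) (a b : R) : a <= b ->
  (forall t, a <= t <= b -> exists2 h, drv H t h & forall e, 0 < e -> exists2 d, 0 < d &
    forall s, a <= s <= b -> `|s - t| < d ->
      (t <= s -> P s - P t <= (h + e) * (s - t)) /\ (s <= t -> P t - P s <= (h + e) * (t - s))) -> P b - P a <= H b - H a.
Proof.
move=> ab hP; apply/ler_addgt0Pr => e e0; pose e1 := e / (b - a + 1).
have ba : 0 < b - a + 1 by rewrite ltr_wpDl // subr_ge0.
have e10 : 0 < e1 by rewrite divr_gt0.
have e12 : 0 < e1 / 2 by rewrite divr_gt0.
suff : P b - P a <= H b - H a + e1 * (b - a).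
  move=> /le_trans; apply; rewrite lerD2l /e1 mulrAC ler_pdivrMr // ler_pM2l //; lra.
pose Q t : Prop := P t - P a <= H t - H a + e1 * (t - a).
suff : Q b by [].
apply: (line_ind ab); first by rewrite /Q !subrr mulr0 addr0.
move=> t tab; have [h dH hh] := hP t tab; have [d d0 hd] := hh _ e12.
have [d' d'0 hd'] := (drvP H t h).1 dH _ e12.
exists (Num.min d d'); first by rewrite lt_min d0.
move=> t1 t2 a1 t1t tt2 b2; rewrite !lt_min => /andP[x1 y1] /andP[x2 y2]; rewrite /Q => Q1.
have t1ab : a <= t1 <= b by rewrite a1 (le_trans t1t) // (le_trans tt2).
have t2ab : a <= t2 <= b by rewrite b2 andbT (le_trans _ tt2) // (le_trans a1).
have [_ /(_ t1t) p1] := hd t1 t1ab x1; have [/(_ tt2) p2 _] := hd t2 t2ab x2.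
have := hd' (t1 - t) y1; have := hd' (t2 - t) y2.
rewrite !(addrC t) !subrK (ger0_norm (x := t2 - t)) ?subr_ge0 // (ler0_norm (x := t1 - t)) ?subr_le0 //.
rewrite !ler_norml => /andP[q1 q2] /andP[q3 q4].
have t10 : 0 <= t - t1 by rewrite subr_ge0. have t20 : 0 <= t2 - t by rewrite subr_ge0.
lra.
Qed.

End DiniBound.

(** * Geodesics minimise locally *)

Section RadialDistance.
Variables (R : realType) (M : topologicalType) (X : manifold4 R M) (g : metric X).
Hypothesis cpl : complete_metric g.
Implicit Types (j : chart X) (p q : M) (c : R -> M) (u v w x y : 'rV[R]_4).
Notation nrm i x v := (Num.sqrt (ip g i x v v)).
Variables (i : chart X) (z : M) (r K e : R).
Let x0 := coord i z.
Hypotheses (di : dom i z) (gb : good_ball g i x0 r K) (e0 : 0 < e).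
Hypotheses (e_r : K * (K * e) < r) (e_K : 48 * K ^+ 3 * e <= 1).
Let K1 : 1 <= K := gb_K gb.
Let K0 : 0 < K := lt_le_trans ltr01 K1.
Let r0 : 0 < r := gb_r gb.

Definition lexp_inv y := xget 0 [set u | `|u| <= e /\ lexp g i z u = y].

Lemma lexp_invP y : cball x0 (e / 2) y -> `|lexp_inv y| <= e /\ lexp g i z (lexp_inv y) = y.
Proof.
move=> hy; have [u ue uy] := lexp_surj cpl di gb e0 e_r e_K hy.
by have := xgetPex 0 (ex_intro [set u | `|u| <= e /\ lexp g i z u = y] u (conj ue uy)).
Qed.

Lemma half_ball y : cball x0 (e / 2) y -> cball x0 r y.
Proof.
move=> h; apply: (le_trans h); apply: le_trans (ltW e_r).
have : e <= K * (K * e) by rewrite mulrA ler_peMl ?(ltW e0) // -expr2 exprn_ege1.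
have := e0; lra.
Qed.

(** The squared length of the short geodesic from [z] to the point with coordinates [y]. *)
Definition radial y := ip g i x0 (lexp_inv y) (lexp_inv y).

Lemma radial_ge0 y : 0 <= radial y.
Proof. exact: ip_ge0 (codom_coord di). Qed.

Lemma radial_step y1 y2 : cball x0 (e / 2) y1 -> cball x0 (e / 2) y2 ->
  radial y2 <= radial y1 + 2 * (Num.sqrt (radial y1) * nrm i y1 (y2 - y1)) + 208 * K ^+ 2 * `|y2 - y1| ^+ 2.
Proof.
move=> h1 h2; have [u1e u1y] := lexp_invP h1; have [u2e u2y] := lexp_invP h2.
have := first_variation cpl di gb e0 e_r e_K u1e u2e; rewrite u1y u2y => /le_trans; apply.
rewrite lerD2r lerD2l ler_wpM2l //.
apply: le_trans (cauchy_sqrt g _ _ (gb_codom gb (half_ball h1))) _.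
rewrite ler_wpM2r ?sqrtr_ge0 //; have [gc c0 cv] := geo_fromP cpl (lexp_inv y1) di.
have [|d1 _ _] := exp_stay cpl di gb e_r (t := 1) u1e; first by rewrite ler01 lexx.
by rewrite -[X in ip g i X]u1y /lexp (gspeedE gc d1) gspeed_from.
Qed.

(** The square root is regularised by [e1]: the quadratic error of [radial_step] is divided by the
    root, which could vanish at the centre. Here 104 is half of 208. *)
Lemma radial_sqrt_step (e1 : R) y1 y2 : 0 < e1 -> cball x0 (e / 2) y1 -> cball x0 (e / 2) y2 ->
  Num.sqrt (radial y2 + e1 ^+ 2) - Num.sqrt (radial y1 + e1 ^+ 2) <=
  nrm i y1 (y2 - y1) + 104 * K ^+ 2 / e1 * `|y2 - y1| ^+ 2.
Proof.
move=> e10 h1 h2; rewrite lerBlDl; set G1 := Num.sqrt (radial y1 + _); set n := nrm _ _ _; set D := 104 * _ / _ * _.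
have n0 : 0 <= n by exact: sqrtr_ge0.
have D0 : 0 <= D by rewrite !mulr_ge0 ?exprn_ge0 ?invr_ge0 ?(ltW K0) ?(ltW e10).
have p0 := radial_ge0 y1; have q0 := radial_ge0 y2; have s0 : 0 <= e1 ^+ 2 by exact: sqr_ge0.
have GG : G1 ^+ 2 = radial y1 + e1 ^+ 2 by rewrite sqr_sqrtr // addr_ge0.
have Ge : e1 <= G1 by rewrite -[e1](ger0_norm (ltW e10)) -sqrtr_sqr ler_wsqrtr // lerDr.
have Gr : Num.sqrt (radial y1) <= G1 by rewrite ler_wsqrtr // lerDl.
have G0 : 0 <= G1 by exact: sqrtr_ge0.
rewrite -(ler_pXn2r (n := 2)) ?nnegrE ?sqrtr_ge0 ?addr_ge0 // sqr_sqrtr ?addr_ge0 //.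
apply: le_trans (lerD (radial_step h1 h2) (lexx _)) _; rewrite -/n.
have k1 : Num.sqrt (radial y1) * n <= G1 * n by rewrite ler_wpM2r.
have k2 : e1 * D <= G1 * D by rewrite ler_wpM2r.
have k3 : e1 * D = 104 * K ^+ 2 * `|y2 - y1| ^+ 2.
  by rewrite /D mulrA [e1 * _]mulrC -[104 * _ / _ * _]mulrA mulVf ?mulr1 // gt_eqF.
have k4 : 0 <= (n + D) ^+ 2 by exact: sqr_ge0.
have -> : (G1 + (n + D)) ^+ 2 = G1 ^+ 2 + 2 * (G1 * n) + 2 * (G1 * D) + (n + D) ^+ 2 by ring.
rewrite GG; lra.
Qed.

(** The Gauss lemma as an inequality: radial length grows no faster than arclength. *)
Lemma radial_path a b c H : path g a b c H -> (forall t, a <= t <= b -> dom i (c t) /\ cball x0 (e / 2) (coord i (c t))) ->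
  Num.sqrt (radial (coord i (c b))) <= Num.sqrt (radial (coord i (c a))) + (H b - H a).
Proof.
move=> [ab hp] stay; pose y t := coord i (c t).
have main (e1 : R) : 0 < e1 -> Num.sqrt (radial (y b) + e1 ^+ 2) - Num.sqrt (radial (y a) + e1 ^+ 2) <= H b - H a.
  move=> e10; apply: (dini_bound (P := fun t => Num.sqrt (radial (y t) + e1 ^+ 2))) => // t tab.
  have [cc [h dH sp]] := hp t tab; have [dt bt] := stay t tab; have [v hv vh] := sp i dt.
  have Vt := gb_codom gb (half_ball bt).
  exists h => // e2 e20.
  pose D := 104 * K ^+ 2 / e1; have D0 : 0 <= D by rewrite !mulr_ge0 ?exprn_ge0 ?invr_ge0 ?(ltW K0) ?(ltW e10).
  pose e3 := e2 / (3 * K); have e30 : 0 < e3 by rewrite divr_gt0 // mulr_gt0.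
  have n1 : \forall s \near t, nrm i (y s) v < h + e2 / 3.
    have := drv_cont (ip_along g Vt hv (vdrv_cst v t) (vdrv_cst v t)).
    move=> /(continuous_comp (g := Num.sqrt))/(_ (@sqrt_continuous R _)).
    move=> /cvgrPdist_lt/(_ (e2 / 3)); rewrite divr_gt0 // => /(_ isT).
    apply: filterS => s; rewrite ltr_norml => /andP[h1 h2]; rewrite /= in h1 h2; rewrite /y; lra.
  have [d1 d10 hd1] := (near0P _ _).1 n1.
  have [d2 d20 hd2] : exists2 d, 0 < d & forall s, `|s - t| < d -> `|y s - y t - (s - t) *: v| <= e3 * `|s - t|.
    have [d d0 hd] := vdrvP hv e30; exists d => // s /hd; rewrite [t + _]addrC subrK; apply.
  pose V := `|v| + e3; have V0 : 0 < V by rewrite ltr_wpDl.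
  pose d3 := e2 / (3 * (D * V ^+ 2 + 1)).
  have DV : 0 < D * V ^+ 2 + 1 by rewrite ltr_wpDl // mulr_ge0 // exprn_ge0 // ltW.
  have d30 : 0 < d3 by rewrite divr_gt0 // mulr_gt0.
  exists (Num.min d1 (Num.min d2 d3)); first by rewrite !lt_min d10 d20.
  move=> s sab; rewrite !lt_min => /and3P[s1 s2 s3].
  have [_ bs] := stay s sab; have Vs := gb_codom gb (half_ball bs).
  have N0 := hd2 s s2; have nv := hd1 s s1; set N := `|s - t| in N0 s3.
  have N00 : 0 <= N := normr_ge0 _.
  have yb : `|y s - y t| <= V * N.
    rewrite -[y s - y t](subrK ((s - t) *: v)) (le_trans (ler_normD _ _)) //.
    by rewrite normrZ -/N /V; have := N0; lra.
  have key x : cball x0 r x -> nrm i x v <= h + e2 / 3 -> nrm i x (y s - y t) + D * `|y s - y t| ^+ 2 <= (h + e2) * N.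
    move=> bx nx; have Vx := gb_codom gb bx.
    have a1 : nrm i x (y s - y t) <= (h + e2 / 3) * N + K * (e3 * N).
      rewrite -[y s - y t](subrK ((s - t) *: v)) addrC.
      apply: le_trans (nrm_triangle g _ _ Vx) _; rewrite nrmZ -/N mulrC lerD ?ler_wpM2r //.
      by apply: le_trans (speed_le_norm gb _ bx) _; rewrite ler_wpM2l // ltW.
    have a2 : K * (e3 * N) = e2 / 3 * N.
      by rewrite /e3; field; rewrite gt_eqF.
    have a3 : D * `|y s - y t| ^+ 2 <= e2 / 3 * N.
      apply: (@le_trans _ _ (D * (V * N) ^+ 2)).
        by rewrite ler_wpM2l // lerXn2r ?nnegrE ?mulr_ge0 // ltW.
      have -> : D * (V * N) ^+ 2 = D * V ^+ 2 * N * N by ring.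
      rewrite ler_wpM2r // (le_trans (y := (D * V ^+ 2 + 1) * d3)) //.
        have DV0 : 0 <= D * V ^+ 2 by rewrite mulr_ge0 // exprn_ge0 // ltW.
        by apply: ler_pM => //; [rewrite lerDl|exact: ltW].
      by rewrite /d3 le_eqVlt; apply/orP; left; apply/eqP; field; rewrite gt_eqF.
    by move: a1 a3; rewrite a2; lra.
  have ks := key _ (half_ball bs) (ltW nv).
  have vh' : nrm i (coord i (c t)) v <= h + e2 / 3.
    by apply: (le_trans vh); rewrite lerDl divr_ge0 // ltW.
  have kt := key _ (half_ball bt) vh'.
  split=> [ts|st].
    apply: le_trans (radial_sqrt_step e10 bt bs) _; apply: (le_trans kt).
    by rewrite /N ger0_norm // subr_ge0.
  apply: le_trans (radial_sqrt_step e10 bs bt) _.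
  have -> : coord i (c t) - coord i (c s) = - (y s - y t) by rewrite opprB.
  rewrite ipNl ipNr opprK normrN; apply: (le_trans ks).
  by rewrite /N ler0_norm ?opprB // subr_le0.
rewrite -lerBlDl; apply/ler_addgt0Pr => e1 e10; have := main e1 e10.
have h1 : Num.sqrt (radial (y b)) <= Num.sqrt (radial (y b) + e1 ^+ 2).
  by rewrite ler_wsqrtr // lerDl sqr_ge0.
have h2 : Num.sqrt (radial (y a) + e1 ^+ 2) <= Num.sqrt (radial (y a)) + e1.
  have p0 := radial_ge0 (y a); have s0 := sqrtr_ge0 (radial (y a)).
  rewrite -(ler_pXn2r (n := 2)) ?nnegrE ?addr_ge0 ?sqrtr_ge0 ?(ltW e10) //.
  rewrite sqr_sqrtr ?addr_ge0 ?sqr_ge0 // sqrrD sqr_sqrtr //.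
  have : 0 <= Num.sqrt (radial (y a)) * e1 by rewrite mulr_ge0 // ltW.
  lra.
rewrite -/(y a) -/(y b); lra.
Qed.

Lemma radial_chain p q L : chain g p q L -> dom i p -> `|coord i p - x0| + K * L <= e / 2 ->
  Num.sqrt (radial (coord i q)) <= Num.sqrt (radial (coord i p)) + L.
Proof.
elim=> {p q L} [p|a b c H q L hp hL IH] dp lt_r; first by rewrite addr0.
have HH := path_mono hp; have L0 := chain_ge0 hL; have [ab _] := hp.
have er : e / 2 < r.
  apply: le_lt_trans e_r; have : e <= K * (K * e).
    by rewrite mulrA ler_peMl ?(ltW e0) // -expr2 exprn_ege1.
  have := e0; lra.
have bound t : a <= t <= b -> dom i (c t) /\ `|coord i (c t) - x0| <= `|coord i (c a) - x0| + K * (H b - H a).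
  move=> /andP[at_ tb]; have hpt := path_sub hp (lexx a) at_ tb.
  have Ht : K * (H t - H a) <= K * (H b - H a).
    by rewrite ler_wpM2l ?(ltW K0) // lerD2r (path_mono (path_sub hp at_ tb (lexx b))).
  have KL : 0 <= K * L by rewrite mulr_ge0 // ltW.
  rewrite mulrDr in lt_r.
  have [|dt ht] := path_in_ball gb hpt dp; first by lra.
  split=> //; apply: le_trans (ler_distD (coord i (c a)) _ _) _; lra.
have KL : 0 <= K * L by rewrite mulr_ge0 // ltW.
have lt_r' := lt_r; rewrite mulrDr in lt_r'.
have := radial_path hp => h; have {}h : Num.sqrt (radial (coord i (c b))) <= Num.sqrt (radial (coord i (c a))) + (H b - H a).
  by apply: h => t tab; have [dt ht] := bound t tab; split=> //; rewrite /cball /=; lra.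
have [db hb] := bound b (introT andP (conj ab (lexx b))).
have := IH db _; rewrite -/x0 => h2; have {}h2 := h2 (ltac:(lra)).
by apply: (le_trans h2); rewrite addrA lerD2r.
Qed.

(** The radial geodesic is no longer than any nearly minimal chain, by [radial_chain]. *)
Lemma local_geodesic_ball (x : M) : dist g z x < e / (2 * K) ->
  exists c, [/\ geodesic g c, c 0 = z, c 1 = x & gspeed g c = dist g z x].
Proof.
move=> zx; have Kzx : K * dist g z x < e / 2.
  by move: zx; rewrite ltr_pdivlMr ?mulr_gt0 //; have := K0; lra.
have er : e / 2 < r.
  apply: le_lt_trans e_r; have : e <= K * (K * e).
    by rewrite mulrA ler_peMl ?(ltW e0) // -expr2 exprn_ege1.
  have := e0; lra.
have [|dx hx] := dist_in_ball gb di (q := x); first by rewrite subrr normr0 add0r (lt_trans Kzx).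
have bx : cball x0 (e / 2) (coord i x) by apply: (le_trans hx); exact: ltW.
have [ue uy] := lexp_invP bx; have [gc c0 cv] := geo_fromP cpl (lexp_inv (coord i x)) di.
exists (geo_from g i z (lexp_inv (coord i x))).
have c1 : geo_from g i z (lexp_inv (coord i x)) 1 = x.
  have [|d1 _ _] := exp_stay cpl di gb e_r (t := 1) ue; first by rewrite ler01 lexx.
  by rewrite -(coordK d1) -[RHS](coordK dx) -[in RHS]uy.
split=> //; rewrite gspeed_from //; apply/eqP; rewrite eq_le; apply/andP; split; last first.
  have := geodesic_dist gc ler01; rewrite c0 c1 subr0 mulr1 gspeed_from //.
rewrite -/x0 -/(radial (coord i x)); apply/ler_addgt0Pr => e1 e10.
pose e2 := Num.min e1 ((e / 2 - K * dist g z x) / K).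
have e20 : 0 < e2 by rewrite lt_min e10 divr_gt0 // subr_gt0.
have [L hL lL] := dist_adherent g z x e20.
have r00 : radial (coord i z) = 0.
  have [|u0e u0y] := @lexp_invP (coord i z); first by apply: cball_center; rewrite divr_ge0 // ltW.
  have e00 : `|0 : 'rV[R]_4| <= e by rewrite normr0 ltW.
  have := lexp_inj cpl di gb e0 e_r e_K u0e e00; rewrite (lexp0 cpl di gb e0) u0y subrr normr0 mulr0.
  by rewrite subr0 normr_le0 => /eqP u00; rewrite /radial u00 ip0.
have := radial_chain hL di; rewrite subrr normr0 add0r r00 sqrtr0 add0r => h.
apply: le_trans (h _) _; last by apply/ltW/(lt_le_trans lL); rewrite lerD2l ge_min lexx.
have e2K : K * e2 <= e / 2 - K * dist g z x.
  by rewrite mulrC -ler_pdivlMr // ge_min lexx orbT.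
have : K * L <= K * (dist g z x + e2) by rewrite ler_wpM2l // ltW.
rewrite mulrDr; lra.
Qed.

End RadialDistance.

Lemma local_geodesic (R : realType) (M : topologicalType) (X : manifold4 R M) (g : metric X) z :
  complete_metric g -> exists2 d : R, 0 < d & forall x, dist g z x < d ->
  exists c, [/\ geodesic g c, c 0 = z, c 1 = x & gspeed g c = dist g z x].
Proof.
move=> cpl; have [i di] := dom_cover X z.
have [r [K gb]] := good_ball_exists g (codom_coord di).
have K0 : 0 < K := lt_le_trans ltr01 (gb_K gb); have r0 := gb_r gb.
have k2 : 0 < 2 * K ^+ 2 by rewrite mulr_gt0 ?exprn_gt0.
have k3 : 0 < 48 * K ^+ 3 by rewrite mulr_gt0 ?exprn_gt0.
(* The two entries ensure the smallness conditions [e_r] and [e_K]. *)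
pose e := Num.min (r / (2 * K ^+ 2)) (48 * K ^+ 3)^-1.
have e0 : 0 < e by rewrite lt_min divr_gt0 // invr_gt0.
exists (e / (2 * K)); first by rewrite divr_gt0 // mulr_gt0.
move=> x; apply: (local_geodesic_ball cpl di gb e0).
  have : e <= r / (2 * K ^+ 2) by rewrite ge_min lexx.
  by rewrite ler_pdivlMr //; lra.
have : e <= (48 * K ^+ 3)^-1 by rewrite ge_min lexx orbT.
by rewrite -[(48 * _)^-1]mul1r ler_pdivlMr // mulrC.
Qed.

(** * The Hopf-Rinow theorem *)

Section HopfRinow.
Variables (R : realType) (M : topologicalType) (X : manifold4 R M) (g : metric X).
Hypothesis cpl : complete_metric g.
Implicit Types (i j : chart X) (p q z : M) (c : R -> M) (u v w y : 'rV[R]_4).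

Lemma geodesic_of_chart c : continuous c -> (forall i t, dom i (c t) -> exists v : R -> 'rV[R]_4,
     (\forall s \near t, vdrv (fun s => coord i (c s)) s (v s)) /\
     vdrv v t (- gam g i (coord i (c t)) (v t) (v t))) -> geodesic g c.
Proof.
move=> cc h; split=> // i t di ck k; have [v [hv hv']] := h i t di.
have E a : \forall s \near t, derive1 (fun s => coord i (c s) 0 a) s = v s 0 a.
  by apply: filterS hv => s /(_ a)[_ <-]; rewrite derive1E.
have D := drv_near (filterS (fun s => @esym _ _ _) (E k)) (hv' k).
split; first by apply: filterS hv => s /(_ k)[].
  by case: D.
rewrite derive1E; case: D => _ ->; rewrite !mxE; congr (- _).
ext_sum a; ext_sum b.
by rewrite (nbhs_singleton (E a)) (nbhs_singleton (E b)) [LHS]mulrC mulrA.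
Qed.

Lemma geodesic_affine c (a b : R) : geodesic g c -> geodesic g (fun t => c (b + a * t)) /\
  forall i t, dom i (c (b + a * t)) -> vel i (fun t => c (b + a * t)) t = a *: vel i c (b + a * t).
Proof.
move=> gc; have [cc _] := gc.
have ca : continuous (fun t => b + a * t) by move=> t; exact: drv_cont (drv_affine b a t).
have cca : continuous (fun t => c (b + a * t)).
  by move=> t; apply: (@continuous_comp _ _ _ (fun t => b + a * t) c t (ca t)); exact: (cc (b + a * t)).
have V i t : dom i (c (b + a * t)) -> vdrv (fun t => coord i (c (b + a * t))) t (a *: vel i c (b + a * t)).
  move=> di; have [h _] := geodesic_chart gc di.
  exact: (@vdrv_comp R (fun s => coord i (c s)) (fun t => b + a * t) t a _ h (drv_affine b a t)).
split; last by move=> i t /V/vel_unique.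
apply: geodesic_of_chart => // i t di; exists (fun t => a *: vel i c (b + a * t)); split.
  by apply: filterS (dom_near (cca t) di) => s; exact: V.
have [_ h] := geodesic_chart gc di.
have := vdrvZl a (@vdrv_comp R (vel i c) (fun t => b + a * t) t a _ h (drv_affine b a t)).
by rewrite !gaml !scalerN.
Qed.

Lemma gspeed_affine c (a b : R) : geodesic g c -> gspeed g (fun t => c (b + a * t)) = `|a| * gspeed g c.
Proof.
move=> gc; have [ga hv] := geodesic_affine a b gc.
have [i di] := dom_cover X (c (b + a * 0)).
by rewrite -(gspeedE ga di) hv // nrmZ (gspeedE gc di).
Qed.

Lemma dist_eq0 p q : dist g p q = 0 -> p = q.
Proof.
move=> pq; have [i di] := dom_cover X p; have [r [K gb]] := good_ball_exists g (codom_coord di).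
have [|dq] := dist_in_ball gb di (q := q); first by rewrite pq subrr normr0 mulr0 addr0 (gb_r gb).
by rewrite pq mulr0 normr_le0 subr_eq0 -{2}(coordK di) -{2}(coordK dq) => /eqP ->.
Qed.

Lemma dist_ball_closed p (e : R) : closed [set q | dist g p q <= e].
Proof.
rewrite (_ : [set q | _] = dist g p @^-1` [set x | x <= e]) //.
by apply: closed_comp; [move=> q _; exact: dist_continuous|exact: closed_le].
Qed.

Lemma small_ball_compact z : exists2 d0 : R, 0 < d0 & forall d, d < d0 -> compact [set x | dist g z x <= d].
Proof.
have [i di] := dom_cover X z; have [r [K gb]] := good_ball_exists g (codom_coord di).
have K0 : 0 < K := lt_le_trans ltr01 (gb_K gb).
exists (r / K) => [|d dK]; first by rewrite divr_gt0 // (gb_r gb).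
apply: (subclosed_compact (@dist_ball_closed z d) (param_ball_compact gb)) => x /= xd.
have Kd : K * dist g z x < r.
  by rewrite mulrC -ltr_pdivlMr //; exact: le_lt_trans dK.
have [|dx hx] := dist_in_ball gb di (q := x); first by rewrite subrr normr0 add0r.
by exists (coord i x); [apply: le_trans hx (ltW Kd)|rewrite coordK].
Qed.

(** The intermediate value theorem, on the path of the chain where the distance to [z] passes
    [d]. *)
Lemma sphere_crossing z p q (d L : R) : chain g p q L -> dist g z p <= d -> d <= dist g z q ->
  exists2 x, dist g z x = d & d - dist g z p + dist g x q <= L.
Proof.
elim=> {p q L} [p|a b c H q L hp hL IH] h1 h2.
  have E : dist g z p = d by apply/eqP; rewrite eq_le h1.
  by exists p => //; rewrite E subrr dist_refl add0r.
have [ab hpt] := hp.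
have tri := dist_triangle g z (c a) (c b); have dab := dist_path hp.
have [le_d|gt_d] := leP (dist g z (c b)) d.
  by have [x xd hx] := IH le_d h2; exists x => //; lra.
have [||t] := @IVT R (fun t => dist g z (c t)) a b d ab.
- apply: continuous_in_subspaceT => t; rewrite inE /= in_itv /= => tab.
  apply: (@continuous_comp _ _ _ c (dist g z)); first by case: (hpt t tab).
  exact: dist_continuous.
- by rewrite ge_min h1 le_max (ltW gt_d) orbT.
rewrite in_itv /= => /andP[at_ tb] td; exists (c t) => //.
have d1 := dist_path (path_sub hp (lexx a) at_ tb); have d2 := dist_path (path_sub hp at_ tb (lexx b)).
have t1 := dist_triangle g z (c a) (c t); have t2 := dist_triangle g (c t) (c b) q.
have := dist_le hL; lra.
Qed.

(** On a small compact sphere the point nearest to [q] splits the distance, since every chain from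
    [z] to [q] crosses the sphere. *)
Lemma sphere_point z : exists2 d0 : R, 0 < d0 & forall q d, 0 <= d -> d < d0 -> d <= dist g z q ->
  exists2 x, dist g z x = d & dist g z q = d + dist g x q.
Proof.
have [d0 d00 hd] := small_ball_compact z; exists d0 => // q d dge dlt dq.
pose S := [set x | dist g z x = d].
have cS : compact S.
  apply: subclosed_compact (hd d dlt) _ => [|x /= ->//].
  rewrite (_ : S = dist g z @^-1` [set x | x = d]) //.
  by apply: closed_comp; [move=> x _; exact: dist_continuous|exact: closed_eq].
have cross L : chain g z q L -> exists2 x, S x & d + dist g x q <= L.
  by move=> /(sphere_crossing (z := z))-/(_ d); rewrite dist_refl subr0; apply.
have [||x Sx xmin] := compact_min cS (u := fun x => dist g x q).
- by have [L /cross[x Sx _]] := chain_exists g z q; exists x.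
- move=> x _; rewrite (_ : (fun x => dist g x q) = dist g q); first exact: dist_continuous.
  by apply/funext => y; rewrite distC.
exists x => //; apply/eqP; rewrite eq_le; apply/andP; split.
  by rewrite -Sx dist_triangle.
by apply: dist_ge => L /cross[y Sy dy]; apply: le_trans dy; rewrite lerD2l xmin.
Qed.

(* A broken geodesic with a genuine corner is shortened by a straight coordinate segment. *)
Lemma no_corner c1 c2 i (t e : R) : geodesic g c1 -> geodesic g c2 -> gspeed g c1 = 1 ->
  gspeed g c2 = 1 -> c1 t = c2 0 -> dom i (c2 0) -> 0 < e ->
  (forall s, 0 < s -> s < e -> 2 * s <= dist g (c1 (t - s)) (c2 s)) -> vel i c1 t = vel i c2 0.
Proof.
move=> g1 g2 s1 s2 c12 di e0 hd; have d1 : dom i (c1 t) by rewrite c12.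
set v := vel i c1 t; set u := vel i c2 0; set x0 := coord i (c2 0).
have Vx : codom i x0 := codom_coord di.
have nv : ip g i x0 v v = 1.
  have := gspeedE g1 d1; rewrite s1 -/v c12 -/x0 => /(congr1 (fun a => a ^+ 2)).
  by rewrite sqr_sqrtr ?ip_ge0 // expr1n.
have nu : ip g i x0 u u = 1.
  have := gspeedE g2 di; rewrite s2 -/u -/x0 => /(congr1 (fun a => a ^+ 2)).
  by rewrite sqr_sqrtr ?ip_ge0 // expr1n.
apply/eqP/contraT => vu; have vu0 : v - u != 0 by rewrite subr_eq0.
have p0 := ip_gt0 g Vx vu0; pose m2 := ip g i x0 (u + v) (u + v).
have m24 : m2 < 4.
  by move: p0; rewrite /m2 !ipl (ipC g v u) // nu nv; lra.
have m20 : 0 <= m2 by exact: ip_ge0.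
have [r [K gb]] := good_ball_exists g Vx; have r0 := gb_r gb.
have K0 : 0 < K := lt_le_trans ltr01 (gb_K gb).
(* If the unit vectors differ, [m] lies strictly between the norm of [u + v] and 2. The coordinate
   segment between the points at distance [s] before and after the corner is shorter than about
   [s m], against [2 s] along the geodesics. *)
pose m := Num.sqrt ((m2 + 4) / 2).
have mm : m ^+ 2 = (m2 + 4) / 2 by rewrite sqr_sqrtr // divr_ge0 // addr_ge0.
have m0 : 0 <= m by exact: sqrtr_ge0.
have m2' : m < 2.
  by rewrite -(ltr_pXn2r (n := 2)) ?nnegrE // mm expr2; lra.
pose N := `|u + v|; have N0 : 0 <= N := normr_ge0 _.
pose C := N + 1; have C0 : 0 < C by rewrite ltr_wpDl.
pose e1 := Num.min 2^-1 ((2 - m) / (4 * K)).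
have e10 : 0 < e1 by rewrite lt_min invr_gt0 ltr0n divr_gt0 ?mulr_gt0 // subr_gt0.
have [a1 a10 h1] := vdrvP (proj1 (geodesic_chart g1 d1)) e10.
have [a2 a20 h2] := vdrvP (proj1 (geodesic_chart g2 di)) e10.
pose V := `|u| + `|v| + 1; have V0 : 0 < V by rewrite ltr_wpDl ?addr_ge0.
pose b := Num.min r ((4 - m2) / (2 * K * (N ^+ 2 + 1))).
have kn : 0 < 2 * K * (N ^+ 2 + 1) by rewrite !mulr_gt0 // ltr_wpDl // exprn_ge0.
have b0 : 0 < b by rewrite lt_min r0 divr_gt0 // subr_gt0.
have near1 : \forall s \near t, dom i (c1 s) by apply: dom_near d1; case: g1 => cc _; exact: cc.
have near2 : \forall s \near 0, dom i (c2 s) by apply: dom_near di; case: g2 => cc _; exact: cc.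
have [a3 a30 h3] := (near0P _ _).1 near1; have [a4 a40 h4] := (near0P _ _).1 near2.
pose s := Num.min (Num.min (Num.min a1 a2) (Num.min a3 a4)) (Num.min e (b / V)) / 2.
have s0 : 0 < s by rewrite divr_gt0 // !lt_min a10 a20 a30 a40 e0 divr_gt0.
have slt x : Num.min (Num.min (Num.min a1 a2) (Num.min a3 a4)) (Num.min e (b / V)) <= x -> s < x.
  by apply: lt_le_trans; rewrite /s ltr_pdivrMr // ltr_pMr ?ltr1n // -(pmulr_lgt0 _ (_ : 0 < 2^-1)) ?invr_gt0.
have [sa1 sa2 sa3 sa4] : [/\ s < a1, s < a2, s < a3 & s < a4].
  by split; apply: slt; rewrite !ge_min lexx ?orbT.
have [se sb] : s < e /\ s < b / V by split; apply: slt; rewrite !ge_min lexx ?orbT.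
have ns : `|s| = s by rewrite ger0_norm // ltW.
have nms : `|- s| = s by rewrite normrN ns.
pose y1 := coord i (c1 (t - s)); pose y2 := coord i (c2 s).
have {h1} : `|y1 - x0 - - s *: v| <= e1 * s by rewrite -{2}nms /x0 -c12; apply: h1; rewrite nms.
rewrite scaleNr opprK => h1.
have {h2} h2 : `|y2 - x0 - s *: u| <= e1 * s.
  by have := h2 s; rewrite ns add0r; apply.
have e12 : e1 <= 2^-1 by rewrite ge_min lexx.
have e1K : K * e1 <= (2 - m) / 4.
  have : e1 <= (2 - m) / (4 * K) by rewrite ge_min lexx orbT.
  by rewrite ler_pdivlMr ?mulr_gt0 //; lra.
have sV : s * V < b by rewrite -ltr_pdivlMr.
have s2s : e1 * s <= s by rewrite ler_piMl ?(ltW s0) // (le_trans e12) // invf_le1 // ler1n.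
have b1 : cball x0 b y1.
  rewrite /cball /=; have -> : y1 - x0 = (y1 - x0 + s *: v) - s *: v by rewrite addrK.
  apply: le_trans (ler_normB _ _) _; rewrite normrZ ns.
  have : 0 <= s * `|u| by rewrite mulr_ge0 // ltW.
  by move: sV h1 s2s; rewrite /V !mulrDr mulr1; lra.
have b2 : cball x0 b y2.
  rewrite /cball /=; have -> : y2 - x0 = (y2 - x0 - s *: u) + s *: u by rewrite subrK.
  apply: le_trans (ler_normD _ _) _; rewrite normrZ ns.
  have : 0 <= s * `|v| by rewrite mulr_ge0 // ltW.
  by move: sV h2 s2s; rewrite /V !mulrDr mulr1; lra.
have br : b <= r by rewrite ge_min lexx.
have dy1 : dom i (c1 (t - s)) by apply: h3; rewrite addrAC subrr add0r nms.
have dy2 : dom i (c2 s) by apply: h4; rewrite subr0 ns.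
have seg : dist g (c1 (t - s)) (c2 s) <= s * m + K * (2 * (e1 * s)).
  rewrite -(coordK dy1) -(coordK dy2) -/y1 -/y2; apply: dist_le.
  apply: (segment_path gb); [exact: le_trans b1 br|exact: le_trans b2 br|] => w w01.
  have bw := cball_convex b1 b2 w01; set x := y1 + _ in bw *.
  have bwr : cball x0 r x := le_trans bw br; have Vw := gb_codom gb bwr.
  have -> : y2 - y1 = s *: (u + v) + ((y2 - x0 - s *: u) - (y1 - x0 + s *: v)).
    by apply/rowP => k; rewrite !mxE; ring.
  apply: le_trans (nrm_triangle g _ _ Vw) _; apply: lerD.
    rewrite nrmZ ns ler_wpM2l ?(ltW s0) // /m ler_wsqrtr //.
    have := gb_ip_lip gb (u + v) (u + v) (cball_center _ (ltW r0)) bwr.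
    rewrite -/m2 -/N => /ler_normlW hx.
    have : K * `|x - x0| * (N * N) <= K * b * (N * N).
      by rewrite ler_wpM2r ?mulr_ge0 // ler_wpM2l // ltW.
    have : b <= (4 - m2) / (2 * K * (N ^+ 2 + 1)) by rewrite ge_min lexx orbT.
    rewrite ler_pdivlMr // expr2; have : 0 <= K * b by rewrite mulr_ge0 // ltW.
    move: hx; rewrite /m2; lra.
  apply: le_trans (speed_le_norm gb _ bwr) _; rewrite ler_wpM2l ?(ltW K0) //.
  by apply: le_trans (ler_normB _ _) _; lra.
have := hd s s0 se; have : K * e1 * s <= (2 - m) / 4 * s by rewrite ler_wpM2r // ltW.
have : 0 < (2 - m) * s by rewrite mulr_gt0 // subr_gt0.
lra.
Qed.

Lemma unit_geodesic z : exists2 d0 : R, 0 < d0 & forall x, 0 < dist g z x -> dist g z x < d0 ->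
  exists c, [/\ geodesic g c, c 0 = z, c (dist g z x) = x & gspeed g c = 1].
Proof.
have [d0 d00 hd] := local_geodesic z cpl; exists d0 => // x x0 xd.
have [c [gc c0 c1 sc]] := hd x xd; pose a := (dist g z x)^-1.
have [ga _] := geodesic_affine a 0 gc.
exists (fun t => c (0 + a * t)); split; rewrite ?gspeed_affine //.
- by rewrite mulr0 addr0.
- by rewrite add0r mulVf // gt_eqF.
by rewrite ger0_norm ?invr_ge0 ?dist_ge0 // sc mulVf // gt_eqF.
Qed.

(** Line induction on [dist (c t) q <= L - t]. At such a time a minimal piece from [c t] towards [q]
    joins [c] without a corner, since a corner could be shortened, and hence continues it by
    uniqueness. *)
Theorem hopf_rinow p q : p <> q -> exists c, [/\ geodesic g c, gspeed g c = 1, c 0 = p,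
  c (dist g p q) = q & forall t, 0 <= t <= dist g p q -> dist g p (c t) = t].
Proof.
move=> pq; set L := dist g p q.
have L0 : 0 < L by rewrite lt_neqAle dist_ge0 andbT; apply/eqP => /esym/dist_eq0.
have [d1 d10 hd1] := unit_geodesic p; have [d2 d20 hd2] := sphere_point p.
pose d := Num.min L (Num.min d1 d2) / 2.
have dmin : 0 < Num.min L (Num.min d1 d2) by rewrite !lt_min L0 d10.
have d0 : 0 < d by rewrite divr_gt0.
have dlt x : Num.min L (Num.min d1 d2) <= x -> d < x.
  by apply: lt_le_trans; rewrite /d ltr_pdivrMr // ltr_pMr // ltr1n.
have dL : d < L by apply: dlt; rewrite ge_min lexx.
have dd2 : d < d2 by apply: dlt; rewrite !ge_min lexx !orbT.
have [x xd Lx] := hd2 q d (ltW d0) dd2 (ltW dL).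
have [||c [gc c0 cx sc]] := hd1 x; rewrite ?xd //.
  by apply: dlt; rewrite !ge_min lexx ?orbT.
rewrite xd in cx.
have cd a b : a <= b -> dist g (c a) (c b) <= b - a.
  by move=> ab; have := geodesic_dist gc ab; rewrite sc mul1r.
pose Q t : Prop := dist g (c t) q <= L - t.
have Qd : Q d by rewrite /Q cx; move: Lx; rewrite -/L; lra.
suff QL : Q L.
  have cL : c L = q by apply: dist_eq0; apply/eqP; rewrite eq_le dist_ge0 andbT; move: QL; rewrite /Q subrr.
  exists c; split=> // t /andP[t0 tL]; have h1 := cd 0 t t0; have h2 := cd t L tL.
  have := dist_triangle g p (c t) q; rewrite -/L -cL.
  by rewrite c0 subr0 in h1; move=> h3; apply/eqP; rewrite eq_le h1 /=; lra.
apply: (line_ind (ltW dL) Qd) => t /andP[dt tL].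
have t0 : 0 < t := lt_le_trans d0 dt.
(* A failure at [t] would persist at slightly earlier times, so the premise of the step is
   contradictory there. *)
have [Qt|nQ] := pselect (Q t); last first.
  have {}nQ : L - t < dist g (c t) q by rewrite ltNge; apply/negP.
  exists ((dist g (c t) q - (L - t)) / 2); first by rewrite divr_gt0 // subr_gt0.
  move=> t1 t2 _ t1t _ _; rewrite ler0_norm ?subr_le0 // => t1e _ Q1; exfalso.
  have := cd t1 t t1t; have := dist_triangle g (c t) (c t1) q; rewrite (distC g (c t) (c t1)).
  move: Q1; rewrite /Q; lra.
have [tL'|tL'] := eqVneq t L.
  exists 1 => // t1 t2 _ _ tt2 t2L _ _ _; suff -> : t2 = t by [].
  by apply/eqP; rewrite eq_le tt2 andbT tL'.
have {}tL : t < L by rewrite lt_neqAle tL'.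
set z := c t; have zq : dist g z q = L - t.
  apply/eqP; rewrite eq_le Qt /=; have := cd 0 t (ltW t0); rewrite c0 -/z.
  have := dist_triangle g p z q; rewrite -/L; lra.
have [a1 a10 ha1] := unit_geodesic z; have [a2 a20 ha2] := sphere_point z.
pose a := Num.min (L - t) (Num.min a1 a2) / 2.
have amin : 0 < Num.min (L - t) (Num.min a1 a2) by rewrite !lt_min subr_gt0 tL a10.
have a0 : 0 < a by rewrite divr_gt0.
have alt (b : R) : Num.min (L - t) (Num.min a1 a2) <= b -> a < b.
  by apply: lt_le_trans; rewrite /a ltr_pdivrMr // ltr_pMr // ltr1n.
have aL : a < L - t by apply: alt; rewrite ge_min lexx.
have [||x' xa Lx'] := ha2 q a (ltW a0).
- by apply: alt; rewrite !ge_min lexx !orbT.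
- by rewrite zq ltW.
have [||c' [gc' c'0 c'x sc']] := ha1 x'; rewrite ?xa //.
  by apply: alt; rewrite !ge_min lexx ?orbT.
rewrite xa in c'x.
have cd' a' b : a' <= b -> dist g (c' a') (c' b) <= b - a'.
  by move=> ab; have := geodesic_dist gc' ab; rewrite sc' mul1r.
have [i di] := dom_cover X (c' 0).
have corner : vel i c t = vel i c' 0.
  apply: (no_corner gc gc' sc sc' _ di (e := Num.min a t)); first by rewrite c'0.
    by rewrite lt_min a0.
  move=> s s0; rewrite lt_min => /andP[sa st].
  have ts0 : 0 <= t - s by rewrite subr_ge0 ltW.
  have h1 := cd 0 (t - s) ts0.
  have h2 := cd' s a (ltW sa); rewrite c'x in h2; rewrite c0 in h1.
  have := dist_triangle g p (c (t - s)) q; have := dist_triangle g (c (t - s)) (c' s) q.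
  have := dist_triangle g (c' s) x' q; rewrite -/L; move: Lx'; rewrite zq; lra.
have [gt vt] := geodesic_affine 1 t gc.
have same s : 0 <= s -> c (t + s) = c' s.
  move=> s0; have := geodesic_unique (c1 := fun s => c (t + 1 * s)) (i := i) gt gc' s0.
  rewrite mulr0 addr0 mul1r; apply; [by rewrite c'0|by rewrite -/z -c'0|].
  by rewrite vt mulr0 addr0 ?scale1r // -/z -c'0.
exists a => // t1 t2 _ _ tt2 _ _; rewrite ger0_norm ?subr_ge0 // => t2a _.
rewrite /Q -[t2](subrK t) addrC same ?subr_ge0 //.
have := cd' (t2 - t) a (ltW t2a); have := dist_triangle g (c' (t2 - t)) x' q.
rewrite c'x; move: Lx'; rewrite zq; lra.
Qed.

(** By [hopf_rinow] the ball is a closed part of the continuous image of a compact set of initial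
    velocities. *)
Theorem dist_ball_compact p (e : R) : compact [set q | dist g p q <= e].
Proof.
have [i di] := dom_cover X p; have [r [K gb]] := good_ball_exists g (codom_coord di).
have K0 : 0 < K := lt_le_trans ltr01 (gb_K gb).
have cI : compact ((fun v => geo_from g i p v 1) @` cball 0 (K * e)).
  apply: continuous_compact; last exact: cball_compact.
  by apply: continuous_in_subspaceT => v _; exact: geo_from_continuous.
apply: (subclosed_compact (@dist_ball_closed p e) cI) => q /= qe.
have e0 : 0 <= e := le_trans (dist_ge0 g p q) qe.
have [<-|pq] := pselect (p = q).
  exists 0; first by apply: cball_center; rewrite mulr_ge0 // ltW.
  have [gc c0 cv] := geo_fromP cpl 0 di; apply/esym/dist_eq0/eqP; rewrite eq_le dist_ge0 andbT.
  by have := geodesic_dist gc ler01; rewrite c0 gspeed_from // ip0 sqrtr0 mul0r.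
have [c [gc sc c0 cL _]] := hopf_rinow pq; set L := dist g p q in qe cL.
have L0 : 0 <= L := dist_ge0 g p q.
have dc : dom i (c (0 + L * 0)) by rewrite mulr0 addr0 c0.
have [ga va] := geodesic_affine L 0 gc; have [gv v0 vv] := geo_fromP cpl (L *: vel i c 0) di.
exists (L *: vel i c 0).
  rewrite /cball /= subr0 normrZ ger0_norm // mulrC ler_pM //.
  have dc0 : dom i (c 0) by rewrite c0.
  have := norm_le_speed gb (v := vel i c 0) (cball_center _ (ltW (gb_r gb))) (h := 1).
  by rewrite mulr1; apply; rewrite -[X in ip g i (coord i X)]c0 (gspeedE gc dc0) sc.
have := geodesic_unique (i := i) (t := 1) ga gv ler01.
rewrite mulr0 mulr1 !add0r cL => <- //; first by rewrite v0 c0.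
  by rewrite c0.
by rewrite va // mulr0 add0r vv.
Qed.

End HopfRinow.

(** * Parallel transport and second variation *)

Section LinearODE.
Variable R : realType.
Implicit Types (t : R) (y v : 'rV[R]_4).

Lemma norm_mulmx_le y (A : 'M[R]_4) (C : R) : (forall a b, `|A a b| <= C) -> `|y *m A| <= 4 * C * `|y|.
Proof.
move=> hA; have C0 : 0 <= C by apply: le_trans (hA ord0 ord0).
apply: norm_le_coord => [|k]; first by rewrite !mulr_ge0.
rewrite mxE; apply: le_trans (ler_norm_sum _ _ _) _.
apply: (@le_trans _ _ (\sum_(a < 4) `|y| * C)).
  by apply: ler_sum => a _; rewrite normrM ler_pM // coord_le_norm.
by rewrite sumr_const card_ord -mulr_natl; lra.
Qed.

Lemma geometric_limit (u : nat -> R) (B : R) : (forall n, `|u n.+1 - u n| <= B / 2 ^+ n) ->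
  exists l, forall n, `|u n - l| <= 2 * B / 2 ^+ n.
Proof.
move=> hu; pose b n := 2 * B / 2 ^+ n; have B0 : 0 <= B.
  by have := le_trans (normr_ge0 _) (hu 0%N); rewrite expr0 divr1.
have b0 n : 0 <= b n by rewrite divr_ge0 ?mulr_ge0 ?exprn_ge0.
have bS n : b n = B / 2 ^+ n + b n.+1.
  by rewrite /b exprS; field; rewrite expf_neq0.
have up n m : u n - b n <= u (n + m)%N - b (n + m)%N.
  elim: m => [|m /le_trans]; first by rewrite addn0.
  by apply; rewrite addnS; have := hu (n + m)%N; rewrite ler_norml (bS (n + m)%N) => /andP[? ?]; lra.
have dn n m : u (n + m)%N + b (n + m)%N <= u n + b n.
  elim: m => [|m IH]; first by rewrite addn0.
  apply: le_trans _ IH.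
  by rewrite addnS; have := hu (n + m)%N; rewrite ler_norml (bS (n + m)%N) => /andP[? ?]; lra.
have ub n m : u n - b n <= u m + b m.
  have := up n m; have := dn m n; rewrite [(m + n)%N]addnC; have := b0 (n + m)%N; lra.
pose S := range (fun n => u n - b n).
have hS : has_sup S by split; [exists (u 0%N - b 0%N); exists 0%N|exists (u 0%N + b 0%N) => _ [n _ <-]].
exists (sup S) => n; rewrite ler_distl; apply/andP; split.
  by rewrite lerBlDr; apply: ge_sup; [case: hS|move=> _ [m _ <-]].
by rewrite -lerBlDr; apply: ub_le_sup; [case: hS|exists n].
Qed.

Lemma pow2_small (B e : R) : 0 < e -> exists n, 2 * B / 2 ^+ n < e.
Proof.
move=> e0; have x0 : 0 <= `|2 * B| / e by rewrite divr_ge0 // ltW.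
have hn := archi_boundP x0; set n := Num.bound _ in hn; exists n; apply: le_lt_trans (ler_norm _) _; rewrite normf_div (ger0_norm (x := 2 ^+ n)) ?exprn_ge0 //.
rewrite ltr_pdivrMr ?exprn_gt0 // [e * _]mulrC -ltr_pdivrMr //; apply: lt_trans hn _.
by rewrite -natrX ltr_nat ltn_expl.
Qed.

(** Constant extension beyond the interval makes functions that are regular only on [[a, b]]
    continuous on the whole line. *)
Definition clip (a b t : R) := Num.max a (Num.min b t).

Lemma clip_id (a b t : R) : a <= t <= b -> clip a b t = t.
Proof. by move=> /andP[h1 h2]; rewrite /clip (min_idPr h2) (max_idPr h1). Qed.

Lemma clip_in (a b t : R) : a <= b -> a <= clip a b t <= b.
Proof. by move=> ab; rewrite /clip le_max lexx ge_max ab ge_min lexx. Qed.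

Lemma clip_continuous (a b : R) : continuous (clip a b).
Proof.
move=> t; apply: continuous_max; first exact: cst_continuous.
by apply: continuous_min; [exact: cst_continuous|exact: cvg_id].
Qed.

Variables (A : R -> 'M[R]_4) (a b s0 C : R).
Hypotheses (ab : a <= b) (s0ab : a <= s0 <= b) (Aab : 4 * C * (b - a) <= 2^-1).
Hypotheses (cA : forall k l, continuous (fun t => A t k l)) (hA : forall t k l, `|A t k l| <= C).
Variable y0 : 'rV[R]_4.

Let C0 : 0 <= C. Proof. exact: le_trans (hA 0 ord0 ord0). Qed.

(** Continuity of [Z] is a premise inside the existential, so that the chosen [I] is a total
    operator. *)
Let has_I (Z : R -> 'rV[R]_4) : exists Y : R -> 'rV[R]_4, continuous Z -> Y s0 = 0 /\
  forall t, a <= t <= b -> vdrv Y t (Z t).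
Proof.
have [cZ|nZ] := pselect (continuous Z); last by exists (fun=> 0) => /nZ.
have /boolp.choice[H hH] k : exists H : R -> R, forall t, a - 1 < t < b + 1 -> drv H t (Z t 0 k).
  by apply: antiderivative => t; apply: continuous_coord; exact: cZ.
exists (fun t => \row_k (H k t - H k s0)) => _; split.
  by apply/rowP => k; rewrite !mxE subrr.
move=> t /andP[h1 h2] k; rewrite (_ : (fun s => _) = fun s => H k s - H k s0).
  by apply: (drv_val _ (drvB (hH k t _) (drv_cst (H k s0) t))); rewrite ?subr0 //; apply/andP; split; lra.
by apply/funext => s; rewrite mxE.
Qed.

Let I Z := sval (cid (has_I Z)).

Let IP Z : continuous Z -> I Z s0 = 0 /\ forall t, a <= t <= b -> vdrv (I Z) t (Z t).
Proof. by rewrite /I; case: cid. Qed.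

Let step (Z : R -> 'rV[R]_4) t := (y0 + I Z (clip a b t)) *m A t.

Let step_cont Z : continuous Z -> continuous (step Z).
Proof.
move=> cZ t; apply: vcontinuous => k.
rewrite (_ : (fun s => _) = fun s => \sum_l (y0 0 l + I Z (clip a b s) 0 l) * A s l k); last first.
  by apply/funext => s; rewrite mxE; ext_sum l; rewrite mxE.
apply: continuous_sum => l; apply: continuous_mul; last exact: cA.
apply: continuousD; first exact: cst_continuous.
apply: (@continuous_comp _ _ _ (clip a b) (fun s => I Z s 0 l)); first exact: clip_continuous.
by apply: continuous_coord; apply: vdrv_cont ((IP cZ).2 _ (clip_in _ ab)).
Qed.

Let I_diff Z Z' (N t : R) : continuous Z -> continuous Z' -> 0 <= N ->
  (forall s, `|Z s - Z' s| <= N) -> a <= t <= b -> `|I Z t - I Z' t| <= N * (b - a).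
Proof.
move=> cZ cZ' N0 hN tab; have [z0 hz] := IP cZ; have [z'0 hz'] := IP cZ'.
have := @vmvt_le R (fun s => I Z s - I Z' s) (fun s => Z s - Z' s) s0 t N N0.
rewrite z0 z'0 subrr subr0 => h; apply: le_trans (h _ _) _.
- move=> s; rewrite /btw => /andP[h1 h2].
  have sab : a <= s <= b.
    move: s0ab tab h1 h2 => /andP[? ?] /andP[? ?]; rewrite ge_min le_max.
    by move=> /orP[] ? /orP[] ?; apply/andP; split; lra.
  by apply: vdrvB; [exact: hz|exact: hz'].
- by move=> s _; exact: hN.
rewrite ler_wpM2l //; move: s0ab tab => /andP[? ?] /andP[? ?]; rewrite ler_norml; apply/andP; split; lra.
Qed.

Let step_diff Z Z' (N : R) t : continuous Z -> continuous Z' -> 0 <= N ->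
  (forall s, `|Z s - Z' s| <= N) -> `|step Z t - step Z' t| <= N / 2.
Proof.
move=> cZ cZ' N0 hN; rewrite /step -mulmxBl.
have -> : y0 + I Z (clip a b t) - (y0 + I Z' (clip a b t)) = I Z (clip a b t) - I Z' (clip a b t).
  by apply/rowP => k; rewrite !mxE; ring.
apply: le_trans (norm_mulmx_le _ (hA t)) _.
have := I_diff cZ cZ' N0 hN (clip_in t ab) => h.
apply: (@le_trans _ _ (4 * C * (N * (b - a)))); first by rewrite ler_wpM2l // mulr_ge0.
by have := ler_wpM2l N0 Aab; lra.
Qed.

(** Picard iteration for the derivative [Z] of [Y]: by the hypothesis on [b - a] each step halves
    sup distances, so the iterates converge geometrically to a fixed point. *)
Lemma linear_ode : exists Y : R -> 'rV[R]_4, Y s0 = y0 /\ forall t, a <= t <= b -> vdrv Y t (Y t *m A t).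
Proof.
pose Z n := iter n step (fun=> 0).
have cZ n : continuous (Z n).
  by elim: n => [|n IH]; [exact: cst_continuous|exact: step_cont].
have c0 : continuous (fun _ : R => 0 : 'rV[R]_4) by exact: cst_continuous.
have [i0 hi0] := IP c0.
pose B := 4 * C * `|y0|; have B0 : 0 <= B by rewrite !mulr_ge0.
have I0 t : a <= t <= b -> I (fun=> 0) t = 0.
  move=> tab; have [] : exists2 d : R, d = `|I (fun=> 0) t - I (fun=> 0) s0| & d <= 0.
    exists `|I (fun=> 0) t - I (fun=> 0) s0| => //.
    have := @vmvt_le R (I (fun=> 0)) (fun=> 0) s0 t 0 (lexx 0); rewrite mul0r; apply.
      move=> s; rewrite /btw => /andP[h1 h2]; apply: hi0.
      move: s0ab tab h1 h2 => /andP[? ?] /andP[? ?]; rewrite ge_min le_max.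
      by move=> /orP[] ? /orP[] ?; apply/andP; split; lra.
    by move=> s _; rewrite normr0.
  by move=> d ->; rewrite i0 subr0 normr_le0 => /eqP.
have hZ n t : `|Z n.+1 t - Z n t| <= B / 2 ^+ n.
  elim: n t => [|n IH] t.
    rewrite /Z /= /step I0 ?clip_in // addr0 subr0 expr0 divr1; exact: norm_mulmx_le.
  have := step_diff t (cZ n.+1) (cZ n) _ IH; rewrite exprS invfM [2^-1 * _]mulrC mulrA; apply.
  by rewrite divr_ge0 ?exprn_ge0.
have /boolp.choice[W hW] tk : exists l, forall n, `|Z n tk.1 0 tk.2 - l| <= 2 * B / 2 ^+ n.
  apply: geometric_limit => n; apply: le_trans (hZ n tk.1).
  by have := coord_le_norm (Z n.+1 tk.1 - Z n tk.1) tk.2; rewrite !mxE.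
pose Zl t : 'rV[R]_4 := \row_k W (t, k).
have hZl n t : `|Z n t - Zl t| <= 2 * B / 2 ^+ n.
  apply: norm_le_coord => [|k]; first by rewrite divr_ge0 ?mulr_ge0 ?exprn_ge0.
  by rewrite !mxE; exact: (hW (t, k)).
have cl : continuous Zl.
  move=> t; apply: continuous_dist => e e0.
  have [n hn] := pow2_small B (ltac:(by rewrite divr_gt0) : 0 < e / 3).
  have /cvgrPdist_lt/(_ (e / 3) (ltac:(by rewrite divr_gt0))) := cZ n t.
  apply: filterS => s hs.
  have -> : Zl t - Zl s = (Z n s - Zl s) - (Z n t - Zl t) + (Z n t - Z n s).
    by apply/rowP => k; rewrite !mxE; ring.
  apply: le_lt_trans (ler_normD _ _) _; have := ler_normB (Z n s - Zl s) (Z n t - Zl t).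
  have := hZl n s; have := hZl n t; lra.
have fixp t : Zl t = step Zl t.
  apply/eqP; rewrite -subr_eq0 -normr_le0; apply/ler_addgt0Pr => e e0.
  have [n hn] := pow2_small B (ltac:(by rewrite divr_gt0) : 0 < e / 2).
  have -> : Zl t - step Zl t = (step (Z n) t - step Zl t) - (Z n.+1 t - Zl t).
    by rewrite -[step (Z n) t]/(Z n.+1 t) opprB [RHS]addrC addrA subrK.
  have b0 : 0 <= 2 * B / 2 ^+ n by rewrite divr_ge0 ?mulr_ge0 ?exprn_ge0.
  have := step_diff t (cZ n) cl b0 (hZl n); have := hZl n.+1 t.
  have := ler_normB (step (Z n) t - step Zl t) (Z n.+1 t - Zl t).
  rewrite exprS invfM [2^-1 * _]mulrC mulrA; lra.
have [z0 hz] := IP cl.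
exists (fun t => y0 + I Zl t); rewrite z0 addr0; split=> // t tab.
have := vdrvD (vdrv_cst y0 t) (hz t tab); rewrite add0r [Zl t]fixp /step clip_id //.
Qed.

End LinearODE.

Section ParallelTransport.
Variables (R : realType) (M : topologicalType) (X : manifold4 R M) (g : metric X).
Implicit Types (i j : chart X) (p q : M) (c : R -> M) (u v w x y : 'rV[R]_4) (t s : R).

Section TensorDerivative.
Variables (i : chart X) (x : R -> 'rV[R]_4) (t : R) (v : 'rV[R]_4).
Hypotheses (Vx : codom i (x t)) (hx : vdrv x t v).
Let V : opens R := chart_opens i.
Let C : lc_geometry (sring V) := cgeo g (i := i) (V := V) (fun x Vx => Vx).

Lemma sring_along (u : sring V) : drv (fun s => u (x s)) t (\sum_k v 0 k * C k u (x t)).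
Proof.
apply: (drv_val _ (smooth_on_chain (@opensP R V) (sfun_smooth u) Vx hx)).
by ext_sum k; rewrite mulrC; congr (_ * _); symmetry; exact: sderE.
Qed.

Lemma cov_value (T : seq I4 -> sring V) k (a : I4) (s : seq I4) :
  cov C (lcGam C) k T (a :: s) (x t) = cov C (lcGam C) k (fun r => T (a :: r)) s (x t) -
    \sum_m christoffel g i m k a (x t) * T (m :: s) (x t).
Proof.
pose ev : {rmorphism sring V -> R} := @ev_ R V (x t) Vx.
have E : cov C (lcGam C) k T (a :: s) = cov C (lcGam C) k (fun r => T (a :: r)) s -
    \sum_m lcGam C m k a * T (m :: s) by rewrite /cov /= opprD addrA addrAC.
apply: (etrans (congr1 ev E)); rewrite rmorphB rmorph_sum; congr (_ - _).
ext_sum m; rewrite rmorphM; congr (_ * _).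
exact: (cGam_ev g (V := V) (fun x Vx => Vx) m k a Vx).
Qed.

(** Parallel arguments contribute nothing to the product rule, so only the covariant derivative of
    the tensor in the direction of the curve is left. *)
Lemma tval_along (T : seq I4 -> sring V) (ws : seq (R -> 'rV[R]_4)) : (forall n, (n < size ws)%N ->
    vdrv (nth (fun=> 0) ws n) t (- gam g i (x t) v (nth (fun=> 0) ws n t))) ->
  drv (fun s => tval T (x s) [seq z s | z <- ws]) t (tval (chart_nab g (i := i) T) (x t) (v :: [seq z t | z <- ws])).
Proof.
rewrite /tval con_cons; elim: ws T => [|w ws IH] T hw.
  apply: (drv_val _ (sring_along (T [::]))); ext_sum k; congr (_ * _).
  pose ev : {rmorphism sring V -> R} := @ev_ R V (x t) Vx; have E : C k (T [::]) = cov C (lcGam C) k T [::] by rewrite /cov /= subr0.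
  exact: (congr1 ev E).
have h0 := hw 0%N isT; rewrite /= in h0.
have hs n : (n < size ws)%N -> vdrv (nth (fun=> 0) ws n) t (- gam g i (x t) v (nth (fun=> 0) ws n t)).
  exact: (hw n.+1).
apply: (drv_val _ (drv_sum (fun a => drvM (h0 a) (IH (fun r => T (a :: r)) hs)))).
set vs := [seq z t | z <- ws]; pose ct (a : I4) := con (fun s : seq I4 => T (a :: s) (x t)) vs.
pose cc k a := con (fun s : seq I4 => cov C (lcGam C) k (fun r => T (a :: r)) s (x t)) vs.
transitivity (\sum_k \sum_a v 0 k * (w t 0 a * (cc k a - \sum_m christoffel g i m k a (x t) * ct m))).
  have -> : \sum_k \sum_a v 0 k * (w t 0 a * (cc k a - \sum_m christoffel g i m k a (x t) * ct m)) =
    \sum_a (w t 0 a * \sum_k v 0 k * cc k a) - \sum_k \sum_a v 0 k * (w t 0 a * \sum_m christoffel g i m k a (x t) * ct m).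
    rewrite exchange_big -[X in _ = _ - X]exchange_big -sumrB; ext_sum a => /=.
    by rewrite mulr_sumr -sumrB; ext_sum k; ring.
  rewrite big_split /= addrC; congr (_ + _).
  rewrite -sumrN; transitivity (\sum_m - (\sum_k \sum_a v 0 k * w t 0 a * christoffel g i m k a (x t) * ct m)).
    by ext_sum m; rewrite !mxE mulNr mulr_suml; congr (- _); ext_sum k; rewrite mulr_suml.
  rewrite !sumrN; congr (- _); swap_sum k => /=.
  swap_sum a => /=; rewrite !mulr_sumr.
  by ext_sum m; ring.
ext_sum k; rewrite -mulr_sumr; congr (_ * _).
apply: (etrans _ (esym (con_cons _ (w t) vs))); ext_sum a; congr (_ * _); rewrite -con_sum.
rewrite [RHS](eq_con (T' := fun s : seq I4 => cov C (lcGam C) k (fun r => T (a :: r)) s (x t) +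
    -1 * \sum_m christoffel g i m k a (x t) * T (m :: s) (x t))).
  by rewrite conD conZ mulN1r.
by move=> s _; rewrite mulN1r; exact: cov_value.
Qed.

End TensorDerivative.

Definition parallel i c t (w : R -> 'rV[R]_4) := vdrv w t (- gam g i (coord i (c t)) (vel i c t) (w t)).

Lemma parallel_vel i c t : geodesic g c -> dom i (c t) -> parallel i c t (vel i c).
Proof. by move=> gc di; case: (geodesic_chart gc di). Qed.

Lemma parallel_ip i c t (w1 w2 : R -> 'rV[R]_4) : geodesic g c -> dom i (c t) -> parallel i c t w1 -> parallel i c t w2 ->
  drv (fun s => ip g i (coord i (c s)) (w1 s) (w2 s)) t 0.
Proof.
move=> gc di h1 h2; have [hc _] := geodesic_chart gc di.
by have := ip_along g (codom_coord di) hc h1 h2; rewrite !addNr ip0 ip0r addr0.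
Qed.

(** The radius [e] does not depend on the starting time [s0], as the later line induction
    demands. *)
Lemma parallel_exists i c t : geodesic g c -> dom i (c t) -> exists2 e : R, 0 < e &
  (forall s, `|s - t| <= e -> dom i (c s)) /\ forall s0 w0, `|s0 - t| <= e -> exists w : R -> 'rV[R]_4, w s0 = w0 /\
    forall s, `|s - t| <= e -> parallel i c s w.
Proof.
move=> gc di; have [cc _] := gc.
have [e1 e10 h1] := (near0P _ _).1 (dom_near (cc t) di).
pose a := t - e1 / 2; pose b := t + e1 / 2.
have ab : a <= b by rewrite /a /b; lra.
have dab s : a <= s <= b -> dom i (c s).
  rewrite /a /b => /andP[? ?]; apply: h1; apply: (@le_lt_trans _ _ (e1 / 2)); last lra.
  by rewrite ler_distl; apply/andP; split; lra.
pose A s : 'M[R]_4 := \matrix_(k, l) - \sum_m vel i c (clip a b s) 0 m * christoffel g i l m k (coord i (c (clip a b s))).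
have cA k l : continuous (fun s => A s k l).
  move=> s; rewrite (_ : (fun s => A s k l) = (fun s => - \sum_m vel i c s 0 m *
    christoffel g i l m k (coord i (c s))) \o clip a b); last by apply/funext => s'; rewrite mxE.
  apply: continuous_comp; first exact: clip_continuous.
  have ds := dab _ (clip_in s ab); have [hc hv] := geodesic_chart gc ds.
  apply: cvgN; apply: continuous_sum => m; apply: continuous_mul.
    by apply: continuous_coord; exact: vdrv_cont hv.
  apply: (@continuous_comp _ _ _ (fun s => coord i (c s))); first exact: vdrv_cont hc.
  exact: smooth_on_cont (@christoffel_smooth_chart R M X g i l m k) (codom_coord ds).
have /boolp.choice[B hB] kl : exists B, forall s, `|A s kl.1 kl.2| <= B.
  have [||m mab hm] := @compact_max R R `[a, b]%classic (fun s => `|A s kl.1 kl.2|) (@segment_compact _ a b).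
  - by exists a; rewrite /= in_itv /= lexx ab.
  - move=> s _; apply: (@continuous_comp _ _ _ (fun s => A s kl.1 kl.2) (fun z : R => `|z|)).
      exact: cA.
    exact: norm_continuous.
  exists `|A m kl.1 kl.2| => s.
  have -> : A s kl.1 kl.2 = A (clip a b s) kl.1 kl.2.
    by rewrite !mxE (clip_id (clip_in s ab)).
  by apply: hm; rewrite /= in_itv; exact: clip_in.
pose Cb := \sum_kl `|B kl|.
have hA s k l : `|A s k l| <= Cb.
  apply: le_trans (hB (k, l) s) _; rewrite /Cb (bigD1 (k, l)) //=.
  by apply: le_trans (ler_norm _) _; rewrite lerDl sumr_ge0.
have Cb0 : 0 <= Cb by exact: sumr_ge0.
pose e := Num.min (e1 / 2) (16 * (Cb + 1))^-1.
have e0 : 0 < e by rewrite lt_min divr_gt0 // invr_gt0 mulr_gt0 // ltr_wpDl.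
have ee1 : e <= e1 / 2 by rewrite ge_min lexx.
have eC : 16 * Cb * e <= 1.
  have : e <= (16 * (Cb + 1))^-1 by rewrite ge_min lexx orbT.
  rewrite -[(16 * _)^-1]mul1r ler_pdivlMr ?mulr_gt0 // ?ltr_wpDl //; lra.
have sub s : `|s - t| <= e -> a <= s <= b.
  by rewrite ler_distl /a /b => /andP[? ?]; apply/andP; split; lra.
exists e => //; split=> [s /sub/dab//|s0 w0 s0e].
have [|||w [ws hw]] := @linear_ode R A (t - e) (t + e) s0 Cb _ _ _ cA hA w0.
- by lra.
- by move: s0e; rewrite ler_distl.
- by lra.
exists w; split=> // s se; have := hw s; rewrite -ler_distl => /(_ se).
rewrite /parallel (_ : w s *m A s = - gam g i (coord i (c s)) (vel i c s) (w s)) //.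
apply/rowP => l; rewrite !mxE exchange_big -sumrN; ext_sum k.
rewrite mxE clip_id; last exact: sub.
rewrite mulrN mulr_sumr; congr (- _); ext_sum m; ring.
Qed.

Lemma frame_ip i x (E : 'M[R]_4) : E *m gram g i x *m E^T = 1%:M <-> forall a b, ip g i x (row a E) (row b E) = (a == b)%:R.
Proof.
have Eab a b : (E *m gram g i x *m E^T) a b = ip g i x (row a E) (row b E).
  rewrite ipE -row_mul mxE [RHS]mxE; ext_sum k; congr (_ * _); rewrite !mxE //.
split=> [h a b|h]; first by rewrite -Eab h mxE.
by apply/matrixP => a b; rewrite Eab h mxE.
Qed.

Definition parallel_frame i c t (E : R -> 'M[R]_4) := forall a, parallel i c t (fun s => row a (E s)).

(** Parallel transport preserves inner products, so the frame stays orthonormal. *)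
Lemma parallel_frame_exists i c t : geodesic g c -> dom i (c t) -> exists2 e : R, 0 < e &
  (forall s, `|s - t| <= e -> dom i (c s)) /\
  forall s0 E0, `|s0 - t| <= e -> E0 *m gram g i (coord i (c s0)) *m E0^T = 1%:M ->
  exists E : R -> 'M[R]_4, E s0 = E0 /\ forall s, `|s - t| <= e ->
    parallel_frame i c s E /\ E s *m gram g i (coord i (c s)) *m (E s)^T = 1%:M.
Proof.
move=> gc di; have [e e0 [hd hp]] := parallel_exists gc di; exists e => //; split=> // s0 E0 s0e on.
have /boolp.choice[w hw] a : exists w : R -> 'rV[R]_4, w s0 = row a E0 /\
    forall s, `|s - t| <= e -> parallel i c s w by exact: hp.
have rowE s a : row a (\matrix_(k, l) w k s 0 l) = w a s by apply/rowP => k; rewrite !mxE.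
exists (fun s => \matrix_(k, l) w k s 0 l); split.
  by apply/matrixP => k l; rewrite mxE (hw k).1 mxE.
move=> s se; split=> [a|].
  have := (hw a).2 s se; rewrite /parallel rowE.
  by rewrite (_ : (fun s => row a _) = w a) //; apply/funext => s'; rewrite rowE.
apply/frame_ip => a b; rewrite !rowE.
have h0 : ip g i (coord i (c s0)) (w a s0) (w b s0) = (a == b)%:R.
  by rewrite (hw a).1 (hw b).1; exact: (frame_ip _ _ _).1.
rewrite -h0; apply/eqP; rewrite -subr_eq0; apply/eqP.
have D r : btw s0 s r -> drv (fun s => ip g i (coord i (c s)) (w a s) (w b s)) r 0.
  move=> hr; have re : `|r - t| <= e.
    move: hr; rewrite /btw ge_min le_max => /andP[]; move: s0e se; rewrite !ler_distl.
    by move=> /andP[? ?] /andP[? ?] /orP[] ? /orP[] ?; apply/andP; split; lra.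
  by apply: parallel_ip gc (hd r re) _ _; [exact: (hw a).2|exact: (hw b).2].
by have [s1 _ ->] := mvt D; rewrite mul0r.
Qed.

End ParallelTransport.

Notation orthonormal g i p b := (forall k l : I4, ip g i (coord i p) (vel i (b k) 0) (vel i (b l) 0) = (k == l)%:R).

(** * Second variation of arclength *)

Section SecondVariation.
Variables (R : realType) (M : topologicalType) (X : manifold4 R M) (g : metric X).
Implicit Types (i j : chart X) (p q : M) (c : R -> M) (u v w x y : 'rV[R]_4) (t s a : R).

Lemma con_swap34 (T : seq I4 -> R) u v w z : con T [:: u; v; w; z] =
  con (fun s : seq I4 => T (dep (dep swp) s)) [:: u; v; z; w].
Proof.
rewrite /=; ext_sum k; congr (_ * _); ext_sum l; congr (_ * _).
under eq_bigr do rewrite mulr_sumr.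
swap_sum m => /=; rewrite mulr_sumr.
by ext_sum n; rewrite mulrCA.
Qed.

Lemma riem_skew34 i x u v w z : codom i x -> con (riemT g i x) [:: u; v; w; z] = - con (riemT g i x) [:: u; v; z; w].
Proof.
move=> Vx; pose V : opens R := chart_opens i.
pose C : lc_geometry (sring V) := cgeo g (i := i) (V := V) (fun x Vx => Vx).
rewrite con_swap34 (eq_con (T' := fun s : seq I4 => -1 * riemT g i x s)) ?conZ ?mulN1r // => s _.
have E (q : seq I4) := crmT_ev g (h := i) (U := V) (fun x Vx => Vx) q Vx.
apply: (etrans (esym (E (dep (dep swp) s)))); rewrite mulN1r -(E s).
pose ev : {rmorphism sring V -> R} := @ev_ R V x Vx.
have := congr1 (fun T => ev (T s)) (rm_skew34 C) => h.
by apply: (etrans h); rewrite rmorphN.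
Qed.

Lemma dgamC i x w u v : codom i x -> dgam g i x w u v = dgam g i x w v u.
Proof.
move=> Vx; have E (k a b m : I4) : partial m (christoffel g i k a b) x = partial m (christoffel g i k b a) x.
  apply: partial_near; near=> z; apply: christoffel_sym.
  by near: z; apply: open_nbhs_nbhs; split => //; exact: codom_open.
pose S (k a b : I4) := \sum_m partial m (christoffel g i k a b) x * w 0 m.
have ES (k a b : I4) : S k a b = S k b a by ext_sum m; rewrite E.
have dE u1 v1 : dgam g i x w u1 v1 = \row_k \sum_a \sum_b u1 0 a * v1 0 b * S k a b by [].
rewrite !dE; apply/rowP => k; rewrite !mxE; swap_sum a.
by ext_sum b; rewrite [u 0 b * v 0 a]mulrC ES.
Unshelve. all: by end_near. Qed.

Lemma con_scale13 (T : seq I4 -> R) u v (a : R) : con T [:: a *: u; v; a *: u; v] = a * a * con T [:: u; v; u; v].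
Proof.
rewrite /= mulr_sumr; ext_sum k; rewrite mxE !mulr_sumr; ext_sum l.
rewrite !mulr_sumr; ext_sum m; rewrite mxE; ring.
Qed.

Section Continuity.
Variables (T : topologicalType) (i : chart X) (x u v w : T -> 'rV[R]_4) (p : T).
Hypotheses (Vx : codom i (x p)) (cx : cont_at x p) (cu : cont_at u p).
Hypotheses (cv : cont_at v p) (cw : cont_at w p).

Lemma smooth_comp_continuous (h : 'rV[R]_4 -> R) : smooth_on (codom i) h -> cont_at (fun z => h (x z)) p.
Proof. by move=> sh; apply: (@continuous_comp _ _ _ x h) => //; exact: smooth_on_cont sh Vx. Qed.

Lemma bilinear_continuous (h : I4 -> I4 -> T -> R) : (forall a b : I4, cont_at (h a b) p) ->
  cont_at (fun z => \sum_(a < 4) \sum_(b < 4) u z 0 a * v z 0 b * h a b z) p.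
Proof.
move=> hc; apply: continuous_sum => a; apply: continuous_sum => b.
by apply: continuous_mul => //; apply: continuous_mul; exact: continuous_coord.
Qed.

Lemma ip_continuous : cont_at (fun z => ip g i (x z) (u z) (v z)) p.
Proof. by apply: bilinear_continuous => a b; apply: (smooth_comp_continuous (@gram_smooth _ _ _ g i a b)). Qed.

Lemma gam_continuous : cont_at (fun z => gam g i (x z) (u z) (v z)) p.
Proof.
apply: vcontinuous => k; rewrite (_ : (fun s : T => _) = fun z => \sum_a \sum_b u z 0 a * v z 0 b *
  christoffel g i k a b (x z)); last by apply/funext => z; rewrite mxE.
by apply: bilinear_continuous => a b; apply: smooth_comp_continuous; exact: christoffel_smooth_chart.
Qed.

Lemma dgam_continuous : cont_at (fun z => dgam g i (x z) (w z) (u z) (v z)) p.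
Proof.
apply: vcontinuous => k; rewrite (_ : (fun s : T => _) = fun z => \sum_a \sum_b u z 0 a * v z 0 b *
  \sum_m partial m (christoffel g i k a b) (x z) * w z 0 m); last by apply/funext => z; rewrite mxE.
apply: bilinear_continuous => a b; apply: continuous_sum => m; apply: continuous_mul.
  by apply: smooth_comp_continuous; apply: smooth_on_partial; exact: christoffel_smooth_chart.
exact: continuous_coord.
Qed.

End Continuity.

Lemma continuous_addv (T : topologicalType) (u v : T -> 'rV[R]_4) (p : T) :
  cont_at u p -> cont_at v p -> cont_at (fun z => u z + v z) p.
Proof.
move=> cu cv; apply: vcontinuous => k; rewrite (_ : (fun s : T => _) = fun z => u z 0 k + v z 0 k).
  by apply: continuousD; exact: continuous_coord.
by apply/funext => z; rewrite mxE.
Qed.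

Lemma continuous_scalev (T : topologicalType) (h : T -> R) (v : T -> 'rV[R]_4) (p : T) :
  cont_at h p -> cont_at v p -> cont_at (fun z => h z *: v z) p.
Proof.
move=> ch cv; apply: vcontinuous => k; rewrite (_ : (fun s : T => _) = fun z => h z * v z 0 k).
  by apply: continuous_mul => //; exact: continuous_coord.
by apply/funext => z; rewrite mxE.
Qed.

Lemma continuous_oppv (T : topologicalType) (v : T -> 'rV[R]_4) (p : T) : cont_at v p -> cont_at (fun z => - v z) p.
Proof.
move=> cv; rewrite (_ : (fun z : T => - v z) = fun z => (fun=> -1) z *: v z).
  by apply: continuous_scalev => //; exact: cst_continuous.
by apply/funext => z; rewrite scaleN1r.
Qed.

Lemma continuous_near_eq (T : topologicalType) (f h : T -> R) (p : T) (e : R) : cont_at f p ->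
  cont_at h p -> f p = h p -> 0 < e -> \forall z \near p, `|f z - h z| < e.
Proof.
move=> cf ch fh e0; have /cvgrPdist_lt/(_ e e0) := continuousB cf ch.
by apply: filterS => z; rewrite /= fctE fh subrr sub0r normrN.
Qed.

(** Only an upper bound on the second derivative is available; the sign of [P1 b * b] settles both
    directions of [a] at once. *)
Lemma taylor2 (f f1 f2 : R -> R) (d N : R) :
  (forall a, `|a| < d -> drv f a (f1 a)) -> (forall a, `|a| < d -> drv f1 a (f2 a)) -> (forall a, `|a| < d -> f2 a <= N) ->
  forall a, `|a| < d -> f a <= f 0 + a * f1 0 + N / 2 * a ^+ 2.
Proof.
move=> h1 h2 hN a ad.
pose q b := f 0 + b * f1 0 + N / 2 * b ^+ 2.
pose P b := q b - f b; pose P1 b := f1 0 + N * b - f1 b.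
have bd b : btw 0 a b -> `|b| < d.
  rewrite /btw ge_min le_max => hb; move: ad hb; rewrite !ltr_norml.
  by move=> /andP[? ?] /andP[/orP[] ? /orP[] ?]; apply/andP; split; lra.
have D b : btw 0 a b -> drv P b (P1 b).
  move=> hb; have Dq : drv q b (f1 0 + N * b).
    apply: (drv_val _ (drvD (drvD (drv_cst (f 0) b) (drvM (drv_id b) (drv_cst (f1 0) b)))
      (drvZ (N / 2) (drvM (drv_id b) (drv_id b))))).
    by field.
  exact: drvB Dq (h1 b (bd b hb)).
have D1 b : btw 0 a b -> drv P1 b (N - f2 b).
  move=> hb; apply: (drvB _ (h2 b (bd b hb))).
  by have := drv_affine (f1 0) N b.
have sign b : btw 0 a b -> 0 <= P1 b * b.
  move=> hb; have sub b' : btw 0 b b' -> btw 0 a b'.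
    move: hb; rewrite /btw !ge_min !le_max => /andP[/orP[] ? /orP[] ?] /andP[/orP[] ? /orP[] ?];
      apply/andP; split; apply/orP; lra.
  have [b' hb' e] := mvt (fun b' (h : btw 0 b b') => D1 b' (sub b' h)).
  have -> : P1 b = (N - f2 b') * b by move: e; rewrite /P1 mulr0 addr0 subrr !subr0.
  by rewrite -mulrA -expr2 mulr_ge0 ?sqr_ge0 // subr_ge0 hN // bd // sub.
have [b hb e] := mvt D.
have ba : 0 <= P1 b * a.
  have := sign b hb; have [->|b0] := eqVneq b 0.
    by have -> : P1 0 = 0; [rewrite /P1 mulr0 addr0 subrr|rewrite !mul0r].
  move: hb; rewrite /btw ge_min le_max => /andP[/orP[] h1' /orP[] h2'] h3.
  - by have : b = 0 by [lra]; move/eqP: b0.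
  - have bp : 0 < b by rewrite lt_neqAle eq_sym b0.
    by move: h3; rewrite pmulr_lge0 // => h3; rewrite mulr_ge0 // (le_trans h1').
  - have bn : b < 0 by rewrite lt_neqAle b0.
    by move: h3; rewrite nmulr_lge0 // => h3; rewrite mulr_le0 // (le_trans h1').
  by have : b = a by [lra]; move=> <-.
have P0 : P 0 = 0 by rewrite /P /q mul0r expr0n mulr0 !addr0 subrr.
by move: e ba; rewrite P0 !subr0 /P => <-; rewrite subr_ge0.
Qed.

(* A geodesic agrees to second order with the coordinate parabola of acceleration [- gam E E]. *)
Definition parabola i x u a : 'rV[R]_4 := x + a *: u - (a ^+ 2 / 2) *: gam g i x u u.

Lemma geodesic_parabola c i (e : R) : geodesic g c -> dom i (c 0) -> 0 < e ->
  exists2 d : R, 0 < d & forall a, `|a| < d -> dom i (c a) /\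
    `|coord i (c a) - parabola i (coord i (c 0)) (vel i c 0) a| <= e * a ^+ 2.
Proof.
move=> gc di e0; have [cc _] := gc; have [d1 d10 hd1] := (near0P _ _).1 (dom_near (cc 0) di).
have [_ hv] := geodesic_chart gc di; have [d2 d20 hd2] := vdrvP hv e0.
exists (Num.min d1 d2); first by rewrite lt_min d10.
move=> a; rewrite lt_min => /andP[a1 a2]; split; first by apply: hd1; rewrite subr0.
set x := coord i (c 0); set u := vel i c 0; set G := gam g i x u u.
have bd b : btw 0 a b -> `|b| <= `|a|.
  rewrite /btw ge_min le_max => /andP[/orP[] ? /orP[] ?]; rewrite ler_norml; apply/andP;
   have := ler_norm a; have := ler_norm (- a); rewrite normrN; split; lra.
have := @vmvt_le R (fun b => coord i (c b) - parabola i x u b) (fun b => vel i c b - (u - b *: G))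
  0 a (e * `|a|) (ltac:(by rewrite mulr_ge0 // ltW)).
have -> : coord i (c 0) - parabola i x u 0 = 0.
  by rewrite /parabola scale0r expr0n mul0r scale0r addr0 subr0 subrr.
rewrite !subr0 -mulrA -expr2 real_normK ?num_real //; apply=> b hb.
  apply: vdrvB.
    have db : dom i (c b) by apply: hd1; rewrite subr0; exact: le_lt_trans (bd b hb) a1.
    by case: (geodesic_chart gc db).
  apply: vdrvB; first exact: vdrv_line.
  have D : drv (fun b => b ^+ 2 / 2) b b.
    by apply: (drv_val _ (drvM (drvM (drv_id b) (drv_id b)) (drv_cst 2^-1 b))); field.
  by have := vdrvZ D (vdrv_cst G b); rewrite scaler0 addr0.
have := hd2 b (le_lt_trans (bd b hb) a2); rewrite add0r scalerN -/u -/G => h.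
apply: le_trans (_ : e * `|b| <= _); last by rewrite ler_wpM2l ?bd // ltW.
by rewrite opprK in h; rewrite opprB addrA addrAC.
Qed.

Lemma parabola_dist c i (e : R) : geodesic g c -> dom i (c 0) -> 0 < e -> exists2 d : R, 0 < d & forall a, `|a| < d ->
    dist g (c a) (param i (parabola i (coord i (c 0)) (vel i c 0) a)) <= e * a ^+ 2.
Proof.
move=> gc di e0; have [r [K gb]] := good_ball_exists g (codom_coord di).
have K0 : 0 < K := lt_le_trans ltr01 (gb_K gb); have r0 := gb_r gb.
have [d1 d10 h1] := geodesic_parabola gc di (ltac:(by rewrite divr_gt0) : 0 < e / K).
have [gc' _] := gc; set x := coord i (c 0); set u := vel i c 0.
have n2 : \forall a \near 0, cball x r (coord i (c a)).
  have [U [oU U0] hU] := neighbor_ball di r0.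
  have nU : \forall a \near 0, U (c a) by apply: (gc'); exact: open_nbhs_nbhs.
  by apply: filterS nU => a /hU[].
have [d2 d20 h2] := (near0P _ _).1 n2.
have cP : cont_at (parabola i x u) (0 : R).
  apply: continuous_addv; first exact: vdrv_cont (vdrv_line x u 0).
  apply: continuous_oppv; apply: continuous_scalev; last exact: cst_continuous.
  exact: drv_cont (drvM (drvM (drv_id (0 : R)) (drv_id 0)) (drv_cst 2^-1 0)).
have P0 : parabola i x u 0 = x by rewrite /parabola scale0r expr0n mul0r scale0r addr0 subr0.
have n3 : \forall a \near 0, cball x r (parabola i x u a).
  have /cvgrPdist_lt/(_ r r0) := cP; apply: filterS => a; rewrite P0 distrC => h; exact: ltW.
have [d3 d30 h3] := (near0P _ _).1 n3.
exists (Num.min d1 (Num.min d2 d3)); first by rewrite !lt_min d10 d20.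
move=> a; rewrite !lt_min => /and3P[a1 a2 a3]; have [da ha] := h1 a a1.
rewrite -[c a](coordK da); apply: le_trans (dist_local gb (h2 a _) (h3 a _)) _; rewrite ?subr0 //.
by rewrite distrC mulrC -ler_pdivlMr // mulrAC.
Qed.

(* Upper bound of the distance to [p] along geodesics issuing from [c t]: it is attained by
   the variation of [c] with field [phi E_m], where [phi = h] at [t]. *)
Definition variation_bound p c t (h J : R) := exists (b : I4 -> R -> M) (I : I4 -> R),
  [/\ forall m, geodesic g (b m) /\ b m 0 = c t, forall i, dom i (c t) -> orthonormal g i (c t) b, \sum_m I m <= J &
      forall i, dom i (c t) -> forall m (e : R), 0 < e -> exists2 d : R, 0 < d & forall a, `|a| < d ->
        dist g p (b m (a * h)) <= t + a * h * ip g i (coord i (c t)) (vel i (b m) 0) (vel i c t) + (I m + e) / 2 * a ^+ 2].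

Lemma parallel_ip_const c i t1 t2 (w1 w2 : R -> 'rV[R]_4) : geodesic g c -> t1 <= t2 ->
  (forall s, t1 <= s <= t2 -> dom i (c s) /\ parallel g i c s w1 /\ parallel g i c s w2) ->
  ip g i (coord i (c t2)) (w1 t2) (w2 t2) = ip g i (coord i (c t1)) (w1 t1) (w2 t1).
Proof.
move=> gc t12 h; pose B s := ip g i (coord i (c s)) (w1 s) (w2 s).
have D r : btw t1 t2 r -> drv B r 0.
  rewrite /btw (min_idPl t12) (max_idPr t12) => /h[dr [p1 p2]].
  exact: parallel_ip gc dr p1 p2.
by have [r _ /eqP] := mvt D; rewrite mul0r subr_eq0 => /eqP.
Qed.

Section Step.
Variables (c : R -> M) (i : chart X) (t1 t2 al k : R).
Hypotheses (gc : geodesic g c) (sc : gspeed g c = 1) (t12 : t1 <= t2).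
Variables (W : R -> 'rV[R]_4).
Hypothesis hdom : forall s, t1 <= s <= t2 -> dom i (c s).
Hypothesis hW : forall s, t1 <= s <= t2 -> parallel g i c s W.
Let y s := coord i (c s).
Let v := vel i c.
Let ph s := al + k * s.
Let V s := ph s *: W s.
Let V' s := k *: W s - gam g i (y s) (v s) (V s).
Let Z s := gam g i (y s) (V s) (V s).
Let Z' s := dgam g i (y s) (v s) (V s) (V s) + gam g i (y s) (V' s) (V s) + gam g i (y s) (V s) (V' s).
(** The variation by parabolas, whose transversal accelerations vanish at [a = 0]. [Ps], [Pa] and
    [Psa] are its partial derivatives, [F] is the squared speed of the varied curve, and [eta] is
    the covariant derivative of [Ps] in the direction of [a]. *)
Let P s a := y s + a *: V s - (a ^+ 2 / 2) *: Z s.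
Let Ps s a := v s + a *: V' s - (a ^+ 2 / 2) *: Z' s.
Let Pa s a := V s - a *: Z s.
Let Psa s a := V' s - a *: Z' s.
Let F s a := ip g i (P s a) (Ps s a) (Ps s a).
Let eta s a := Psa s a + gam g i (P s a) (Pa s a) (Ps s a).
Let eta' s a := - Z' s + (dgam g i (P s a) (Pa s a) (Pa s a) (Ps s a) + gam g i (P s a) (- Z s) (Ps s a)
  + gam g i (P s a) (Pa s a) (Psa s a)).
Let F2 s a := 2 * (ip g i (P s a) (eta' s a + gam g i (P s a) (Pa s a) (eta s a)) (Ps s a)
  + ip g i (P s a) (eta s a) (eta s a)).
(** The integrand of the index form of the field [ph * W]. *)
Let K s := k ^+ 2 * ip g i (y s) (W s) (W s) - ph s ^+ 2 * con (riemT g i (y s)) [:: W s; v s; W s; v s].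

Let Dph s : drv ph s k. Proof. exact: drv_affine. Qed.

Let DV s : t1 <= s <= t2 -> vdrv V s (V' s).
Proof.
move=> hs; have := vdrvZ (Dph s) (hW hs); rewrite scalerN -gamZr; exact.
Qed.

Let Dy s : t1 <= s <= t2 -> vdrv y s (v s) /\ vdrv v s (- gam g i (y s) (v s) (v s)).
Proof. by move=> /hdom/(geodesic_chart gc). Qed.

Let Vy s : t1 <= s <= t2 -> codom i (y s).
Proof. by move=> /hdom; exact: codom_coord. Qed.

Let DZ s : t1 <= s <= t2 -> vdrv Z s (Z' s).
Proof. by move=> hs; apply: gam_along (Vy hs) (Dy hs).1 (DV hs) (DV hs). Qed.

Let DP s a : t1 <= s <= t2 -> vdrv (fun s => P s a) s (Ps s a).
Proof.
move=> hs; apply: vdrvB; last exact: vdrvZl (DZ hs).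
by apply: vdrvD; [exact: (Dy hs).1|exact: vdrvZl (DV hs)].
Qed.

Let Dsq a : drv (fun a => a ^+ 2 / 2) a a.
Proof. by apply: (drv_val _ (drvM (drvM (drv_id a) (drv_id a)) (drv_cst 2^-1 a))); field. Qed.

Let DPa s a : vdrv (P s) a (Pa s a).
Proof.
apply: vdrvB; first exact: vdrv_line.
by have := vdrvZ (Dsq a) (vdrv_cst (Z s) a); rewrite scaler0 addr0.
Qed.

Let DPsa s a : vdrv (Ps s) a (Psa s a).
Proof.
apply: vdrvB; first exact: vdrv_line.
by have := vdrvZ (Dsq a) (vdrv_cst (Z' s) a); rewrite scaler0 addr0.
Qed.

Let DPaa s a : vdrv (Pa s) a (- Z s).
Proof.
have := vdrvB (vdrv_cst (V s) a) (vdrvZ (drv_id a) (vdrv_cst (Z s) a)).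
by rewrite scale1r scaler0 addr0 add0r.
Qed.

Let DPsaa s a : vdrv (Psa s) a (- Z' s).
Proof.
have := vdrvB (vdrv_cst (V' s) a) (vdrvZ (drv_id a) (vdrv_cst (Z' s) a)).
by rewrite scale1r scaler0 addr0 add0r.
Qed.

Let DF s a : codom i (P s a) -> drv (F s) a (2 * ip g i (P s a) (eta s a) (Ps s a)).
Proof.
move=> Va; have := ip_along g Va (DPa s a) (DPsa s a) (DPsa s a); apply: drv_val.
by rewrite (ipC g (Ps s a)) // mulr2n mulrDl mul1r.
Qed.

Let DF1 s a : codom i (P s a) -> drv (fun a => 2 * ip g i (P s a) (eta s a) (Ps s a)) a (F2 s a).
Proof.
move=> Va; apply: drvZ.
have De : vdrv (eta s) a (eta' s a).
  by apply: vdrvD; [exact: DPsaa|exact: gam_along Va (DPa s a) (DPaa s a) (DPsa s a)].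
exact: (ip_along g Va (DPa s a) De (DPsa s a)).
Qed.

Let P0 s : P s 0 = y s. Proof. by rewrite /P scale0r expr0n mul0r scale0r addr0 subr0. Qed.
Let Ps0 s : Ps s 0 = v s. Proof. by rewrite /Ps scale0r expr0n mul0r scale0r addr0 subr0. Qed.
Let Pa0 s : Pa s 0 = V s. Proof. by rewrite /Pa scale0r subr0. Qed.
Let Psa0 s : Psa s 0 = V' s. Proof. by rewrite /Psa scale0r subr0. Qed.

Let eta0 s : t1 <= s <= t2 -> eta s 0 = k *: W s.
Proof. by move=> hs; rewrite /eta Psa0 P0 Pa0 Ps0 (gamC g (V s)) ?subrK //; exact: Vy. Qed.

Let F20 s : t1 <= s <= t2 -> F2 s 0 = 2 * K s.
Proof.
move=> hs; have Vs := Vy hs; rewrite /F2 eta0 // /eta' P0 Pa0 Ps0 Psa0; congr (_ * _).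
rewrite [ip g i _ (k *: W s) (k *: W s)]ipZl ipZr mulrA -expr2 addrC /K; congr (_ + _).
transitivity (con (riemT g i (y s)) [:: V s; v s; v s; V s]).
  rewrite curvature_vector (ipC g _ (v s)) //; congr (ip _ _ _ _ _).
  have VV : gam g i (y s) (V s) (V' s) = gam g i (y s) (V s) (k *: W s) -
      gam g i (y s) (V s) (gam g i (y s) (v s) (V s)) by rewrite /V' gamDr gamNr.
  rewrite /Z' (gamC g (V' s)) // VV gamNl (gamC g (Z s)) // (dgamC (V s) (v s)) //.
  by rewrite -/(Z s); apply/rowP => l; rewrite ![in LHS]mxE ![in RHS]mxE; ring.
by apply: (etrans (riem_skew34 _ _ _ _ Vs)); rewrite /V con_scale13 expr2.
Qed.

(** The parameters [sg] and [aa] are general, so that joint continuity and continuity in time alone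
    are both instances. *)
Let jointly_continuous (T : topologicalType) (sg aa : T -> R) (p : T) : cont_at sg p ->
  cont_at aa p -> t1 <= sg p <= t2 -> aa p = 0 ->
  cont_at (fun z => P (sg z) (aa z)) p /\ cont_at (fun z => F2 (sg z) (aa z)) p.
Proof.
move=> cs ca hs a0.
have lift (h : R -> 'rV[R]_4) : cont_at h (sg p) -> cont_at (fun z => h (sg z)) p.
  by move=> ch; exact: (@continuous_comp _ _ _ sg h).
have c_y := lift _ (vdrv_cont (Dy hs).1); have c_v := lift _ (vdrv_cont (Dy hs).2).
have cW := lift _ (vdrv_cont (hW hs)); have cV := lift _ (vdrv_cont (DV hs)).
have cZ := lift _ (vdrv_cont (DZ hs)).
have Vs := Vy hs; have Vp : codom i (P (sg p) (aa p)) by rewrite a0 P0.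
have cV' : cont_at (fun z => V' (sg z)) p.
  apply: continuous_addv; first by apply: continuous_scalev => //; exact: cst_continuous.
  by apply: continuous_oppv; exact: gam_continuous.
have cZ' : cont_at (fun z => Z' (sg z)) p.
  apply: continuous_addv; last exact: gam_continuous.
  by apply: continuous_addv; [exact: dgam_continuous|exact: gam_continuous].
have csq : cont_at (fun z => aa z ^+ 2 / 2) p.
  by apply: continuous_mul; [apply: continuous_mul|exact: cst_continuous].
have cP : cont_at (fun z => P (sg z) (aa z)) p.
  exact: continuous_addv (continuous_addv c_y (continuous_scalev ca cV)) (continuous_oppv (continuous_scalev csq cZ)).
have cPs : cont_at (fun z => Ps (sg z) (aa z)) p.
  exact: continuous_addv (continuous_addv c_v (continuous_scalev ca cV')) (continuous_oppv (continuous_scalev csq cZ')).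
have cPa : cont_at (fun z => Pa (sg z) (aa z)) p.
  exact: continuous_addv cV (continuous_oppv (continuous_scalev ca cZ)).
have cPsa : cont_at (fun z => Psa (sg z) (aa z)) p.
  exact: continuous_addv cV' (continuous_oppv (continuous_scalev ca cZ')).
pose x0 z := P (sg z) (aa z).
have G (u w : T -> 'rV[R]_4) : cont_at u p -> cont_at w p -> _ := @gam_continuous T i x0 u w p Vp cP.
have I (u w : T -> 'rV[R]_4) : cont_at u p -> cont_at w p -> _ := @ip_continuous T i x0 u w p Vp cP.
have ceta : cont_at (fun z => eta (sg z) (aa z)) p := continuous_addv cPsa (G _ _ cPa cPs).
have ceta' : cont_at (fun z => eta' (sg z) (aa z)) p :=
  continuous_addv (continuous_oppv cZ') (continuous_addv (continuous_addv
    (@dgam_continuous T i x0 _ _ _ p Vp cP cPa cPs cPa) (G _ _ (continuous_oppv cZ) cPs)) (G _ _ cPa cPsa)).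
split; first exact: cP.
have c1 := I _ _ (continuous_addv ceta' (G _ _ cPa ceta)) cPs.
apply: (continuous_mul (f := fun=> 2)); first exact: cst_continuous.
exact: continuousD c1 (I _ _ ceta ceta).
Qed.

Let K_antiderivative : exists H : R -> R, forall s, t1 <= s <= t2 -> drv H s (K s).
Proof.
pose h s := F2 (clip t1 t2 s) 0 / 2.
have ch : continuous h.
  move=> s; apply: (continuous_mul (f := fun s => F2 (clip t1 t2 s) 0)); last exact: cst_continuous.
  apply: (jointly_continuous (sg := clip t1 t2) (aa := fun=> 0) (p := s) _ _ _ _).2 => //.
  - exact: clip_continuous.
  - exact: cst_continuous.
  exact: clip_in.
have [H hH] := antiderivative (t1 - 1) (t2 + 1) ch; exists H => s hs.
have /andP[s1 s2] := hs.
have := hH s (ltac:(apply/andP; split; lra)); rewrite /h clip_id // F20 //; apply: drv_val.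
by rewrite [2 * _]mulrC mulfK // pnatr_eq0.
Qed.

Let uniform_bound (e : R) : 0 < e -> exists2 d : R, 0 < d & forall a, `|a| < d -> forall s, t1 <= s <= t2 ->
  codom i (P s a) /\ F2 s a <= 2 * (K s + e).
Proof.
move=> e0; have /compact_near_coveringP nc := @segment_compact R t1 t2.
have := nc R (nbhs (0 : R)) (fun a s => t1 <= s <= t2 -> codom i (P s a) /\ F2 s a <= 2 * (K s + e)) _ _.
have h : forall s, [set` `[t1, t2]] s -> \forall s' \near s & a \near (0 : R), t1 <= s' <= t2 ->
    codom i (P s' a) /\ F2 s' a <= 2 * (K s' + e).
  move=> s /=; rewrite in_itv /= => hs.
  have [cP cF] := jointly_continuous (sg := fst) (aa := snd) (p := (s, 0 : R)) (@cvg_fst _ _ _ _ _)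
    (@cvg_snd _ _ _ _ _) hs erefl.
  have [_ cF0] := jointly_continuous (sg := fst) (aa := fun=> 0) (p := (s, 0 : R)) (@cvg_fst _ _ _ _ _)
    (@cst_continuous _ _ _ _) hs erefl.
  have nP : \forall z \near (s, 0 : R), codom i (P z.1 z.2).
    by apply: cP; apply: open_nbhs_nbhs; split; [exact: codom_open|rewrite /= P0; exact: Vy].
  have nF : \forall z \near (s, 0 : R), `|F2 z.1 z.2 - F2 z.1 0| < 2 * e.
    by apply: (continuous_near_eq cF cF0) => //; rewrite mulr_gt0.
  apply: filterS2 nP nF => -[s' a] /= h1 h2 hs'; split=> //.
  by rewrite mulrDr -F20 // -lerBlDl (le_trans (ler_norm _)) // ltW.
move=> /(_ _ h); case/near0P => d d0 hd; exists d => // a ad s hs.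
by apply: (hd a _ s _ hs); rewrite ?subr0 //= in_itv.
Qed.

(** [F] is at most its second-order expansion up to [e], uniformly in [s] by compactness. The speed
    is then bounded through [sqrt F <= (1 + F) / 2], which is exact to first order since [F = 1] at
    [a = 0]. *)
Lemma step_bound : exists H : R -> R, (forall s, t1 <= s <= t2 -> drv H s (K s)) /\
  forall e : R, 0 < e -> exists2 d : R, 0 < d & forall a, `|a| < d ->
    dist g (param i (P t1 a)) (param i (P t2 a)) <= (t2 - t1) * (1 + a * (k * ip g i (y t1) (W t1) (v t1))) +
      a ^+ 2 / 2 * (H t2 - H t1 + e * (t2 - t1)).
Proof.
have [H hH] := K_antiderivative; exists H; split=> // e e0; have [d d0 hd] := uniform_bound e0.
exists d => // a ad; set b := ip g i (y t1) (W t1) (v t1).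
have bE s : t1 <= s <= t2 -> ip g i (y s) (W s) (v s) = b.
  move=> /andP[s1 s2]; apply: (parallel_ip_const gc s1) => r /andP[r1 r2].
  have hr : t1 <= r <= t2 by rewrite r1 (le_trans r2).
  by split; [exact: hdom|split; [exact: hW|exact: parallel_vel (hdom hr)]].
pose L s := (1 + a * (k * b)) * s + a ^+ 2 / 2 * (H s + e * s).
have pa : path g t1 t2 (fun s => param i (P s a)) L.
  split=> // s hs; have [Va _] := hd a ad s hs.
  have [q dq cq] := Va; have dP : dom i (param i (P s a)) by rewrite -cq coordK.
  have pP : cont_at (fun s => param i (P s a)) s.
    apply: (@continuous_comp _ _ _ (fun s => P s a) (param i)); first exact: vdrv_cont (DP a hs).
    exact: param_continuous.
  split=> //; exists (1 + a * (k * b) + a ^+ 2 / 2 * (K s + e)).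
    apply: (drvD _ (drvZ _ (drvD (hH s hs) _))).
      by apply: (drv_val _ (drvZ (1 + a * (k * b)) (drv_id s))); rewrite mulr1.
    by apply: (drv_val _ (drvZ e (drv_id s))); rewrite mulr1.
  have cc : coord i (param i (P s a)) = P s a by rewrite -cq coordK.
  apply: (speed_chart (i := i) (v := Ps s a)) => //.
    apply: vdrv_near (DP a hs).
    have nV : \forall w \near s, codom i (P w a).
      apply: (vdrv_cont (DP a hs)); apply: open_nbhs_nbhs; split=> //; exact: codom_open.
    by apply: filterS nV => w [p pi pw]; rewrite -pw coordK.
  rewrite cc; have F0 : 0 <= F s a by exact: ip_ge0.
  have tay := @taylor2 (F s) (fun a => 2 * ip g i (P s a) (eta s a) (Ps s a)) (F2 s) d (2 * (K s + e))
    (fun a h => DF (hd a h s hs).1) (fun a h => DF1 (hd a h s hs).1) (fun a h => (hd a h s hs).2) a ad.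
  have F0E : F s 0 = 1.
    by rewrite /F P0 Ps0 -(sqr_sqrtr (ip_ge0 _ _ (Vy hs))) (gspeedE gc (hdom hs)) sc expr1n.
  move: tay; rewrite F0E P0 Ps0 eta0 // ipZl bE // => tay.
  have sq : Num.sqrt (F s a) ^+ 2 = F s a by rewrite sqr_sqrtr.
  have := sqr_ge0 (Num.sqrt (F s a) - 1); rewrite sqrrB1 sq.
  rewrite -/(F s a); move: tay; set A := Num.sqrt _; rewrite (_ : 2 * (K s + e) / 2 = K s + e); last by field.
  by rewrite -mulr_natl => h1 h2; lra.
have := dist_path pa; rewrite /L => h; apply: le_trans h _; rewrite le_eqVlt; apply/orP; left; apply/eqP; ring.
Qed.

End Step.

Lemma ip_vel i j (a b : R -> M) s t : geodesic g a -> geodesic g b -> a s = b t -> dom i (a s) -> dom j (a s) ->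
  ip g i (coord i (a s)) (vel i a s) (vel i b t) = ip g j (coord j (a s)) (vel j a s) (vel j b t).
Proof.
move=> ga gb ab di dj; rewrite (@ip_transition _ _ _ g i j) // -(vel_transition ga di dj).
by rewrite ab in di dj *; rewrite (vel_transition gb di dj).
Qed.

Variables (f : M -> R) (rho : R).
Hypothesis sol : gradient_shrinking_soliton g f rho.

Lemma dist_chain4 p (x1 x2 x3 x4 : M) (d1 d2 d3 d4 : R) : dist g p x1 <= d1 -> dist g x1 x2 <= d2 ->
  dist g x2 x3 <= d3 -> dist g x3 x4 <= d4 -> dist g p x4 <= d1 + d2 + d3 + d4.
Proof.
move=> h1 h2 h3 h4; have := dist_triangle g p x1 x4; have := dist_triangle g x1 x2 x4.
have := dist_triangle g x2 x3 x4; lra.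
Qed.

Lemma variation_arith (t1 t2 a k p1 p2 x I H1 H2 e e1 : R) : p2 = p1 + k * (t2 - t1) ->
  e / 2 = e1 * (1 + p1 ^+ 2 + p2 ^+ 2 + (t2 - t1)) -> 0 < e1 -> t1 <= t2 ->
  t1 + a * p1 * x + (I + e1) / 2 * a ^+ 2 + e1 * (a ^+ 2 * p1 ^+ 2) +
  ((t2 - t1) * (1 + a * (k * x)) + a ^+ 2 / 2 * (H2 - H1 + e1 * (t2 - t1))) + e1 * (a ^+ 2 * p2 ^+ 2)
  <= t2 + a * p2 * x + (I + (H2 - H1) + e) / 2 * a ^+ 2.
Proof.
move=> p2E eE e10 t12.
have le : e1 * (1 / 2 + p1 ^+ 2 + p2 ^+ 2 + (t2 - t1) / 2) <= e / 2.
  by rewrite eE ler_wpM2l ?(ltW e10) //; lra.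
have := ler_wpM2r (sqr_ge0 a) le; rewrite p2E; lra.
Qed.

Section VariationStep.
Variables (p : M) (c : R -> M) (i : chart X) (t1 t2 al k j : R) (J J' hs : R -> R).
Hypotheses (gc : geodesic g c) (sc : gspeed g c = 1) (t12 : t1 <= t2).
Hypothesis hdom : forall s, t1 <= s <= t2 -> dom i (c s).
Let v := vel i c.
Let ph s := al + k * s.
Hypothesis hess : forall s, t1 <= s <= t2 -> \sum_a \sum_b v s 0 a * v s 0 b * hessian g f i a b (coord i (c s)) = hs s.
Hypothesis DJ : forall s, t1 <= s <= t2 -> drv J s (J' s) /\ 4 * k ^+ 2 - ph s ^+ 2 * (rho - hs s) <= J' s.
Hypothesis frames : forall E0, E0 *m gram g i (coord i (c t1)) *m E0^T = 1%:M ->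
  exists E : R -> 'M[R]_4, E t1 = E0 /\ forall s, t1 <= s <= t2 ->
    parallel_frame g i c s E /\ E s *m gram g i (coord i (c s)) *m (E s)^T = 1%:M.

Let parabola_scale x w (a h : R) : parabola i x w (a * h) = x + a *: (h *: w) - (a ^+ 2 / 2) *: gam g i x (h *: w) (h *: w).
Proof. by rewrite /parabola scalerA gamZl gamZr !scalerA; congr (_ - _ *: _); field. Qed.

Let parabola_error (b : R -> M) (t h e : R) : geodesic g b -> b 0 = c t -> dom i (c t) -> 0 < e ->
  exists2 d : R, 0 < d & forall a, `|a| < d -> dist g (b (a * h)) (param i (coord i (c t) + a *: (h *: vel i b 0) -
    (a ^+ 2 / 2) *: gam g i (coord i (c t)) (h *: vel i b 0) (h *: vel i b 0))) <= e * (a ^+ 2 * h ^+ 2).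
Proof.
move=> gb b0 di e0; rewrite -b0 in di *; have [d d0 hd] := parabola_dist gb di e0.
have h1 : 0 < `|h| + 1 by rewrite ltr_wpDl.
exists (d / (`|h| + 1)); first by rewrite divr_gt0.
move=> a; rewrite ltr_pdivlMr // => had; rewrite -parabola_scale -exprMn; apply: hd.
by apply: le_lt_trans had; rewrite normrM ler_wpM2l // lerDl.
Qed.

(** The geodesics from [c t1] and [c t2] agree to second order with the parabolas, so the triangle
    inequality joins the old bound to [step_bound]. Summed over the frame the curvature terms give
    Rc(v, v) = rho - f'', and [J] dominates the sum of the index forms. *)
Lemma variation_step : variation_bound p c t1 (ph t1) j -> variation_bound p c t2 (ph t2) (j + J t2 - J t1).
Proof.
move=> [b [I [hb on sI hI]]]; have [cpl sf rho0 eqn] := sol.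
have l1 : t1 <= t1 <= t2 by rewrite lexx.
have l2 : t1 <= t2 <= t2 by rewrite t12 lexx.
have d1 := hdom l1; have d2 := hdom l2.
pose E0 : 'M[R]_4 := \matrix_(m, n) vel i (b m) 0 0 n.
have rE0 m : row m E0 = vel i (b m) 0 by apply/rowP => n; rewrite !mxE.
have [E [Et1 hE]] : exists E : R -> 'M[R]_4, E t1 = E0 /\ forall s, t1 <= s <= t2 ->
    parallel_frame g i c s E /\ E s *m gram g i (coord i (c s)) *m (E s)^T = 1%:M.
  by apply: frames; apply/frame_ip => m n; rewrite !rE0; exact: on.
have /boolp.choice[H hH] m := step_bound al k gc sc t12 (W := fun s => row m (E s)) hdom (fun s h => (hE s h).1 m).
have gF m := geo_fromP cpl (row m (E t2)) d2.
pose b' m := geo_from g i (c t2) (row m (E t2)).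
exists b', (fun m => I m + (H m t2 - H m t1)); split.
- by move=> m; have [] := gF m.
- move=> i' di' m n; have [g1 b1 v1] := gF m; have [g2 b2 v2] := gF n.
  rewrite -b1 in di'; have := ip_vel g1 g2 (etrans b1 (esym b2)) di' (eq_ind_r _ d2 b1).
  by rewrite v1 v2 b1 => ->; apply: (frame_ip g _ _ _).1; exact: (hE _ l2).2.
- rewrite big_split /= -addrA lerD //.
  pose B s := J s - \sum_m H m s.
  suff : B t1 <= B t2 by rewrite /B sumrB; lra.
  pose S s := \sum_m (k ^+ 2 * ip g i (coord i (c s)) (row m (E s)) (row m (E s)) - ph s ^+ 2 *
    con (riemT g i (coord i (c s))) [:: row m (E s); v s; row m (E s); v s]).
  have DB s : btw t1 t2 s -> drv B s (J' s - S s).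
    rewrite /btw (min_idPl t12) (max_idPr t12) => hs'.
    by apply: drvB (DJ hs').1 _; apply: drv_sum => m; exact: (hH m).1 s hs'.
  have SE s : t1 <= s <= t2 -> S s = 4 * k ^+ 2 - ph s ^+ 2 * (rho - hs s).
    move=> hs'; have di := hdom hs'; have onE := (hE _ hs').2.
    have Vx := codom_coord di.
    rewrite /S sumrB -!mulr_sumr (ricci_trace Vx (v s) sf onE (eqn i _ Vx)).
    rewrite hess // -ipE -(sqr_sqrtr (ip_ge0 _ _ Vx)) (gspeedE gc di) sc expr1n mulr1.
    under eq_bigr do rewrite ((frame_ip g _ _ _).1 onE) eqxx.
    by rewrite sumr_const card_ord mulrC.
  have [s hs' e] := mvt DB; rewrite -subr_ge0 e mulr_ge0 ?subr_ge0 //.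
  by move: hs'; rewrite /btw (min_idPl t12) (max_idPr t12) => hs'; rewrite SE //; exact: (DJ hs').2.
move=> i' di' m e e0; have [g1 b1 v1] := gF m; have [gm bm0] := hb m.
pose C := 1 + ph t1 ^+ 2 + ph t2 ^+ 2 + (t2 - t1).
have C0 : 0 < C by have := sqr_ge0 (ph t1); have := sqr_ge0 (ph t2); rewrite /C; lra.
pose e1 := e / (2 * C); have e10 : 0 < e1 by rewrite divr_gt0 // mulr_gt0.
have eC : e / 2 = e1 * C by rewrite /e1; field; rewrite gt_eqF.
have [D1 D10 h1] := hI i d1 m e1 e10.
have [D2 D20 h2] := parabola_error (ph t1) gm bm0 d1 e10.
have [D3 D30 h3] := (hH m).2 e1 e10.
have [D4 D40 h4] := parabola_error (ph t2) g1 b1 d2 e10.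
exists (Num.min (Num.min D1 D2) (Num.min D3 D4)); first by rewrite !lt_min D10 D20 D30.
move=> a; rewrite !lt_min => /andP[/andP[a1 a2] /andP[a3 a4]].
have := h1 a a1; have := h2 a a2; have := h3 a a3; have := h4 a a4.
rewrite -rE0 -Et1 v1 => q4 q3 q2 q1.
rewrite distC in q4.
have ipE2 : ip g i' (coord i' (c t2)) (vel i' (b' m) 0) (vel i' c t2) = ip g i (coord i (c t1)) (row m (E t1)) (v t1).
  have <- : ip g i (coord i (c t2)) (row m (E t2)) (v t2) = ip g i (coord i (c t1)) (row m (E t1)) (v t1).
    apply: (parallel_ip_const gc t12 (w1 := fun s => row m (E s))) => s hs'.
    by split; [exact: hdom|split; [exact: (hE s hs').1|exact: parallel_vel (hdom hs')]].
  have := ip_vel g1 gc b1; rewrite b1 => /(_ i' i di' d2); rewrite v1 => ->; exact: erefl.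
rewrite ipE2.
apply: le_trans (dist_chain4 q1 q2 q3 q4) _.
apply: variation_arith e10 t12; first by rewrite /ph; ring.
exact: eC.
Qed.

End VariationStep.

Lemma hess_along c i t (v := vel i c t) : geodesic g c -> dom i (c t) ->
  drv (f \o c) t (\sum_k v 0 k * partial k (f \o param i) (coord i (c t))) /\
  drv (derive1 (f \o c)) t (\sum_a \sum_b v 0 a * v 0 b * hessian g f i a b (coord i (c t))).
Proof.
move=> gc di; have [_ sf _ _] := sol; have [cc _] := gc.
have oV := @codom_open R M X i.
have D s : dom i (c s) -> drv (f \o c) s (\sum_k vel i c s 0 k * partial k (f \o param i) (coord i (c s))).
  move=> ds; have [hc _] := geodesic_chart gc ds.
  have := smooth_on_chain oV (sf i) (codom_coord ds) hc => h.
  apply: (drv_near _ (drv_val _ h)).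
    by have := dom_near (cc s) ds; apply: filterS => r dr /=; rewrite coordK.
  by ext_sum k; rewrite mulrC.
split; first exact: D.
have [hc hv] := geodesic_chart gc di.
have h := drv_sum (fun k => drvM (hv k) (smooth_on_chain oV (smooth_on_partial k (sf i)) (codom_coord di) hc)).
apply: (drv_near _ (drv_val _ h)).
  have := dom_near (cc t) di; apply: filterS => s /D[_ <-].
  by rewrite derive1E.
rewrite -/v; under [RHS]eq_bigr do under eq_bigr do rewrite /hessian mulrBr.
under [RHS]eq_bigr do rewrite sumrB; rewrite sumrB big_split /= addrC; congr (_ + _).
  swap_sum k; rewrite mulr_sumr; ext_sum l; ring.
under eq_bigr do rewrite mxE mulNr; rewrite sumrN; congr (- _).
have G k : gam g i (coord i (c t)) v v 0 k =
    \sum_a \sum_b v 0 a * v 0 b * christoffel g i k a b (coord i (c t)) by rewrite [LHS]mxE.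
under [LHS]eq_bigr do (rewrite G mulr_suml; under eq_bigr do rewrite mulr_suml).
swap_sum a; swap_sum b.
by rewrite mulr_sumr; ext_sum k; exact/esym/mulrA.
Qed.

(** Line induction carries the bound from chart to chart along [c]. *)
Lemma second_variation p c (a b al k j : R) (J J' : R -> R) : geodesic g c -> gspeed g c = 1 -> a <= b ->
  (forall s, a <= s <= b -> drv J s (J' s) /\
    4 * k ^+ 2 - (al + k * s) ^+ 2 * (rho - derive1 (derive1 (f \o c)) s) <= J' s) ->
  variation_bound p c a (al + k * a) j -> variation_bound p c b (al + k * b) (j + J b - J a).
Proof.
move=> gc sc ab hJ h0.
apply: (@line_ind R (fun t => variation_bound p c t (al + k * t) (j + J t - J a)) a b) => //.
  by rewrite addrK.
move=> t /andP[a_t tb]; have [i di] := dom_cover X (c t).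
have [e e0 [hd hE]] := parallel_frame_exists gc di; exists e => // t1 t2 at1 t1t tt2 t2b e1 e2 Q1.
have near_t s : t1 <= s <= t2 -> `|s - t| <= e.
  move=> /andP[? ?]; move: e1 e2; rewrite !ltr_distl ler_distl => /andP[? ?] /andP[? ?].
  by apply/andP; split; lra.
have t12 := le_trans t1t tt2.
have -> : j + J t2 - J a = (j + J t1 - J a) + J t2 - J t1 by ring.
apply: (variation_step (i := i) (hs := fun s => derive1 (derive1 (f \o c)) s) (J' := J')) => //.
- by move=> s /near_t/hd.
- by move=> s /near_t/hd di'; have [_ [_ <-]] := hess_along gc di'; rewrite derive1E.
- by move=> s /andP[? ?]; apply: hJ; apply/andP; split; lra.
move=> E0 on; have [|E [Et hE']] := hE t1 E0 _ on; first by apply: near_t; rewrite lexx.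
by exists E; split=> // s /near_t/hE'.
Qed.

Lemma variation_bound0 p c : geodesic g c -> c 0 = p -> variation_bound p c 0 0 0.
Proof.
move=> gc c0; have [i di] := dom_cover X (c 0); have [cpl _ _ _] := sol.
have [E on] := frame_exists (gram_sym g (codom_coord di)) (fun v => gram_pos g (v := v) (codom_coord di)).
have gF m := geo_fromP cpl (row m E) di.
exists (fun m => geo_from g i (c 0) (row m E)), (fun=> 0); split.
- by move=> m; have [] := gF m.
- move=> i' di' m n; have [g1 b1 v1] := gF m; have [g2 b2 v2] := gF n.
  rewrite -b1 in di'; have := ip_vel g1 g2 (etrans b1 (esym b2)) di' (eq_ind_r _ di b1).
  by rewrite v1 v2 b1 => ->; exact: (frame_ip g _ _ _).1.
- by rewrite big1.
move=> i' _ m e e0; exists 1 => // a _; have [_ b0 _] := gF m.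
rewrite mulr0 b0 c0 dist_refl mul0r !add0r.
by rewrite mulr_ge0 ?sqr_ge0 // divr_ge0 // ltW.
Qed.

End SecondVariation.

(** * Eigenvalues of the half curvature *)

Section SpectralTheorem.
Variable R : realType.
Implicit Types (S P : 'M[R]_3) (x y w : 'rV[R]_3).

Definition qf S x y : R := (x *m S *m y^T) 0 0.
Definition dot x y : R := (x *m y^T) 0 0.

Lemma sum3 (V : zmodType) (F : 'I_3 -> V) : \sum_i F i = F 0 + F 1 + F 2%:R.
Proof.
rewrite !big_ord_recl big_ord0 addr0 !addrA.
by congr (_ + _ + _); congr F; apply/val_inj.
Qed.

Lemma dotE x y : dot x y = x 0 0 * y 0 0 + x 0 1 * y 0 1 + x 0 2%:R * y 0 2%:R.
Proof. by rewrite /dot mxE sum3 !mxE. Qed.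

Lemma dotC x y : dot x y = dot y x.
Proof. by rewrite !dotE; ring. Qed.

Lemma dotDl x y w (a b : R) : dot (a *: x + b *: y) w = a * dot x w + b * dot y w.
Proof. by rewrite /dot mulmxDl -!scalemxAl !mxE. Qed.

Lemma qfC S x y : S^T = S -> qf S x y = qf S y x.
Proof.
move=> sS; have -> : qf S x y = (x *m S *m y^T)^T 0 0 by rewrite mxE.
by rewrite !trmx_mul trmxK sS mulmxA.
Qed.

Lemma qfDl S x y w (a b : R) : qf S (a *: x + b *: y) w = a * qf S x w + b * qf S y w.
Proof. by rewrite /qf !mulmxDl -!scalemxAl !mxE. Qed.

Lemma qf_comb S x y (a b : R) : S^T = S -> qf S (a *: x + b *: y) (a *: x + b *: y) =
  a ^+ 2 * qf S x x + 2 * a * b * qf S x y + b ^+ 2 * qf S y y.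
Proof.
move=> sS; rewrite qfDl !(qfC _ (a *: x + b *: y) sS) !qfDl (qfC y x sS); ring.
Qed.

Lemma dot_comb x y (a b : R) : dot (a *: x + b *: y) (a *: x + b *: y) =
  a ^+ 2 * dot x x + 2 * a * b * dot x y + b ^+ 2 * dot y y.
Proof. by rewrite dotDl !(dotC _ (a *: x + b *: y)) !dotDl (dotC y x); ring. Qed.

Lemma dot_ge0 x : 0 <= dot x x.
Proof. by rewrite dotE -!expr2 !addr_ge0 ?sqr_ge0. Qed.

Lemma dot_eq0 x : dot x x = 0 -> x = 0.
Proof.
rewrite dotE -!expr2 => /eqP h; apply/rowP => k; rewrite mxE; apply/eqP; rewrite -sqrf_eq0.
have h0 := sqr_ge0 (x 0 0); have h1 := sqr_ge0 (x 0 1); have h2 := sqr_ge0 (x 0 2%:R).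
by case: k => -[|[|[|//]]] i; [rewrite (_ : Ordinal i = 0)|rewrite (_ : Ordinal i = 1)|rewrite (_ : Ordinal i = 2%:R)];
  try exact/val_inj; move/eqP: h => h; apply/eqP; lra.
Qed.

Lemma row_coord_continuous n (x : 'rV[R]_n.+1) k : cont_at (fun y : 'rV[R]_n.+1 => y 0 k) x.
Proof. exact: (@matrix_normedtype.coord_continuous R 1 n.+1 0 k). Qed.

Lemma bounded_row_compact n (K : set 'rV[R]_n.+1) (r : R) : closed K -> 0 <= r ->
  (forall x : 'rV[R]_n.+1, K x -> forall k, `|x 0 k| <= r) -> compact K.
Proof.
move=> clK r0 h; apply: bounded_closed_compact => //; exists r; split; first exact: num_real.
move=> M rM x Kx; apply: le_trans (ltW rM).
by apply: norm_le_coord => // k; exact: h.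
Qed.

Lemma level_closed (T : topologicalType) (f : T -> R) (a : R) : continuous f -> closed [set x | f x = a].
Proof. by move=> cf; apply: (closed_comp (D := [set a])) => // x _; exact: cf. Qed.

(** A minimum over a compact set of unit vectors, extended by homogeneity. With [w = 0] the
    constraint is void. *)
Lemma constrained_min S w : (exists2 x, dot x x = 1 & dot x w = 0) ->
  exists x, [/\ dot x x = 1, dot x w = 0 & forall y, dot y w = 0 -> qf S x x * dot y y <= qf S y y].
Proof.
move=> [x0 x01 x0w]; pose K := [set x | dot x x = 1] `&` [set x | dot x w = 0].
have cdot (f h : 'rV[R]_3 -> 'rV[R]_3) x : (forall k, cont_at (fun y => f y 0 k) x) ->
    (forall k, cont_at (fun y => h y 0 k) x) -> cont_at (fun y => dot (f y) (h y)) x.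
  move=> cf ch; rewrite (_ : (fun y => _) = fun y => \sum_k f y 0 k * h y 0 k).
    by apply: continuous_sum => k; exact: continuous_mul.
  by apply/funext => y; rewrite /dot mxE; ext_sum k; rewrite mxE.
have cid (x : 'rV[R]_3) k : cont_at (fun y : 'rV[R]_3 => y 0 k) x by exact: row_coord_continuous.
have ccst (a x : 'rV[R]_3) k : cont_at (fun _ : 'rV[R]_3 => a 0 k) x by exact: cst_continuous.
have cK : compact K.
  apply: (@bounded_row_compact 2 K 1) => //.
    by apply: closedI; apply: level_closed => x; exact: cdot.
  move=> x [/= x1 _] k; move: x1; rewrite dotE => x1.
  have bd (a b c : R) : a * a + b * b + c * c = 1 -> `|a| <= 1.
    have := sqr_ge0 b; have := sqr_ge0 c => ? ? ?.
    by rewrite ler_norml; apply/andP; split; nra.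
  case: k => -[|[|[|//]]] i; [rewrite (_ : Ordinal i = 0)|rewrite (_ : Ordinal i = 1)|
    rewrite (_ : Ordinal i = 2%:R)]; try exact/val_inj.
  - exact: bd x1.
  - by apply: (bd _ (x 0 0) (x 0 2%:R)); rewrite -x1; ring.
  by apply: (bd _ (x 0 0) (x 0 1)); rewrite -x1; ring.
have [||x [/= x1 xw] hx] := compact_min cK (u := fun x => qf S x x).
- by exists x0.
- move=> x _; apply: (cdot (fun y => y *m S) id) => // k.
  rewrite (_ : (fun y => _) = fun y : 'rV[R]_3 => \sum_l y 0 l * S l k).
    by apply: continuous_sum => l; apply: continuous_mul => //; exact: cst_continuous.
  by apply/funext => y; rewrite mxE.
exists x; split=> // y yw; have [y0|y0] := eqVneq (dot y y) 0.
  by rewrite (dot_eq0 y0) /qf /dot !mul0mx !mxE mulr0.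
pose m := (Num.sqrt (dot y y))^-1.
have dy : 0 < dot y y by rewrite lt_neqAle eq_sym y0 dot_ge0.
have m2 : m ^+ 2 = (dot y y)^-1 by rewrite exprVn sqr_sqrtr // ltW.
have z0 : 0 *: y = 0 by rewrite scale0r.
have /hx : K (m *: y).
  rewrite /K /= -(addr0 (m *: y)) -z0; split; rewrite ?dot_comb ?dotDl ?yw; last by ring.
  by rewrite m2 expr0n /= mulr0 !mul0r !addr0 mulVf.
rewrite /= -(addr0 (m *: y)) -z0 /qf -!/(qf S _ _) => h.
have -> : qf S y y = dot y y * qf S (m *: y) (m *: y).
  have -> : qf S (m *: y) (m *: y) = m ^+ 2 * qf S y y.
    by rewrite /qf linearZ /= -!scalemxAl -scalemxAr scalerA mxE.
  by rewrite m2 mulrA mulfV ?mul1r.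
by rewrite mulrC ler_pM2l //; move: h; rewrite z0 addr0.
Qed.

(** If [b] were not 0, a small [t] of opposite sign would let the linear term win; [- b / (|c| + 1)]
    is small enough. *)
Lemma first_order (b c : R) : (forall t, 0 <= 2 * t * b + t ^+ 2 * c) -> b = 0.
Proof.
move=> h; have c1 : 0 < `|c| + 1 by rewrite ltr_wpDl.
have hc := ler_norm c; have := h (- b / (`|c| + 1)).
set d := `|c| + 1 in c1 *; have -> : 2 * (- b / d) * b + (- b / d) ^+ 2 * c = (b ^+ 2 * (c - 2 * d)) / d ^+ 2.
  by field; rewrite gt_eqF.
rewrite pmulr_lge0 ?invr_gt0 ?exprn_gt0 // => h'; apply/eqP; rewrite -sqrf_eq0; apply/eqP.
have := sqr_ge0 b; have := normr_ge0 c; have : c - 2 * d < - 1 by rewrite /d; have := normr_ge0 c; lra.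
by move=> ?; nra.
Qed.

Definition cross x y : 'rV[R]_3 := \row_k [:: x 0 1 * y 0 2%:R - x 0 2%:R * y 0 1;
  x 0 2%:R * y 0 0 - x 0 0 * y 0 2%:R; x 0 0 * y 0 1 - x 0 1 * y 0 0]`_k.

Lemma crossE x y : (cross x y 0 0 = x 0 1 * y 0 2%:R - x 0 2%:R * y 0 1) *
  (cross x y 0 1 = x 0 2%:R * y 0 0 - x 0 0 * y 0 2%:R) * (cross x y 0 2%:R = x 0 0 * y 0 1 - x 0 1 * y 0 0).
Proof. by rewrite !mxE. Qed.

(* The minima of the quadratic form on the unit sphere and then on the unit circle orthogonal to the
   first minimiser are the two smallest eigenvalues. *)
Lemma rotation_diagonal S : S^T = S -> exists x0 x1 x2, [/\ [/\ dot x0 x0 = 1, dot x1 x1 = 1 & dot x0 x1 = 0],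
  x2 = cross x0 x1, [/\ qf S x0 x1 = 0, qf S x0 x2 = 0 & qf S x1 x2 = 0] &
  qf S x0 x0 <= qf S x1 x1 <= qf S x2 x2 /\ forall y, qf S x0 x0 * dot y y <= qf S y y].
Proof.
move=> sS; pose e k : 'rV[R]_3 := delta_mx 0 k.
have [|x0 [x00 _ h0]] := @constrained_min S 0.
  by exists (e 0); rewrite dotE !mxE /=; ring.
have {}h0 y : qf S x0 x0 * dot y y <= qf S y y.
  by apply: h0; rewrite dotE !mxE; ring.
have stat (x : 'rV[R]_3) w : dot x x = 1 -> dot w x = 0 -> (forall t : R, qf S x x * dot (1 *: x + t *: w) (1 *: x + t *: w) <=
    qf S (1 *: x + t *: w) (1 *: x + t *: w)) -> qf S x w = 0.
  move=> xx xw h; apply: (first_order (c := qf S w w - qf S x x * dot w w)) => t.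
  by have := h t; rewrite qf_comb // dot_comb xx (dotC x w) xw; lra.
have [|x1 [x11 x10 h1]] := @constrained_min S x0.
  have [z|z] := eqVneq (x0 0 0 ^+ 2 + x0 0 1 ^+ 2) 0.
    have h a b : a ^+ 2 + b ^+ 2 = 0 -> a = 0 :> R.
      by move=> hz; apply/eqP; rewrite -sqrf_eq0; have := sqr_ge0 a; have := sqr_ge0 b => ? ?; apply/eqP; lra.
    by exists (e 0); rewrite dotE !mxE /= ?(h _ _ z); ring.
  set m := Num.sqrt (x0 0 0 ^+ 2 + x0 0 1 ^+ 2).
  have m2 : m ^+ 2 = x0 0 0 ^+ 2 + x0 0 1 ^+ 2 by rewrite sqr_sqrtr ?addr_ge0 ?sqr_ge0.
  have m0 : m != 0 by apply: contraNneq z => m0; rewrite -m2 m0 expr0n.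
  exists ((- x0 0 1 / m) *: e 0 + (x0 0 0 / m) *: e 1); rewrite dotE !mxE /=; last by field.
  apply: (mulfI (expf_neq0 2 m0)); apply: (etrans _ (esym (etrans (mulr1 _) m2))); by field.
pose x2 := cross x0 x1; have x20 : dot x2 x0 = 0 by rewrite dotE !crossE; ring.
have x21 : dot x2 x1 = 0 by rewrite dotE !crossE; ring.
have x22 : dot x2 x2 = 1.
  have : dot x2 x2 = dot x0 x0 * dot x1 x1 - dot x1 x0 ^+ 2 by rewrite !dotE !crossE; ring.
  by rewrite x00 x11 x10 => ->; ring.
exists x0, x1, x2; split=> //; first by rewrite dotC.
  split; [exact: stat|exact: stat|apply: stat => // t].
  by apply: h1; rewrite dotDl x10 x20; ring.
split=> //; apply/andP; split.
  by have := h0 x1; rewrite x11 mulr1.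
by have := h1 x2 x20; rewrite x22 mulr1.
Qed.

(** Entries indexed by natural numbers let the cofactor expansion compute down to a polynomial. *)
Definition det_nat n (m : nat -> nat -> R) := \det (\matrix_(i < n, j < n) m i j).

Lemma det_expand n m : det_nat n.+1 m = \sum_(j < n.+1) m 0%N j * ((-1) ^+ j * det_nat n (fun i k => m i.+1 (bump j k))).
Proof.
rewrite [LHS](expand_det_row _ ord0); ext_sum j; rewrite mxE /cofactor add0n.
by congr (_ * (_ * \det _)); apply/matrixP => i k; rewrite !mxE.
Qed.

Lemma det_nat0 m : det_nat 0 m = 1.
Proof. exact: det_mx00. Qed.

Lemma det3E (m : nat -> nat -> R) : det_nat 3 m =
  m 0%N 0%N * (m 1%N 1%N * m 2%N 2%N - m 1%N 2%N * m 2%N 1%N) - m 0%N 1%N * (m 1%N 0%N * m 2%N 2%N - m 1%N 2%N * m 2%N 0%N)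
  + m 0%N 2%N * (m 1%N 0%N * m 2%N 1%N - m 1%N 1%N * m 2%N 0%N).
Proof.
rewrite !(det_expand, big_ord_recl, big_ord0, det_nat0) /= /bump /=; ring.
Qed.

Lemma det4E (m : nat -> nat -> R) (d := fun a b c : nat => m 1%N a * (m 2%N b * m 3%N c - m 2%N c * m 3%N b)
    - m 1%N b * (m 2%N a * m 3%N c - m 2%N c * m 3%N a) + m 1%N c * (m 2%N a * m 3%N b - m 2%N b * m 3%N a)) :
  det_nat 4 m = m 0%N 0%N * d 1%N 2%N 3%N - m 0%N 1%N * d 0%N 2%N 3%N + m 0%N 2%N * d 0%N 1%N 3%N - m 0%N 3%N * d 0%N 1%N 2%N.
Proof.
rewrite /d !(det_expand, big_ord_recl, big_ord0, det_nat0) /= /bump /=; ring.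
Qed.

Definition row3 x y w : 'M[R]_3 := \matrix_(i, j) ([:: x; y; w]`_i) 0 j.

Lemma row3_gram x y w S (P := row3 x y w) (v := fun i : 'I_3 => [:: x; y; w]`_i) (i j : 'I_3) :
  (P *m S *m P^T) i j = qf S (v i) (v j).
Proof.
have -> : v i = row i P by apply/rowP => k; rewrite !mxE.
have -> : v j = row j P by apply/rowP => k; rewrite !mxE.
by rewrite /qf -row_mul mxE [RHS]mxE; ext_sum k; rewrite !mxE.
Qed.

Lemma ord3P (i : 'I_3) : [\/ i = 0, i = 1 | i = 2%:R].
Proof. by case: i => -[|[|[|//]]] i; [constructor 1|constructor 2|constructor 3]; exact/val_inj. Qed.

Lemma char_poly_orthogonal S P : P *m P^T = 1%:M -> char_poly (P *m S *m P^T) = char_poly S.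
Proof.
move=> on; pose C := map_mx (@polyC R) : 'M[R]_3 -> 'M[{poly R}]_3.
have onC : C P *m C P^T = 1%:M by rewrite /C -map_mxM on map_mx1.
rewrite /char_poly /char_poly_mx !map_mxM -!/(C _).
have -> : 'X%:M - C P *m C S *m C P^T = C P *m ('X%:M - C S) *m C P^T.
  rewrite mulmxBr mulmxBl; congr (_ - _).
  by rewrite scalar_mxC -mulmxA onC mulmx1.
by rewrite !det_mulmx mulrC mulrA -det_mulmx (mulmx1C onC) det1 mul1r.
Qed.

(** The polynomial determines its sorted list of roots, so the choice inside [eigval] is
    harmless. *)
Lemma eigval_sorted (s : seq R) S k : sorted <=%R s -> char_poly S = \prod_(a <- s) ('X - a%:P) -> eigval k S = s`_k.-1.
Proof.
move=> ss cs; rewrite /eigval; case: xgetP => [t _ [st ct]|]; last by move=> /(_ s) [].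
congr nth; apply: (sorted_eq le_trans le_anti st ss).
by apply: prod_XsubC_eq; rewrite -ct.
Qed.

Lemma spectral S : S^T = S -> exists P, [/\ P *m P^T = 1%:M, \det P = 1,
  P *m S *m P^T = diag_mx (\row_j eigval (nat_of_ord j).+1 S),
  eigval 1 S <= eigval 2 S <= eigval 3 S & forall y, eigval 1 S * dot y y <= qf S y y].
Proof.
move=> sS; have [x0 [x1 [x2 [[x00 x11 x01] x2E [q01 q02 q12] [le hmin]]]]] := rotation_diagonal sS.
pose P := row3 x0 x1 x2; exists P.
have x02 : dot x0 x2 = 0 by rewrite x2E dotE !crossE; ring.
have x12 : dot x1 x2 = 0 by rewrite x2E dotE !crossE; ring.
have x22 : dot x2 x2 = 1.
  have -> : dot x2 x2 = dot x0 x0 * dot x1 x1 - dot x0 x1 ^+ 2 by rewrite x2E !dotE !crossE; ring.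
  by rewrite x00 x11 x01; ring.
have qf1 x y : qf 1%:M x y = dot x y by rewrite /qf mulmx1.
have on : P *m P^T = 1%:M.
  apply/matrixP => i j; rewrite -[P in P *m _]mulmx1 row3_gram qf1 mxE.
  by case: (ord3P i) => ->; case: (ord3P j) => ->; rewrite /= ?(dotC x1 x0) ?(dotC x2 x0) ?(dotC x2 x1).
pose d : 'rV[R]_3 := \row_j qf S [:: x0; x1; x2]`_j [:: x0; x1; x2]`_j.
have PSP : P *m S *m P^T = diag_mx d.
  apply/matrixP => i j; rewrite row3_gram !mxE.
  by case: (ord3P i) => ->; case: (ord3P j) => ->; rewrite /= ?mulr1n ?mulr0n // 1?qfC // ?q01 ?q02 ?q12.
have cs : char_poly S = \prod_(a <- [:: d 0 0; d 0 1; d 0 2%:R]) ('X - a%:P).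
  rewrite -(char_poly_orthogonal S on) PSP char_poly_trig ?diag_mx_is_trig //.
  by rewrite !big_cons big_nil mulr1 !big_ord_recl big_ord0 mulr1 !mxE !eqxx !mulr1n.
have sd : sorted <=%R [:: d 0 0; d 0 1; d 0 2%:R].
  by move: le => /andP[h1 h2]; rewrite /= !mxE /= h1 h2.
have ev := eigval_sorted _ sd cs; rewrite !ev /= !mxE; split=> //.
- have -> : \det P = det_nat 3 (fun k l => ([:: x0; x1; x2]`_k) 0 (inord l)).
    by congr determinant; apply/matrixP => i j; rewrite !mxE inord_val.
  have i0 : inord 0 = 0 :> 'I_3 by apply/val_inj; rewrite /= inordK.
  have i1 : inord 1 = 1 :> 'I_3 by apply/val_inj; rewrite /= inordK.
  have i2 : inord 2 = 2%:R :> 'I_3 by apply/val_inj; rewrite /= inordK.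
  by rewrite det3E /= i0 i1 i2 -[RHS]x22 {1}x2E !dotE x2E !crossE; ring.
- rewrite PSP; congr diag_mx; apply/rowP => j; rewrite [RHS]mxE ev.
  by case: (ord3P j) => ->.
Qed.
End SpectralTheorem.

(** * The half curvature under rotations of the frame *)

Section HalfFrames.
Variables (R : realType) (M : topologicalType) (X : manifold4 R M) (g : metric X) (o : orientation X).
Implicit Types (i j : chart X) (p : M) (E Q : 'M[R]_4) (a b c : 'I_3).

Lemma half_basisE (s : R) E a : half_basis s E a = (Num.sqrt 2)^-1 *:
  (wedge (row o0 E) (row (pair1 a) E) + s *: wedge (row (pair2 a) E) (row (pair3 a) E)).
Proof. by rewrite /half_basis (_ : inord 0 = o0) //; apply/val_inj; rewrite /= inordK. Qed.

Lemma wedge_mul u v E : wedge (u *m E) (v *m E) = E^T *m wedge u v *m E :> 'M[R]_4.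
Proof. by rewrite /wedge !trmx_mul mulmxBr mulmxBl !mulmxA. Qed.

Lemma half_basis_mul (s : R) Q E a : half_basis s (Q *m E) a = E^T *m half_basis s Q a *m E.
Proof.
rewrite !half_basisE !row_mul !wedge_mul -scalemxAr -scalemxAl; congr (_ *: _).
move: (wedge _ _) (wedge _ _) => A B; by rewrite mulmxDr mulmxDl -scalemxAr -scalemxAl.
Qed.

Lemma I4P (x : I4) : x = o0 \/ exists a, x = pair1 a.
Proof.
case: x => -[|[|[|[|//]]]] i; first by left; exact/val_inj.
- by right; exists 0; apply/val_inj; rewrite /= inordK.
- by right; exists 1; apply/val_inj; rewrite /= inordK.
by right; exists 2%:R; apply/val_inj; rewrite /= inordK.
Qed.

Definition nat4 (k : nat) : I4 := inord k.

Lemma pairE : ((o0 = nat4 0) * (pair1 0 = nat4 1) * (pair1 1 = nat4 2) * (pair1 2%:R = nat4 3)) *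
  ((pair2 0 = nat4 2) * (pair2 1 = nat4 3) * (pair2 2%:R = nat4 1)) *
  ((pair3 0 = nat4 3) * (pair3 1 = nat4 1) * (pair3 2%:R = nat4 2)).
Proof. by do !split; apply/val_inj; rewrite /= ?inordK. Qed.

Lemma nat4_eq k l : (k < 4)%N -> (l < 4)%N -> (nat4 k == nat4 l) = (k == l).
Proof. by move=> hk hl; rewrite -val_eqE /= !inordK. Qed.

Lemma wedgeE (u v : 'rV[R]_4) k l : wedge u v k l = u 0 k * v 0 l - v 0 k * u 0 l.
Proof. by rewrite /wedge !mxE !big_ord1 !mxE. Qed.

Lemma sum4_nat (F : I4 -> R) : \sum_k F k = F (nat4 0) + F (nat4 1) + F (nat4 2) + F (nat4 3).
Proof. by rewrite sum4 -!pairE; congr (F _ + F _ + F _ + F _); apply/val_inj; rewrite /= inordK. Qed.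

(** A self-dual or anti-self-dual skew matrix is determined by its three entries in row 0. *)
Lemma self_dual_basis (s : R) (q : 'M[R]_4) : (forall k l, q k l = - q l k) ->
  (forall a, q (pair2 a) (pair3 a) = s * q o0 (pair1 a)) ->
  q = \sum_a q o0 (pair1 a) *: (wedge (row o0 1%:M) (row (pair1 a) 1%:M)
    + s *: wedge (row (pair2 a) 1%:M) (row (pair3 a) 1%:M)).
Proof.
move=> sk sd; have := sd 0; have := sd 1; have := sd 2%:R; rewrite !pairE => d3 d2 d1.
have z k : q k k = 0 by have := sk k k; lra.
have nE (x : I4) : [\/ x = nat4 0, x = nat4 1, x = nat4 2 | x = nat4 3].
  by case: (I4P x) => [->|[a ->]]; [constructor 1|case: (ord3P a) => ->];
    [|constructor 2|constructor 3|constructor 4]; rewrite ?pairE.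
apply/matrixP => k l; rewrite sum3 !mxE !big_ord1 !mxE !pairE.
by case: (nE k) => ->; case: (nE l) => ->; rewrite !nat4_eq // /= ?z ?d1 ?d2 ?d3
  ?(sk (nat4 3) (nat4 2)) ?(sk (nat4 2) (nat4 1)) ?(sk (nat4 1) (nat4 3)) ?d1 ?d2 ?d3 ?(sk _ (nat4 0)); ring.
Qed.

Section Hodge.
Variables u v w z : nat -> R.
Let ip4 (x y : nat -> R) := x 0%N * y 0%N + x 1%N * y 1%N + x 2%N * y 2%N + x 3%N * y 3%N.
Let d3 k l m := u k * (v l * z m - v m * z l) - u l * (v k * z m - v m * z k) + u m * (v k * z l - v l * z k).
Hypothesis cols : forall k l, (k < 4)%N -> (l < 4)%N -> u k * u l + v k * v l + w k * w l + z k * z l = (k == l)%:R.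
Hypotheses (zz : ip4 z z = 1) (uz : ip4 u z = 0) (vz : ip4 v z = 0).
Hypothesis det1 : det_nat 4 (fun k => nth u [:: u; v; w; z] k) = 1.

(** The vector [w] is orthogonal to [u], [v], [z], so it is given by their minors; the determinant
    fixes the sign. *)
Let third_row : [/\ w 0%N = d3 1 2 3, w 1%N = - d3 0 2 3, w 2%N = d3 0 1 3 & w 3%N = - d3 0 1 2].
Proof.
pose N := [:: d3 1 2 3; - d3 0 2 3; d3 0 1 3; - d3 0 1 2]; pose n k := N`_k.
have nu : ip4 n u = 0 by rewrite /ip4 /n /= /d3; ring.
have nv : ip4 n v = 0 by rewrite /ip4 /n /= /d3; ring.
have nz : ip4 n z = 0 by rewrite /ip4 /n /= /d3; ring.
have nw : ip4 n w = 1 by rewrite -det1 det4E /ip4 /n /= /d3; ring.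
have key k : (k < 4)%N -> w k = n k.
  move=> k4; have : n 0%N * (k == 0)%:R + n 1%N * (k == 1)%:R + n 2%N * (k == 2)%:R + n 3%N * (k == 3)%:R = n k.
    by case: k k4 => [|[|[|[|//]]]] _ /=; ring.
  rewrite -!cols // => <-; transitivity (ip4 n u * u k + ip4 n v * v k + ip4 n w * w k + ip4 n z * z k).
    by rewrite nu nv nw nz; ring.
  by rewrite /ip4; ring.
by split; rewrite key.
Qed.

(* The plane of the last two vectors is the Hodge dual of that of the first two. *)
Lemma hodge_dual (p := fun k l => u k * v l - u l * v k) (q := fun k l => w k * z l - w l * z k) :
  [/\ q 2 3 = p 0 1, q 3 1 = p 0 2 & q 1 2 = p 0 3]%N /\ [/\ q 0 1 = p 2 3, q 0 2 = p 3 1 & q 0 3 = p 1 2]%N.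
Proof.
have [w0 w1 w2 w3] := third_row.
have E k l : p k l = p k l * ip4 z z - (z k * v l - z l * v k) * ip4 u z - (u k * z l - u l * z k) * ip4 v z.
  by rewrite zz uz vz; ring.
by split; split; rewrite E /q ?w0 ?w1 ?w2 ?w3 /p /ip4 /d3; ring.
Qed.

End Hodge.

(** The action of [Q] in SO(4) on one half of the bivectors, read off from components with first
    index 0. *)
Definition rotation (s : R) Q : 'M[R]_3 := \matrix_(a, b) (wedge (row o0 Q) (row (pair1 a) Q)
  + s *: wedge (row (pair2 a) Q) (row (pair3 a) Q)) o0 (pair1 b).

(** [hodge_dual] for the rows of [Q], the last three being permuted cyclically so that [pair1 a]
    comes first; this leaves the determinant unchanged. *)
Lemma plane_dual Q a (e : 'I_3) (p := wedge (row o0 Q) (row (pair1 a) Q)) (q := wedge (row (pair2 a) Q) (row (pair3 a) Q)) :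
  Q *m Q^T = 1%:M -> \det Q = 1 -> q (pair2 e) (pair3 e) = p o0 (pair1 e) /\ q o0 (pair1 e) = p (pair2 e) (pair3 e).
Proof.
move=> on det1.
have rows k l : (k < 4)%N -> (l < 4)%N -> Q (nat4 k) (nat4 0) * Q (nat4 l) (nat4 0) + Q (nat4 k) (nat4 1) * Q (nat4 l) (nat4 1)
    + Q (nat4 k) (nat4 2) * Q (nat4 l) (nat4 2) + Q (nat4 k) (nat4 3) * Q (nat4 l) (nat4 3) = (k == l)%:R.
  move=> hk hl; have := congr1 (fun A : 'M[R]_4 => A (nat4 k) (nat4 l)) on.
  by rewrite !mxE nat4_eq // sum4_nat !mxE.
have cols k l : (k < 4)%N -> (l < 4)%N -> Q (nat4 0) (nat4 k) * Q (nat4 0) (nat4 l) + Q (nat4 1) (nat4 k) * Q (nat4 1) (nat4 l)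
    + Q (nat4 2) (nat4 k) * Q (nat4 2) (nat4 l) + Q (nat4 3) (nat4 k) * Q (nat4 3) (nat4 l) = (k == l)%:R.
  move=> hk hl; have := congr1 (fun A : 'M[R]_4 => A (nat4 k) (nat4 l)) (mulmx1C on).
  by rewrite !mxE nat4_eq // sum4_nat !mxE.
have detE : det_nat 4 (fun k l => Q (nat4 k) (nat4 l)) = 1.
  by rewrite -det1; congr determinant; apply/matrixP => k l; rewrite !mxE /nat4 !inord_val.
pose f k l := Q (nat4 k) (nat4 l).
pose P k l x y := f k x * f l y - f k y * f l x.
pose dual (b c d : nat) := [/\ [/\ pair1 a = nat4 b, pair2 a = nat4 c & pair3 a = nat4 d],
    [/\ P c d 2 3 = P 0%N b 0 1, P c d 3 1 = P 0%N b 0 2 & P c d 1 2 = P 0%N b 0 3]%N &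
    [/\ P c d 0 1 = P 0%N b 2 3, P c d 0 2 = P 0%N b 3 1 & P c d 0 3 = P 0%N b 1 2]%N].
have [b [c [d [[E1 E2 E3] [D1 D2 D3] [D4 D5 D6]]]]] : exists b c d : nat, dual b c d.
  have cyc (b c d : nat) : pair1 a = nat4 b -> pair2 a = nat4 c -> pair3 a = nat4 d -> (forall k l, (k < 4)%N -> (l < 4)%N ->
        f 0%N k * f 0%N l + f b k * f b l + f c k * f c l + f d k * f d l = (k == l)%:R) ->
      [&& (d < 4)%N, (b < 4)%N, (0 != d)%N & (b != d)%N] ->
      det_nat 4 (fun k => nth (f 0%N) [:: f 0%N; f b; f c; f d] k) = 1 -> exists b c d : nat, dual b c d.
    move=> e1 e2 e3 co /and4P[ld lb n0 nb] de; exists b, c, d; split=> //.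
      by apply: (hodge_dual co _ _ _ de).1; rewrite rows // ?eqxx ?(negPf n0) ?(negPf nb).
    by apply: (hodge_dual co _ _ _ de).2; rewrite rows // ?eqxx ?(negPf n0) ?(negPf nb).
  case: (ord3P a) => aE; [apply: (cyc 1 2 3)%N|apply: (cyc 2 3 1)%N|apply: (cyc 3 1 2)%N];
    rewrite ?aE ?pairE //; first [by move=> k l hk hl; rewrite -cols // /f; ring |by rewrite -detE !det4E /f /=; ring].
rewrite /p /q !wedgeE !mxE !E1 !E2 !E3; case: (ord3P e) => ->; rewrite !pairE; move: D1 D2 D3 D4 D5 D6;
  rewrite /P /f => D1 D2 D3 D4 D5 D6; split; lra.
Qed.

Lemma half_basis_rotation (s : R) Q a : s = 1 \/ s = -1 -> Q *m Q^T = 1%:M -> \det Q = 1 ->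
  half_basis s Q a = \sum_b rotation s Q a b *: half_basis s 1%:M b.
Proof.
move=> hs on det1; set q := wedge (row o0 Q) (row (pair1 a) Q) + s *: wedge (row (pair2 a) Q) (row (pair3 a) Q).
have qE : forall k l, q k l = wedge (row o0 Q) (row (pair1 a) Q) k l + s * wedge (row (pair2 a) Q) (row (pair3 a) Q) k l.
  by move=> k l; rewrite /q !mxE.
have ss : s * s = 1 by case: hs => ->; ring.
have -> : half_basis s Q a = (Num.sqrt 2)^-1 *: q by rewrite half_basisE.
rewrite {1}(self_dual_basis (s := s) (q := q)).
- rewrite scaler_sumr; ext_sum b'; rewrite half_basisE scalerA mulrC -scalerA.
  by have -> : rotation s Q a b' = q o0 (pair1 b') by rewrite [LHS]mxE.
- by move=> k l; rewrite !qE !wedgeE; ring.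
move=> b; rewrite !qE; have [-> ->] := plane_dual a b on det1.
by rewrite mulrDr mulrA ss mul1r addrC.
Qed.

Definition half_matrix (s : R) i (x : 'rV[R]_4) E : 'M[R]_3 :=
  \matrix_(a, b) curvature_form g i x (half_basis s E a) (half_basis s E b).

Lemma curvature_form_sum i x (I : finType) (c : I -> R) (v : I -> 'M[R]_4) z :
  (curvature_form g i x (\sum_k c k *: v k) z = \sum_k c k * curvature_form g i x (v k) z) *
  (curvature_form g i x z (\sum_k c k *: v k) = \sum_k c k * curvature_form g i x z (v k)).
Proof.
rewrite /curvature_form; split; under [RHS]eq_bigr do rewrite mulrCA; rewrite -mulr_sumr; congr (_ * _);
  do 4! (under [RHS]eq_bigr do rewrite mulr_sumr; rewrite [RHS]exchange_big; apply: eq_bigr => ? _ /=);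
  rewrite summxE mulr_sumr ?mulr_suml; ext_sum k; rewrite mxE; ring.
Qed.

Lemma half_matrix_rotation (s : R) i x Q E : s = 1 \/ s = -1 -> Q *m Q^T = 1%:M -> \det Q = 1 ->
  half_matrix s i x (Q *m E) = rotation s Q *m half_matrix s i x E *m (rotation s Q)^T.
Proof.
move=> hs on det1.
have E1 a : half_basis s (Q *m E) a = \sum_b rotation s Q a b *: half_basis s E b.
  rewrite half_basis_mul half_basis_rotation // mulmx_sumr mulmx_suml; ext_sum b.
  by rewrite -scalemxAr -scalemxAl -half_basis_mul mul1mx.
apply/matrixP => a b; rewrite [LHS]mxE !E1 curvature_form_sum [RHS]mxE.
under eq_bigr do rewrite curvature_form_sum mulr_sumr.
swap_sum d => /=.
have -> : (rotation s Q)^T d b = rotation s Q b d by rewrite mxE.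
rewrite [X in X * _]mxE mulr_suml; ext_sum e; rewrite [half_matrix _ _ _ _ e d]mxE; ring.
Qed.

(* The half basis has norm 1 because the Pfaffian of a decomposable bivector vanishes. *)
Lemma rotation_norm (s : R) Q : s = 1 \/ s = -1 -> Q *m Q^T = 1%:M -> \det Q = 1 ->
  dot (row 0 (rotation s Q)) (row 0 (rotation s Q)) = 1.
Proof.
move=> hs on det1; pose u := row o0 Q; pose v := row (pair1 0) Q.
have W b : rotation s Q 0 b = wedge u v o0 (pair1 b) + s * wedge u v (pair2 b) (pair3 b).
  by rewrite -(plane_dual 0 b on det1).2 mxE [LHS]mxE [X in _ + X]mxE.
have rr k l : \sum_m Q k m * Q l m = (k == l)%:R.
  have := congr1 (fun A : 'M[R]_4 => A k l) on; rewrite !mxE => <-.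
  by ext_sum m; rewrite mxE.
have := rr o0 (pair1 0); have := rr (pair1 0) (pair1 0); have := rr o0 o0.
rewrite dotE ![row 0 _ _ _]mxE !W !wedgeE /u /v !pairE !sum4_nat !nat4_eq //= => uu vv uv.
rewrite ![row _ _ _ _]mxE; move: uu vv uv.
set a0 := Q _ (nat4 0); set a1 := Q _ (nat4 1); set a2 := Q _ (nat4 2); set a3 := Q _ (nat4 3).
set b0 := Q (nat4 1) (nat4 0); set b1 := Q _ (nat4 1); set b2 := Q _ (nat4 2); set b3 := Q _ (nat4 3) => uu vv uv.
transitivity ((a0 * a0 + a1 * a1 + a2 * a2 + a3 * a3) * (b0 * b0 + b1 * b1 + b2 * b2 + b3 * b3)
  - (a0 * b0 + a1 * b1 + a2 * b2 + a3 * b3) ^+ 2); last by rewrite uu vv uv; ring.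
by case: hs => ->; ring.
Qed.

Lemma con_wedge (T : seq I4 -> R) u v w z :
  4^-1 * \sum_k \sum_l \sum_m \sum_n T [:: k; l; m; n] * wedge u v k l * wedge w z m n =
  4^-1 * (con T [:: u; v; w; z] - con T [:: v; u; w; z] - con T [:: u; v; z; w] + con T [:: v; u; z; w]).
Proof.
have E (u' v' w' z' : 'rV[R]_4) : con T [:: u'; v'; w'; z'] =
    \sum_k \sum_l \sum_m \sum_n T [:: k; l; m; n] * (u' 0 k * v' 0 l) * (w' 0 m * z' 0 n).
  rewrite /=; ext_sum k; rewrite mulr_sumr; ext_sum l.
  rewrite !mulr_sumr; ext_sum m; rewrite !mulr_sumr; ext_sum n; ring.
congr (_ * _); rewrite !E -!sumrB -big_split; ext_sum k; rewrite -!sumrB -big_split.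
ext_sum l; rewrite -!sumrB -big_split; ext_sum m; rewrite -!sumrB -big_split.
by ext_sum n; rewrite /= !wedgeE; ring.
Qed.

Definition frame_curvature i x E (k l m n : I4) := con (riemT g i x) [:: row k E; row l E; row m E; row n E].

Lemma half_matrixE (s : R) i x E a b : codom i x -> E *m gram g i x *m E^T = 1%:M ->
  half_matrix s i x E a b = half_form (frame_curvature i x E) s s a b.
Proof.
move=> Vx on; have cw k l m n : curvature_form g i x (wedge (row k E) (row l E)) (wedge (row m E) (row n E)) =
    frame_curvature i x E k l m n.
  rewrite [LHS](con_wedge (riemT g i x)) -!/(frame_curvature i x E _ _ _ _).
  have sk k' l' m' n' : frame_curvature i x E l' k' m' n' = - frame_curvature i x E k' l' m' n' := curvature_skew Vx on k' l' m' n'.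
  have pr k' l' m' n' : frame_curvature i x E k' l' m' n' = frame_curvature i x E m' n' k' l' := curvature_pair Vx on k' l' m' n'.
  by rewrite !(sk k l) (pr k l n m) (sk m n) -(pr k l m n); field.
pose c := (Num.sqrt 2)^-1 : R; have c2 : c * c = 2^-1 by rewrite -expr2 exprVn sqr_sqrtr.
(* The sum of two terms is written over [bool] so that bilinearity is an instance of
   [curvature_form_sum]. *)
have hb d : half_basis s E d = \sum_(e : bool) (if e then c else c * s) *:
    (if e then wedge (row o0 E) (row (pair1 d) E) else wedge (row (pair2 d) E) (row (pair3 d) E)).
  by rewrite big_bool /= half_basisE scalerDr scalerA.
rewrite mxE !hb curvature_form_sum big_bool /= !curvature_form_sum !big_bool /= !cw.
rewrite /half_form -c2; ring.
Qed.

Lemma con_mulr (T : seq I4 -> R) (J : 'M[R]_4) vs :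
  con (fun s => con T [seq row m J | m : I4 <- s]) vs = con T [seq v *m J | v <- vs].
Proof.
elim: vs T => [|v vs IH] T //=.
under eq_bigr => k _ do (rewrite (con_sum (fun m => row k J 0 m)
  (fun (m : I4) s => con (fun s => T (m :: s)) [seq row n J | n : I4 <- s])) mulr_sumr; under eq_bigr do rewrite IH).
swap_sum m; rewrite mxE mulr_suml; ext_sum k.
by rewrite mxE mulrA.
Qed.

Variable s : R.
Hypothesis hs : s = 1 \/ s = -1.

Section AtPoint.
Variable p : M.

Lemma half_matrix_chart i j E : dom i p -> dom j p -> E *m gram g i (coord i p) *m E^T = 1%:M ->
  half_matrix s i (coord i p) E = half_matrix s j (coord j p) (E *m transition_jac i j p).
Proof.
move=> di dj on; have Vi := codom_coord di; have Vj := codom_coord dj.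
have on' : (E *m transition_jac i j p) *m gram g j (coord j p) *m (E *m transition_jac i j p)^T = 1%:M.
  by rewrite -on (gram_transition g di dj) trmx_mul !mulmxA.
suff FE : frame_curvature i (coord i p) E = frame_curvature j (coord j p) (E *m transition_jac i j p).
  by apply/matrixP => a b; rewrite (half_matrixE s a b Vi on) (half_matrixE s a b Vj on') FE.
do 4!apply/funext => ?; rewrite /frame_curvature.
rewrite (eq_con (T' := fun s => con (riemT g j (coord j p)) [seq row m (transition_jac i j p) | m : I4 <- s])).
  by rewrite con_mulr /= !row_mul.
by move=> r _; exact: riemann4_transition.
Qed.

Lemma oriented_transition i j E : dom i p -> dom j p -> oriented_orthonormal_frame g o i p E ->
  oriented_orthonormal_frame g o j p (E *m transition_jac i j p).
Proof.
move=> di dj [on or]; split; first by rewrite -on (gram_transition g di dj) trmx_mul !mulmxA.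
move: or; rewrite (sgn_transition o di dj) det_mulmx; set d := \det (transition_jac i j p) => or.
have d0 : d != 0 by apply: contraTneq or => ->; rewrite sgr0 !mul0r ltxx.
have : 0 < Num.sg d * sgn o j p * \det E * `|d| by rewrite mulr_gt0 ?normr_gt0.
have dd : Num.sg d * `|d| = d by rewrite -numEsg.
have -> : Num.sg d * sgn o j p * \det E * `|d| = sgn o j p * (\det E * (Num.sg d * `|d|)) by ring.
by rewrite dd.
Qed.

Lemma oriented_exists i : dom i p -> exists E, oriented_orthonormal_frame g o i p E.
Proof.
move=> di; have Vi := codom_coord di.
have [E on] := frame_exists (gram_sym g Vi) (fun v => gram_pos g (v := v) Vi).
have dE : \det E != 0.
  apply/eqP => d0; have := congr1 determinant on; rewrite !det_mulmx d0 !mul0r det1 => /eqP.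
  by rewrite eq_sym oner_eq0.
have s0 : sgn o i p != 0 by rewrite -normr_gt0 (sgn_unit o di).
have := mulf_neq0 s0 dE; rewrite neq_lt => /orP[neg|pos]; last by exists E.
(* Reversing the first frame vector reverses the orientation. *)
pose D : 'M[R]_4 := diag_mx (\row_k (if k == o0 then -1 else 1)).
have DD : D *m D^T = 1%:M.
  rewrite /D tr_diag_mx mulmx_diag; apply/matrixP => k l; rewrite !mxE.
  by case: (k == o0); rewrite ?mulrNN mulr1.
exists (D *m E); split.
  by rewrite trmx_mul !mulmxA -(mulmxA D E) -(mulmxA D (E *m _)) on mulmx1.
have dD : \det D = -1.
  rewrite det_diag prod4 !mxE /=; ring.
by rewrite det_mulmx dD mulN1r mulrN oppr_gt0.
Qed.

Lemma oriented_rotation i E1 E2 : dom i p -> oriented_orthonormal_frame g o i p E1 ->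
  oriented_orthonormal_frame g o i p E2 -> exists Q, [/\ Q *m Q^T = 1%:M, \det Q = 1 & E2 = Q *m E1].
Proof.
move=> di [on1 or1] [on2 or2]; pose G := gram g i (coord i p); pose Q := E2 *m G *m E1^T.
have sG : G^T = G by apply: gram_sym; exact: codom_coord.
have uG : G \in unitmx.
  by have := congr1 determinant on1; rewrite !det_mulmx det1 unitmxE unitfE => h; apply/eqP => d0;
    move/eqP: h; rewrite d0 mulr0 mul0r eq_sym oner_eq0.
have QE : E2 = Q *m E1 by rewrite /Q -!mulmxA (frame_cogram on1) mulmxV // mulmx1.
have on : Q *m Q^T = 1%:M.
  have -> : Q^T = E1 *m (G *m E2^T) by rewrite /Q !trmx_mul trmxK sG.
  by rewrite mulmxA -QE mulmxA.
exists Q; split=> //.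
have : \det Q ^+ 2 == 1 by rewrite expr2 -{2}det_tr -det_mulmx on det1.
rewrite sqrf_eq1 => /orP[/eqP//|/eqP d1].
by move: or2; rewrite QE det_mulmx d1 mulN1r mulrN oppr_gt0 => /(lt_trans or1); rewrite ltxx.
Qed.

Lemma half_curvature_frame i : dom i p -> exists E, oriented_orthonormal_frame g o i p E /\
  half_curvature g o s p = half_matrix s i (coord i p) E.
Proof.
move=> di; rewrite /half_curvature; case: xgetP => [S _ [j [E [dj oE ->]]]|h].
  exists (E *m transition_jac j i p); split; first exact: oriented_transition.
  by rewrite -half_matrix_chart //; case: oE.
by have [E oE] := oriented_exists di; case: (h (half_matrix s i (coord i p) E)); exists i, E.
Qed.

Lemma half_curvature_sym : (half_curvature g o s p)^T = half_curvature g o s p.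
Proof.
have [i di] := dom_cover X p; have [E [[on _] ->]] := half_curvature_frame di.
have Vi := codom_coord di; apply/matrixP => a b; rewrite mxE !half_matrixE //.
have pr k l m n : frame_curvature i (coord i p) E k l m n = frame_curvature i (coord i p) E m n k l :=
  curvature_pair Vi on k l m n.
rewrite /half_form (pr o0 (pair1 b) o0 (pair1 a)) (pr o0 (pair1 b) (pair2 a)) (pr (pair2 b) _ o0).
rewrite (pr (pair2 b) _ (pair2 a)); ring.
Qed.

(** The entry is the value of the quadratic form on a vector that is a unit vector by
    [rotation_norm]. Every oriented frame thus yields an upper barrier for the lowest eigenvalue. *)
Lemma eigval1_le i E : dom i p -> oriented_orthonormal_frame g o i p E ->
  eigval 1 (half_curvature g o s p) <= half_matrix s i (coord i p) E 0 0.
Proof.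
move=> di oE; have [E1 [oE1 SE]] := half_curvature_frame di.
have [Q [on d1 ->]] := oriented_rotation di oE1 oE.
have [_ [_ _ _ _ h]] := spectral half_curvature_sym.
have := h (row 0 (rotation s Q)); rewrite rotation_norm // mulr1 => /le_trans; apply.
rewrite half_matrix_rotation // -SE /qf -row_mul mxE [leRHS]mxE le_eqVlt; apply/orP; left; apply/eqP.
by ext_sum k; rewrite !mxE.
Qed.

(** A rotation that fixes the first frame vector acts on either half of the bivectors by its own 3
    by 3 block, so the diagonalising matrix of [spectral] lifts to SO(4). *)
Lemma eigen_frame i : dom i p -> exists E, oriented_orthonormal_frame g o i p E /\
  half_matrix s i (coord i p) E = diag_mx (\row_j eigval (nat_of_ord j).+1 (half_curvature g o s p)).
Proof.
move=> di; have [E1 [[on1 or1] SE]] := half_curvature_frame di.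
have [P [onP dP diagP _ _]] := spectral half_curvature_sym.
pose Q : 'M[R]_(1 + 3) := block_mx 1%:M 0 0 P.
have onQ : Q *m Q^T = 1%:M.
  by rewrite tr_block_mx mulmx_block !trmx0 trmx1 !mulmx0 !mul0mx mulmx1 onP !addr0 add0r -scalar_mx_block.
have dQ : \det Q = 1 by rewrite det_ublock det1 dP mulr1.
have rot : rotation s Q = P.
  have e0 : o0 = lshift 3 (0 : 'I_1) by apply/val_inj.
  have e1 a : pair1 a = rshift 1 a by apply/val_inj; rewrite /= inordK // ltnS.
  have e2 a : exists b, pair2 a = rshift 1 b.
    by case: (ord3P a) => ->; [exists 1|exists 2%:R|exists 0]; apply/val_inj; rewrite /= inordK.
  have e3 a : exists b, pair3 a = rshift 1 b.
    by case: (ord3P a) => ->; [exists 2%:R|exists 0|exists 1]; apply/val_inj; rewrite /= inordK.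
  have qul : Q (lshift 3 (0 : 'I_1)) (lshift 3 (0 : 'I_1)) = 1.
    by have := block_mxEul (1%:M : 'M[R]_1) 0 0 P 0 0; rewrite [X in _ = X -> _]mxE.
  have qur b : Q (lshift 3 (0 : 'I_1)) (rshift 1 b) = 0.
    by have := block_mxEur (1%:M : 'M[R]_1) 0 0 P 0 b; rewrite [X in _ = X -> _]mxE.
  have qdl a : Q (rshift 1 a) (lshift 3 (0 : 'I_1)) = 0.
    by have := block_mxEdl (1%:M : 'M[R]_1) 0 0 P a 0; rewrite [X in _ = X -> _]mxE.
  have qdr a b : Q (rshift 1 a) (rshift 1 b) = P a b := block_mxEdr (1%:M : 'M[R]_1) 0 0 P a b.
  apply/matrixP => a b; rewrite mxE [LHS]mxE [X in _ + X]mxE !wedgeE ![row _ _ _ _]mxE.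
  have [b2 ->] := e2 a; have [b3 ->] := e3 a; rewrite e0 !e1.
  by rewrite qul !qdr !qur !qdl; ring.
exists (Q *m E1); split.
  split; last by rewrite det_mulmx dQ mul1r.
  by rewrite trmx_mul !mulmxA -(mulmxA Q E1) -(mulmxA Q (E1 *m _)) on1 mulmx1.
by rewrite half_matrix_rotation // rot -SE diagP.
Qed.

End AtPoint.
End HalfFrames.

(** * Barriers for the lowest eigenvalue *)

Section FrameEvolution.
Variables (R : realType) (M : topologicalType) (X : manifold4 R M) (g : metric X) (o : orientation X) (s : R).
Hypothesis hs : s = 1 \/ s = -1.
Implicit Types (i j : chart X) (p : M) (E : 'M[R]_4).
Local Notation A k p := (eigval k (half_curvature g o s p)).

Lemma near_gt (T : topologicalType) (u : T -> R) (p : T) (a : R) : cont_at u p -> a < u p -> \forall t \near p, a < u t.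
Proof.
move=> cu ap; have /cvgrPdist_lt/(_ (u p - a)) := cu; rewrite subr_gt0 => /(_ ap).
by apply: filterS => t /(le_lt_trans (ler_norm _)); rewrite ltrD2l ltrN2.
Qed.

Lemma continuous_det (T : topologicalType) (F : nat -> nat -> T -> R) (p : T) :
  (forall k l, cont_at (F k l) p) -> cont_at (fun t => det_nat 4 (fun k l => F k l t)) p.
Proof.
move=> cF; have c0 (c : R) : cont_at (fun=> c : R) p by exact: cvg_cst.
refine (@big_closed R T (fun u => cont_at u p) +%R 0 _ _ _ _ (c0 0) _ _) => [u w|h]; first exact: cvgD.
apply: continuous_mul => //.
refine (@big_closed R T (fun u => cont_at u p) *%R 1 _ _ _ _ (c0 1) _ _) => [u w|k]; first exact: continuous_mul.
by apply: (near_continuousM _ (cF k _)); apply: nearW => t; rewrite mxE.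
Qed.

Lemma half_form_drv (r : R -> I4 -> I4 -> I4 -> I4 -> R) r1 t a b :
  (forall k l m n, drv (fun t => r t k l m n) t (r1 k l m n)) ->
  drv (fun t => half_form (r t) s s a b) t (half_form r1 s s a b).
Proof. by move=> h; apply: drvZ; apply: drvD; [apply: drvD; [apply: drvD|]|]; first [exact: h|apply: drvZ; exact: h]. Qed.

Lemma half_form_lin (I : finType) (c : I -> R) (r : I -> I4 -> I4 -> I4 -> I4 -> R) a b :
  half_form (fun k l m n => \sum_j c j * r j k l m n) s s a b = \sum_j c j * half_form (r j) s s a b.
Proof.
rewrite /half_form !mulr_sumr -!big_split mulr_sumr; ext_sum j => /=; ring.
Qed.

Lemma half_form00 (r : I4 -> I4 -> I4 -> I4 -> R) : half_form r s s 0 0 =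
  2^-1 * (r o0 o1 o0 o1 + s * r o0 o1 o2 o3 + s * r o2 o3 o0 o1 + s * s * r o2 o3 o2 o3).
Proof.
have -> : o1 = pair1 0 by apply/val_inj; rewrite /= inordK.
have -> : o2 = pair2 0 by apply/val_inj; rewrite /= inordK.
by have -> : o3 = pair3 0 by apply/val_inj; rewrite /= inordK.
Qed.

Definition tensor_form i (T : seq I4 -> sring (chart_opens i)) y vs E (k l m n : I4) :=
  tval T y (vs ++ [:: row k E; row l E; row m E; row n E]).

Let R1 i := chart_nab g (curvature_tensor g i).
Let R2 i := chart_nab g (R1 i).

Lemma tensor_form_along i (T : seq I4 -> sring (chart_opens i)) c t (E : R -> 'M[R]_4) (vs : seq (R -> 'rV[R]_4)) k l m n :
  geodesic g c -> dom i (c t) -> parallel_frame g i c t E -> (forall n, (n < size vs)%N -> parallel g i c t (nth (fun=> 0) vs n)) ->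
  drv (fun r => tensor_form T (coord i (c r)) [seq z r | z <- vs] (E r) k l m n) t
    (tensor_form (chart_nab g T) (coord i (c t)) (vel i c t :: [seq z t | z <- vs]) (E t) k l m n).
Proof.
move=> gc di pE pv; have [hc _] := geodesic_chart gc di.
have := tval_along (g := g) (codom_coord di) hc T (ws := vs ++ [seq (fun r => row j (E r)) | j : I4 <- [:: k; l; m; n]]).
rewrite /tensor_form; have E4 r : [seq z r | z <- vs ++ [seq (fun r => row j (E r)) | j : I4 <- [:: k; l; m; n]]] =
  [seq z r | z <- vs] ++ [:: row k (E r); row l (E r); row m (E r); row n (E r)] by rewrite map_cat.
move=> H; apply: (drv_near _ (drv_val _ (H _))); first by apply/near0P; exists 1 => // r _; rewrite E4.
  by rewrite E4 cat_cons.
move=> h; rewrite nth_cat; case: ifP => [/pv//|hn].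
rewrite size_cat /= => lt; have : (h - size vs < 4)%N by rewrite ltn_subLR // leqNgt hn.
by case: (h - size vs)%N => [|[|[|[|]]]] //= _; exact: pE.
Qed.

(** [E0] is translated in parallel along [c]. By continuity it stays oriented for a short time, so
    that [eigval1_le] applies, and its time derivatives are covariant derivatives of the
    curvature. *)
Lemma barrier_along c i E0 : geodesic g c -> dom i (c 0) -> oriented_orthonormal_frame g o i (c 0) E0 ->
  exists u u1 : R -> R, [/\ (\forall t \near 0, A 1 (c t) <= u t /\ drv u t (u1 t)),
    u 0 = half_matrix g s i (coord i (c 0)) E0 0 0,
    u1 0 = half_form (tensor_form (R1 i) (coord i (c 0)) [:: vel i c 0] E0) s s 0 0 &
    drv u1 0 (half_form (tensor_form (R2 i) (coord i (c 0)) [:: vel i c 0; vel i c 0] E0) s s 0 0)].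
Proof.
move=> gc di [on or]; have [e e0 [hd hE]] := parallel_frame_exists gc di.
have [|E [E00 {}hE]] := hE 0 E0 _ on; first by rewrite subrr normr0 ltW.
have h0 : `|(0 : R) - 0| <= e by rewrite subrr normr0 ltW.
pose x t := coord i (c t).
pose u t := half_form (tensor_form (curvature_tensor g i) (x t) [::] (E t)) s s 0 0.
pose u1 t := half_form (tensor_form (R1 i) (x t) [:: vel i c t] (E t)) s s 0 0.
have uE t : `|t - 0| <= e -> u t = half_matrix g s i (x t) (E t) 0 0.
  move=> te; have Vt := codom_coord (hd t te).
  rewrite half_matrixE ?(hE t te).2 //; congr (half_form _ s s 0 0).
  by do 4!apply/funext => ?; rewrite /tensor_form curvature_tval.
have D t : `|t - 0| <= e -> drv u t (u1 t).
  move=> te; apply: half_form_drv => k l m n.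
  exact: (tensor_form_along (vs := [::]) _ _ _ _ _ gc (hd t te) (hE t te).1).
have D1 : drv u1 0 (half_form (tensor_form (R2 i) (x 0) [:: vel i c 0; vel i c 0] E0) s s 0 0).
  rewrite -E00; apply: half_form_drv => k l m n.
  apply: (tensor_form_along (vs := [:: vel i c]) _ _ _ _ _ gc di (hE 0 h0).1) => -[|//] _.
  exact: parallel_vel.
exists u, u1; split=> //; [|by rewrite uE // E00|by rewrite /u1 E00].
have cE : cont_at (fun t => sgn o i (c t) * \det (E t)) 0.
  apply: continuous_mul.
    by apply: (@continuous_comp _ _ _ c (sgn o i)); [exact: gc.1|exact: sgn_continuous].
  rewrite (_ : (fun t => \det (E t)) = fun t => det_nat 4 (fun k l => row (nat4 k) (E t) 0 (nat4 l))).
    have cr k l : cont_at (fun t => row (nat4 k) (E t) 0 (nat4 l)) 0.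
      by apply: continuous_coord; exact: vdrv_cont ((hE 0 h0).1 (nat4 k)).
    exact: continuous_det.
  by apply/funext => t; congr determinant; apply/matrixP => k l; rewrite !mxE /nat4 !inord_val.
have pos : \forall t \near 0, 0 < sgn o i (c t) * \det (E t).
  by apply: (near_gt cE); rewrite E00.
have [d d0 hpos] := (near0P _ _).1 pos.
apply/near0P; exists (Num.min d e); first by rewrite lt_min d0.
move=> t; rewrite lt_min => /andP[td /ltW te]; split; last exact: D.
by rewrite uE //; apply: eigval1_le; [exact: hs|exact: hd|split; [exact: (hE t te).2|exact: hpos]].
Qed.

Section Soliton.
Variables (f : M -> R) (rho : R).
Hypothesis sol : gradient_shrinking_soliton g f rho.

Lemma second_order_ge (w w1 : R -> R) (w2 : R) : (\forall t \near 0, w 0 <= w t /\ drv w t (w1 t)) ->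
  drv w1 0 w2 -> w1 0 = 0 /\ 0 <= w2.
Proof.
move=> /near0P[d d0 h] D1; have {}h t : `|t| < d -> w 0 <= w t /\ drv w t (w1 t) by move=> td; apply: h; rewrite subr0.
have w10 : w1 0 = 0.
  have Dw : drv w 0 (w1 0) by apply: (h 0 _).2; rewrite normr0.
  have itv t : t \in `]-d, d[%R -> `|t| < d by rewrite in_itv /= ltr_norml.
  have := derive1_at_min (f := w) (a := - d) (b := d) (c := 0) _ _ _ _.
  move=> m; apply: drv_unique Dw (m _ _ _ _); [lra|move=> t /itv/h[_ []]//| |move=> t /itv/h[]//].
  by rewrite in_itv /= d0 oppr_lt0 d0.
split=> //; rewrite leNgt; apply/negP => w2n.
have [d1 d10 h1] := (drvP _ _ _).1 D1 (- w2 / 2) (ltac:(lra)).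
pose b := Num.min d d1 / 2; have m0 : 0 < Num.min d d1 by rewrite lt_min d0.
have b0 : 0 < b by rewrite divr_gt0.
have [bd bd1] : b < d /\ b < d1.
  by split; apply: lt_le_trans (_ : Num.min d d1 <= _); rewrite ?ge_min ?lexx ?orbT // /b; lra.
have bt t : btw 0 b t -> 0 <= t <= b by rewrite (btwE _ (ltW b0)).
have D t : btw 0 b t -> drv (fun t => w t - w2 / 4 * t ^+ 2) t (w1 t - w2 / 2 * t).
  move=> /bt/andP[t0 tb]; apply: drvB; first by apply: (h t _).2; rewrite ger0_norm // (le_lt_trans tb).
  by apply: (drv_val _ (drvZ (w2 / 4) (drvM (drv_id t) (drv_id t)))); field.
have [t /bt/andP[t0 tb] e] := mvt D.
have := h1 t; rewrite ger0_norm // w10 add0r subr0 => /(_ (le_lt_trans tb bd1)); rewrite ler_norml => /andP[_ le].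
have wb : w 0 <= w b by apply: (h b _).1; rewrite gtr0_norm.
have : (w1 t - w2 / 2 * t) * b <= 0 by rewrite mulr_le0_ge0 ?(ltW b0) //; lra.
have : w2 * b ^+ 2 < 0 by rewrite pmulr_llt0 ?exprn_gt0.
move: e; rewrite subr0 expr0n mulr0 subr0; lra.
Qed.

(** [half_reaction] in the eigenframe; the squares of the mixed block [half_form s (- s)] are
    dropped. *)
Lemma eigenvalue_evolution i p E E2 (x := coord i p) (ev := fun k => A k p) : dom i p ->
  oriented_orthonormal_frame g o i p E -> half_matrix g s i x E = diag_mx (\row_j ev (nat_of_ord j).+1) ->
  E2 *m gram g i x *m E2^T = 1%:M -> \sum_m half_form (tensor_form (R2 i) x [:: row m E2; row m E2] E) s s 0 0
  - \sum_m (\sum_k E2 m k * partial k (f \o param i) x) * half_form (tensor_form (R1 i) x [:: row m E2] E) s s 0 0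
  <= 2 * rho * ev 1%N - 2 * ev 1%N ^+ 2 - 4 * (ev 2%N * ev 3%N).
Proof.
move=> di [on _] diag on2; have Vx := codom_coord di; have [_ sf _ eqn] := sol.
pose r := frame_curvature g i x E; pose c m := \sum_k E2 m k * partial k (f \o param i) x.
have -> : \sum_m half_form (tensor_form (R2 i) x [:: row m E2; row m E2] E) s s 0 0
    - \sum_m c m * half_form (tensor_form (R1 i) x [:: row m E2] E) s s 0 0 =
    half_form (fun k l m n => 2 * rho * r k l m n + reaction r k l m n) s s 0 0.
  transitivity (half_form (fun k l m n => \sum_p 1 * tensor_form (R2 i) x [:: row p E2; row p E2] E k l m n
      - \sum_p c p * tensor_form (R1 i) x [:: row p E2] E k l m n) s s 0 0).
    have -> (F G : I4 -> I4 -> I4 -> I4 -> R) : half_form (fun k l m n => F k l m n - G k l m n) s s 0 0 =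
      half_form F s s 0 0 - half_form G s s 0 0 by rewrite /half_form; ring.
    by rewrite !half_form_lin; congr (_ - _); ext_sum m; rewrite mul1r.
  congr (half_form _ s s 0 0); do 4!apply/funext => ?.
  under eq_bigr do rewrite mul1r.
  exact: (curvature_evolution Vx on sf (eqn i) _ _ _ _ on2).
have ss : s * s = 1 by case: hs => ->; ring.
have -> : half_form (fun k l m n => 2 * rho * r k l m n + reaction r k l m n) s s 0 0 =
    2 * rho * half_form r s s 0 0 + half_form (reaction r) s s 0 0 by rewrite /half_form; ring.
have S a b : half_form r s s a b = (if a == b then ev a.+1 else 0).
  by rewrite -half_matrixE // diag !mxE; case: eqP => // _; rewrite mulr0n.
have := half_reaction (curvature_skew Vx on) (curvature_pair Vx on) (curvature_bianchi Vx on) hs.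
rewrite -/r (half_form00 (reaction r)) ss mul1r => ->; rewrite !S /=.
set B0 := half_form _ _ _ 0 0; set B1 := half_form _ _ _ 0 1; set B2 := half_form _ _ _ 0 _.
have := sqr_ge0 B0; have := sqr_ge0 B1; have := sqr_ge0 B2; rewrite expr0n /=; lra.
Qed.

(* [ph] touches the lowest eigenvalue from below at [p], hence also the smooth functions obtained
   from the eigenframe by parallel translation along the geodesics [b m], which lie above it. *)
Lemma barrier_inequality i p (b : I4 -> R -> M) (ph ph1 : I4 -> R -> R) (ph2 : I4 -> R) (ev := fun k => A k p) :
  dom i p -> (forall m, geodesic g (b m) /\ b m 0 = p) -> orthonormal g i p b ->
  (forall m, ph m 0 = ev 1%N /\ (\forall t \near 0, ph m t <= A 1 (b m t) /\ drv (ph m) t (ph1 m t)) /\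
    drv (ph1 m) 0 (ph2 m)) ->
  \sum_m (ph2 m - derive1 (f \o b m) 0 * ph1 m 0) <= 2 * rho * ev 1%N - 2 * ev 1%N ^+ 2 - 4 * (ev 2%N * ev 3%N).
Proof.
move=> di hb on h; have [E [oE diag]] := eigen_frame g o hs di.
pose E2 : 'M[R]_4 := \matrix_(m, n) vel i (b m) 0 0 n.
have rE m : row m E2 = vel i (b m) 0 by apply/rowP => n; rewrite !mxE.
have on2 : E2 *m gram g i (coord i p) *m E2^T = 1%:M.
  by apply/frame_ip => k l; rewrite !rE; exact: on.
apply: le_trans (eigenvalue_evolution di oE diag on2); rewrite -sumrB; apply: ler_sum => m _.
have [gb b0] := hb m; have [ph0 [nph Dph]] := h m.
have db : dom i (b m 0) by rewrite b0.
have [|u [u1 [nu u0 u10 Du]]] := @barrier_along (b m) i E gb db; first by rewrite b0.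
have [] := @second_order_ge (fun t => u t - ph m t) (fun t => u1 t - ph1 m t) _ _ (drvB Du Dph).
  apply: filterS2 nu nph => t [h1 h2] [h3 h4]; split; last exact: drvB.
  have -> : u 0 - ph m 0 = 0 by rewrite u0 b0 diag ph0 !mxE /= mulr1n subrr.
  by rewrite subr_ge0 (le_trans h3).
move=> /eqP; rewrite subr_eq0 u10 => /eqP <-; rewrite rE b0 => h2.
have -> : derive1 (f \o b m) 0 = \sum_k E2 m k * partial k (f \o param i) (coord i p).
  have [D _] := hess_along sol gb db; rewrite derive1E; case: D => _ ->; rewrite b0.
  by ext_sum k; rewrite -rE [row m E2 0 k]mxE.
lra.
Qed.

End Soliton.
End FrameEvolution.

Section Semicontinuity.
Variables (R : realType) (M : topologicalType) (X : manifold4 R M) (g : metric X) (o : orientation X) (s : R).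
Hypothesis hs : s = 1 \/ s = -1.
Implicit Types (i j : chart X) (p q : M).
Local Notation A k p := (eigval k (half_curvature g o s p)).

Lemma riemann4_continuous i x k l m n : codom i x -> cont_at (riemann4 g i k l m n) x.
Proof.
move=> Vx; pose V : opens R := chart_opens i.
pose u : sring V := crm g (i := i) (V := V) (fun x Vx => Vx) [:: k; l; m; n].
apply: (@near_continuousM _ _ (fun y => u y)).
  have nV := open_nbhs_nbhs (conj (@codom_open R M X i) Vx).
  by near=> y; apply: (crmT_ev g (h := i) (U := V) (fun x Vx => Vx)); near: y.
exact: smooth_on_cont (sfun_smooth u) Vx.
Unshelve. all: by end_near. Qed.

Lemma continuous_add (T : topologicalType) (u w : T -> R) (p : T) : cont_at u p ->
  cont_at w p -> cont_at (fun t => u t + w t) p.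
Proof. by move=> cu cw; apply: cvgD. Qed.

Lemma row_ball_compact n (r : R) : compact [set z : 'rV[R]_n | `|z| <= r].
Proof.
apply: bounded_closed_compact; first by exists r; split=> [|e re z /le_trans]; [exact: num_real|apply; exact: ltW].
rewrite (_ : [set z : 'rV[R]_n | `|z| <= r] = closed_ball_ Num.norm 0 r); first exact: closed_closed_ball_.
by apply/seteqP; split=> z; rewrite /closed_ball_ /= sub0r normrN.
Qed.

Section JointContinuity.
Variables (i : chart X) (p : M) (z0 : 'rV[R]_(4 * 4)).
Hypothesis di : dom i p.
Let T : topologicalType := ('rV[R]_(4 * 4) * M)%type.
Let E (z : T) : 'M[R]_4 := vec_mx z.1.
Let y (z : T) := coord i z.2.

Let cE k l : {for (z0, p) : T, continuous (fun z => E z k l)}.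
Proof.
rewrite (_ : (fun z => E z k l) = fun z => z.1 0 (mxvec_index k l)); last by apply/funext => z; rewrite mxE.
apply: (@continuous_comp _ _ _ fst (fun w : 'rV[R]_(4 * 4) => w 0 (mxvec_index k l))); first exact: cvg_fst.
exact: (@row_coord_continuous R 15).
Qed.

Let cy : {for (z0, p) : T, continuous y}.
Proof. by apply: (@continuous_comp _ _ _ snd (coord i)); [exact: cvg_snd|exact: coord_continuous]. Qed.

Lemma gram_joint_continuous k l : {for (z0, p) : T, continuous (fun z => (E z *m gram g i (y z) *m (E z)^T) k l)}.
Proof.
rewrite (_ : (fun z => _) = fun z => \sum_m (\sum_n E z k n * gram g i (y z) n m) * E z l m).
  apply: continuous_sum => m; apply: continuous_mul; last exact: cE.
  apply: continuous_sum => n; apply: continuous_mul; first exact: cE.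
  apply: (@smooth_comp_continuous R M X T i y (z0, p) (codom_coord di) cy (fun x => gram g i x n m)).
  exact: gram_smooth.
by apply/funext => z; rewrite mxE; ext_sum m; rewrite mxE [X in _ * X]mxE.
Qed.

Lemma orientation_joint_continuous : {for (z0, p) : T, continuous (fun z => sgn o i z.2 * \det (E z))}.
Proof.
apply: continuous_mul.
  by apply: (@continuous_comp _ _ _ snd (sgn o i)); [exact: cvg_snd|exact: sgn_continuous].
rewrite (_ : (fun z => \det (E z)) = fun z => det_nat 4 (fun k l => E z (nat4 k) (nat4 l))).
  by apply: continuous_det => k l; exact: cE.
by apply/funext => z; congr determinant; apply/matrixP => k l; rewrite [RHS]mxE /nat4 !inord_val.
Qed.

Lemma half_matrix_joint_continuous : {for (z0, p) : T, continuous (fun z => half_matrix g s i (y z) (E z) 0 0)}.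
Proof.
have cB k l : {for (z0, p) : T, continuous (fun z => half_basis s (E z) 0 k l)}.
  pose e a b z := E z a b.
  have cw a b : {for (z0, p) : T, continuous (fun z => e a k z * e b l z + - 1 * (e b k z * e a l z))}.
    apply: continuous_add; first by apply: continuous_mul; exact: cE.
    by apply: continuous_mul; [exact: cst_continuous|apply: continuous_mul; exact: cE].
  rewrite (_ : (fun z => _) = fun z => (Num.sqrt 2)^-1 * ((e (Ordinal (isT : 0 < 4)%N) k z * e (pair1 0) l z + - 1 * (e (pair1 0) k z * e (Ordinal (isT : 0 < 4)%N) l z)) +
    s * (e (pair2 0) k z * e (pair3 0) l z + - 1 * (e (pair3 0) k z * e (pair2 0) l z)))).
    apply: continuous_mul; first exact: cst_continuous.
    apply: continuous_add; first exact: cw.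
    by apply: continuous_mul; [exact: cst_continuous|exact: cw].
  apply/funext => z; rewrite half_basisE mxE [X in _ * X]mxE [X in _ + X]mxE !wedgeE !mxE /e.
  by rewrite !mulN1r /E !mxE.
rewrite (_ : (fun z => _) = fun z => 4^-1 * \sum_a \sum_b \sum_c \sum_d
  riemann4 g i a b c d (y z) * half_basis s (E z) 0 a b * half_basis s (E z) 0 c d); last by apply/funext => z; rewrite mxE.
apply: continuous_mul; first exact: cst_continuous.
do 4! (apply: continuous_sum => ?); apply: continuous_mul; last exact: cB.
apply: continuous_mul; last exact: cB.
by apply: (@continuous_comp _ _ _ y); [exact: cy|apply: riemann4_continuous; exact: codom_coord].
Qed.

End JointContinuity.

(** The lowest eigenvalue is a minimum of one matrix entry over oriented orthonormal frames, and
    these stay in a compact ball of radius [K]. Matrices that are not oriented orthonormal frames at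
    [p] are not such frames at nearby points either, so compactness applies to the whole ball. *)
Lemma eigval1_lsc p (e : R) : 0 < e -> \forall q \near p, A 1 p - e < A 1 q.
Proof.
move=> e0; have [i di] := dom_cover X p; have [r [K gb]] := good_ball_exists g (codom_coord di).
have K1 := gb_K gb.
have /compact_near_coveringP nc := @row_ball_compact (4 * 4) K.
have := nc M (nbhs p) (fun q z => dom i q -> oriented_orthonormal_frame g o i q (vec_mx z) ->
  A 1 p - e < half_matrix g s i (coord i q) (vec_mx z) 0 0) _ _.
have cov : forall z, `|z| <= K -> \forall z' \near z & q \near p, dom i q ->
    oriented_orthonormal_frame g o i q (vec_mx z') -> A 1 p - e < half_matrix g s i (coord i q) (vec_mx z') 0 0.
  move=> z _; have [on|/eqP noton] := eqVneq (vec_mx z *m gram g i (coord i p) *m (vec_mx z)^T) 1%:M; last first.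
    have [k [l kl]] : exists k l, (vec_mx z *m gram g i (coord i p) *m (vec_mx z)^T) k l != (1%:M : 'M[R]_4) k l.
      apply: contrapT => h; apply: noton; apply/matrixP => k l; apply/eqP; apply: contrapT => /negP kl.
      by apply: h; exists k, l.
    have c := gram_joint_continuous (z0 := z) (k := k) (l := l) di.
    have c' : {for (z, p), continuous (fun w : 'rV[R]_(4 * 4) * M => `|(vec_mx w.1 *m gram g i (coord i w.2) *m (vec_mx w.1)^T) k l - (1%:M : 'M[R]_4) k l|)}.
      by apply: cvg_norm; apply: cvgB c (@cst_continuous _ _ _ _).
    have := near_gt c' (a := 0); rewrite normr_gt0 subr_eq0 => /(_ kl).
    by apply: filterS => -[z' q] /=; rewrite normr_gt0 subr_eq0 => h _ [on' _]; rewrite on' eqxx in h.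
  have dn : sgn o i p * \det (vec_mx z) != 0.
    rewrite mulf_neq0 //; first by rewrite -normr_gt0 (sgn_unit o di).
    by apply/eqP => d0; have := congr1 determinant on; rewrite !det_mulmx d0 !mul0r det1 => /eqP; rewrite eq_sym oner_eq0.
  have co := orientation_joint_continuous (z0 := z) di.
  move: dn; rewrite neq_lt => /orP[neg|pos].
    have c' : {for (z, p), continuous (fun w : 'rV[R]_(4 * 4) * M => - (sgn o i w.2 * \det (vec_mx w.1)))} by apply: cvgN.
    have := near_gt c' (a := 0); rewrite oppr_gt0 => /(_ neg).
    by apply: filterS => -[z' q] /=; rewrite oppr_gt0 => h _ [_ /(lt_trans h)]; rewrite ltxx.
  have := near_gt (half_matrix_joint_continuous (z0 := z) di) (a := A 1 p - e).
  have le := eigval1_le hs di (conj on pos).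
  move=> /(_ (lt_le_trans _ le)); rewrite ltrBlDr ltrDl => /(_ e0).
  by apply: filterS => -[z' q] /= h _ _.
move=> /(_ (nbhs_filter p) cov) near1.
have [U [oU Up] hU] := neighbor_ball di (gb_r gb).
have nU : \forall q \near p, U q by exact: open_nbhs_nbhs.
apply: filterS2 near1 nU => q h1 /hU[dq hq].
have [E [oE diag]] := eigen_frame g o hs dq.
have := h1 (mxvec E) _ dq; rewrite mxvecK diag !mxE /= mulr1n; apply => //.
rewrite /= [leLHS]/Num.Def.normr /= mx_normrE; apply/bigmax_leP; split; first exact: le_trans K1.
move=> [a b] _ /=; rewrite ord1; case/mxvec_indexP: b => k l; rewrite mxvecE.
have := gb_low gb (row k E) hq; rewrite ((frame_ip g _ _ _).1 oE.1) eqxx mulr1 => le.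
have le1 := coord_le_norm (row k E) l; rewrite mxE in le1; apply: le_trans le1 _.
have := normr_ge0 (row k E); nra.
Qed.

End Semicontinuity.

(** * The maximum principle *)

#[local] Opaque eigval half_curvature.

Section MaximumPrinciple.
Variables (R : realType) (M : topologicalType) (X : manifold4 R M) (g : metric X) (o : orientation X) (s : R).
Hypothesis hs : s = 1 \/ s = -1.
Variables (f : M -> R) (rho : R).
Hypothesis sol : gradient_shrinking_soliton g f rho.
Implicit Types (i j : chart X) (p q : M) (c : R -> M).
Local Notation A k p := (eigval k (half_curvature g o s p)).

(** Compactness is used twice: it bounds [F], and it contradicts a supremum that is not attained. *)
Lemma usc_max (K : set M) (F : M -> R) : compact K -> K !=set0 ->
  (forall x, K x -> forall e : R, 0 < e -> \forall y \near x, F y < F x + e) -> exists2 x, K x & forall y, K y -> F y <= F x.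
Proof.
move=> /compact_near_coveringP nc [x0 Kx0] usc.
have [N hN] : exists N, forall y, K y -> F y < N.
  suff /filter_ex[N hN] : \forall N \near +oo%R, K `<=` (fun y => F y < N) by exists N.
  apply: (nc R +oo%R (fun N y => F y < N)) => x Kx; near=> y N => /=; apply: lt_trans (_ : F x + 1 < N).
    by near: y; apply: (usc x Kx).
  by near: N; exact/nbhs_pinfty_gt/num_real.
pose S := F @` K; have hS : has_sup S.
  by split; [exists (F x0), x0|exists N => _ [y Ky <-]; exact: ltW (hN y Ky)].
apply: contrapT => nomax; have lt x : K x -> F x < sup S.
  move=> Kx; rewrite lt_neqAle; apply/andP; split; last by apply: ub_le_sup; [exact: hS.2|exists x].
  apply/eqP => FS; apply: nomax; exists x => // y Ky; rewrite FS; apply: ub_le_sup; [exact: hS.2|by exists y].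
have near1 : \forall N \near at_left (sup S), K `<=` (fun y => F y < N).
  apply: (nc R (at_left (sup S)) (fun N y => F y < N)) => x Kx.
  have d0 : 0 < (sup S - F x) / 2 by rewrite divr_gt0 // subr_gt0 lt.
  near=> y N1 => /=; apply: lt_trans (_ : F x + (sup S - F x) / 2 < N1).
    by near: y; exact: usc.
  by near: N1; apply: nbhs_left_gt; have := lt x Kx; lra.
have [N1 [hN1 hN2]] : exists N1, K `<=` (fun y => F y < N1) /\ N1 < sup S.
  by apply: (@filter_ex _ (at_left (sup S))); apply: filterI near1 (nbhs_left_lt _).
suff : sup S <= N1 by rewrite leNgt hN2.
by apply: ge_sup; [exact: hS.1|move=> _ [y Ky <-]; exact: ltW (hN1 y Ky)].
Unshelve. all: by end_near. Qed.

Lemma near0_imp3 (P1 P2 P3 Q : R -> Prop) : (\forall t \near 0, P1 t) -> (\forall t \near 0, P2 t) ->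
  (\forall t \near 0, P3 t) -> (forall t, P1 t -> P2 t -> P3 t -> Q t) -> \forall t \near 0, Q t.
Proof. by move=> h1 h2 h3 h; apply: filterS3 h1 h2 h3. Qed.

Lemma potential_drv c t : geodesic g c -> drv (f \o c) t (derive1 (f \o c) t) /\
  drv (derive1 (f \o c)) t (derive1 (derive1 (f \o c)) t).
Proof.
move=> gc; have [i di] := dom_cover X (c t); have [D1 D2] := hess_along sol gc di.
by split; [apply: (drv_val _ D1); case: D1|apply: (drv_val _ D2); case: D2] => _ <-; rewrite derive1E.
Qed.

(** The bound is used near [p], where the field of the second variation grows from 0 and the Hessian
    of [f] is integrated by parts against it. *)
Lemma gradient_bound p : exists2 N : R, 0 <= N & forall c t, geodesic g c -> gspeed g c = 1 ->
  dist g p (c t) <= 1 -> `|derive1 (f \o c) t| <= N.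
Proof.
have [cpl sf _ _] := sol; have /compact_near_coveringP nc := dist_ball_compact cpl (p := p) (e := 1).
pose P (N : R) q := forall c t, geodesic g c -> gspeed g c = 1 -> c t = q -> `|derive1 (f \o c) t| <= N.
have /filter_ex[N hN] : \forall N \near +oo%R, [set q | dist g p q <= 1] `<=` P N.
  apply: (nc R +oo%R P) => x _.
  have [i di] := dom_cover X x; have [r [K gb]] := good_ball_exists g (codom_coord di).
  have [U [oU Ux] hU] := neighbor_ball di (gb_r gb).
  pose D k y := partial k (f \o param i) (coord i y).
  have cD k : cont_at (D k) x.
    apply: (@continuous_comp _ _ _ (coord i) (partial k (f \o param i))); first exact: coord_continuous.
    by apply: smooth_on_cont (codom_coord di); exact: smooth_on_partial (sf i).
  have nD k : \forall y \near x, `|D k y| < `|D k x| + 1.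
    have /cvgrPdist_lt/(_ 1 ltr01) := cD k; apply: filterS => y h.
    by rewrite -ltrBlDl; apply: le_lt_trans h; rewrite distrC lerB_dist.
  have nDk : \forall y \near x, forall k, `|D k y| < `|D k x| + 1 by apply: filter_forall => k; exact: nD.
  near=> q N => /=; have hD : forall k, `|D k q| < `|D k x| + 1 by near: q.
  move=> c t gc sc ctq.
  have [dq hq] : dom i q /\ cball (coord i x) r (coord i q).
    by apply: hU; near: q; exact: open_nbhs_nbhs.
  rewrite -ctq in dq hq; have [[_ D1] _] := hess_along sol gc dq; rewrite derive1E D1.
  apply: le_trans (_ : \sum_k K * (`|D k x| + 1) <= N).
    apply: le_trans (ler_norm_sum _ _ _) _; apply: ler_sum => k _; rewrite normrM ler_pM //.
      have := gb_low gb (vel i c t) hq; rewrite -(sqr_sqrtr (ip_ge0 _ _ (codom_coord dq))) (gspeedE gc dq) sc expr1n mulr1.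
      have := coord_le_norm (vel i c t) k; have := gb_K gb; have := normr_ge0 (vel i c t); nra.
    by rewrite ctq; apply: ltW; exact: hD.
  by near: N; exact/nbhs_pinfty_ge/num_real.
exists (Num.max N 0); first by rewrite le_max lexx orbT.
move=> c t gc sc pc; rewrite le_max; apply/orP; left; exact: (hN (c t) pc c t).
Unshelve. all: by end_near. Qed.

Section MinimalGeodesic.
Variables (p : M) (c : R -> M) (N : R).
Hypotheses (gc : geodesic g c) (sc : gspeed g c = 1) (c0 : c 0 = p) (N0 : 0 <= N).
Let h' := derive1 (f \o c).
Let D t : drv h' t (derive1 h' t) := (potential_drv t gc).2.

Let Dsq (a b t : R) : drv (fun t => (a + b * t) ^+ 2) t (2 * b * (a + b * t)).
Proof. by have h := drv_affine a b t; apply: (drv_val _ (drvM h h)); ring. Qed.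

Let Dcube (a b t : R) : drv (fun t => (a + b * t) ^+ 3) t (3 * b * (a + b * t) ^+ 2).
Proof.
have h := drv_affine a b t; apply: (drv_val _ (drvM h (Dsq a b t))); ring.
Qed.

(** The field grows linearly from [p]. Integrating [4 - t^2 (rho - f'')] by parts gives
    [4 - rho / 3 + f'(1)] minus the integral of [2 t f'], which [N] absorbs. *)
Lemma variation_unit : (forall t, 0 <= t <= 1 -> `|h' t| <= N) -> variation_bound g p c 1 1 (4 - rho / 3 + h' 1 + N).
Proof.
move=> hN; pose J t := 4 * t - rho / 3 * (0 + 1 * t) ^+ 3 + (0 + 1 * t) ^+ 2 * (h' t + N).
pose J' t := 4 - rho * t ^+ 2 + (2 * t * (h' t + N) + t ^+ 2 * derive1 h' t).
have := @second_variation _ _ _ g f rho sol p c 0 1 0 1 0 J J' gc sc ler01 _ _.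
have -> : 0 + J 1 - J 0 = 4 - rho / 3 + h' 1 + N by rewrite /J; ring.
rewrite !mulr1 mulr0 !add0r; apply; last exact: (variation_bound0 sol).
move=> t t01; split.
  have DN : drv (fun t => h' t + N) t (derive1 h' t) by apply: (drv_val _ (drvD (D t) (drv_cst N t))); rewrite addr0.
  apply: (drv_val _ (drvD (drvB (drvZ 4 (drv_id t)) (drvZ (rho / 3) (Dcube 0 1 t))) (drvM (Dsq 0 1 t) DN))).
  by rewrite /J'; field.
have := hN t t01; rewrite ler_norml => /andP[hN' _]; have /andP[t0 _] := t01.
have : 0 <= t * (h' t + N) by rewrite mulr_ge0 //; lra.
rewrite /J' -/h'; lra.
Qed.

(** With a constant field the bound contains [f'(b)], exactly the drift term; what is left of the
    drift Laplacian of the distance is a constant minus [rho (b - 1)]. *)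
Lemma variation_middle b : 1 <= b -> (forall t, 0 <= t <= 1 -> `|h' t| <= N) ->
  variation_bound g p c b 1 (4 - rho / 3 + N - rho * (b - 1) + h' b).
Proof.
move=> b1 hN; pose J t := h' t - rho * t.
have := @second_variation _ _ _ g f rho sol p c 1 b 1 0 (4 - rho / 3 + h' 1 + N) J (fun t => derive1 h' t - rho) gc sc b1 _ _.
have -> : 4 - rho / 3 + h' 1 + N + J b - J 1 = 4 - rho / 3 + N - rho * (b - 1) + h' b by rewrite /J; ring.
rewrite !mul0r !addr0; apply; last exact: variation_unit.
move=> t _; split; last by rewrite -/h'; lra.
by apply: drvB (D t) _; apply: (drv_val _ (drvZ rho (drv_id t))); rewrite mulr1.
Qed.

(** The mirror image of the initial piece, which brings the field back to 0 at time [L]. *)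
Lemma variation_end (L N' : R) : 2 <= L -> (forall t, 0 <= t <= 1 -> `|h' t| <= N) ->
  (forall t, L - 1 <= t <= L -> h' t <= N') -> variation_bound g p c L 0 (8 - 2 * rho / 3 + N + N' - rho * (L - 2)).
Proof.
move=> L2 hN hN'; pose J t := 4 * t + rho / 3 * (L + -1 * t) ^+ 3 + (L + -1 * t) ^+ 2 * (h' t - N').
pose J' t := 4 - rho * (L - t) ^+ 2 + (- 2 * (L - t) * (h' t - N') + (L - t) ^+ 2 * derive1 h' t).
have := @second_variation _ _ _ g f rho sol p c (L - 1) L L (-1) _ J J' gc sc _ _ (_ : variation_bound g p c (L - 1) _ (4 - rho / 3 + N - rho * (L - 1 - 1) + h' (L - 1))).
have -> : 4 - rho / 3 + N - rho * (L - 1 - 1) + h' (L - 1) + J L - J (L - 1) = 8 - 2 * rho / 3 + N + N' - rho * (L - 2).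
  by rewrite /J; field.
have -> : L + -1 * L = 0 by ring.
have -> : L + -1 * (L - 1) = 1 by ring.
apply; [lra| |by apply: variation_middle => //; lra].
move=> t tL; split.
  have DN : drv (fun t => h' t - N') t (derive1 h' t) by apply: (drv_val _ (drvB (D t) (drv_cst N' t))); rewrite subr0.
  apply: (drv_val _ (drvD (drvD (drvZ 4 (drv_id t)) (drvZ (rho / 3) (Dcube L (-1) t))) (drvM (Dsq L (-1) t) DN))).
  by rewrite /J'; field.
have := hN' t tL; have /andP[_ tL'] := tL => hN1.
have : 0 <= (L - t) * (N' - h' t) by rewrite mulr_ge0 //; lra.
rewrite /J' -/h'; lra.
Qed.

End MinimalGeodesic.

Lemma reaction_le (a x : R) : rho * a <= 0 -> 0 <= x -> 2 * rho * a - 2 * a ^+ 2 - 4 * x <= - 2 * a ^+ 2.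
Proof. by move=> h1 h2; lra. Qed.

Section CutoffInequality.
Variables (q : M) (i : chart X) (b : I4 -> R -> M) (P P1 : I4 -> R -> R) (P2 : I4 -> R) (ps : R).
Hypotheses (di : dom i q) (hb : forall m, geodesic g (b m) /\ b m 0 = q).
Hypothesis on : orthonormal g i q b.
Hypotheses (ps0 : 0 < ps) (A1 : A 1 q < 0) (A23 : 0 <= A 2 q * A 3 q).
Hypothesis hP : forall m, P m 0 = ps /\ (\forall t \near 0, - A 1 (b m t) * P m t ^+ 2 <= - A 1 q * ps ^+ 2) /\
  (\forall t \near 0, drv (P m) t (P1 m t)) /\ drv (P1 m) 0 (P2 m).

(* The comparison function is [F0 / P ^ 2], with [F0] the maximal value of the cut-off function. *)
Lemma cutoff_inequality : - A 1 q * ps ^+ 2 <= 3 * \sum_m P1 m 0 ^+ 2 - ps * \sum_m (P2 m - derive1 (f \o b m) 0 * P1 m 0).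
Proof.
set F0 := - A 1 q * ps ^+ 2; have F00 : 0 < F0 by rewrite mulr_gt0 ?exprn_gt0 ?oppr_gt0.
have [_ _ rho0 _] := sol; have ps1 : ps != 0 by rewrite gt_eqF.
pose V m t := (P m t)^-1.
have drvV2 m t : P m t != 0 -> drv (P m) t (P1 m t) -> drv (fun t => V m t ^+ 2) t (- 2 * P1 m t * V m t ^+ 3).
  by move=> n0 Dm; have h := drvV n0 Dm; apply: (drv_val _ (drvM h h)); rewrite /V; field.
have drvV3 m t : P m t != 0 -> drv (P m) t (P1 m t) -> drv (fun t => V m t ^+ 3) t (- 3 * P1 m t * V m t ^+ 4).
  by move=> n0 Dm; apply: (drv_val _ (drvM (drvV n0 Dm) (drvV2 m t n0 Dm))); rewrite /V; field.
have := @barrier_inequality R M X g o s hs f rho sol i q b (fun m t => - F0 * V m t ^+ 2)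
  (fun m t => - F0 * (- 2 * P1 m t * V m t ^+ 3))
  (fun m => - F0 * (- 2 * P2 m * ps^-1 ^+ 3 + - 2 * P1 m 0 * (- 3 * P1 m 0 * ps^-1 ^+ 4))) di hb on.
have Vps m : V m 0 = ps^-1 by rewrite /V (hP m).1.
move=> ineq; lapply ineq; last first.
  move=> m.
  have [Pm0 [nF [nD D0]]] := hP m.
  have D00 : drv (P m) 0 (P1 m 0) by exact: nbhs_singleton nD.
  have np : P m 0 != 0 by rewrite Pm0.
  split; first by rewrite Vps /F0; field.
  split.
    have nP : \forall t \near 0, 0 < P m t by apply: (near_gt (drv_cont D00)); rewrite Pm0.
    apply: (near0_imp3 nF nP nD) => t hF Pt Dt.
    have Pn : P m t != 0 by rewrite gt_eqF.
    split; last exact: drvZ (drvV2 m t Pn Dt).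
    have -> : - F0 * V m t ^+ 2 = - F0 / P m t ^+ 2 by rewrite /V exprVn.
    by rewrite ler_pdivrMr ?exprn_gt0 // -lerN2 opprK -mulNr.
  apply: drvZ; apply: (drv_val _ (drvM (drvZ (- 2) D0) (drvV3 m 0 np D00))).
  by rewrite !Vps.
move=> {ineq}.
under eq_bigr => m _ do rewrite Vps.
have E (x y h : R) : - F0 * (- 2 * x * ps^-1 ^+ 3 + - 2 * y * (- 3 * y * ps^-1 ^+ 4)) - h * (- F0 * (- 2 * y * ps^-1 ^+ 3)) =
    2 * F0 / ps ^+ 4 * (ps * (x - h * y) - 3 * y ^+ 2) by field.
under eq_bigr => m _ do rewrite E.
rewrite -mulr_sumr sumrB -!mulr_sumr; set S1 := \sum_m _; set S2 := \sum_m _ => le.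
have lt : 2 * F0 / ps ^+ 4 * (ps * S1 - 3 * S2) <= 2 * F0 / ps ^+ 4 * - F0.
  apply: le_trans le _; have -> : 2 * F0 / ps ^+ 4 * - F0 = - 2 * A 1 q ^+ 2 by rewrite /F0; field.
  have le0 : rho * A 1 q <= 0 by rewrite mulr_ge0_le0 ?ltW.
  exact: reaction_le.
have c0 : 0 < 2 * F0 / ps ^+ 4 by rewrite divr_gt0 ?exprn_gt0 // mulr_gt0.
by rewrite (ler_pM2l c0) in lt; rewrite -lerN2 opprB.
Qed.

End CutoffInequality.

Lemma geodesic_frame p : exists b : I4 -> R -> M, (forall m, geodesic g (b m) /\ b m 0 = p) /\
  forall i, dom i p -> orthonormal g i p b.
Proof.
have [cpl _ _ _] := sol; have [i di] := dom_cover X p; have [c [gc c0 _]] := cpl i p 0 di.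
by have [b [I [hb on _ _]]] := variation_bound0 sol gc c0; exists b; split=> [m|j dj]; rewrite -?c0; [|apply: on; rewrite c0].
Qed.

Lemma unit_gspeed i p c : geodesic g c -> c 0 = p -> dom i p -> ip g i (coord i p) (vel i c 0) (vel i c 0) = 1 -> gspeed g c = 1.
Proof. by move=> gc c0 di; rewrite -(gspeedE gc (i := i) (t := 0)) c0 // => ->; rewrite sqrtr1. Qed.

(** Parseval's identity for the unit velocity of [c], and the derivative of [f] expanded in the same
    frame. *)
Lemma frame_expansion i p (b : I4 -> R -> M) c t : dom i p -> c t = p -> geodesic g c -> gspeed g c = 1 ->
  (forall m, geodesic g (b m) /\ b m 0 = p) -> orthonormal g i p b ->
  let v m := ip g i (coord i p) (vel i (b m) 0) (vel i c t) in
  \sum_m v m ^+ 2 = 1 /\ \sum_m derive1 (f \o b m) 0 * v m = derive1 (f \o c) t.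
Proof.
move=> di ct gc sc hb on v; have Vx := codom_coord di; set x := coord i p.
pose E : 'M[R]_4 := \matrix_(m, n) vel i (b m) 0 0 n.
have rE m : row m E = vel i (b m) 0 by apply/rowP => n; rewrite !mxE.
have onE : E *m gram g i x *m E^T = 1%:M by apply/frame_ip => k l; rewrite !rE; exact: on.
pose w : 'rV[R]_4 := \row_m v m.
have wE : w *m E = vel i c t.
  have -> : w = vel i c t *m gram g i x *m E^T.
    apply/rowP => m; rewrite mxE /v ipC // ipE -rE [LHS]mxE [RHS]mxE; ext_sum n; rewrite !mxE //.
  rewrite -!mulmxA (frame_cogram onE) mulmxV ?mulmx1 //.
  have := congr1 determinant onE; rewrite !det_mulmx det1 unitmxE unitfE => h; apply/eqP => d0.
  by move/eqP: h; rewrite d0 mulr0 mul0r eq_sym oner_eq0.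
split.
  have <- : ip g i x (vel i c t) (vel i c t) = 1.
    have dt : dom i (c t) by rewrite ct.
    by rewrite /x -[in coord i p]ct -(sqr_sqrtr (ip_ge0 _ _ (codom_coord dt))) (gspeedE gc dt) sc expr1n.
  rewrite ipE -wE trmx_mul -!mulmxA (mulmxA E) (mulmxA (E *m _)) onE mul1mx mxE.
  by ext_sum m; rewrite !mxE.
have D (a : R -> M) r : geodesic g a -> a r = p -> derive1 (f \o a) r = \sum_k vel i a r 0 k * partial k (f \o param i) x.
  move=> ga ar; have da : dom i (a r) by rewrite ar.
  by have [[_ D1] _] := hess_along sol ga da; rewrite derive1E D1 ar.
rewrite (D c t gc ct) -wE; under eq_bigr => m _ do rewrite (D _ _ (hb m).1 (hb m).2) mulr_suml.
swap_sum k => /=; rewrite [in RHS]mxE mulr_suml; ext_sum m.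
have -> : w 0 m = v m by rewrite mxE.
by have -> : E m k = vel i (b m) 0 0 k; [rewrite -rE [RHS]mxE|ring].
Qed.

Lemma usc_arith (a y e e1 m P : R) : 0 <= P -> a - e1 < y -> (- a + e1) * P - (- a + e1) * m < e / 2 ->
  e1 * m <= e / 2 -> - y * P < - a * m + e.
Proof.
move=> P0 h1 h2 h3; have : - y * P <= (- a + e1) * P by rewrite ler_wpM2r //; lra.
lra.
Qed.

Lemma cutoff_contradiction (a C r : R) : 0 < a -> 1 <= r -> C / a + 1 <= r -> a * r ^+ 6 <= C * r ^+ 5 -> False.
Proof.
move=> a0 r1 rC; rewrite exprS mulrA ler_pM2r ?exprn_gt0 //; last lra.
by move: rC; rewrite -lerBrDr ler_pdivrMr // => h1; nra.
Qed.

(** [h] is the derivative of [f] along the minimal geodesic, and it cancels against the [h] in the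
    bound on [S]. Every other term is at most a multiple of [r ^ 5]. *)
Lemma cutoff_arith (r z N S h : R) : 1 <= r -> 0 <= z -> z < r -> 0 <= N -> S <= 4 + N + h ->
  3 * (9 * z ^+ 4) - (r ^+ 3 - z ^+ 3) * (- 6 * z - 3 * z ^+ 2 * (S + 4) + 3 * z ^+ 2 * h) <= (33 + 3 * (8 + N)) * r ^+ 5.
Proof.
move=> r1 z0 zr N0 hS; have r0 : 0 <= r by lra.
have zz : z <= r by exact: ltW.
have z3 : 0 <= z ^+ 3 by exact: exprn_ge0.
have le k : z ^+ k <= r ^+ k by rewrite lerXn2r ?nnegrE.
have up (k l : nat) : (k <= l)%N -> r ^+ k <= r ^+ l by move=> kl; exact: ler_weXn2l.
have h1 : z ^+ 4 <= r ^+ 5 := le_trans (le 4%N) (up 4 5 isT)%N.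
have ps : 0 <= r ^+ 3 - z ^+ 3 by rewrite subr_ge0.
have h2 : (r ^+ 3 - z ^+ 3) * (6 * z) <= r ^+ 3 * (6 * r) by apply: ler_pM => //; lra.
have h3 : (r ^+ 3 - z ^+ 3) * (3 * z ^+ 2 * (8 + N)) <= r ^+ 3 * (3 * r ^+ 2 * (8 + N)).
  apply: ler_pM => //; first by rewrite !mulr_ge0 ?exprn_ge0 //; lra.
    by lra.
  by apply: ler_wpM2r; [lra|rewrite ler_pM2l // le].
have h4 : (r ^+ 3 - z ^+ 3) * (3 * z ^+ 2 * (S + 4 - h)) <= (r ^+ 3 - z ^+ 3) * (3 * z ^+ 2 * (8 + N)).
  by apply: ler_wpM2l => //; apply: ler_wpM2l; [rewrite mulr_ge0 ?sqr_ge0|lra].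
have e3 : r ^+ 3 * (6 * r) <= 6 * r ^+ 5 by have := up 4 5 isT; rewrite (_ : r ^+ 3 * (6 * r) = 6 * r ^+ 4); [lra|ring].
have e4 : r ^+ 3 * (3 * r ^+ 2 * (8 + N)) = 3 * (8 + N) * r ^+ 5 by ring.
have e5 : - (r ^+ 3 - z ^+ 3) * (- 6 * z - 3 * z ^+ 2 * (S + 4) + 3 * z ^+ 2 * h) =
  (r ^+ 3 - z ^+ 3) * (6 * z) + (r ^+ 3 - z ^+ 3) * (3 * z ^+ 2 * (S + 4 - h)) by ring.
rewrite -mulNr e5; rewrite e4 in h3; lra.
Qed.

Section LowerBound.
Hypothesis A2 : (forall q, 0 <= A 2 q).

Let A3_ge0 q : 0 <= A 3 q.
Proof.
by have [_ [_ _ _ /andP[_ le] _]] := spectral (half_curvature_sym g o s q); exact: le_trans (A2 q) le.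
Qed.

(* At a maximum [q] of [(r ^ 3 - ((d - 1)_+) ^ 3) ^ 2 * - A 1] with [d] the distance to [p]. *)
Lemma cutoff_estimate p : exists C : R, forall (r : R) q, 1 <= r -> A 1 q < 0 ->
  let psi x := r ^+ 3 - Num.max (dist g p x - 1) 0 ^+ 3 in 0 < psi q ->
  (forall y, dist g p y <= 1 + r -> - A 1 y * psi y ^+ 2 <= - A 1 q * psi q ^+ 2) -> - A 1 q * psi q ^+ 2 <= C * r ^+ 5.
Proof.
have [cpl _ rho0 _] := sol; have [N N0 hN] := gradient_bound p.
exists (33 + 3 * (8 + N)) => r q r1 Aq psi psq qmax.
have [i di] := dom_cover X q; pose F0 := - A 1 q * psi q ^+ 2; change (F0 <= (33 + 3 * (8 + N)) * r ^+ 5).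
have {}qmax : forall y, dist g p y <= 1 + r -> - A 1 y * psi y ^+ 2 <= F0 := qmax.
have F00 : 0 <= F0 by rewrite mulr_ge0 ?sqr_ge0 // oppr_ge0 ltW.
have below y P : 0 <= P -> P <= psi y -> dist g p y <= 1 + r -> - A 1 y * P ^+ 2 <= F0.
  move=> P0 Py yr; have [Ay|Ay] := lerP 0 (A 1 y).
    by apply: le_trans F00; rewrite mulNr oppr_le0 mulr_ge0 ?sqr_ge0.
  apply: le_trans (qmax y yr); rewrite ler_pM2l ?oppr_gt0 // lerXn2r ?nnegrE //; exact: le_trans Py.
(* Close to [p] no second variation is used: near such a [q] the function [psi] is at least
   [r^3 - |t|^3], so the parabola [r^3 - t^2] lies below it. *)
set L := dist g p q; have [L1|L1] := lerP L 1.
  have psE : psi q = r ^+ 3 by rewrite /psi max_r ?expr0n ?subr0 // subr_le0.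
  have [b [hb on]] := geodesic_frame q.
  have := @cutoff_inequality q i b (fun _ t => r ^+ 3 - t ^+ 2) (fun _ t => - 2 * t) (fun=> - 2) (psi q)
    di hb (on i di) psq Aq (mulr_ge0 (A2 q) (A3_ge0 q)) _.
  have -> : \sum_(m < 4) (- 2 * 0 : R) ^+ 2 = 0 by rewrite big1 // => m _; rewrite mulr0 expr0n.
  have -> : \sum_m (- 2 - derive1 (f \o b m) 0 * (- 2 * 0)) = - 8.
    by under eq_bigr do rewrite !mulr0 subr0; rewrite sumr_const card_ord; ring.
  move=> h; apply: le_trans (h _) _; last first.
    rewrite psE; have : r ^+ 3 <= r ^+ 5 by exact: ler_weXn2l.
    have : 0 <= r ^+ 5 * N by rewrite mulr_ge0 ?exprn_ge0 //; lra.
    have : 0 <= r ^+ 5 by rewrite exprn_ge0; lra.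
    lra.
  move=> m; split; first by rewrite psE expr0n subr0.
  split; last first.
    have Dq t : drv (fun t => r ^+ 3 - t ^+ 2) t (- 2 * t).
      by apply: (drv_val _ (drvB (drv_cst (r ^+ 3) t) (drvM (drv_id t) (drv_id t)))); ring.
    split; first by apply/near0P; exists 1.
    by apply: (drv_val _ (drvZ (- 2) (drv_id 0))); rewrite mulr1.
  apply/near0P; exists 1 => // t; rewrite subr0 => t1.
  have [gb b0] := hb m; have sb : gspeed g (b m) = 1 by apply: (unit_gspeed gb b0 di); rewrite (on i di) eqxx.
  have dy : dist g p (b m t) <= 1 + `|t|.
    apply: le_trans (dist_triangle g p q _) _; apply: lerD => //; rewrite -b0.
    have [t0|t0] := lerP 0 t.
      by have := geodesic_dist gb t0; rewrite sb mul1r subr0 (ger0_norm t0).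
    by have := geodesic_dist gb (ltW t0); rewrite sb mul1r sub0r distC (ltr0_norm t0).
  have tn := normr_ge0 t; have r3 : 1 <= r ^+ 3 by rewrite exprn_ege1.
  have t2 : t ^+ 2 = `|t| ^+ 2 by rewrite real_normK ?num_real.
  apply: below; [by rewrite subr_ge0 t2; apply: le_trans r3; rewrite exprn_ile1 // ltW| |by lra].
  rewrite lerD2l lerN2 t2; apply: le_trans (_ : `|t| ^+ 3 <= _); last by rewrite ler_wiXn2l // ltW.
  by rewrite lerXn2r ?nnegrE ?le_max ?lexx ?orbT // ge_max tn andbT; lra.
have pq : p <> q by move=> pq; move: L1; rewrite /L pq dist_refl; lra.
have [c [gc sc c0 cL cmin]] := hopf_rinow cpl pq.
have z0 : 0 <= L - 1 by lra.
have psE : psi q = r ^+ 3 - (L - 1) ^+ 3 by rewrite /psi max_l.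
have zr : L - 1 < r.
  rewrite ltNge; apply/negP => rz; move: psq; rewrite psE subr_gt0; apply/negP; rewrite -leNgt.
  by rewrite lerXn2r ?nnegrE //; lra.
have hN' t : 0 <= t <= 1 -> `|derive1 (f \o c) t| <= N.
  move=> /andP[t0 t1]; apply: hN => //; rewrite cmin //; apply/andP; split=> //; lra.
have [b [I [hb on sI hI]]] := variation_middle gc sc c0 (ltW L1) hN'.
rewrite cL in hb on hI; have {}on := on i di; have {}hI := hI i di.
have [v2 hv] := frame_expansion di cL gc sc hb on.
pose v m := ip g i (coord i q) (vel i (b m) 0) (vel i c L).
pose D m t := L + v m * t + (I m + 1) / 2 * t ^+ 2.
pose D1 m t := v m + (I m + 1) * t.
have drvD' m t : drv (D m) t (D1 m t).
  apply: (drv_val _ (drvD (drv_affine L (v m) t) (drvZ ((I m + 1) / 2) (drvM (drv_id t) (drv_id t))))).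
  by rewrite /D1; field.
have drvD1 m t : drv (D1 m) t (I m + 1) := drv_affine _ _ t.
have D0 m : D m 0 = L by rewrite /D mulr0 expr0n mulr0 !addr0.
have D10 m : D1 m 0 = v m by rewrite /D1 mulr0 addr0.
have drvD2 m t : drv (fun t => D m t - 1) t (D1 m t) by apply: (drv_val _ (drvB (drvD' m t) (drv_cst 1 t))); rewrite subr0.
have := @cutoff_inequality q i b (fun m t => r ^+ 3 - (D m t - 1) ^+ 3) (fun m t => - 3 * ((D m t - 1) ^+ 2 * D1 m t))
  (fun m => - 6 * (L - 1) * v m ^+ 2 - 3 * (L - 1) ^+ 2 * (I m + 1)) (psi q) di hb on psq Aq (mulr_ge0 (A2 q) (A3_ge0 q)) _.
have -> : \sum_m (- 3 * ((D m 0 - 1) ^+ 2 * D1 m 0)) ^+ 2 = 9 * (L - 1) ^+ 4 * \sum_m v m ^+ 2.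
  by rewrite mulr_sumr; ext_sum m; rewrite D0 D10; ring.
have -> : \sum_m (- 6 * (L - 1) * v m ^+ 2 - 3 * (L - 1) ^+ 2 * (I m + 1) - derive1 (f \o b m) 0 * (- 3 * ((D m 0 - 1) ^+ 2 * D1 m 0)))
    = - 6 * (L - 1) * (\sum_m v m ^+ 2) - 3 * (L - 1) ^+ 2 * (\sum_m I m + 4) + 3 * (L - 1) ^+ 2 * (\sum_m derive1 (f \o b m) 0 * v m).
  have -> : \sum_m I m + 4 = \sum_m (I m + 1) by rewrite big_split /= sumr_const card_ord.
  by rewrite !mulr_sumr -sumrB -big_split; ext_sum m; rewrite D0 D10 /=; ring.
rewrite v2 hv !mulr1 => h; apply: le_trans (h _) _; last first.
  by rewrite psE; apply: cutoff_arith => //; move: sI; have : 0 <= rho * (L - 1) := mulr_ge0 (ltW rho0) z0; lra.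
move=> m; split; first by rewrite D0 psE.
split; last first.
  have dr t : drv (fun t => r ^+ 3 - (D m t - 1) ^+ 3) t (- 3 * ((D m t - 1) ^+ 2 * D1 m t)).
    have d := drvD2 m t; apply: (drv_val _ (drvB (drv_cst (r ^+ 3) t) (drvM d (drvM d d)))); ring.
  split; first by apply/near0P; exists 1.
  have d := drvD2 m 0; apply: (drv_val _ (drvZ (- 3) (drvM (drvM d d) (drvD1 m 0)))).
  by rewrite D0 D10; ring.
have [d d0 hd] := hI m 1 ltr01.
have cD := drv_cont (drvD' m 0).
have n1 : \forall t \near 0, 1 < D m t by apply: (near_gt cD); rewrite D0.
have n2 : \forall t \near 0, - (1 + r) < - D m t by apply: (near_gt (drv_cont (drvN (drvD' m 0)))); rewrite D0; lra.
have n3 : \forall t \near (0 : R), `|t| < d by apply/near0P; exists d => // t; rewrite subr0.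
apply: (near0_imp3 n1 n2 n3) => t h1 h2 h3; have := hd t h3; rewrite !mulr1.
have -> : L + t * ip g i (coord i q) (vel i (b m) 0) (vel i c L) + (I m + 1) / 2 * t ^+ 2 = D m t by rewrite /D /v; ring.
move=> dt; apply: below; last by lra.
  by rewrite subr_ge0 lerXn2r ?nnegrE //; lra.
rewrite lerD2l lerN2 lerXn2r ?nnegrE ?le_max ?lexx ?orbT //; first by lra.
by rewrite ge_max; apply/andP; split; lra.
Qed.

Lemma eigval1_ge0 q : 0 <= A 1 q.
Proof.
rewrite leNgt; apply/negP => neg; have [cpl _ _ _] := sol; have [C hC] := cutoff_estimate q.
(* For this [r] the value [- A 1 q * r ^ 6] at the centre exceeds the bound [C * r ^ 5] at the
   maximum. *)
pose r : R := Num.max 1 (C / - A 1 q + 1).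
have r1 : 1 <= r by rewrite le_max lexx.
have rC : C / - A 1 q + 1 <= r by rewrite le_max lexx orbT.
clearbody r; pose psi x := r ^+ 3 - Num.max (dist g q x - 1) 0 ^+ 3.
pose F y := - A 1 y * Num.max (psi y) 0 ^+ 2.
have cpsi y : cont_at psi y.
  apply: continuous_add; first exact: cst_continuous.
  apply: cvgN; have cm : cont_at (fun x => Num.max (dist g q x - 1) 0) y.
    apply: continuous_max; last exact: cst_continuous.
    by apply: continuous_add; [exact: dist_continuous|exact: cst_continuous].
  by apply: (@continuous_comp _ _ _ _ (fun z : R => z ^+ 3) _ cm); exact: exprn_continuous.
have cm y : cont_at (fun x => Num.max (psi x) 0 ^+ 2) y.
  have cm : cont_at (fun x => Num.max (psi x) 0) y by apply: continuous_max => //; exact: cst_continuous.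
  exact: continuous_mul.
have [||x Kx xmax] := usc_max (dist_ball_compact cpl (p := q) (e := 1 + r)) (F := F).
- by exists q; rewrite /= dist_refl; lra.
- move=> x _ e e0; set m := Num.max (psi x) 0 ^+ 2; have m0 : 0 <= m by exact: sqr_ge0.
  pose e1 := e / (2 * (m + 1)); have e10 : 0 < e1 by rewrite divr_gt0 // mulr_gt0 // ltr_wpDl.
  have n1 := eigval1_lsc g o hs x e10.
  have cc : cont_at (fun y => (- A 1 x + e1) * Num.max (psi y) 0 ^+ 2) x.
    by apply: continuous_mul; [exact: cst_continuous|exact: cm].
  have n2 : \forall y \near x, `|(- A 1 x + e1) * Num.max (psi y) 0 ^+ 2 - (- A 1 x + e1) * m| < e / 2.
    by apply: (continuous_near_eq cc (@cst_continuous _ _ _ _)) => //; rewrite divr_gt0.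
  apply: filterS2 n1 n2 => y h1 /ltr_normlW h2; rewrite /F.
  apply: usc_arith (sqr_ge0 _) h1 h2 _.
  have -> : e / 2 = e1 * (m + 1) by rewrite /e1; field; rewrite gt_eqF // ltr_wpDl.
  by rewrite ler_wpM2l ?(ltW e10) // lerDl.
have r6 : F q = - A 1 q * r ^+ 6.
  rewrite /F /psi dist_refl; have -> : Num.max (0 - 1) 0 = 0 :> R by apply: max_r; lra.
  by rewrite expr0n subr0 max_l ?exprn_ge0 //; [ring|lra].
have Fq : 0 < F q by rewrite r6 mulr_gt0 ?oppr_gt0 // exprn_gt0 //; lra.
have Fx : 0 < F x by apply: lt_le_trans Fq _; apply: xmax; rewrite /= dist_refl; lra.
have psix : 0 < psi x.
  by rewrite ltNge; apply/negP => h; move: Fx; rewrite /F (max_r h) expr0n mulr0 ltxx.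
have FE y : dist g q y <= 1 + r -> F y = - A 1 y * psi y ^+ 2.
  move=> yr; rewrite /F max_l // /psi subr_ge0 lerXn2r ?nnegrE ?le_max ?lexx ?orbT //; first by lra.
  by rewrite ge_max; apply/andP; split; lra.
have Ax : A 1 x < 0.
  rewrite ltNge; apply/negP => a0; move: Fx; rewrite (FE x Kx); apply/negP; rewrite -leNgt.
  by apply: mulr_le0_ge0; [rewrite oppr_le0|exact: sqr_ge0].
have qmax y : dist g q y <= 1 + r -> - A 1 y * psi y ^+ 2 <= - A 1 x * psi x ^+ 2.
  by move=> yr; have h := xmax y yr; rewrite (FE y yr) (FE x Kx) in h.
have le : F x <= C * r ^+ 5 by rewrite (FE x Kx); exact: hC r x r1 Ax psix qmax.
have Kq : dist g q q <= 1 + r by rewrite dist_refl addr_ge0 // (le_trans ler01).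
have {}le := le_trans (xmax q Kq) le; rewrite r6 in le.
apply: (cutoff_contradiction _ r1 rC le); rewrite oppr_gt0; exact: neg.
Unshelve. all: by end_near. Qed.

End LowerBound.
End MaximumPrinciple.

(** * The potential *)

Section PositiveSpectrum.
Variable R : realType.
Implicit Type S : 'M[R]_3.

Lemma eigval1_psd S : S^T = S -> 0 <= eigval 1 S -> psd S.
Proof.
move=> sS e0 u; have [_ [_ _ _ _ h]] := spectral sS.
by apply: le_trans (h u); rewrite mulr_ge0 ?dot_ge0.
Qed.

Lemma eigval1_posdef S : S^T = S -> 0 < eigval 1 S -> posdef S.
Proof.
move=> sS e0 u u0; have [_ [_ _ _ _ h]] := spectral sS.
apply: lt_le_trans (h u); rewrite mulr_gt0 // lt_neqAle dot_ge0 andbT eq_sym.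
by apply: contraNN u0 => /eqP/dot_eq0 ->.
Qed.

End PositiveSpectrum.

(** The terms linear in [s] cancel by the first Bianchi identity, so the trace of either block is a
    quarter of the scalar curvature. *)
Lemma half_form_trace (R : realType) (r : I4 -> I4 -> I4 -> I4 -> R) (s : R) : s * s = 1 ->
  (forall a b c d : I4, r b a c d = - r a b c d) -> (forall a b c d : I4, r a b c d = r c d a b) ->
  (forall a b c d : I4, r a b c d + r b c a d + r c a b d = 0) -> \sum_p \sum_m r p m p m = 4 * \sum_a half_form r s s a a.
Proof.
move=> s2 sk pr bi; rewrite sum3 sum4_nat !sum4_nat /half_form s2 !pairE !mul1r.
have z a c d : r a a c d = 0 by have := sk a a c d; lra.
have sym a b : r b a b a = r a b a b by rewrite sk (pr a b b a) sk opprK.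
rewrite !z (sym (nat4 0) (nat4 1)) (sym (nat4 0) (nat4 2)) (sym (nat4 0) (nat4 3)).
rewrite (sym (nat4 1) (nat4 2)) (sym (nat4 1) (nat4 3)) (sym (nat4 2) (nat4 3)).
have := bi (nat4 1) (nat4 2) (nat4 3) (nat4 0).
rewrite (pr (nat4 1) (nat4 2) (nat4 3)) (pr (nat4 2) (nat4 3) (nat4 1)) (pr (nat4 3) (nat4 1) (nat4 2)).
rewrite !(sk (nat4 0)) => bi1.
have : s * (r (nat4 0) (nat4 1) (nat4 2) (nat4 3) + r (nat4 0) (nat4 2) (nat4 3) (nat4 1) + r (nat4 0) (nat4 3) (nat4 1) (nat4 2)) = 0.
  by apply/eqP; rewrite mulf_eq0; apply/orP; right; apply/eqP; lra.
rewrite (pr (nat4 2) (nat4 3) (nat4 0)) (pr (nat4 3) (nat4 1) (nat4 0)) (pr (nat4 1) (nat4 2) (nat4 0)); lra.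
Qed.

Section Potential.
Variables (R : realType) (M : topologicalType) (X : manifold4 R M) (g : metric X).
Implicit Types (i : chart X) (p q : M) (c : R -> M).

Lemma frame_trace i x (E : 'M[R]_4) (T : I4 -> I4 -> R) : E *m gram g i x *m E^T = 1%:M ->
  \sum_m \sum_a \sum_b E m a * E m b * T a b = \sum_a \sum_b cogram g i x a b * T a b.
Proof.
move=> on; swap_sum a; swap_sum b => /=.
rewrite /cogram -(frame_cogram on) mxE mulr_suml; ext_sum m; by rewrite mxE.
Qed.

Lemma scalar_curvature_smooth i : smooth_on (codom i) (scalar_curvature g i).
Proof.
pose V : opens R := Opens (@codom_open R M X i).
pose C := cgeo g (V := V) (i := i) (fun x Vx => Vx).
apply: (@smooth_on_eq _ V (contr C (rc C) [::] : sring V)) (sfun_smooth _) => x Vx.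
exact: (scal_ev g (i := i) (V := V) (fun x Vx => Vx) Vx).
Qed.

Variables (f : M -> R) (rho : R).
Hypothesis sol : gradient_shrinking_soliton g f rho.

Lemma grad_sqnorm_smooth i : smooth_on (codom i) (grad_sqnorm g f i).
Proof.
have [_ sf _ _] := sol; pose V : opens R := Opens (@codom_open R M X i).
pose C := cgeo g (V := V) (i := i) (fun x Vx => Vx); pose cf' := cf (i := i) (V := V) (fun x Vx => Vx) sf.
apply: (@smooth_on_eq _ V (contr C (tens (fun a => C a cf') (grad C cf')) [::] : sring V)) (sfun_smooth _) => x Vx.
exact: (cgrad2_ev g (i := i) (V := V) (fun x Vx => Vx) sf Vx).
Qed.

Lemma unit_dot_sqr (h v : I4 -> R) (w : R) : \sum_m v m ^+ 2 = 1 -> \sum_m h m * v m = w -> w ^+ 2 <= \sum_m h m ^+ 2.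
Proof.
move=> v2 hv; have : 0 <= \sum_m (h m - w * v m) ^+ 2 by apply: sumr_ge0 => m _; exact: sqr_ge0.
have -> : \sum_m (h m - w * v m) ^+ 2 = \sum_m h m ^+ 2 - 2 * w * (\sum_m h m * v m) + w ^+ 2 * (\sum_m v m ^+ 2).
  by rewrite !mulr_sumr -sumrB -big_split; ext_sum m => /=; ring.
rewrite v2 hv; lra.
Qed.

Section Frame.
Variables (i : chart X) (p : M) (b : I4 -> R -> M).
Hypotheses (di : dom i p) (hb : forall m, geodesic g (b m) /\ b m 0 = p).
Hypothesis on : orthonormal g i p b.
Let E : 'M[R]_4 := \matrix_(m, n) vel i (b m) 0 0 n.
Let rowE m : row m E = vel i (b m) 0. Proof. by apply/rowP => n; rewrite !mxE. Qed.
Let onE : E *m gram g i (coord i p) *m E^T = 1%:M.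
Proof. by apply/frame_ip => k l; rewrite !rowE. Qed.
Let along m (d : dom i (b m 0)) := hess_along sol (hb m).1 d.
Let dm m : dom i (b m 0). Proof. by rewrite (hb m).2. Qed.

Lemma frame_grad : \sum_m derive1 (f \o b m) 0 ^+ 2 = grad_sqnorm g f i (coord i p).
Proof.
transitivity (\sum_m \sum_a \sum_c E m a * E m c *
    (partial a (f \o param i) (coord i p) * partial c (f \o param i) (coord i p))); last first.
  by rewrite (frame_trace _ onE); ext_sum a; ext_sum c; rewrite mulrA.
ext_sum m; have [[_ D] _] := along (dm m); rewrite derive1E D (hb m).2 expr2 mulr_suml.
ext_sum a; rewrite mulr_sumr; ext_sum c; rewrite !mxE; ring.
Qed.

Lemma frame_laplace : \sum_m derive1 (derive1 (f \o b m)) 0 = 4 * rho - scalar_curvature g i (coord i p).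
Proof.
have [_ _ _ eqn] := sol; have Vx := codom_coord di.
transitivity (\sum_m \sum_a \sum_c E m a * E m c * hessian g f i a c (coord i p)).
  ext_sum m; have [_ [_ D]] := along (dm m); rewrite derive1E D (hb m).2.
  by ext_sum a; ext_sum c; rewrite !mxE.
have h (a c : I4) : hessian g f i a c (coord i p) = rho * gram g i (coord i p) a c - ricci g i a c (coord i p).
  by rewrite -(eqn i _ Vx a c) addrC addKr.
under eq_bigr => m _ do under eq_bigr => a _ do under eq_bigr => c _ do rewrite h mulrBr.
under eq_bigr => m _ do under eq_bigr => a _ do rewrite sumrB.
under eq_bigr => m _ do rewrite sumrB.
rewrite sumrB; congr (_ - _); last exact: frame_trace.
transitivity (\sum_(m < 4) rho); last by rewrite sumr_const card_ord; ring.
ext_sum m; have h1 : ip g i (coord i p) (row m E) (row m E) = 1 by rewrite ((frame_ip g i (coord i p) E).1 onE) eqxx.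
rewrite -[RHS]mulr1 -h1 /ip mulr_sumr; ext_sum a; rewrite mulr_sumr; ext_sum c.
by rewrite !mxE; ring.
Qed.

End Frame.

(** The differential vanishes in every chart; geodesics from [hopf_rinow] connect any two points. *)
Lemma hamilton_constant : exists k : R, forall i p, dom i p ->
  scalar_curvature g i (coord i p) + grad_sqnorm g f i (coord i p) - 2 * rho * f p = k.
Proof.
have [cpl sf _ eqn] := sol.
pose u i x := scalar_curvature g i x + grad_sqnorm g f i x - 2 * rho * f (param i x).
have su i : smooth_on (codom i) (u i).
  apply: smooth_closureP; first exact: codom_open.
  apply: sc_add; first by apply: sc_add; apply: sc_smooth; [exact: scalar_curvature_smooth|exact: grad_sqnorm_smooth].
  have -> : (fun x => - (2 * rho * f (param i x))) = fun x => - (2 * rho) * (f \o param i) x.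
    by apply/funext => x; rewrite mulNr.
  by apply: sc_mul; [exact: sc_cst|apply: sc_smooth; exact: sf].
have tr i j p : dom i p -> dom j p -> u i (coord i p) = u j (coord j p).
  by move=> di dj; rewrite /u (scalar_curvature_transition g di dj) (grad_sqnorm_transition g di dj sf) !coordK.
(* A global function is obtained by choosing a chart at each point; [tr] makes the choice
   harmless. *)
have [ch hch] := choice (dom_cover X); pose G p := u (ch p) (coord (ch p) p).
have GE i p : dom i p -> G p = u i (coord i p) by move=> di; exact: tr.
have [[p _]|e] := pselect (exists p : M, True); last by exists 0 => i p _; case: e; exists p.
suff eqG q : G q = G p.
  by exists (G p) => i q di; rewrite -(eqG q) (GE i q di) /u coordK.
have [->//|/eqP pq] := eqVneq p q; have [c [gc _ c0 cL _]] := hopf_rinow cpl pq.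
have D t : drv (G \o c) t 0.
  set i := ch (c t); have di : dom i (c t) := hch _; have Vx := codom_coord di.
  have [hc _] := geodesic_chart gc di; have h := smooth_on_chain (@codom_open R M X i) (su i) Vx hc.
  apply: (drv_near _ (drv_val _ h)).
    by have := dom_near (gc.1 t) di; apply: filterS => r dr; rewrite /= -(GE i _ dr).
  apply: big1 => k _; have [E on] := frame_exists (gram_sym g Vx) (fun v => gram_pos g (v := v) Vx).
  by rewrite (hamilton_identity Vx on sf (eqn i)) mul0r.
have [r _] := mvt (a := 0) (b := dist g p q) (fun t _ => D t).
by rewrite mul0r /= c0 cL => /eqP; rewrite subr_eq0 => /eqP.
Qed.

Lemma derive_potential_sqr i c t : geodesic g c -> gspeed g c = 1 -> dom i (c t) ->
  derive1 (f \o c) t ^+ 2 <= grad_sqnorm g f i (coord i (c t)).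
Proof.
move=> gc sc di; have [b [hb on]] := geodesic_frame sol (c t).
have [v2 hv] := frame_expansion sol di erefl gc sc hb (on i di).
rewrite -(frame_grad di hb (on i di)); exact: unit_dot_sqr v2 hv.
Qed.

Section Normalized.
Hypothesis norm : normalized_potential g f rho.
Hypothesis scal_gt0 : forall i p, dom i p -> 0 < scalar_curvature g i (coord i p).

Lemma potential_gt0 p : 0 < f p.
Proof.
have [_ _ rho0 _] := sol; have [i di] := dom_cover X p; have [b [hb on]] := geodesic_frame sol p.
have : 0 < 2 * rho * f p by rewrite -(norm di) ltr_wpDr ?scal_gt0 // -(frame_grad di hb (on i di)) sumr_ge0 // => m _; exact: sqr_ge0.
by rewrite pmulr_rgt0 // mulr_gt0.
Qed.

Lemma derive_potential_le c t : geodesic g c -> gspeed g c = 1 -> `|derive1 (f \o c) t| <= Num.sqrt (2 * rho * f (c t)).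
Proof.
move=> gc sc; have [i di] := dom_cover X (c t); rewrite -sqrtr_sqr ler_wsqrtr //.
apply: le_trans (derive_potential_sqr gc sc di) _; rewrite -(norm di) lerDr; exact: ltW (scal_gt0 di).
Qed.

(** Positive scalar curvature and the normalisation give |grad f|^2 <= 2 rho f. *)
Lemma sqrt_potential_lipschitz c (a b : R) : geodesic g c -> gspeed g c = 1 ->
  `|Num.sqrt (2 * rho * f (c b)) - Num.sqrt (2 * rho * f (c a))| <= rho * `|b - a|.
Proof.
move=> gc sc; have [_ _ rho0 _] := sol; pose u t := Num.sqrt (2 * rho * f (c t)).
have pos t : 0 < 2 * rho * f (c t) by rewrite !mulr_gt0 // potential_gt0.
apply: (@mvt_le R u (fun t => (2 * u t)^-1 * (2 * rho * derive1 (f \o c) t))) => t _.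
  exact: (drv_comp (f := Num.sqrt) (g := fun t => 2 * rho * f (c t)) (is_derive1_sqrt (pos t)) (drvZ (2 * rho) (potential_drv sol t gc).1)).
have u0 : 0 < u t by rewrite sqrtr_gt0.
have -> : (2 * u t)^-1 * (2 * rho * derive1 (f \o c) t) = rho * (derive1 (f \o c) t / u t) by field; rewrite gt_eqF.
rewrite normrM (gtr0_norm rho0) -[leRHS]mulr1 ler_pM2l // normrM normfV (gtr0_norm u0) ler_pdivrMr // mul1r.
exact: derive_potential_le.
Qed.

(** The field of [variation_end] vanishes at both ends, so the sum of the indices is nonnegative.
    Hence [rho * L] is at most a constant plus the bound on [f'] near [q], which is
    [sqrt (2 rho f q) + rho] by the Lipschitz property. *)
Lemma potential_growth p : exists C : R, forall q, rho * dist g p q <= C + Num.sqrt (2 * rho * f q).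
Proof.
have [cpl _ rho0 _] := sol; have [N N0 hN] := gradient_bound sol p.
exists (8 + 3 * rho + N) => q; have s0 := sqrtr_ge0 (2 * rho * f q).
have [L2|L2] := ltrP (dist g p q) 2.
  have : rho * dist g p q <= rho * 2 by rewrite ler_wpM2l ?ltW.
  lra.
set L := dist g p q in L2 *.
have pq : p <> q by move=> pq; move: L2; rewrite /L pq dist_refl; lra.
have [c [gc sc c0 cL cmin]] := hopf_rinow cpl pq.
have h1 t : 0 <= t <= 1 -> `|derive1 (f \o c) t| <= N.
  move=> /andP[t0 t1]; apply: hN => //; rewrite cmin //; apply/andP; split=> //; rewrite -/L; lra.
have h2 t : L - 1 <= t <= L -> derive1 (f \o c) t <= Num.sqrt (2 * rho * f q) + rho.
  move=> /andP[t1 t2]; apply: le_trans (ler_norm _) _; apply: le_trans (derive_potential_le t gc sc) _.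
  have := sqrt_potential_lipschitz L t gc sc; rewrite cL -/L => /(le_trans (ler_norm _)) h.
  have : rho * `|t - L| <= rho * 1 by rewrite ler_pM2l // ler_norml; lra.
  lra.
have [b [I [hb _ sI hI]]] := variation_end sol gc sc c0 L2 h1 h2.
(* At time [L] the varied end point does not move, so a negative index would put the distance
   strictly below itself. *)
have : 0 <= \sum_m I m.
  apply: sumr_ge0 => m _; rewrite leNgt; apply/negP => Im.
  have [i di] := dom_cover X (c L); have e0 : 0 < - I m / 2 by rewrite divr_gt0 // oppr_gt0.
  have [d d0 hd] := hI i di m _ e0.
  have := hd (d / 2); rewrite gtr0_norm ?divr_gt0 // => /(_ _)/wrap[]; first by lra.
  rewrite !mulr0 (hb m).2 mul0r addr0 cL -/L => h.
  have : 0 < - I m * (d / 2) ^+ 2 by rewrite mulr_gt0 ?oppr_gt0 // exprn_gt0 // divr_gt0.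
  lra.
by move=> h; have := le_trans h sI; lra.
Qed.

Lemma potential_continuous p : cont_at f p.
Proof.
have [_ sf _ _] := sol; have [i di] := dom_cover X p.
have cc := smooth_on_cont (sf i) (codom_coord di).
have h : cont_at ((f \o param i) \o coord i) p.
  by apply: continuous_comp => //; exact: coord_continuous.
apply: near_continuousM h; near=> q => /=.
by rewrite coordK //; near: q; apply: open_nbhs_nbhs; split=> //; exact: dom_open.
Unshelve. all: by end_near. Qed.

Lemma potential_proper (c : R) : compact [set q | f q <= c].
Proof.
have [[p _]|e] := pselect (exists p : M, True); last first.
  suff -> : [set q | f q <= c] = set0 by exact: compact0.
  by apply/seteqP; split=> q //; case: e; exists q.
have [cpl _ rho0 _] := sol; have [C hC] := potential_growth p.
apply: (subclosed_compact _ (dist_ball_compact cpl (p := p) (e := (C + Num.sqrt (2 * rho * c)) / rho))).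
  apply: (@closed_comp _ _ f [set y : R | y <= c]); last exact: closed_le.
  by move=> q _; exact: potential_continuous.
move=> q /= fq; rewrite ler_pdivlMr // mulrC; apply: le_trans (hC q) _.
by rewrite lerD2l ler_wsqrtr // ler_pM2l // mulr_gt0.
Qed.

End Normalized.
End Potential.

Section Trace.
Variables (R : realType) (M : topologicalType) (X : manifold4 R M) (g : metric X) (o : orientation X) (s : R).
Hypothesis hs : s = 1 \/ s = -1.
Variables (f : M -> R) (rho : R).
Hypothesis sol : gradient_shrinking_soliton g f rho.
Local Notation A k p := (eigval k (half_curvature g o s p)).

Lemma scalar_eigval i p : dom i p -> scalar_curvature g i (coord i p) = 4 * (A 1 p + A 2 p + A 3 p).
Proof.
move=> di; have Vx := codom_coord di; have [_ sf _ eqn] := sol.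
have [E [[on _] diag]] := eigen_frame g o hs di.
have s2 : s * s = 1 by case: hs => ->; ring.
have -> : A 1 p + A 2 p + A 3 p = \sum_a half_form (frame_curvature g i (coord i p) E) s s a a.
  by rewrite sum3 -!half_matrixE // diag !mxE !mulr1n.
rewrite -(half_form_trace s2 (curvature_skew Vx on) (curvature_pair Vx on) (curvature_bianchi Vx on)).
rewrite exchange_big /=.
under eq_bigr => m _ do rewrite /frame_curvature (ricci_trace Vx (row m E) sf on (eqn i _ Vx)).
transitivity (\sum_m \sum_a \sum_c E m a * E m c * ricci g i a c (coord i p)).
  by rewrite (frame_trace (fun a c => ricci g i a c (coord i p)) on).
ext_sum m; have -> : (row m E *m gram g i (coord i p) *m (row m E)^T) 0 0 = ip g i (coord i p) (row m E) (row m E) by rewrite ipE.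
rewrite /ip mulr_sumr -sumrB; ext_sum a; rewrite mulr_sumr -sumrB; ext_sum c.
by rewrite !mxE; have := eqn i _ Vx a c; move=> /(congr1 (fun z => E m a * E m c * z)); lra.
Qed.

End Trace.

(** * Decay of the lowest eigenvalue *)

Section BarrierAlternative.
Variables (R : realType) (M : topologicalType) (a f : M -> R).
Hypotheses (a_gt0 : forall p, 0 < a p) (f_gt0 : forall p, 0 < f p).
Hypothesis lsc : forall p (e : R), 0 < e -> \forall q \near p, a p - e < a q.
Hypotheses (cf : forall p, cont_at f p) (proper : forall c, compact [set q | f q <= c]).
Let W (y : R) := y^-1 + 4 * y^-1 ^+ 2.

Let W_gt0 p : 0 < W (f p).
Proof. by rewrite addr_gt0 ?mulr_gt0 ?exprn_gt0 ?invr_gt0. Qed.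

Let W_le p q : f p <= f q -> W (f q) <= W (f p).
Proof.
move=> le; have h : (f q)^-1 <= (f p)^-1 by rewrite lef_pV2 ?posrE.
by rewrite lerD // ler_pM2l // lerXn2r // nnegrE invr_ge0; exact: ltW.
Qed.

Let cW p : cont_at (W \o f) p.
Proof.
have cV : cont_at (fun q => (f q)^-1) p by apply: cvgV; [rewrite gt_eqF|exact: cf].
apply: continuous_add => //; apply: continuous_mul; first exact: cst_continuous.
exact: continuous_mul.
Qed.

(* Otherwise [K * W (f q) - a q] has a positive maximum, far out where [W (f q)] is a strict subsolution. *)
Lemma barrier_alternative : exists2 K : R, 0 < K & (forall p, K * W (f p) <= a p) \/
  exists q, [/\ 8 < f q, a q < K * W (f q) & forall p, K * W (f p) - a p <= K * W (f q) - a q].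
Proof.
have [[p0 _]|e] := pselect (exists p : M, True); last by exists 1 => //; left=> p; case: e; exists p.
(* The level exceeds 8, as the alternative requires, and [f p0] makes the sublevel set nonempty. *)
pose c0 := Num.max 9 (f p0); have ne : [set q | f q <= c0] !=set0 by exists p0; rewrite /= /c0 le_max lexx orbT.
have [x Kx xmin] : exists2 x, f x <= c0 & forall p, f p <= c0 -> a x <= a p.
  have [|x Kx h] := @usc_max R M _ (fun p => - a p) (proper (c := c0)) ne.
    by move=> p _ e e0; apply: filterS (lsc p e0) => q; lra.
  by exists x => // p /h; lra.
have [|y Ky ymin] := @compact_min R M _ f (proper (c := c0)) ne; first by move=> p _; exact: cf.
have aW : 0 < a x / W (f y) by rewrite divr_gt0.
(* The least value of [a] over the greatest value of [W] on the sublevel set. *)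
exists (a x / W (f y)) => //; set K := a x / W (f y) in aW *.
have near p : f p <= c0 -> K * W (f p) <= a p.
  move=> fp; apply: le_trans (xmin p fp); rewrite /K -mulrA ger_pMr //.
  by rewrite mulrC ler_pdivrMr // mul1r W_le // ymin.
have [all|/existsNP[q0 /negP]] := pselect (forall p, K * W (f p) <= a p); first by left.
rewrite -ltNge => q0W; right; set e := K * W (f q0) - a q0; have e0 : 0 < e by rewrite subr_gt0.
(* Beyond this level [K * W] is below the excess [e] found at [q0], since [W <= 5 / f] once
   [f >= 1]. A maximum over the sublevel set is therefore global. *)
pose c1 := Num.max (f q0) (Num.max 1 (5 * K / e)).
have [||q Kq qmax] := @usc_max R M _ (fun p => K * W (f p) - a p) (proper (c := c1)).
- by exists q0; rewrite /= le_max lexx.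
- move=> p _ d d0; have d2 : 0 < d / 2 by rewrite divr_gt0.
  have n1 := lsc p d2; have cKW : cont_at (fun q => K * W (f q)) p.
    by apply: continuous_mul; [exact: cst_continuous|exact: cW].
  have n2 : \forall q \near p, `|K * W (f q) - K * W (f p)| < d / 2.
    exact: (continuous_near_eq cKW (@cst_continuous _ _ _ _)).
  by apply: filterS2 n1 n2 => q h1 /ltr_normlW; lra.
have eq : e <= K * W (f q) - a q by apply: qmax; rewrite /= le_max lexx.
exists q; split; last 2 first.
- by move: eq e0; lra.
- move=> p; have [fp|fp] := lerP (f p) c1; first exact: qmax.
  apply: le_trans eq; move: fp; rewrite !gt_max => /and3P[_ fp1 fp2].
  have v0 : 0 < (f p)^-1 by rewrite invr_gt0.
  have v1 : (f p)^-1 <= 1 by rewrite invf_le1 // ltW.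
  have h1 : W (f p) <= 5 * (f p)^-1.
    have : (f p)^-1 ^+ 2 <= (f p)^-1 by rewrite expr2 ger_pMl.
    rewrite /W; lra.
  have h2 : K * (5 * (f p)^-1) <= e.
    by rewrite mulrA ler_pdivrMr // mulrC (mulrC e) -ler_pdivrMr // ltW.
  have h3 : K * W (f p) <= K * (5 * (f p)^-1) by rewrite ler_pM2l.
  by have := a_gt0 p; lra.
rewrite ltNge; apply/negP => q8; have : K * W (f q) <= a q.
  by apply: near; rewrite le_max; apply/orP; left; lra.
move: eq e0; lra.
Qed.

End BarrierAlternative.

(** [S] stands for the scalar curvature, [G] for |grad f|^2, and [4 rho - S - G] for the drift
    Laplacian of [f]. The right side minus the left side is [K / F^4] times
    [4 rho F (F - 8) + 2 F G + 24 G]. *)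
Lemma barrier_arith (R : realType) (K rho F G S v : R) : v = F^-1 -> 0 < K -> 0 < rho -> 8 < F -> 0 <= G -> S + G = 2 * rho * F ->
  2 * rho * (K * (v + 4 * v ^+ 2)) < - K * (v ^+ 2 + 8 * v ^+ 3) * (4 * rho - S - G) + K * (2 * v ^+ 3 + 24 * v ^+ 4) * G.
Proof.
move=> -> K0 rho0 F8 G0 SG; have F0 : 0 < F by lra.
rewrite -subr_gt0.
have -> : S = 2 * rho * F - G by lra.
have -> : - K * (F^-1 ^+ 2 + 8 * F^-1 ^+ 3) * (4 * rho - (2 * rho * F - G) - G) + K * (2 * F^-1 ^+ 3 + 24 * F^-1 ^+ 4) * G -
    2 * rho * (K * (F^-1 + 4 * F^-1 ^+ 2)) = K / F ^+ 4 * (4 * (rho * (F * (F - 8))) + 2 * (F * G) + 24 * G + 0).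
  by field; rewrite gt_eqF.
rewrite mulr_gt0 ?divr_gt0 ?exprn_gt0 // addr0.
have h1 : 0 < rho * (F * (F - 8)) by rewrite !mulr_gt0 // subr_gt0.
have : 0 <= F * G by rewrite mulr_ge0 // ltW.
lra.
Qed.

Lemma barrier_touch (R : realType) (a a1 K w w1 : R) : K * w1 - a1 <= K * w - a -> a + K * (w1 - w) <= a1.
Proof. lra. Qed.

Lemma decay_contradiction (R : realType) (rho a1 a2 a3 w : R) : 0 < rho -> a1 < w -> 0 < a2 * a3 ->
  2 * rho * w < 2 * rho * a1 - 2 * a1 ^+ 2 - 4 * (a2 * a3) -> False.
Proof.
move=> rho0 h1 h2; have := sqr_ge0 a1; have : rho * a1 < rho * w by rewrite ltr_pM2l.
lra.
Qed.

Section Positive.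
Variables (R : realType) (M : topologicalType) (X : manifold4 R M) (g : metric X) (o : orientation X) (s : R).
Hypothesis hs : s = 1 \/ s = -1.
Local Notation A k p := (eigval k (half_curvature g o s p)).
Hypothesis A2 : forall p, 0 < A 2 p.

Let A23 p : 0 < A 2 p * A 3 p.
Proof.
have [_ [_ _ _ /andP[_ le] _]] := spectral (half_curvature_sym g o s p).
exact: mulr_gt0 (A2 p) (lt_le_trans (A2 p) le).
Qed.

Section Soliton.
Variables (f : M -> R) (rho : R).
Hypothesis sol : gradient_shrinking_soliton g f rho.

Lemma eigval1_gt0 q : 0 < A 1 q.
Proof.
have := eigval1_ge0 hs sol (fun p => ltW (A2 p)); rewrite lt_neqAle => A1; rewrite A1 andbT; apply/negP => /eqP A0.
have [i di] := dom_cover X q; have [b [hb on]] := geodesic_frame sol q.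
have := @barrier_inequality R M X g o s hs f rho sol i q b (fun _ _ => 0) (fun _ _ => 0) (fun=> 0) di hb (on i di).
move=> h; lapply h.
  rewrite big1 => [|m _]; last by rewrite mulr0 subr0.
  by rewrite -A0; have := A23 q; set x := A 2 q * A 3 q; lra.
move=> m; split; first exact: A0.
split; last exact: drv_cst.
by apply/near0P; exists 1 => // t _; split; [exact: A1|exact: drv_cst].
Qed.

Lemma scalar_curvature_gt0 i p : dom i p -> 0 < scalar_curvature g i (coord i p).
Proof.
move=> di; rewrite (scalar_eigval o hs sol di); have [_ [_ _ _ /andP[_ le] _]] := spectral (half_curvature_sym g o s p).
by rewrite mulr_gt0 // addr_gt0 ?(lt_le_trans (A2 p) le) // addr_gt0 ?A2 ?eigval1_gt0.
Qed.

Lemma eigval1_decay_normalized : normalized_potential g f rho -> exists2 K : R, 0 < K & forall p, K / f p <= A 1 p.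
Proof.
move=> norm; have [_ _ rho0 _] := sol; have fp := potential_gt0 sol norm scalar_curvature_gt0.
have [K K0 h] := @barrier_alternative R M (fun p => A 1 p) f eigval1_gt0 fp (eigval1_lsc g o hs)
  (potential_continuous sol) (potential_proper sol norm scalar_curvature_gt0).
exists K => //; case: h => [h p|[q [q8 qW qmax]]].
  apply: le_trans (h p); rewrite ler_pM2l // lerDl mulr_ge0 // exprn_ge0 // invr_ge0; exact: ltW.
exfalso; have [i di] := dom_cover X q; have [b [hb on]] := geodesic_frame sol q; have {}on := on i di.
pose v m t := (f (b m t))^-1; pose h m := derive1 (f \o b m).
(* [K w] along the geodesic, shifted by a constant so that it touches the eigenvalue at [q] from
   below. *)
pose ph m t := A 1 q + K * (v m t + 4 * v m t ^+ 2 - ((f q)^-1 + 4 * (f q)^-1 ^+ 2)).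
pose ph1 m t := - K * h m t * (v m t ^+ 2 + 8 * v m t ^+ 3).
pose ph2 m := - K * (v m 0 ^+ 2 + 8 * v m 0 ^+ 3) * derive1 (h m) 0 + K * (2 * v m 0 ^+ 3 + 24 * v m 0 ^+ 4) * h m 0 ^+ 2.
have dv m t : drv (v m) t (- h m t * v m t ^+ 2).
  have n0 : f (b m t) != 0 by rewrite gt_eqF.
  by apply: (drv_val _ (drvV n0 (potential_drv sol t (hb m).1).1)); rewrite /v exprVn.
have dv2 m t : drv (fun t => v m t ^+ 2) t (- 2 * h m t * v m t ^+ 3).
  by apply: (drv_val _ (drvM (dv m t) (dv m t))); ring.
have dv3 m t : drv (fun t => v m t ^+ 3) t (- 3 * h m t * v m t ^+ 4).
  by apply: (drv_val _ (drvM (dv m t) (dv2 m t))); ring.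
have v0 m : v m 0 = (f q)^-1 by rewrite /v (hb m).2.
have := @barrier_inequality R M X g o s hs f rho sol i q b ph ph1 ph2 di hb on.
move=> ineq; lapply ineq; last first.
  move=> m; split; first by rewrite /ph v0 subrr mulr0 addr0.
  split.
    apply/near0P; exists 1 => // t _; split; first exact: barrier_touch (qmax (b m t)).
    apply: (drv_val _ (drvD (drv_cst _ t) (drvZ K (drvB (drvD (dv m t) (drvZ 4 (dv2 m t))) (drv_cst _ t))))).
    by rewrite /ph1; ring.
  apply: (drv_val _ (drvM (drvZ (- K) (potential_drv sol 0 (hb m).1).2) (drvD (dv2 m 0) (drvZ 8 (dv3 m 0))))).
  by rewrite /ph2 -/(h m); ring.
have -> : \sum_m (ph2 m - derive1 (f \o b m) 0 * ph1 m 0) =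
    - K * ((f q)^-1 ^+ 2 + 8 * (f q)^-1 ^+ 3) * (\sum_m derive1 (h m) 0 - \sum_m h m 0 ^+ 2)
    + K * (2 * (f q)^-1 ^+ 3 + 24 * (f q)^-1 ^+ 4) * \sum_m h m 0 ^+ 2.
  by rewrite -sumrB !mulr_sumr -big_split; ext_sum m; rewrite /ph2 /ph1 v0 -/(h m) /=; ring.
rewrite (frame_laplace sol di hb on) => le.
have SG := norm i q di; rewrite -(frame_grad sol di hb on) in SG.
have G0 : 0 <= \sum_m h m 0 ^+ 2 by apply: sumr_ge0 => m _; exact: sqr_ge0.
have lt := barrier_arith erefl K0 rho0 q8 G0 SG.
exact: (decay_contradiction rho0 qW (A23 q) (lt_le_trans lt le)).
Qed.

End Soliton.

#[local] Transparent partial.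

Lemma partial_addr (u : 'rV[R]_4 -> R) (c : R) k : partial k (fun x => u x + c) = partial k u.
Proof. apply/funext => x; rewrite /partial /derive.
have -> // : (fun h : R => h^-1 *: (((fun y => u y + c) \o shift x) (h *: delta_mx 0 k) - (u x + c))) =
  (fun h => h^-1 *: ((u \o shift x) (h *: delta_mx 0 k) - u x)).
by apply/funext => h; rewrite /= opprD addrACA subrr addr0.
Qed.

Lemma soliton_addr (f : M -> R) (rho c : R) : gradient_shrinking_soliton g f rho ->
  gradient_shrinking_soliton g (fun p => f p + c) rho.
Proof.
move=> [cpl sf rho0 eqn]; split=> // [i|i x Vx a b]; last first.
  rewrite -eqn // /hessian; have E k : partial k ((fun p => f p + c) \o param i) = partial k (f \o param i) by exact: partial_addr.
  by rewrite E; under [in LHS]eq_bigr do rewrite E.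
apply: smooth_closureP; first exact: codom_open.
by apply: sc_add; [apply: sc_smooth; exact: sf|exact: sc_cst].
Qed.

(** If [f] is only known to be positive, the constant of [hamilton_constant] turns it into a
    normalised potential [f1], and [f1 <= C * f] carries the estimate back. *)
Lemma eigval1_decay (f : M -> R) (rho : R) : gradient_shrinking_soliton g f rho ->
  ~ compact [set: M] -> normalized_potential g f rho \/ (forall p, 0 < f p) ->
  exists2 K : R, 0 < K & forall p, K / f p <= A 1 p.
Proof.
move=> sol nc [norm|fpos]; first exact: eigval1_decay_normalized sol norm.
have [_ _ rho0 _] := sol; have [k hk] := hamilton_constant sol.
pose c := k / (2 * rho); pose f1 p := f p + c.
have sol1 : gradient_shrinking_soliton g f1 rho := soliton_addr c sol.
have norm1 : normalized_potential g f1 rho.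
  move=> i p di; have -> : grad_sqnorm g f1 i (coord i p) = grad_sqnorm g f i (coord i p).
    have E a : partial a (f1 \o param i) = partial a (f \o param i) by exact: partial_addr.
    by ext_sum a; ext_sum b; rewrite !E.
  by have := hk i p di; rewrite /f1 /c => <-; field; rewrite gt_eqF.
have f1_gt0 := potential_gt0 sol1 norm1 (scalar_curvature_gt0 sol1).
have [K K0 h] := eigval1_decay_normalized sol1 norm1.
have [C C0 hC] : exists2 C, 0 < C & forall p, f1 p <= C * f p.
  (* For [c > 0] the positive function [f] attains a minimum, because [f1] is proper. *)
  have [c0|c0] := lerP c 0; first by exists 1 => // p; rewrite mul1r /f1; lra.
  have [p0 _] : exists p : M, True.
    by apply: contrapT => e; apply: nc; rewrite (_ : [set: M] = set0); [exact: compact0|apply/seteqP; split=> q // _; apply: e; exists q].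
  have [|x Kx xmin] := compact_min (potential_proper sol1 norm1 (scalar_curvature_gt0 sol1) (c := f1 p0)) _ (fun p _ => potential_continuous sol1 (p := p)).
    by exists p0; rewrite /=.
  have fx p : f x <= f p.
    have [le|lt] := lerP (f1 p) (f1 p0); first by have := xmin p le; rewrite /f1; lra.
    by move: Kx lt; rewrite /= /f1; lra.
  exists (1 + c / f x) => [|p]; first by apply: addr_gt0 => //; exact: divr_gt0.
  by rewrite /f1 mulrDl mul1r lerD2l mulrAC ler_pdivlMr // ler_pM2l.
exists (K / C) => [|p]; first exact: divr_gt0.
apply: le_trans (h p); rewrite -mulrA ler_pM2l // -invfM lef_pV2 ?posrE ?mulr_gt0 //.
Qed.

End Positive.

Theorem theorem5p1 (R : realType) (M : topologicalType) (X : manifold4 R M)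
    (o : orientation X) (g : metric X) (f : M -> R) (rho : R)
    (soliton : gradient_shrinking_soliton g f rho) :
  (* (a) *)
  (((forall p, 0 <= eigval 2 (curvA g o p)) -> forall p, psd (curvA g o p)) /\
   ((forall p, 0 <= eigval 2 (curvC g o p)) -> forall p, psd (curvC g o p))) /\
  (* (b) *)
  (((forall p, 0 < eigval 2 (curvA g o p)) ->
      (forall p, posdef (curvA g o p)) /\
      (~ compact [set: M] ->
       normalized_potential g f rho \/ (forall p, 0 < f p) ->
       exists2 K : R, 0 < K & forall p, K / f p <= eigval 1 (curvA g o p))) /\
   ((forall p, 0 < eigval 2 (curvC g o p)) ->
      (forall p, posdef (curvC g o p)) /\
      (~ compact [set: M] ->
       normalized_potential g f rho \/ (forall p, 0 < f p) ->
       exists2 K : R, 0 < K & forall p, K / f p <= eigval 1 (curvC g o p)))).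
Proof.
(* The self-dual and anti-self-dual statements differ only in the sign [s]. *)
have part s : s = 1 \/ s = -1 :> R ->
    ((forall p, 0 <= eigval 2 (half_curvature g o s p)) -> forall p, psd (half_curvature g o s p)) /\
    ((forall p, 0 < eigval 2 (half_curvature g o s p)) -> (forall p, posdef (half_curvature g o s p)) /\
      (~ compact [set: M] -> normalized_potential g f rho \/ (forall p, 0 < f p) ->
       exists2 K : R, 0 < K & forall p, K / f p <= eigval 1 (half_curvature g o s p))).
  move=> hs; split=> A2; first by move=> p; apply: eigval1_psd (half_curvature_sym g o s p) (eigval1_ge0 hs soliton A2 p).
  split; last by move=> nc; exact: (eigval1_decay hs A2 soliton nc).
  by move=> p; apply: eigval1_posdef (half_curvature_sym g o s p) (eigval1_gt0 hs A2 soliton p).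
have [a1 b1] := part 1 (or_introl erefl); have [a2 b2] := part (-1) (or_intror erefl).
exact: conj (conj a1 a2) (conj b1 b2).
Qed.
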